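(* Let $\Omega\subset\mathbb{R}^N$ be a bounded $C^1$ domain, $m>N$, and let $\Gamma$ be a nonempty (relatively) open subset of $\partial\Omega$. Let $p,q>0$ with $pq>1$, and let $f,g:\Omega\times\mathbb{R}^2\to\mathbb{R}$ be Carath\'eodory functions satisfying the following growth condition up to the boundary: for any compact set $K\subset\mathbb{R}^2$ there exists $C>0$ such that $$|f(x,u,v)|\le C|v|^q,\qquad |g(x,u,v)|\le C|u|^p\qquad \text{for a.e. } x\in \Omega \text{ and every } (u,v)\in K.$$ Let $u,v\in W^{2,m}(\Omega)$ be a solution of $$\Delta u+f(x,u,v)=0,\qquad \Delta v+g(x,u,v)=0\qquad\text{in }\Omega .$$ If $u=v=0$ and $\partial_\nu u=\partial_\nu v=0$ on $\Gamma$, then $u\equiv v\equiv0$ in $\Omega$.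
   Context: A function $f:\Omega\times\mathbb{R}^2\to\mathbb{R}$ is Carath\'eodory if it is continuous in $(u,v)\in\mathbb{R}^2$ for a.e. $x\in\Omega$ and measurable in $x$ for every $(u,v)\in\mathbb{R}^2$. Solutions are understood in the strong sense, i.e. the equations hold at almost every point of $\Omega$. Here $\partial_\nu$ is the exterior normal derivative on $\partial\Omega$; since $m>N$, functions in $W^{2,m}(\Omega)$ are in $C^1(\overline\Omega)$. *)

(* Defs.v *)
From HB Require Import structures.
From mathcomp Require Import all_boot all_order all_algebra.
From mathcomp Require Import all_classical all_reals all_analysis.

Set Implicit Arguments.
Unset Strict Implicit.
Unset Printing Implicit Defensive.
Import Order.TTheory GRing.Theory Num.Theory.
Import numFieldNormedType.Exports.

Local Open Scope classical_set_scope.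
Local Open Scope ring_scope.

(* R^N is 'rV[R]_n.+1 with N = n.+1, so that N >= 1.  The library's norm on it
   is the sup norm: its balls are cubes, its topology is the usual one. *)

Section lebesgue_outer.
Context {R : realType} {n : nat}.
Local Notation V := ('rV[R]_n.+1).
Implicit Types (A : set V) (b : V * V).

Definition box b : set V :=
  [set x | forall i, b.1 ord0 i < x ord0 i <= b.2 ord0 i].

Definition box_volume b : R :=
  \prod_(i < n.+1) Num.max 0 (b.2 ord0 i - b.1 ord0 i).

Definition lebesgue_outer A : \bar R :=
  ereal_inf [set (\sum_(k <oo) (box_volume (B k))%:E)%E
            | B in [set B : nat -> V * V | A `<=` \bigcup_k box (B k)]].

Let box_volume_ge0 b : (0 <= (box_volume b)%:E)%E.
Proof.
by rewrite lee_fin; apply: prodr_ge0 => i _; rewrite le_max lexx.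
Qed.

Let lebesgue_outer_ge0 A : (0 <= lebesgue_outer A)%E.
Proof.
by apply: le_ereal_inf_tmp => _ [B _ <-]; apply: nneseries_ge0.
Qed.

Let lebesgue_outer0 : lebesgue_outer set0 = 0%E.
Proof.
apply/eqP; rewrite eq_le lebesgue_outer_ge0 andbT.
apply: ereal_inf_lbound; exists (fun=> (0, 0)); first exact: sub0set.
rewrite eseries0// => k _ _; congr EFin.
by rewrite /box_volume (bigD1 ord0)//= subrr maxxx mul0r.
Qed.

Let lebesgue_outer_subadditive A (F : (set V)^nat) :
  subset_sigma_subadditive lebesgue_outer A F.
Proof.
move=> AF; have [[i ioo]|] := pselect (exists i, lebesgue_outer (F i) = +oo%E).
  rewrite (eseries_pinfty _ _ ioo) ?leey// => k _.
  by rewrite -ltNye (lt_le_trans _ (lebesgue_outer_ge0 _)).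
rewrite -forallNE => Foo.
apply/lee_addgt0Pr => _/posnumP[e].
apply: le_trans (epsilon_trick _ _ _) => //; last first.
pose P k (B : nat -> V * V) := F k `<=` \bigcup_j box (B j) /\
  (\sum_(j <oo) (box_volume (B j))%:E <=
     lebesgue_outer (F k) + (e%:num / (2 ^ k.+1)%:R)%:E)%E.
have [G PG] : {G : nat -> nat -> V * V & forall k, P k (G k)}.
  apply: (@choice _ _ P) => k; rewrite /P.
  have en1 : 0 < e%:num / (2 ^ k.+1)%:R by [].
  have fin : lebesgue_outer (F k) \is a fin_num.
    by rewrite ge0_fin_numE// ltey; apply/eqP.
  have [_ [B FB <-] Be] := lb_ereal_inf_adherent en1 fin.
  by exists B; split => //; exact: ltW.
have vG_ge0 x : (0 <= (box_volume (uncurry G x))%:E)%E by exact: box_volume_ge0.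
apply: (@le_trans _ _
    (\esum_(i in [set: nat * nat]) (box_volume (uncurry G i))%:E)%E).
  apply: ereal_inf_lbound => /=.
  have /card_esym/ppcard_eqP[f] := card_nat2.
  exists (uncurry G \o f).
    apply: (subset_trans AF) => t [i _ /(PG i).1[j _ Gij]].
    by exists (f^-1%FUN (i, j)) => //=; rewrite invK ?inE.
  rewrite -(esum_pred_image (fun x => (box_volume (uncurry G x))%:E) _ xpredT)
    ?[fun=> _]set_true//.
  by rewrite image_eq.
rewrite (_ : esum _ _ =
    \sum_(i <oo) \sum_(j <oo) (box_volume (G i j))%:E)%E; last first.
  pose J : nat -> set (nat * nat) := fun i => [set (i, j) | j in setT].
  rewrite (_ : setT = \bigcup_k J k); last first.
    by rewrite predeqE => -[a b]; split => // _; exists a => //; exists b.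
  rewrite esum_bigcupT /=; last 2 first.
    - apply/trivIsetP => i j _ _ ij.
      rewrite predeqE => -[k m] /=; split => //= -[] [_] _ [<-{k} _].
      by move=> [m' _] [] /esym/eqP; rewrite (negbTE ij).
    - by move=> /= [k m].
  rewrite -(image_id [set: nat]) -fun_true esum_pred_image//; last first.
    by move=> k _; exact: esum_ge0.
  apply: eq_eseriesr => /= j _.
  rewrite -(esum_pred_image (fun x => (box_volume (uncurry G x))%:E)
    (pair j) predT)//=; last first.
    by move=> ? ? _ _; exact: (@can_inj _ _ _ snd).
  by congr esum; rewrite predeqE => -[a b]; split; move=> [i _ <-]; exists i.
apply: lee_nneseries => [k *|k _]; first by apply: nneseries_ge0 => *.
exact: (PG k).2.
Qed.

HB.instance Definition _ := isSubsetOuterMeasure.Build R V lebesgue_outer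
  lebesgue_outer0 lebesgue_outer_ge0 lebesgue_outer_subadditive.

End lebesgue_outer.

Definition lebesgue_outer_measure (R : realType) (n : nat) :
  {outer_measure set 'rV[R]_n.+1 -> \bar R} := @lebesgue_outer R n.

(* R^N with the (complete) sigma-algebra of Lebesgue measurable sets. *)
Notation lebesgue_space R n := (caratheodory_type (lebesgue_outer_measure R n)).

Definition lebesgueN (R : realType) (n : nat) :
    {measure set (lebesgue_space R n) -> \bar R} :=
  (lebesgue_outer_measure R n : set (lebesgue_space R n) -> \bar R).

Section calculus.
Context {R : realType} {k : nat}.
Local Notation V := ('rV[R]_k).
Implicit Types (f : V -> R) (x : V) (i : 'I_k) (I : seq 'I_k).

Definition partial i f : V -> R := fun x => 'D_(delta_mx ord0 i) f x.

Definition grad f : V -> V := fun x => \row_i partial i f x.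

(* [:: i1; ..; ir] stands for the derivation D_i1 o .. o D_ir, of order r. *)
Definition iter_partial I f : V -> R := foldr partial f I.

Definition C1 f := (forall x, differentiable f x) /\ continuous (grad f).

Definition smooth f := forall I x, differentiable (iter_partial I f) x.

Definition euclidean_norm x : R := Num.sqrt (\sum_i x ord0 i ^+ 2).

Definition boundary (A : set V) : set V := closure A `\` interior A.

End calculus.

Section C1_domain.
Context {R : realType} {n : nat}.
Local Notation V := ('rV[R]_n.+1).
Implicit Types (Om : set V) (x : V) (i : 'I_n.+1) (s : bool).
Implicit Types gam : 'rV[R]_n -> R.

(* For i and s (an axis and its orientation), graph_fun i s gam is negative
   exactly on the side (-1)^s * y_i > gam(y with i-th coordinate removed) of
   the graph of gam. *)
Definition graph_fun i s gam : V -> R :=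
  fun y => gam (col' i y) - (-1) ^+ s * y ord0 i.

Definition boundary_chart Om x i s gam :=
  C1 gam /\ \forall y \near x, Om y <-> graph_fun i s gam y < 0.

Definition C1_domain Om :=
  [/\ open Om, connected Om &
      forall x, boundary Om x -> exists i s gam, boundary_chart Om x i s gam].

Definition is_outer_normal Om x (nu : V) := exists i s gam,
  boundary_chart Om x i s gam /\
  nu = (euclidean_norm (grad (graph_fun i s gam) x))^-1
         *: grad (graph_fun i s gam) x.

Definition outer_normal Om x : V := get [set nu | is_outer_normal Om x nu].

End C1_domain.

Section sobolev.
Context {R : realType} {n : nat}.
Local Notation V := ('rV[R]_n.+1).
Local Notation mu := (lebesgueN R n).
Implicit Types (Om K : set V) (u g w phi : V -> R) (I : seq 'I_n.+1) (p : R).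

Definition Lp Om p u := (u \_ Om : lebesgue_space R n -> R) \in Lfun mu p%:E.

Definition L1loc Om u :=
  measurable_fun (Om : set (lebesgue_space R n)) u /\
  forall K, compact K -> K `<=` Om -> mu.-integrable K (EFin \o u).

Definition test_function Om phi := smooth phi /\
  exists K, [/\ compact K, K `<=` Om & forall x, ~ K x -> phi x = 0].

Definition is_weak_deriv Om I u g :=
  [/\ L1loc Om u, L1loc Om g &
    forall phi, test_function Om phi ->
      \int[mu]_(x in Om) (u x * iter_partial I phi x) =
      (-1) ^+ size I * \int[mu]_(x in Om) (g x * phi x)].

(* Determined up to a null set whenever it exists. *)
Definition weak_deriv Om I u : V -> R := get [set g | is_weak_deriv Om I u g].

(* The space W^{r,p}(Om). *)
Definition sobolev Om (r : nat) p u := Lp Om p u /\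
  forall I, (size I <= r)%N -> exists g, Lp Om p g /\ is_weak_deriv Om I u g.

Definition laplacian Om u : V -> R :=
  fun x => \sum_i weak_deriv Om [:: i; i] u x.

(* w is in C^1(closure Om), and G is the continuous extension to closure Om of
   its gradient. *)
Definition C1_closure Om w (G : V -> V) :=
  [/\ {within closure Om, continuous w}, {within closure Om, continuous G} &
      forall x, Om x -> differentiable w x /\ G x = grad w x].

(* For u in W^{2,m}(Om) with m > N: the representative of u in C^1(closure Om)
   and its gradient, both unique on closure Om. *)
Definition C1_repr Om u : (V -> R) * (V -> V) :=
  get [set wG | C1_closure Om wG.1 wG.2 /\
                {ae mu, forall x, Om x -> wG.1 x = u x}].

Definition boundary_value Om u : V -> R := (C1_repr Om u).1.

Definition normal_derivative Om u : V -> R :=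
  fun x => \sum_i (C1_repr Om u).2 x ord0 i * outer_normal Om x ord0 i.

Definition caratheodory_fun Om (f : V -> R * R -> R) :=
  {ae mu, forall x, Om x -> continuous (f x)} /\
  forall s : R * R, measurable_fun (Om : set (lebesgue_space R n)) (f ^~ s).

End sobolev.

(* Main.v *)
Require Import Defs.
From HB Require Import structures.
From mathcomp Require Import all_boot all_order all_algebra.
From mathcomp Require Import all_classical all_reals all_analysis.
From mathcomp Require Import measurable_realfun lebesgue_integral ring lra zify.

Set Implicit Arguments.
Unset Strict Implicit.
Unset Printing Implicit Defensive.
Import Order.TTheory GRing.Theory Num.Theory.
Import numFieldNormedType.Exports.

Local Open Scope classical_set_scope.
Local Open Scope ring_scope.

(* The solutions have C^1 representatives up to the boundary (Morrey's estimate
   by telescoping mollifications along dyadic scales, with kernels supported in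
   a cone pointing into Om near the boundary).  On Gam the gradients vanish: the
   tangential part because u = v = 0 there, the normal part by hypothesis.  Hence
   the extensions of u and v by 0 satisfy, weakly in a cube B around a point of
   Gam, |Lap u| <= C |v|^q and |Lap v| <= C |u|^p, and they vanish on an open
   part of B.

   The unique continuation across the zero set of the extension rests on a
   Carleman estimate with the weights |x|^(-2k), which gives, for h vanishing on
   the unit ball, h^2 <= C (k/g)^M (sup of |Lap h|^2 / |x|^(2k) + boundary terms)
   |x|^(2k) on a slightly smaller ball.  Since p q > 1, one can choose s between
   1/q and p so that both nonlinearities gain a power of
   max(|u|, |v|^(1/s)); iterating on shrinking balls with k growing geometrically
   makes this maximum vanish on a larger ball, so the zero set is open and closed,
   first in B and then in Om. *)

(** * Lebesgue measure *)

(** The Carleman estimate needs classical second derivatives and a function vanishing near the pole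
    of the weight. Mollifying the solutions gives the former but spoils the latter; so the
    mollification is evaluated at a point pulled towards the pole, just enough to keep the averaging
    cube in the zero ball.

    Weak identities are tested against products of one-variable functions: their derivatives are of
    the same kind, and kernels built on functions climbing from 0 to 1 differ by a divergence of
    compactly supported functions. This one algebraic fact gives the common mass of the kernels, the
    Morrey estimate with one-sided kernels, and the independence of the limit from the kernel.

    In the iteration the gap g between radii shrinks like 2^-j while k grows like 8^j, so the loss,
    a fixed power of k/g, grows like that power of 16^j. The small factor due to superlinearity
    shrinks at the inverse rate, and the ratio of consecutive radii raised to the power k pays for
    both.

    Positivity of the measure on nonempty open sets is carried as the hypothesis [mu_pos]. *)

Section lebesgueN_basics.
Context {R : realType} {n : nat}.
Local Notation V := ('rV[R]_n.+1).
Local Notation L := (lebesgue_space R n).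
Local Notation mu := (lebesgueN R n).
Implicit Types (A : set V) (a x : V) (b : V * V) (l : R).

Lemma box_volume_ge0 b : 0 <= box_volume b.
Proof. by apply: prodr_ge0 => i _; rewrite le_max lexx. Qed.

Lemma lebesgueN_box b : (mu (box b) <= (box_volume b)%:E)%E.
Proof.
have v0 : box_volume ((0, 0) : V * V) = 0.
  by rewrite /box_volume (bigD1 ord0)//= subrr maxxx mul0r.
have -> : ((box_volume b)%:E =
   \sum_(k <oo) (box_volume (if k == 0%N then b else (0, 0)))%:E)%E.
  rewrite (nneseriesD1 (n := 0%N))//=; last first.
    by move=> k _; rewrite lee_fin; exact: box_volume_ge0.
  rewrite eseries0 ?adde0// => k _ /= /negbTE k0.
  by rewrite k0 v0.
apply: ereal_inf_lbound; exists (fun k => if k == 0%N then b else (0, 0)) => //.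
by move=> x bx; exists 0%N.
Qed.

Lemma lebesgueN_leP A (e : R) : 0 < e -> (mu A < +oo)%E ->
  exists2 B : nat -> V * V, A `<=` \bigcup_k box (B k) &
    (\sum_(k <oo) (box_volume (B k))%:E <= mu A + e%:E)%E.
Proof.
move=> e0 Aoo.
have fin : lebesgue_outer A \is a fin_num.
  by rewrite ge0_fin_numE//; exact: (outer_measure_ge0 (lebesgue_outer_measure R n)).
have [_ [B AB <-] Be] := lb_ereal_inf_adherent e0 fin.
by exists B => //; exact: ltW.
Qed.

(** Cutting every box of a cover along the hyperplane yields covers of the two pieces, by the boxes
    [B1 k] and [B2 k], and the volumes of the two halves of a box add up to its volume. *)
Lemma caratheodory_halfspace (i : 'I_n.+1) (a : R) :
  measurable ([set x : V | x ord0 i <= a] : set L).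
Proof.
apply: le_caratheodory_measurable => X.
apply: le_ereal_inf_tmp => _ [B XB <-].
pose B1 k : V * V := ((B k).1, \row_j (if j == i then Num.min ((B k).2 ord0 i) a
  else (B k).2 ord0 j)).
pose B2 k : V * V := (\row_j (if j == i then Num.max ((B k).1 ord0 i) a
  else (B k).1 ord0 j), (B k).2).
apply: (@le_trans _ _ ((\sum_(k <oo) (box_volume (B1 k))%:E) +
    \sum_(k <oo) (box_volume (B2 k))%:E)%E).
  apply: leeD; apply: ereal_inf_lbound.
    exists B1 => // x [Xx xa]; have [k _ Bk] := XB _ Xx.
    exists k => // j; rewrite /B1/= mxE; have := Bk j.
    by case: eqP => // ->; rewrite le_min => /andP[-> ->]/=.
  exists B2 => // x [Xx /= xa]; have [k _ Bk] := XB _ Xx.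
  exists k => // j; rewrite /B2/= mxE; have := Bk j.
  case: eqP => // -> /andP[h1 ->]; rewrite gt_max h1 andbT/=.
  by rewrite ltNge; apply/negP.
rewrite -nneseriesD; last 2 first.
- by move=> k _ _; rewrite lee_fin; exact: box_volume_ge0.
- by move=> k _ _; rewrite lee_fin; exact: box_volume_ge0.
apply: lee_nneseries => [k _|k _].
  by rewrite adde_ge0 ?lee_fin ?box_volume_ge0.
rewrite -EFinD lee_fin /box_volume !(bigD1 (P := xpredT) i)//=.
set P := \prod_(j < n.+1 | j != i) Num.max 0 ((B k).2 ord0 j - (B k).1 ord0 j).
rewrite (eq_bigr (fun j => Num.max 0 ((B k).2 ord0 j - (B k).1 ord0 j))); last first.
  by move=> j /negbTE ji; rewrite mxE ji.
rewrite [X in _ + _ * X](eq_bigr (fun j => Num.max 0 ((B k).2 ord0 j - (B k).1 ord0 j))); last first.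
  by move=> j /negbTE ji; rewrite mxE ji.
rewrite -mulrDl ler_wpM2r//; first by apply: prodr_ge0 => j _; rewrite le_max lexx.
rewrite !mxE eqxx.
move: ((B k).2 ord0 i) ((B k).1 ord0 i) => s t.
rewrite /Num.max /Num.min; do ! case: ifPn; rewrite -?leNgt; lra.
Qed.

Lemma measurable_coord (i : 'I_n.+1) :
  measurable_fun [set: L] (fun x : L => (x : V) ord0 i).
Proof.
apply: (measurability _ (RGenOInfty.measurableE R)).
move=> _ [_ [r ->] <-]; rewrite setTI.
rewrite (_ : _ @^-1` _ = ~` [set x : V | x ord0 i <= r]).
  by apply: measurableC; exact: caratheodory_halfspace.
apply/seteqP; split => x /=; rewrite in_itv/= andbT; first by rewrite ltNge => /negP.
by move=> /negP; rewrite ltNge.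
Qed.

Lemma ballNP (c x : V) (r : R) :
  ball c r x <-> forall i, `|c ord0 i - x ord0 i| < r.
Proof.
split=> [[_ h] i|h]; first by have := h ord0 i.
split; first by rewrite (le_lt_trans _ (h ord0)).
by move=> i j; rewrite ord1; exact: h.
Qed.

Lemma measurable_ballN (c : V) (r : R) : measurable (ball c r : set L).
Proof.
rewrite (_ : (ball c r : set V) =
  \bigcap_(i in [set: 'I_n.+1]) [set x : V | `|c ord0 i - x ord0 i| < r]).
  apply: fin_bigcap_measurable => [|i _]; first exact: finite_finset.
  have mf : measurable_fun [set: L] (fun x : L => `|c ord0 i - (x : V) ord0 i|).
    apply: (measurableT_comp (@normr_measurable R setT)).
    apply: measurable_funB; first exact: measurable_cst.
    exact: measurable_coord.
  rewrite (_ : mkset _ = (fun x : L => `|c ord0 i - (x : V) ord0 i|) @^-1` `]-oo, r[).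
    by rewrite -[X in measurable X]setTI; apply: mf => //; exact: measurable_itv.
  by apply/seteqP; split => x /=; rewrite in_itv.
apply/seteqP; split => x; first by move=> /ballNP h i _; exact: h.
by move=> h; apply/ballNP => i; exact: (h i Logic.I).
Qed.

(** Reduction to countably many balls: every point of [A] lies in a ball contained in [A] with
    rational centre and radius of the form 1/(k+1). *)
Lemma open_measurableN A : open A -> measurable (A : set L).
Proof.
move=> oA.
pose c (z : 'rV[rat]_n.+1) : V := map_mx ratr z.
pose r k : R := k.+1%:R^-1.
pose I := [set zk : 'rV[rat]_n.+1 * nat | ball (c zk.1) (r zk.2) `<=` A].
rewrite (_ : A = \bigcup_(zk in I) ball (c zk.1) (r zk.2)).
  rewrite bigcup_mkcond; apply: countable_bigcupT_measurable => //= zk.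
  by case: ifPn => // _; exact: measurable_ballN.
apply/seteqP; split => [x Ax|x [zk Izk /Izk]//].
have /nbhs_ballP[e /= e0 eA] : nbhs x A by exact: open_nbhs_nbhs.
have [k ke] : exists k, r k < e / 2.
  exists (Num.truncn (e / 2)^-1).
  rewrite /r invf_plt ?posrE ?divr_gt0//.
  exact: truncnS_gt.
have rk0 : 0 < r k by rewrite invr_gt0.
have /choice[z zP] : forall i : 'I_n.+1, exists q : rat, x ord0 i - r k < ratr q < x ord0 i + r k.
  move=> i; have [q] := @rat_in_itvoo R (x ord0 i - r k) (x ord0 i + r k) ltac:(lra).
  by rewrite in_itv => ?; exists q.
have xz : ball (c (\row_i z i)) (r k) x.
  apply/ballNP => i; rewrite !mxE; have := zP i.
  by move=> /andP[h1 h2]; rewrite ltr_norml; apply/andP; split; lra.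
exists (\row_i z i, k) => // y/= yz; apply: eA.
have := ball_triangle (ball_sym xz) yz; apply: le_ball; lra.
Qed.

Lemma continuous_measurableN (f : V -> R) : continuous f ->
  measurable_fun [set: L] (f : L -> R).
Proof.
move=> cf; apply: (measurability _ (RGenOpens.measurableE R)).
move=> _ [_ [a [b ->]] <-]; rewrite setTI.
apply: open_measurableN; apply: open_comp; last exact: interval_open.
by move=> x _; exact: cf.
Qed.

End lebesgueN_basics.

(** * Translations and dilations of Lebesgue measure *)

Section lebesgueN_affine.
Context {R : realType} {n : nat}.
Local Notation V := ('rV[R]_n.+1).
Local Notation L := (lebesgue_space R n).
Local Notation mu := (lebesgueN R n).
Implicit Types (A : set V) (a x : V) (l : R).

Definition affineN a l : V -> V := fun x => a + l *: x.

Lemma affineNK a l : l != 0 ->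
  cancel (affineN a l) (affineN (- (l^-1 *: a)) l^-1).
Proof.
move=> l0 x; rewrite /affineN scalerDr scalerA mulVf// scale1r.
by rewrite addrA addNr add0r.
Qed.

Lemma affineNVK a l : l != 0 ->
  cancel (affineN (- (l^-1 *: a)) l^-1) (affineN a l).
Proof.
move=> l0 x; rewrite /affineN scalerDr scalerN !scalerA mulfV// !scale1r.
by rewrite addrA addrN add0r.
Qed.

Lemma outer_affineN_le a l A : 0 < l ->
  (lebesgue_outer (affineN a l @^-1` A) <= (l ^- n.+1)%:E * lebesgue_outer A)%E.
Proof.
move=> l0; have c0 : 0 < l ^- n.+1 by rewrite invr_gt0 exprn_gt0.
rewrite -lee_pdivrMl//.
apply: le_ereal_inf_tmp => _ [B AB <-]; rewrite lee_pdivrMl//.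
pose B' k : V * V := (affineN (- (l^-1 *: a)) l^-1 (B k).1,
                      affineN (- (l^-1 *: a)) l^-1 (B k).2).
have BB' k : box_volume (B' k) = l ^- n.+1 * box_volume (B k).
  have -> : l ^- n.+1 = \prod_(i < n.+1) l^-1 by rewrite prodr_const card_ord exprVn.
  rewrite /box_volume -big_split/=.
  apply: eq_bigr => i _; rewrite /B'/affineN/= !mxE.
  rewrite opprD addrACA subrr add0r -mulrBr.
  by rewrite -[X in Num.max X _](mulr0 l^-1) -maxr_pMr// invr_ge0 ltW.
apply: (@le_trans _ _ (\sum_(k <oo) (box_volume (B' k))%:E)%E).
  apply: ereal_inf_lbound; exists B' => // x /AB[k _ Bk]; exists k => // i.
  have := Bk i; rewrite /B'/affineN/= !mxE => /andP[h1 h2].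
  rewrite !(addrC (- _)) -!mulrBr ltr_pdivrMl// ler_pdivlMl//.
  by rewrite ltrBlDl lerBrDl h1 h2.
under eq_eseriesr do rewrite BB' EFinM.
by rewrite nneseriesZl// => k _; rewrite lee_fin box_volume_ge0.
Qed.

(** Transporting covers gives one inequality for every affine map; applied to the inverse map it
    gives the other. *)
Lemma lebesgueN_affine a l A : 0 < l ->
  mu (affineN a l @^-1` A) = ((l ^- n.+1)%:E * mu A)%E.
Proof.
move=> l0; have c0 : 0 < l ^- n.+1 by rewrite invr_gt0 exprn_gt0.
apply/eqP; rewrite eq_le; apply/andP; split; first exact: outer_affineN_le.
rewrite -lee_pdivlMl//.
have := @outer_affineN_le (- (l^-1 *: a)) l^-1 (affineN a l @^-1` A).
rewrite invr_gt0 exprVn => /(_ l0); rewrite -comp_preimage.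
by rewrite (_ : _ \o _ = id)//; apply/funext => x /=; rewrite affineNVK// gt_eqF.
Qed.

Lemma measurable_affineN a l : 0 < l ->
  measurable_fun [set: L] (affineN a l : L -> L).
Proof.
move=> l0 _ A mA; rewrite setTI.
suff : caratheodory_measurable (lebesgue_outer_measure R n) (affineN a l @^-1` A) by [].
move=> X.
have XE : X = affineN a l @^-1` (affineN (- (l^-1 *: a)) l^-1 @^-1` X).
  by apply/seteqP; split=> x /=; rewrite affineNK// gt_eqF.
rewrite XE preimage_setC -!preimage_setI.
have h (B : set V) : lebesgue_outer_measure R n (affineN a l @^-1` B) =
   ((l ^- n.+1)%:E * lebesgue_outer_measure R n B)%E by exact: lebesgueN_affine.
rewrite !h -ge0_muleDr ?outer_measure_ge0//; congr (_ * _)%E; exact: mA.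
Qed.

Lemma ge0_integral_affineN a l (f : V -> \bar R) : 0 < l ->
  measurable_fun [set: L] (f : L -> \bar R) -> (forall x, 0 <= f x)%E ->
  (\int[mu]_x f (a + l *: x)%R = (l ^- n.+1)%:E * \int[mu]_x f x)%E.
Proof.
move=> l0 mf f0.
have c0 : 0 <= l ^- n.+1 by rewrite invr_ge0 exprn_ge0// ltW.
have := @ge0_integral_pushforward _ _ _ _ R _ (measurable_affineN a l0) mu
  setT f measurableT mf (fun y _ => f0 y).
rewrite preimage_setT => <-.
transitivity (\int[mscale (NngNum c0) mu]_x f x)%E.
  apply: eq_measure_integral => [|? A mA _]; first exact: measurable_affineN.
  exact: lebesgueN_affine.
by rewrite ge0_integral_mscale.
Qed.

Lemma measurable_fun_affineN d (T : measurableType d) a l (f : V -> T) : 0 < l ->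
  measurable_fun [set: L] (f : L -> T) ->
  measurable_fun [set: L] ((fun x => f (a + l *: x)) : L -> T).
Proof.
move=> l0 mf; exact: (measurableT_comp mf (measurable_affineN a l0)).
Qed.

Lemma integrable_affineN a l (f : V -> R) : 0 < l ->
  mu.-integrable [set: L] (EFin \o f) ->
  mu.-integrable [set: L] (EFin \o (fun x => f (a + l *: x))).
Proof.
move=> l0 /integrableP[mf foo]; apply/integrableP; split.
  exact: (measurable_fun_affineN a l0 mf).
rewrite /= (ge0_integral_affineN a (f := fun x => `|(f x)%:E|%E)) //; last exact: measurableT_comp.
by rewrite lte_mul_pinfty// lee_fin invr_ge0 exprn_ge0// ltW.
Qed.

Lemma Rintegral_affineN a l (f : V -> R) : 0 < l ->
  mu.-integrable [set: L] (EFin \o f) ->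
  \int[mu]_x f (a + l *: x) = l ^- n.+1 * \int[mu]_x f x.
Proof.
move=> l0 intf; have mf := measurable_int _ intf.
transitivity (fine (l ^- n.+1)%:E * fine (\int[mu]_x (f x)%:E)%E); last by [].
rewrite -fineM//; last exact: integrable_fin_num.
congr fine; rewrite integralE [in RHS]integralE.
rewrite muleBr//; last first.
  apply: fin_num_adde_defr; rewrite ?fin_numN; apply: integrable_fin_num => //.
  exact: integrable_funepos.
have ip := ge0_integral_affineN a l0 (measurable_funepos mf) (fun x => funepos_ge0 _ x).
have iN := ge0_integral_affineN a l0 (measurable_funeneg mf) (fun x => funeneg_ge0 _ x).
congr (_ - _)%E.
  by apply: etrans ip; apply: eq_integral => x _; rewrite !funeposE.
by apply: etrans iN; apply: eq_integral => x _; rewrite !funenegE.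
Qed.

End lebesgueN_affine.

(** * Functions with bounded support *)

Section integrable_bounded_support.
Context {R : realType} {n : nat}.
Local Notation V := ('rV[R]_n.+1).
Local Notation L := (lebesgue_space R n).
Local Notation mu := (lebesgueN R n).
Implicit Types (A : set V) (a x y : V) (l M C : R) (f g : V -> R).

Definition cubeN M : set V := [set x | `|x| <= M].

Lemma normV_coord x i : `|x ord0 i| <= `|x|.
Proof.
rewrite [leRHS]/Num.norm/= mx_normrE.
exact: (le_bigmax _ (fun ij : 'I_1 * 'I_n.+1 => `|x ij.1 ij.2|) (ord0, i)).
Qed.

Lemma normV_leP x M : 0 <= M -> (`|x| <= M) <-> (forall i, `|x ord0 i| <= M).
Proof.
move=> M0; split=> [xM i|h]; first exact: le_trans (normV_coord x i) xM.
rewrite [leLHS]/Num.norm/= mx_normrE; apply/bigmax_leP; split=> // -[i j] _ /=.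
by rewrite ord1.
Qed.

Lemma compact_normV_le M : compact (cubeN M).
Proof.
apply: bounded_closed_compact.
  exists M; split; first exact: num_real.
  by move=> r Mr x /= xM; rewrite (le_trans xM)// ltW.
rewrite (_ : cubeN M = (fun x : V => `|x|) @^-1` [set r : R | r <= M])//.
apply: (@closed_comp _ _ (fun x : V => `|x|)); last exact: closed_le.
by move=> x _; exact: norm_continuous.
Qed.

Lemma lebesgueN_normV_lty M : (mu (cubeN M) < +oo)%E.
Proof.
apply: (@le_lt_trans _ _ (mu (box (const_mx (- M - 1) : V, const_mx M)))).
  apply: le_outer_measure => x /= xM i; rewrite !mxE.
  have := le_trans (normV_coord x i) xM; rewrite ler_norml => /andP[h1 ->].
  by rewrite andbT; lra.
by rewrite (le_lt_trans (lebesgueN_box _))// ltry.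
Qed.

Lemma measurable_normV_le M : measurable (cubeN M : set L).
Proof.
rewrite (_ : cubeN M = (fun x : V => `|x|) @^-1` `]-oo, M]); last first.
  by apply/seteqP; split => x /=; rewrite in_itv.
rewrite -[X in measurable X]setTI.
apply: (continuous_measurableN (f := fun x : V => `|x|)) => //.
exact: norm_continuous.
Qed.

Lemma integrable_bsupp f M C : measurable_fun [set: L] (f : L -> R) ->
  (forall x, `|f x| <= C) -> (forall x, M < `|x| -> f x = 0) ->
  mu.-integrable [set: L] (EFin \o f).
Proof.
move=> mf fC f0.
have -> : EFin \o f = (EFin \o f) \_ (cubeN M).
  apply/funext => x /=; rewrite patchE; case: ifPn => // /negP.
  by rewrite inE/= => /negP; rewrite -ltNge => /f0 ->.
apply/(integrable_mkcond _ (measurable_normV_le M)).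
apply: measurable_bounded_integrable.
- exact: measurable_normV_le.
- exact: lebesgueN_normV_lty.
- exact: measurable_funTS.
- exists C; split; first exact: num_real.
  by move=> r Cr x _ /=; rewrite (le_trans (fC x))// ltW.
Qed.

Lemma bounded_bsupp f M : continuous f -> (forall x, M < `|x| -> f x = 0) ->
  exists2 C, 0 < C & forall x, `|f x| <= C.
Proof.
move=> cf f0.
have : compact (f @` cubeN M).
  apply: continuous_compact; last exact: compact_normV_le.
  exact: continuous_subspaceT.
move/compact_bounded => -[C [_ CP]].
exists (Num.max 1 (C + 1)); first by rewrite lt_max ltr01.
move=> x; have [xM|/f0 ->] := leP `|x| M; last by rewrite normr0 le_max ler01.
apply: CP; last by exists x.
by rewrite lt_max ltrDl ltr01 orbT.
Qed.

Lemma integrable_Cc f M : continuous f -> (forall x, M < `|x| -> f x = 0) ->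
  mu.-integrable [set: L] (EFin \o f).
Proof.
move=> cf f0; have [C _ fC] := bounded_bsupp cf f0.
exact: integrable_bsupp (continuous_measurableN cf) fC f0.
Qed.

End integrable_bounded_support.

(** * Differential calculus *)

Section directional_calculus.
Context {R : realType} {n : nat}.
Local Notation V := ('rV[R]_n.+1).
Local Notation L := (lebesgue_space R n).
Local Notation mu := (lebesgueN R n).
Local Notation e_ i := (delta_mx ord0 i : V).
Implicit Types (x y v : V) (f df : V -> R).

Lemma is_derive_line f x v (d t : R) : is_derive (x + t *: v) v f d ->
  is_derive t 1 (fun s : R => f (x + s *: v)) d.
Proof.
move=> [dr de].
have E : (fun h : R => h^-1 *: (((fun s : R => f (x + s *: v)) \o shift t) (h *: 1) - f (x + t *: v)))
  = (fun h : R => h^-1 *: ((f \o shift (x + t *: v)) (h *: v) - f (x + t *: v))).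
  apply/funext => h /=; congr (_ *: (f _ - _)).
  by rewrite -[h *: 1]/(h * 1) mulr1 scalerDl addrCA.
apply: DeriveDef.
  by rewrite /derivable; rewrite E.
by rewrite -de /derive E.
Qed.

Lemma is_derive_unique1 f x v d d' : is_derive x v f d -> is_derive x v f d' -> d = d'.
Proof. by move=> [_ <-] [_ <-]. Qed.

Lemma near_is_derive f g x v d : v != 0 -> (\near x, f x = g x) ->
  is_derive x v f d -> is_derive x v g d.
Proof.
move=> v0 fg [dr de].
have fg' : {near x, f =1 g} by exact: fg.
apply: DeriveDef; first exact: near_eq_derivable fg' dr.
by rewrite -(near_eq_derive _ fg').
Qed.

Lemma delta_neq0 i : e_ i != 0.
Proof.
apply/negP => /eqP/rowP/(_ i); rewrite !mxE !eqxx/= => /eqP.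
by rewrite oner_eq0.
Qed.

Lemma norm_delta i : `|e_ i| = 1.
Proof.
apply/eqP; rewrite eq_le; apply/andP; split.
  apply/normV_leP => // j; rewrite mxE/=.
  by case: (j == i); rewrite ?normr1 ?normr0.
by rewrite -[leLHS]normr1; have := normV_coord (e_ i) i; rewrite mxE !eqxx.
Qed.

Lemma is_derive_near0 f x i d : (\near x, f x = 0) ->
  is_derive x (e_ i) f d -> d = 0.
Proof.
move=> f0 fd; apply: (is_derive_unique1 (v := e_ i) (f := cst 0)).
  by apply: near_is_derive fd; first exact: delta_neq0.
exact: is_derive_cst.
Qed.

Lemma near_lt_norm (x : V) (M : R) : M < `|x| -> \near x, M < `|x|.
Proof.
move=> Mx; have : open [set y : V | M < `|y|].
  rewrite (_ : mkset _ = (fun x : V => `|x|) @^-1` [set r | M < r])//.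
  apply: (@open_comp _ _ (fun x : V => `|x|)); last exact: open_gt.
  by move=> y _; exact: norm_continuous.
by move=> oM; apply: open_nbhs_nbhs.
Qed.

Lemma is_derive_under_integral (F dF : R -> V -> R) (D : set V) (a : R) (G : V -> R) :
  measurable (D : set L) ->
  (forall t, mu.-integrable (D : set L) (EFin \o F t)) ->
  (forall (t : R) y, D y -> is_derive t 1 (F^~ y) (dF t y)) ->
  mu.-integrable (D : set L) (EFin \o G) -> (forall y, 0 <= G y) ->
  (forall t y, `|t - a| < 1 -> D y -> `|dF t y| <= G y) ->
  is_derive a 1 (fun t => \int[mu]_(y in D) F t y) (\int[mu]_(y in D) dF a y).
Proof.
move=> mD iF FdF iG G0 dFG.
have Ia : `]a - 1, a + 1[%classic a by rewrite /= in_itv/=; apply/andP; split; lra.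
have dd : forall (x : R) (y : L), `]a - 1, a + 1[%classic x -> D y -> derivable (F^~ y) x 1.
  by move=> x y _ Dy; have [] := FdF x y Dy.
have p1 (x : R) (y : L) : D y -> partial1of2 F x y = dF x y.
  by move=> Dy; rewrite partial1of2E; have [_ ->] := FdF x y Dy.
have bG : forall (x : R) (y : L), `]a - 1, a + 1[%classic x -> D y -> `|partial1of2 F x y| <= G y.
  move=> x y; rewrite /= in_itv/= => /andP[h1 h2] Dy.
  by rewrite p1//; apply: dFG => //; rewrite ltr_norml; apply/andP; split; lra.
apply: DeriveDef.
  exact: (derivable_under_integral mD Ia (fun t _ => iF t) dd G0 iG bG).
rewrite -derive1E (differentiation_under_integral mD Ia (fun t _ => iF t) dd G0 iG bG).
by apply: eq_Rintegral => y /set_mem Dy; exact: p1.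
Qed.

(** The integral of f(x + t e_i) over x does not depend on t, by translation invariance;
    differentiating it under the integral sign at t = 0 gives the claim without isolating the
    variable i. *)
Lemma integral_partial0 f df i M : continuous f -> continuous df ->
  (forall x, is_derive x (e_ i) f (df x)) -> (forall x, M < `|x| -> f x = 0) ->
  \int[mu]_x df x = 0.
Proof.
move=> cf cdf fdf f0.
have df0 x : M < `|x| -> df x = 0.
  move=> /near_lt_norm Mx; apply: is_derive_near0 (fdf x).
  by apply: filterS Mx => y; exact: f0.
have [C C0 dfC] := bounded_bsupp cdf df0.
pose F (t : R) (x : V) := f (x + t *: e_ i).
pose dF (t : R) (x : V) := df (x + t *: e_ i).
have FE t : F t = (fun y => f (t *: e_ i + 1 *: y)).
  by apply/funext => y; rewrite /F scale1r addrC.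
have iF t : mu.-integrable [set: L] (EFin \o F t).
  rewrite FE; apply: integrable_affineN => //.
  exact: integrable_Cc f0.
(* For |t| < 1 all translates are supported in the cube enlarged by 1, whence a single majorant. *)
have iG : mu.-integrable [set: L] (EFin \o (fun x => C * \1_(cubeN (M + 1)) x)).
  apply: (@integrable_bsupp _ _ _ (M + 1) C).
  - apply: measurable_funM; first exact: measurable_cst.
    apply: measurable_indic.
    exact: measurable_normV_le.
  - move=> x; rewrite indicE normrM (ger0_norm (ltW C0)).
    by case: (x \in _); rewrite /= ?normr1 ?normr0 ?mulr1// mulr0 ltW.
  - move=> x Mx; rewrite indicE memNset ?mulr0//=.
    by rewrite /cubeN/=; apply/negP; rewrite -ltNge.
have G0 x : 0 <= C * \1_(cubeN (M + 1)) x.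
  by rewrite mulr_ge0 ?(ltW C0)// indicE; case: (x \in _).
have FdF (t : R) y : setT y -> is_derive t 1 (F^~ y) (dF t y).
  by move=> _; apply: is_derive_line.
have bG (t : R) y : `|t - 0| < 1 -> setT y -> `|dF t y| <= C * \1_(cubeN (M + 1)) y.
  rewrite subr0 => t1 _; rewrite indicE; case: (boolP (y \in _)) => [_|].
    by rewrite mulr1; exact: dfC.
  move=> /negP; rewrite inE/= /cubeN/= => /negP; rewrite -ltNge => My.
  rewrite mulr0 /dF df0 ?normr0//.
  have : `|t *: e_ i| < 1 by rewrite normrZ norm_delta mulr1.
  have := ler_normD (y + t *: e_ i) (- (t *: e_ i)).
  by rewrite addrK normrN; lra.
have [_] := is_derive_under_integral measurableT iF FdF iG G0 bG.
have -> : (fun t => \int[mu]_y F t y) = cst (\int[mu]_y f y).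
  apply/funext => t /=; rewrite FE.
  by rewrite Rintegral_affineN ?expr1n ?invr1 ?mul1r//; exact: integrable_Cc f0.
rewrite derive_cst => ->; apply: eq_Rintegral => x _.
by rewrite /dF scale0r addr0.
Qed.

End directional_calculus.

(** * Rules for directional derivatives *)

Section derive_rules.
Context {R : realType} {W : normedModType R}.
Implicit Types (f g : W -> R) (x v : W) (df dg c : R).

Lemma drvM f g x v df dg : is_derive x v f df -> is_derive x v g dg ->
  is_derive x v (fun y => f y * g y) (df * g x + f x * dg).
Proof.
move=> hf hg; have := is_deriveM hf hg.
by rewrite addrC ![_ *: _]mulrC [_ * f x]mulrC; exact.
Qed.

Lemma drvD f g x v df dg : is_derive x v f df -> is_derive x v g dg ->
  is_derive x v (fun y => f y + g y) (df + dg).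
Proof. exact: is_deriveD. Qed.

Lemma drvN f x v df : is_derive x v f df ->
  is_derive x v (fun y => - f y) (- df).
Proof. exact: is_deriveN. Qed.

Lemma drvB f g x v df dg : is_derive x v f df -> is_derive x v g dg ->
  is_derive x v (fun y => f y - g y) (df - dg).
Proof. by move=> hf hg; apply: drvD => //; exact: drvN. Qed.

Lemma drvC c x v : is_derive x v (fun _ : W => c) 0.
Proof. exact: is_derive_cst. Qed.

Lemma drvZ c f x v df : is_derive x v f df ->
  is_derive x v (fun y => c * f y) (c * df).
Proof.
by move=> hf; have := drvM (drvC c x v) hf; rewrite mul0r add0r.
Qed.

Lemma drvS k (f : 'I_k -> W -> R) (df : 'I_k -> R) x v :
  (forall i, is_derive x v (f i) (df i)) ->
  is_derive x v (fun y => \sum_(i < k) f i y) (\sum_(i < k) df i).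
Proof.
elim: k f df => [|k IH] f df h.
  under eq_fun do rewrite big_ord0.
  by rewrite big_ord0; exact: drvC.
under eq_fun do rewrite big_ord_recr/=.
by rewrite big_ord_recr/=; exact: (drvD (IH _ _ (fun i => h _)) (h _)).
Qed.

Lemma drvV f x v df : f x != 0 -> is_derive x v f df ->
  is_derive x v (fun y => (f y)^-1) (- df * (f x)^-1 ^+ 2).
Proof.
move=> fx0 [hd he]; apply: DeriveDef; first exact: derivableV.
by rewrite deriveV// he exprVn scaleNr -[_ *: _]/(_ * _) mulrC mulNr.
Qed.

Lemma drvX f k x v df : is_derive x v f df ->
  is_derive x v (fun y => f y ^+ k) (k%:R * f x ^+ k.-1 * df).
Proof.
move=> hf; have := is_deriveX k hf; rewrite -[_ *: _]/(_ * _).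
rewrite (_ : f ^+ k = (fun y => f y ^+ k))//.
by apply/funext => y; elim: k => [|k IH]; rewrite ?expr0// !exprS -IH.
Qed.

Lemma drv_eq f x v d d' : is_derive x v f d -> d = d' -> is_derive x v f d'.
Proof. by move=> h <-. Qed.

(** Reduction to one variable: the chain rule below, and later computations along axes, are carried
    out on lines. *)
Lemma drv_line f x v d :
  is_derive (0 : R) 1 (fun s : R => f (x + s *: v)) d <-> is_derive x v f d.
Proof.
have E : (fun h : R => h^-1 *: (((fun s : R => f (x + s *: v)) \o shift (0 : R)) (h *: 1) - f (x + 0 *: v)))
  = (fun h : R => h^-1 *: ((f \o shift x) (h *: v) - f x)).
  apply/funext => h /=; rewrite scale0r !addr0.
  by rewrite -[h *: 1]/(h * 1) mulr1 [x + _]addrC.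
by split => -[dr de]; apply: DeriveDef;
   rewrite ?/derivable ?/derive ?E// -?E// in dr de *.
Qed.

Lemma drv_comp (g : R -> R) f x v df dg : is_derive (f x) 1 g dg ->
  is_derive x v f df -> is_derive x v (fun y => g (f y)) (dg * df).
Proof.
move=> hg /drv_line hf; apply/drv_line.
have hg' : is_derive ((fun s : R => f (x + s *: v)) 0) 1 g dg by rewrite scale0r addr0.
exact: (is_derive1_comp hg' hf).
Qed.

Lemma drv_continuous (h h' : R -> R) :
  (forall t : R, is_derive t 1 h (h' t)) -> continuous h.
Proof.
move=> hh t; apply: differentiable_continuous.
by apply/derivable1_diffP; have [] := hh t.
Qed.

End derive_rules.

(** * A smooth step function *)

Section smooth_step.
Context {R : realType}.
Implicit Types (f g : R -> R) (t a b c : R).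

Fixpoint Ck k f : Prop := if k is k'.+1
  then exists2 f', (forall t, is_derive t 1 f (f' t)) & Ck k' f' else continuous f.

Lemma CkS k f : Ck k.+1 f -> Ck k f.
Proof.
elim: k f => [f [f' ff' _]|k IH f [f' ff' /IH h]]; last by exists f'.
exact: drv_continuous ff'.
Qed.

Lemma Ck_ext k f g : f =1 g -> Ck k f -> Ck k g.
Proof. by move=> /funext ->. Qed.

Lemma CkD k f g : Ck k f -> Ck k g -> Ck k (fun t => f t + g t).
Proof.
elim: k f g => [f g cf cg t|k IH f g [f' ff' hf] [g' gg' hg]].
  exact: continuousD (cf t) (cg t).
exists (fun t => f' t + g' t); last exact: IH.
by move=> t; exact: drvD.
Qed.

Lemma CkM k f g : Ck k f -> Ck k g -> Ck k (fun t => f t * g t).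
Proof.
elim: k f g => [f g cf cg t|k IH f g hf hg].
  exact: continuousM (cf t) (cg t).
have [hf1 hg1] := (CkS hf, CkS hg).
case: hf hg => f' ff' hf [g' gg' hg].
exists (fun t => f' t * g t + f t * g' t); last by apply: CkD; exact: IH.
by move=> t; exact: drvM.
Qed.

Lemma Ck_cst k c : Ck k (fun=> c).
Proof.
elim: k c => [c t|k IH c]; first exact: cvg_cst.
by exists (fun=> 0) => // t; exact: drvC.
Qed.

Lemma Ck_affine k f a b : Ck k f -> Ck k (fun t => f (a * t + b)).
Proof.
elim: k f => [f cf t|k IH f [f' ff' hf]].
  apply: (@continuous_comp _ _ _ (fun t => a * t + b)) (cf _).
  apply: continuousD; last exact: cvg_cst.
  by apply: continuousM; [exact: cvg_cst|exact: cvg_id].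
exists (fun t => f' (a * t + b) * a); last first.
  by apply: CkM; [exact: IH|exact: Ck_cst].
move=> t; apply: (drv_comp (ff' _)).
apply: (drv_eq (drvD (drvM (drvC a t 1) (is_derive_id t 1)) (drvC b t 1))).
by rewrite mul0r add0r mulr1 addr0.
Qed.

Lemma Ck_inv k f : (forall t, f t != 0) -> Ck k f -> Ck k (fun t => (f t)^-1).
Proof.
elim: k f => [f f0 cf t|k IH f f0 hf]; first exact: continuousV (cf t).
have hf1 := CkS hf; case: hf => f' ff' hf.
exists (fun t => (- 1 * f' t) * ((f t)^-1 * (f t)^-1)).
  by move=> t; have := drvV (f0 t) (ff' t); rewrite mulN1r expr2.
by apply: CkM; apply: CkM => //; [exact: Ck_cst|exact: IH|exact: IH].
Qed.

(** Up to linear combinations this family is stable under differentiation, the value 0 on the left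
    included, so a single induction reaches all derivatives of exp(-1/t). *)
Definition expm m t : R := if 0 < t then t^-1 ^+ m * expR (- t^-1) else 0.

Lemma expm_ge0 m t : 0 <= expm m t.
Proof.
rewrite /expm; case: ifPn => // t0.
by rewrite mulr_ge0 ?expR_ge0// exprn_ge0// invr_ge0 ltW.
Qed.

(** Comparison of exp(1/t) with the term of degree m+3 of its series. The difference quotient of
    [expm m] at 0 from the right is [expm m.+1], so this bound makes it tend to 0. *)
Lemma expm_le m t : 0 <= t -> expm m.+1 t <= m.+3`!%:R * t * t.
Proof.
rewrite le_eqVlt => /predU1P[<-|t0]; first by rewrite /expm ltxx mulr0.
rewrite /expm t0.
have s0 : 0 < t^-1 by rewrite invr_gt0.
have := expR_ge1Dxn m.+2 (ltW s0) => h.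
have {}h : t^-1 ^+ m.+3 <= m.+3`!%:R * expR t^-1.
  rewrite mulrC -ler_pdivrMr ?ltr0n ?fact_gt0//.
  by apply: le_trans h; rewrite lerDr.
rewrite expRN ler_pdivrMr ?expR_gt0//.
rewrite (_ : t^-1 ^+ m.+1 = t^-1 ^+ m.+3 * (t * t)); last first.
  by rewrite [in RHS]exprS [in RHS]exprS; field; rewrite gt_eqF.
rewrite (_ : _ * expR _ = (m.+3`!%:R * expR t^-1) * (t * t)); last by ring.
by rewrite ler_wpM2r// mulr_ge0// ltW.
Qed.

Lemma is_derive_expm m t :
  is_derive t 1 (expm m) (expm m.+2 t - m%:R * expm m.+1 t).
Proof.
have [t0|t0|t0] := ltgtP t 0.
- have -> : expm m.+2 t - m%:R * expm m.+1 t = 0.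
    by rewrite /expm ltNge (ltW t0)/= mulr0 subr0.
  have E : {near t, (fun=> 0 : R) =1 expm m}.
    near=> s; rewrite /expm ifF//; apply/negbTE; rewrite -leNgt ltW//.
    by near: s; exact: lt_nbhsl.
  apply: DeriveDef; first exact: near_eq_derivable E (derivable_cst _ _ _).
  by rewrite -(near_eq_derive _ E) derive_cst.
- have h : is_derive t 1 (fun s => s^-1 ^+ m * expR (- s^-1))
    (expm m.+2 t - m%:R * expm m.+1 t).
    have tn0 := lt0r_neq0 t0.
    have hv := drvV (f := id) tn0 (is_derive_id t (1 : R)).
    apply: (drv_eq (drvM (drvX m hv) (drv_comp (is_derive_expR _) (drvN hv)))).
    rewrite /expm t0; case: m => [|m]; first by rewrite !mul0r !expr0; ring.
    by rewrite /= !exprS; ring.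
  have E : {near t, (fun s => s^-1 ^+ m * expR (- s^-1)) =1 expm m}.
    near=> s; rewrite /expm ifT//.
    by near: s; exact: lt_nbhsr.
  case: h => h1 h2; apply: DeriveDef; first exact: near_eq_derivable E h1.
  by rewrite -(near_eq_derive _ E).
- rewrite t0; have -> : expm m.+2 0 - m%:R * expm m.+1 0 = 0 :> R.
    by rewrite /expm ltxx mulr0 subr0.
  have h : (fun h : R => h^-1 *: ((expm m \o shift (0 : R)) (h *: (1:R)) - expm m 0)) @ 0^' --> (0 : R).
    apply/cvgrPdist_le => e e0.
    have C0 : 0 < (m.+3)`!%:R + 1 :> R by rewrite ltr_wpDl.
    near=> h; rewrite sub0r normrN /= addr0 -[h *: 1]/(h * 1) mulr1.
    rewrite {2}/expm ltxx subr0 -[_ *: _]/(_ * _).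
    have [h0|h0] := leP h 0.
      by rewrite /expm ltNge h0/= mulr0 normr0 ltW.
    rewrite ger0_norm; last by rewrite mulr_ge0 ?expm_ge0// invr_ge0 ltW.
    rewrite (_ : h^-1 * expm m h = expm m.+1 h); last first.
      by rewrite /expm h0 exprS mulrA.
    apply: (le_trans (expm_le m (ltW h0))).
    have hs : `|h| < Num.min 1 (e / ((m.+3)`!%:R + 1)).
      near: h; apply: dnbhs0_lt; rewrite lt_min ltr01/= divr_gt0//.
    move: hs; rewrite lt_min (ger0_norm (ltW h0)) => /andP[h1].
    rewrite ltr_pdivlMr// => h2.
    have : 0 <= (m.+3)`!%:R :> R by [].
    move: ((m.+3)`!%:R : R) h2 => F h2 F0; nra.
  by apply: DeriveDef; [apply/cvg_ex; exists 0|apply/cvg_lim].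
Unshelve. all: by end_near. Qed.

Lemma Ck_expm k m : Ck k (expm m).
Proof.
elim: k m => [m|k IH m]; first exact: drv_continuous (is_derive_expm m).
exists (fun t => expm m.+2 t + (- m%:R) * expm m.+1 t).
  by move=> t; rewrite mulNr; exact: is_derive_expm.
by apply: CkD => //; apply: CkM => //; exact: Ck_cst.
Qed.

Definition step t : R := expm 0 t / (expm 0 t + expm 0 (1 - t)).

Lemma step_den_gt0 t : 0 < expm 0 t + expm 0 (1 - t).
Proof.
have [t0|t0] := ltP 0 t.
  by rewrite ltr_wpDr ?expm_ge0// /expm t0 expr0 mul1r expR_gt0.
by rewrite ltr_wpDl ?expm_ge0// /expm ifT ?expr0 ?mul1r ?expR_gt0//; lra.
Qed.

Lemma Ck_step k : Ck k step.
Proof.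
apply: CkM; first exact: Ck_expm.
apply: Ck_inv; first by move=> t; rewrite gt_eqF// step_den_gt0.
apply: CkD; first exact: Ck_expm.
apply: (Ck_ext (f := fun t => expm 0 (- 1 * t + 1))).
  by move=> t; congr expm; rewrite mulN1r addrC.
exact: Ck_affine (Ck_expm _ _).
Qed.

Lemma step0 t : t <= 0 -> step t = 0.
Proof. by move=> t0; rewrite /step {1}/expm ltNge t0/= mul0r. Qed.

Lemma step1 t : 1 <= t -> step t = 1.
Proof.
move=> t1; rewrite /step (_ : expm 0 (1 - t) = 0); last first.
  by rewrite /expm ltNge subr_le0 t1.
rewrite addr0 divff// /expm ifT ?(lt_le_trans ltr01)//.
by rewrite expr0 mul1r gt_eqF// expR_gt0.
Qed.

Lemma step_ge0 t : 0 <= step t.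
Proof. by rewrite divr_ge0 ?expm_ge0 ?(ltW (step_den_gt0 t)). Qed.

Lemma step_le1 t : step t <= 1.
Proof. by rewrite ler_pdivrMr ?step_den_gt0// mul1r lerDl expm_ge0. Qed.

(** With a and b the two values of [expm 0] in the denominator and a', b' the derivatives of
    [expm 0] at t and 1 - t, the quotient rule gives (a' b + a b') / (a + b)^2, and all four numbers
    are nonnegative. *)
Lemma derive_step_ge0 t d : is_derive t 1 step d -> 0 <= d.
Proof.
move=> hd.
pose a := expm 0 t; pose b := expm 0 (1 - t).
have ha := is_derive_expm 0 t.
have hb : is_derive t 1 (fun t => expm 0 (1 - t)) ((expm 2 (1 - t)) * - 1).
  have h1 : is_derive (1 - t) 1 (expm 0) (expm 2 (1 - t)).
    by apply: (drv_eq (is_derive_expm 0 (1 - t))); rewrite mul0r subr0.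
  apply: (@drv_comp R R (expm 0) (fun s : R => 1 - s) t 1 (- 1) _ h1).
  by apply: (drv_eq (drvB (drvC 1 t 1) (is_derive_id t 1))); rewrite sub0r.
have h0 := gt_eqF (step_den_gt0 t).
have hs := drvD ha hb.
have := drvM ha (drvV (f := fun y : R => expm 0 y + expm 0 (1 - y)) (negbT h0) hs).
case: hd => _ <- [_]; rewrite -/step => ->.
rewrite mul0r subr0 -/a -/b.
have a0 : 0 <= a := expm_ge0 0 t. have b0 : 0 <= b := expm_ge0 0 (1 - t).
have := expm_ge0 2 t; have := expm_ge0 2 (1 - t).
have := step_den_gt0 t; rewrite -/a -/b.
move: (expm 2 t) (expm 2 (1 - t)) => a' b' ab hb' ha'.
rewrite (_ : _ + _ = (a' * b + a * b') * ((a + b)^-1 ^+ 2)).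
  apply: mulr_ge0; first by rewrite addr_ge0 ?mulr_ge0.
  by rewrite exprn_ge0// invr_ge0 ltW.
by field; rewrite gt_eqF.
Qed.

End smooth_step.

(** * The Carleman estimate *)

Section carleman.
Context {R : realType} {n : nat}.
Local Notation V := ('rV[R]_n.+1).
Local Notation L := (lebesgue_space R n).
Local Notation mu := (lebesgueN R n).
Local Notation e_ i := (delta_mx ord0 i : V).
Implicit Types (x y v : V) (f g F : V -> R) (i j : 'I_n.+1).

Lemma contM f g : continuous f -> continuous g -> continuous (fun x => f x * g x).
Proof. by move=> cf cg x; exact: continuousM (cf x) (cg x). Qed.

Lemma contD f g : continuous f -> continuous g -> continuous (fun x => f x + g x).
Proof. by move=> cf cg x; exact: continuousD (cf x) (cg x). Qed.

Lemma contN f : continuous f -> continuous (fun x => - f x).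
Proof. by move=> cf x; exact: continuousN (cf x). Qed.

Lemma contC (c : R) : continuous (fun _ : V => c).
Proof. exact: cst_continuous. Qed.

Lemma cont_coord i : continuous (fun x : V => x ord0 i).
Proof. exact: coord_continuous. Qed.

Lemma contS k (f : 'I_k -> V -> R) : (forall j : 'I_k, continuous (f j)) ->
  continuous (fun x => \sum_(i < k) f i x).
Proof.
elim: k f => [|k IH] f cf.
  under eq_fun do rewrite big_ord0.
  exact: contC.
under eq_fun do rewrite big_ord_recr/=.
by apply: contD; [apply: IH => j; exact: cf|exact: cf].
Qed.

Lemma contX f k : continuous f -> continuous (fun x => f x ^+ k).
Proof.
move=> cf; elim: k => [|k IH].
  by under eq_fun do rewrite expr0; exact: contC.
by under eq_fun do rewrite exprS; exact: contM.
Qed.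

Lemma cont_comp (h : R -> R) f : continuous h -> continuous f ->
  continuous (fun x => h (f x)).
Proof. by move=> ch cf x; apply: (continuous_comp (cf x)); exact: ch. Qed.

Lemma drv_coord i j x : is_derive x (e_ i) (fun y : V => y ord0 j) (j == i)%:R.
Proof.
apply/drv_line.
rewrite (_ : (fun s : R => _) = (fun s => x ord0 j + s * (j == i)%:R)); last first.
  by apply/funext => s; rewrite !mxE eqxx.
apply: (drv_eq (drvD (drvC _ _ _) (drvM (is_derive_id _ _) (drvC _ _ _)))).
by rewrite add0r mul1r mulr0 addr0.
Qed.

(** The square of the Euclidean norm. Bars denote the sup norm, so the weight, the cut-offs and the
    balls of the Carleman estimate are expressed through [sq]. *)
Definition sq x : R := \sum_i x ord0 i * x ord0 i.

Lemma sq_ge0 x : 0 <= sq x.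
Proof. by apply: sumr_ge0 => i _; rewrite -expr2 sqr_ge0. Qed.

Lemma drv_sq i x : is_derive x (e_ i) sq (2 * x ord0 i).
Proof.
apply: (drv_eq (drvS (fun j => drvM (drv_coord i j x) (drv_coord i j x)))).
rewrite (bigD1 i)//= eqxx mul1r mulr1 big1 ?addr0; first by ring.
by move=> j /negbTE ->; rewrite mul0r mulr0 addr0.
Qed.

Lemma cont_sq : continuous sq.
Proof. by apply: contS => i; apply: contM; exact: cont_coord. Qed.

Lemma normV_sq x : `|x| ^+ 2 <= sq x.
Proof.
have h i : `|x ord0 i| ^+ 2 <= sq x.
  rewrite /sq (bigD1 i)//= real_normK ?num_real// -expr2 lerDl.
  by apply: sumr_ge0 => j _; rewrite -expr2 sqr_ge0.
rewrite -[leRHS]sqr_sqrtr ?sq_ge0// ler_pXn2r ?nnegrE ?sqrtr_ge0//.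
apply/normV_leP; first exact: sqrtr_ge0.
by move=> i; rewrite -[leLHS]ger0_norm// -sqrtr_sqr ler_wsqrtr.
Qed.

Lemma sq_normV x : sq x <= n.+1%:R * `|x| ^+ 2.
Proof.
apply: (@le_trans _ _ (\sum_(i < n.+1) `|x| ^+ 2)).
  apply: ler_sum => i _; rewrite -expr2 -(real_normK (num_real _)).
  by rewrite ler_pXn2r ?nnegrE// normV_coord.
by rewrite sumr_const card_ord mulr_natl.
Qed.

Lemma near_cont_lt f x (a : R) : continuous f -> f x < a -> \near x, f x < a.
Proof. by move=> cf fa; exact: (cvgr_lt _ (cf x)). Qed.

Lemma near_cont_gt f x (a : R) : continuous f -> a < f x -> \near x, a < f x.
Proof. by move=> cf fa; exact: (cvgr_gt _ (cf x)). Qed.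

(** The weight is singular at the origin, where the inverse takes the default value 0; [wt] is
    applied to functions that vanish near the origin. *)
Definition wt k F x := (sq x)^-1 ^+ k * F x.

Lemma drv_wt k F dF (a : R) i : 0 < a -> (forall x, sq x < a -> F x = 0) ->
  (forall x, is_derive x (e_ i) F (dF x)) ->
  forall x, is_derive x (e_ i) (wt k F)
    (wt k.+1 (fun y => - (2 * k%:R) * (y ord0 i * F y)) x + wt k dF x).
Proof.
move=> a0 F0 FdF x; have [xa|ax] := ltP (sq x) a.
  have nx := near_cont_lt cont_sq xa.
  have dF0 : dF x = 0.
    by apply: is_derive_near0 (FdF x); apply: filterS nx => y; exact: F0.
  have : is_derive x (e_ i) (cst 0) (0 : R) by exact: is_derive_cst.
  rewrite /wt F0// dF0 !mulr0 addr0; apply: near_is_derive; first exact: delta_neq0.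
  by apply: filterS nx => y /F0 ->; rewrite mulr0.
have sx0 : sq x != 0 by rewrite gt_eqF// (lt_le_trans a0).
apply: (drv_eq (drvM (drvX k (drvV sx0 (drv_sq i x))) (FdF x))).
rewrite /wt; congr (_ + _).
by case: k => [|k]; rewrite ?mulr0 ?oppr0 ?mul0r ?mulr0//= !exprS; ring.
Qed.

Lemma cont_wt k F (a : R) : 0 < a -> (forall x, sq x < a -> F x = 0) ->
  continuous F -> continuous (wt k F).
Proof.
move=> a0 F0 cF x; have [xa|ax] := ltP (sq x) a.
  have nx := near_cont_lt cont_sq xa.
  have E : \forall y \near x, 0 = wt k F y.
    by apply: filterS nx => y /F0; rewrite /wt => ->; rewrite mulr0.
  rewrite /continuous_at [X in _ --> X]/wt F0// mulr0.
  by apply: cvg_trans (near_eq_cvg E) _; exact: (@cst_continuous V R 0 x).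
have sx0 : sq x != 0 by rewrite gt_eqF// (lt_le_trans a0).
apply: (@continuousM _ _ (fun y => (sq y)^-1 ^+ k) F); last exact: cF.
have cV : {for x, continuous (fun y => (sq y)^-1)}.
  by apply: continuousV => //; exact: cont_sq.
elim: k => [|k IH]; first exact: (@cst_continuous V R 1 x).
rewrite (_ : (fun y => _) = (fun y => (sq y)^-1 * (sq y)^-1 ^+ k)).
  exact: (continuousM cV IH).
by apply/funext => y; rewrite exprS.
Qed.

Lemma integrable_add (A : set L) f g : mu.-integrable A (EFin \o f) ->
  mu.-integrable A (EFin \o g) -> measurable A ->
  mu.-integrable A (EFin \o (fun x => f x + g x)).
Proof. by move=> fi gi mA; have := integrableD mA fi gi. Qed.

Lemma integrable_scale (A : set L) (c : R) f : mu.-integrable A (EFin \o f) ->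
  measurable A -> mu.-integrable A (EFin \o (fun x => c * f x)).
Proof. by move=> fi mA; have := integrableZl mA c fi. Qed.

Lemma integrable_sumN k (A : set L) (f : 'I_k -> V -> R) : measurable A ->
  (forall j : 'I_k, mu.-integrable A (EFin \o f j)) ->
  mu.-integrable A (EFin \o (fun x => \sum_(i < k) f i x)).
Proof.
move=> mA; elim: k f => [|k IH] f h.
  under eq_fun do rewrite big_ord0.
  exact: integrable0.
under eq_fun do rewrite big_ord_recr/=.
by apply: integrable_add => //; apply: IH.
Qed.

Lemma Rintegral_sumN k (A : set L) (f : 'I_k -> V -> R) : measurable A ->
  (forall j : 'I_k, mu.-integrable A (EFin \o f j)) ->
  \int[mu]_(x in A) (\sum_(i < k) f i x) = \sum_(i < k) \int[mu]_(x in A) f i x.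
Proof.
move=> mA; elim: k f => [|k IH] f h.
  under eq_Rintegral do rewrite big_ord0.
  by rewrite big_ord0 Rintegral_cst// mul0r.
under eq_Rintegral do rewrite big_ord_recr/=.
rewrite RintegralD//; last by apply: integrable_sumN.
by rewrite IH// big_ord_recr.
Qed.

(** The derivatives are data rather than operators, with [h2 i j] the derivative of [h1 j] along i;
    products, dilations and mollifications then provide them explicitly. *)
Definition C2data (h : V -> R) (h1 : 'I_n.+1 -> V -> R) (h2 : 'I_n.+1 -> 'I_n.+1 -> V -> R) :=
 [/\ continuous h, forall i, continuous (h1 i), forall i j, continuous (h2 i j),
   (forall i x, is_derive x (e_ i) h (h1 i x)) /\
   (forall i j x, is_derive x (e_ i) (h1 j) (h2 i j x)) &
   forall i j x, h2 i j x = h2 j i x].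

Section carleman_estimate.
Variables (h : V -> R) (h1 : 'I_n.+1 -> V -> R) (h2 : 'I_n.+1 -> 'I_n.+1 -> V -> R).
Variables (b : R) (k : nat).
Hypothesis hC2 : C2data h h1 h2.
Hypothesis b1 : 1 <= b.
Hypothesis k0 : (0 < k)%N.
Hypothesis h0 : forall x, sq x < 1 \/ b < sq x -> h x = 0.

Let near_h0 x : sq x < 1 \/ b < sq x -> \forall y \near x, sq y < 1 \/ b < sq y.
Proof.
case=> hx.
  by apply: filterS (near_cont_lt cont_sq hx) => y; left.
by apply: filterS (near_cont_gt cont_sq hx) => y; right.
Qed.

Let h10 i x : sq x < 1 \/ b < sq x -> h1 i x = 0.
Proof.
case: hC2 => _ _ _ [hd _] _ hx.
by apply: is_derive_near0 (hd i x); apply: filterS (near_h0 hx) => y; exact: h0.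
Qed.

Let h20 i j x : sq x < 1 \/ b < sq x -> h2 i j x = 0.
Proof.
case: hC2 => _ _ _ [_ hd] _ hx.
by apply: is_derive_near0 (hd i j x); apply: filterS (near_h0 hx) => y; exact: h10.
Qed.

(* The multiplier is Y = x . grad h - tau h; the flux Q removes from the
   divergence of |x|^(-2k) P + |x|^(-2k-2) Q the cross terms h * Y that carry a
   factor b. *)
Let N : R := n.+1%:R.
Let tau : R := k.+1%:R - N / 2.
Let c0 : R := - b * tau * k%:R.
Let D x := \sum_j x ord0 j * h1 j x.
Let Y x := D x - tau * h x.
Let gr x := \sum_j h1 j x * h1 j x.
Let lap x := \sum_j h2 j j x.
Let dY i x := h1 i x + \sum_j x ord0 j * h2 i j x - tau * h1 i x.
Let dgr i x := \sum_j h1 j x * h2 i j x.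
Let P i x := - b * (h1 i x * Y x - x ord0 i / 2 * gr x) + x ord0 i * (h x * h x).
Let dP i x := - b * (h2 i i x * Y x + h1 i x * dY i x - (gr x / 2 + x ord0 i * dgr i x))
   + (h x * h x + x ord0 i * (2 * h x * h1 i x)).
Let Q i x := c0 * (x ord0 i * (h x * h x)).
Let dQ i x := c0 * (h x * h x + x ord0 i * (2 * h x * h1 i x)).

Let drv_hh i x : is_derive x (e_ i) (fun x => h x * h x) (2 * h x * h1 i x).
Proof.
case: hC2 => _ _ _ [hd _] _.
by apply: (drv_eq (drvM (hd i x) (hd i x))); ring.
Qed.

Let drv_xhh i x : is_derive x (e_ i) (fun x => x ord0 i * (h x * h x))
  (h x * h x + x ord0 i * (2 * h x * h1 i x)).
Proof.
by apply: (drv_eq (drvM (drv_coord i i x) (drv_hh i x))); rewrite eqxx mul1r.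
Qed.

Let drv_Q i x : is_derive x (e_ i) (Q i) (dQ i x).
Proof. exact: drvZ (drv_xhh i x). Qed.

Let drv_Y i x : is_derive x (e_ i) Y (dY i x).
Proof.
case: hC2 => _ _ _ [hd hd1] _.
have hD := drvS (fun j => drvM (drv_coord i j x) (hd1 i j x)).
apply: (drv_eq (drvB hD (drvZ tau (hd i x)))).
congr (_ - _); rewrite big_split/=; congr (_ + _).
rewrite (bigD1 i)//= eqxx mul1r big1 ?addr0// => j /negbTE ->.
by rewrite mul0r.
Qed.

Let drv_gr i x : is_derive x (e_ i) gr (2 * dgr i x).
Proof.
case: hC2 => _ _ _ [hd hd1] _.
apply: (drv_eq (drvS (fun j => drvM (hd1 i j x) (hd1 i j x)))).
by rewrite mulr_sumr; apply: eq_bigr => j _; ring.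
Qed.

Let drv_P i x : is_derive x (e_ i) (P i) (dP i x).
Proof.
case: hC2 => _ _ _ [hd hd1] _.
have hx2 := drvM (drv_coord i i x) (drvC 2^-1 x (e_ i)).
have := drvD (drvZ (- b) (drvB (drvM (hd1 i i x) (drv_Y i x))
  (drvM hx2 (drv_gr i x)))) (drv_xhh i x).
by move/drv_eq; apply; rewrite /dP eqxx mulr0 addr0/=; congr (_ * _ + _); field.
Qed.

Let cont_h : continuous h. Proof. by case: hC2. Qed.
Let cont_h1 i : continuous (h1 i). Proof. by case: hC2. Qed.
Let cont_h2 i j : continuous (h2 i j). Proof. by case: hC2. Qed.
Let cont_Y : continuous Y.
Proof.
apply: contD; last by apply: contN; apply: contM => //; exact: contC.
by apply: contS => j; apply: contM => //; exact: cont_coord.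
Qed.
Let cont_gr : continuous gr.
Proof. by apply: contS => j; apply: contM. Qed.
Let cont_hh : continuous (fun x => h x * h x). Proof. exact: contM. Qed.
Let cont_P i : continuous (P i).
Proof.
apply: contD; last by apply: contM => //; exact: cont_coord.
apply: contM; first exact: contC.
apply: contD; first exact: contM.
apply: contN; apply: contM => //.
by apply: contM; [exact: cont_coord|exact: contC].
Qed.
Let cont_hhx i : continuous (fun x => h x * h x + x ord0 i * (2 * h x * h1 i x)).
Proof.
apply: contD => //; apply: contM; first exact: cont_coord.
by apply: contM => //; apply: contM => //; exact: contC.
Qed.
Let cont_Q i : continuous (Q i).
Proof. by apply: contM; [exact: contC|apply: contM => //; exact: cont_coord]. Qed.
Let cont_dQ i : continuous (dQ i).
Proof. by apply: contM; [exact: contC|exact: cont_hhx]. Qed.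
Let cont_dP i : continuous (dP i).
Proof.
apply: contD; last exact: cont_hhx.
apply: contM; first exact: contC.
apply: contD.
  apply: contD; first exact: contM.
  apply: contM => //; apply: contD.
    apply: contD => //; apply: contS => j; apply: contM => //; exact: cont_coord.
  by apply: contN; apply: contM => //; exact: contC.
apply: contN; apply: contD; first by apply: contM => //; exact: contC.
apply: contM; first exact: cont_coord.
by apply: contS => j; exact: contM.
Qed.

Let out x := sq x < 1 \/ b < sq x.

Let D0 x : out x -> D x = 0.
Proof. by move=> ox; rewrite /D big1// => j _; rewrite h10// mulr0. Qed.
Let Y0 x : out x -> Y x = 0.
Proof. by move=> ox; rewrite /Y D0// h0// mulr0 subr0. Qed.
Let gr0 x : out x -> gr x = 0.
Proof. by move=> ox; rewrite /gr big1// => j _; rewrite h10// mulr0. Qed.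
Let P0 i x : out x -> P i x = 0.
Proof. by move=> ox; rewrite /P gr0// h0// h10//; ring. Qed.
Let dP0 i x : out x -> dP i x = 0.
Proof.
move=> ox; rewrite /dP gr0// h0// h10// h20// Y0// /dgr big1; first by ring.
by move=> j _; rewrite h10// mul0r.
Qed.
Let Q0 i x : out x -> Q i x = 0.
Proof. by move=> ox; rewrite /Q h0//; ring. Qed.
Let dQ0 i x : out x -> dQ i x = 0.
Proof. by move=> ox; rewrite /dQ h0//; ring. Qed.

Let G i x := wt k (P i) x + wt k.+1 (Q i) x.
Let dG i x := (wt k.+1 (fun y => - (2 * k%:R) * (y ord0 i * P i y)) x + wt k (dP i) x)
  + (wt k.+2 (fun y => - (2 * k.+1%:R) * (y ord0 i * Q i y)) x + wt k.+1 (dQ i) x).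

Let outM x : b < `|x| -> out x.
Proof.
move=> bx; right; apply: lt_le_trans (normV_sq x).
by rewrite (lt_le_trans bx)// expr2 ler_peMl// (le_trans b1)// ltW.
Qed.

Let integral_dG i : \int[mu]_x dG i x = 0 /\ mu.-integrable [set: L] (EFin \o dG i).
Proof.
have out1 x : sq x < 1 -> out x by left.
have cw F (l : nat) : continuous F -> (forall x, out x -> F x = 0) -> continuous (wt l F).
  by move=> cF F0; apply: (@cont_wt _ _ 1) => // x x1; apply: F0; left.
have cdG : continuous (dG i).
  have cx (F : V -> R) j (c : R) : continuous F -> continuous (fun y => c * (y ord0 j * F y)).
    by move=> cF; apply: contM; [exact: contC|apply: contM => //; exact: cont_coord].
  have a1 : continuous (wt k.+1 (fun y => - (2 * k%:R) * (y ord0 i * P i y))).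
    by apply: cw; [exact: cx|move=> x ox; rewrite P0// !mulr0].
  have a2 : continuous (wt k (dP i)) by apply: cw => //; exact: dP0.
  have a3 : continuous (wt k.+2 (fun y => - (2 * k.+1%:R) * (y ord0 i * Q i y))).
    by apply: cw; [exact: cx|move=> x ox; rewrite Q0// !mulr0].
  have a4 : continuous (wt k.+1 (dQ i)) by apply: cw => //; exact: dQ0.
  exact: (contD (contD a1 a2) (contD a3 a4)).
split.
  apply: (@integral_partial0 _ _ (G i) (dG i) i b) => //.
  - apply: (contD (f := wt k (P i)) (g := wt k.+1 (Q i))); apply: cw => //.
      exact: P0.
    exact: Q0.
  - move=> x; have hP : is_derive x (e_ i) (wt k (P i)) _ := @drv_wt k (P i) (dP i) 1 i ltr01
      (fun y oy => P0 i (or_introl oy)) (drv_P i) x.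
    have hQ := @drv_wt k.+1 (Q i) (dQ i) 1 i ltr01
      (fun y oy => Q0 i (or_introl oy)) (drv_Q i) x.
    exact: (drvD hP hQ).
  - by move=> x /outM ox; rewrite /G/wt P0// Q0// !mulr0 addr0.
apply: (@integrable_Cc _ _ (dG i) b) => // x /outM ox.
by rewrite /dG/wt P0// Q0// dP0// dQ0// !mulr0 !addr0.
Qed.

Let sum_xP x : \sum_i x ord0 i * P i x =
  - b * (D x * Y x - sq x / 2 * gr x) + sq x * (h x * h x).
Proof.
have E i : x ord0 i * P i x = (- b * Y x) * (x ord0 i * h1 i x)
   + (b / 2 * gr x + h x * h x) * (x ord0 i * x ord0 i) by rewrite /P; field.
rewrite (eq_bigr _ (fun i _ => E i)) big_split/= -!mulr_sumr -/(D x) -/(sq x).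
by field.
Qed.

Let sum_xQ x : \sum_i x ord0 i * Q i x = c0 * sq x * (h x * h x).
Proof.
have E i : x ord0 i * Q i x = (c0 * (h x * h x)) * (x ord0 i * x ord0 i) by rewrite /Q; ring.
by rewrite (eq_bigr _ (fun i _ => E i)) -!mulr_sumr -/(sq x); ring.
Qed.

Let sum_dQ x : \sum_i dQ i x = c0 * (N * (h x * h x) + 2 * h x * D x).
Proof.
have E i : dQ i x = c0 * (h x * h x) + (c0 * 2 * h x) * (x ord0 i * h1 i x) by rewrite /dQ; ring.
rewrite (eq_bigr _ (fun i _ => E i)) big_split/= -!mulr_sumr -/(D x).
by rewrite sumr_const card_ord -[_ *+ _]mulr_natl -/N; ring.
Qed.

Let sum_dP x : \sum_i dP i x = - b * (lap x * Y x + (1 - tau - N / 2) * gr x)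
  + N * (h x * h x) + 2 * h x * D x.
Proof.
have E i : dP i x = (- b * Y x) * h2 i i x + (- b * (1 - tau)) * (h1 i x * h1 i x)
  + (- b) * (\sum_j h1 i x * (x ord0 j * h2 i j x)) + b * (\sum_j x ord0 i * (h1 j x * h2 i j x))
  + (b / 2 * gr x + h x * h x) + (2 * h x) * (x ord0 i * h1 i x).
  by rewrite /dP /dY /dgr -!mulr_sumr; field.
rewrite (eq_bigr _ (fun i _ => E i)) !big_split/= -!mulr_sumr -/(D x) -/(gr x) -/(lap x).
rewrite !sumr_const card_ord -[_ *+ _]mulr_natl -/N.
have -> : \sum_(i < n.+1) \sum_j h1 i x * (x ord0 j * h2 i j x) =
          \sum_(i < n.+1) \sum_j x ord0 i * (h1 j x * h2 i j x).
  rewrite exchange_big/=; apply: eq_bigr => i _; apply: eq_bigr => j _.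
  by case: hC2 => _ _ _ _ ->; ring.
by field.
Qed.

(** The sum of the [dG i] is an exact divergence. As 1 - tau - N/2 = -k, the terms in |grad h|^2
    coming from the weight and from [P] cancel. The choice of [c0] cancels the terms in b h Y and,
    since N = 2(k+1) - 2 tau, those in b h^2 as well. A quadratic form in Y, h and the Laplacian
    remains. *)
Let pointwise x : wt k (fun x => h x * h x) x <=
  b * wt k (fun x => sq x * (lap x * lap x)) x + \sum_i dG i x.
Proof.
have [ox|nox] := pselect (out x).
  rewrite /wt h0// !mulr0 big1 ?addr0.
    by rewrite /lap big1 ?mulr0// => j _; exact: h20.
  by move=> i _; rewrite /dG /wt P0// Q0// dP0// dQ0// !mulr0 !addr0.
have [s1 sb] : 1 <= sq x /\ sq x <= b.
  by split; rewrite leNgt; apply/negP => hh; apply: nox; [left|right].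
have s0 : sq x != 0 by rewrite gt_eqF// (lt_le_trans ltr01).
have -> : \sum_i dG i x = (sq x)^-1 ^+ k * ((sq x)^-1 * (- (2 * k%:R)) * (\sum_i x ord0 i * P i x)
  + (\sum_i dP i x) + (sq x)^-1 * (sq x)^-1 * (- (2 * k.+1%:R)) * (\sum_i x ord0 i * Q i x)
  + (sq x)^-1 * \sum_i dQ i x).
  rewrite !mulr_sumr -!big_split/= mulr_sumr; apply: eq_bigr => i _.
  by rewrite /dG /wt !exprS; ring.
rewrite sum_xP sum_xQ sum_dQ sum_dP /wt [b * _]mulrCA -mulrDr.
apply: ler_wpM2l; first by rewrite exprn_ge0// invr_ge0 sq_ge0.
have YE : D x = Y x + tau * h x by rewrite /Y subrK.
have NE : N = 2 * k.+1%:R - 2 * tau by rewrite /tau; field.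
rewrite YE /c0 NE -natr1.
move: (Y x) (h x) (lap x) (gr x) s0 s1 sb => y a l g s0 s1 sb.
have tb : 1 <= b * (sq x)^-1.
  by rewrite ler_pdivlMr ?mul1r// (lt_le_trans ltr01).
have kR : 1 <= k%:R :> R by rewrite ler1n.
rewrite -subr_ge0.
(* A completed square. In the shell 1 <= sq x <= b one has b / sq x >= 1, and k >= 1 gives 2k - 1/4
   >= 1, so the remaining terms dominate (a + y)^2. *)
rewrite [leRHS](_ : _ = b * (sq x)^-1 * (sq x * l - y / 2) ^+ 2 +
  (2 * k%:R - 1 / 4) * (b * (sq x)^-1) * (y * y) + a * a + 2 * a * y); last by field.
have := sqr_ge0 (sq x * l - y / 2); move: ((_ - _) ^+ 2) => z z0.
move: (b / sq x) tb => w w1.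
have : 0 <= w * z by rewrite mulr_ge0// (le_trans ler01).
have : y * y <= (2 * k%:R - 1 / 4) * w * (y * y).
  rewrite -[leLHS]mul1r; apply: ler_wpM2r; first by rewrite -expr2 sqr_ge0.
  by move: (k%:R : R) kR => K K1; nra.
have := sqr_ge0 (a + y); rewrite sqrrD !expr2 => h3 h4 h5.
rewrite -mulr_natr in h3.
lra.
Qed.

(** Integration of [pointwise], the divergence contributing nothing. The constant [b], the square of
    the outer radius, does not depend on [k]; this is what makes large [k] useful. *)
Lemma carleman : \int[mu]_x wt k (fun x => h x * h x) x <=
  b * \int[mu]_x wt k (fun x => sq x * (lap x * lap x)) x.
Proof.
have c1 : continuous (wt k (fun x => h x * h x)).
  by apply: (@cont_wt _ _ 1) => // x x1; rewrite h0 ?mulr0//; left.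
have lap0 x : out x -> lap x = 0 by move=> ox; rewrite /lap big1// => j _; exact: h20.
have c2 : continuous (wt k (fun x => sq x * (lap x * lap x))).
  apply: (@cont_wt _ _ 1) => // [x x1|]; first by rewrite lap0 ?mulr0//; left.
  by apply: contM; [exact: cont_sq|apply: contM; apply: contS => j].
have i1 : mu.-integrable [set: L] (EFin \o wt k (fun x => h x * h x)).
  by apply: (integrable_Cc (M := b)) => // x /outM ox; rewrite /wt h0// !mulr0.
have i2 : mu.-integrable [set: L] (EFin \o wt k (fun x => sq x * (lap x * lap x))).
  by apply: (integrable_Cc (M := b)) => // x /outM ox; rewrite /wt lap0// !mulr0.
have i3 := integrable_sumN measurableT (fun i => (integral_dG i).2).
have i2' : mu.-integrable [set: L] (EFin \o (fun x => b * wt k (fun x => sq x * (lap x * lap x)) x)).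
  exact: integrable_scale.
have := le_Rintegral measurableT i1 _ (fun x _ => pointwise x).
rewrite RintegralD// RintegralZl// Rintegral_sumN//; last by move=> i; exact: (integral_dG i).2.
rewrite big1 ?addr0; last by move=> i _; exact: (integral_dG i).1.
by apply; exact: integrable_add.
Qed.

End carleman_estimate.

End carleman.

(** * Increments and gradients *)

Section gradient.
Context {R : realType} {n : nat}.
Local Notation V := ('rV[R]_n.+1).
Local Notation e_ i := (delta_mx ord0 i : V).
Implicit Types (x y v : V) (f : V -> R) (i : 'I_n.+1).

Lemma MVT_line_loc f (df : V -> R) x v (t : R) :
  (forall s, `|s| <= `|t| -> is_derive (x + s *: v) v f (df (x + s *: v))) ->
  exists2 s, `|s| <= `|t| & f (x + t *: v) - f x = t * df (x + s *: v).
Proof.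
move=> fd; pose F (s : R) := f (x + s *: v).
have fl (s : R) : `|s| <= `|t| -> is_derive s 1 F (df (x + s *: v)).
  by move=> /fd; exact: is_derive_line.
have F0 : F 0 = f x by rewrite /F scale0r addr0.
have [t0|t0] := leP 0 t.
  have fl' (s : R) : s \in `[0, t] -> is_derive s 1 F (df (x + s *: v)).
    by rewrite in_itv/= => /andP[s0 st]; apply: fl; rewrite !ger0_norm.
  have cF : {within `[0, t], continuous F}.
    by apply: derivable_within_continuous => s /fl' [].
  have flo (s : R) : s \in `]0, t[ -> is_derive s 1 F (df (x + s *: v)).
    by move=> /subset_itv_oo_cc; exact: fl'.
  have [s] := MVT_segment t0 flo cF.
  rewrite in_itv/= F0 subr0 => /andP[s0 st] ->.
  by exists s; rewrite 1?mulrC// !ger0_norm// (le_trans s0).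
have fl' (s : R) : s \in `[t, 0] -> is_derive s 1 F (df (x + s *: v)).
  rewrite in_itv/= => /andP[st s0]; apply: fl.
  by rewrite !ler0_norm ?lerN2// ltW.
have cF : {within `[t, 0], continuous F}.
  by apply: derivable_within_continuous => s /fl' [].
have flo (s : R) : s \in `]t, 0[ -> is_derive s 1 F (df (x + s *: v)).
  by move=> /subset_itv_oo_cc; exact: fl'.
have [s] := MVT_segment (ltW t0) flo cF.
rewrite in_itv/= F0 sub0r => /andP[st s0] E.
exists s; first by rewrite !ler0_norm ?lerN2// ltW.
by rewrite -opprB E mulrN opprK mulrC.
Qed.

Definition lform (A : V) : V -> R := fun v => \sum_i v ord0 i * A ord0 i.

Lemma lform_is_linear (A : V) : linear (lform A).
Proof.
move=> c u v; rewrite /lform scaler_sumr -big_split/=; apply: eq_bigr => i _.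
by rewrite !mxE mulrDl -[_ *: _]/(_ * _) mulrA.
Qed.

HB.instance Definition _ (A : V) :=
  GRing.isLinear.Build R V R *:%R (lform A) (lform_is_linear A).

Lemma cont_lform (A : V) : continuous (lform A).
Proof.
by apply: contS => i; apply: contM; [exact: cont_coord|exact: contC].
Qed.

Lemma lform_delta (A : V) i : lform A (e_ i) = A ord0 i.
Proof.
rewrite /lform (bigD1 i)//= !mxE !eqxx mul1r big1 ?addr0// => j /negbTE ji.
by rewrite !mxE ji mul0r.
Qed.

Lemma lform_le (A v : V) : `|lform A v| <= n.+1%:R * `|A| * `|v|.
Proof.
rewrite /lform (le_trans (ler_norm_sum _ _ _))//.
apply: (@le_trans _ _ (\sum_(i < n.+1) `|A| * `|v|)).
  by apply: ler_sum => i _; rewrite normrM mulrC ler_pM// normV_coord.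
by rewrite sumr_const card_ord -[leLHS]mulr_natl mulrA.
Qed.

Let pre (j : nat) v : V := \row_i (if (i < j)%N then v ord0 i else 0).

(** The increment is split along the axes, one coordinate changing at a time through the points
    [x + pre j v]. These stay in the sup-norm ball, and the mean value theorem applies to each
    piece. *)
Lemma increment_le f (f1 : 'I_n.+1 -> V -> R) x (A : V) (r e : R) :
  (forall y i, `|y - x| < r -> is_derive y (e_ i) f (f1 i y)) ->
  (forall y i, `|y - x| < r -> `|f1 i y - A ord0 i| <= e) ->
  forall v, `|v| < r -> `|f (x + v) - f x - lform A v| <= n.+1%:R * e * `|v|.
Proof.
move=> fd fe v vr.
have e0 : 0 <= e.
  by apply: le_trans (fe x ord0 _); rewrite ?normr_ge0// subrr normr0 (le_lt_trans _ vr).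
have -> : f (x + v) - f x = \sum_(j < n.+1) (f (x + pre j.+1 v) - f (x + pre j v)).
  rewrite -(big_mkord xpredT (fun j => f (x + pre j.+1 v) - f (x + pre j v))).
  rewrite telescope_sumr//; congr (f _ - f _).
    by congr (_ + _); apply/rowP => i; rewrite mxE ltn_ord.
  by rewrite -[LHS]addr0; congr (_ + _); apply/rowP => i; rewrite !mxE.
rewrite /lform -sumrB (le_trans (ler_norm_sum _ _ _))//.
apply: (@le_trans _ _ (\sum_(i < n.+1) e * `|v|)); last first.
  by rewrite sumr_const card_ord -[leLHS]mulr_natl mulrA.
apply: ler_sum => j _.
have preS : pre j.+1 v = pre j v + v ord0 j *: e_ j.
  apply/rowP => i; rewrite !mxE eqxx/= ltnS leq_eqVlt.
  have [->|ij] := eqVneq i j; first by rewrite eqxx ltnn/= mulr1 add0r.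
  by rewrite (negbTE (_ : (i : nat) != j)) ?orFb ?mulr0 ?addr0.
have npre (s : R) : `|s| <= `|v ord0 j| -> `|x + pre j v + s *: e_ j - x| < r.
  move=> sv; rewrite addrAC [x + _]addrC addrK (le_lt_trans _ vr)//.
  apply/normV_leP => // i; rewrite !mxE eqxx/=.
  have [->|ij] := eqVneq i j.
    by rewrite ltnn add0r mulr1 (le_trans sv)// normV_coord.
  by rewrite mulr0 addr0; case: ifP => _; rewrite ?normr0// normV_coord.
have [s sv E] := @MVT_line_loc f (f1 j) (x + pre j v) (e_ j) (v ord0 j)
  (fun s sv => fd _ j (npre s sv)).
rewrite preS addrA E -mulrBr normrM mulrC.
by apply: ler_pM => //; [exact: fe (npre _ sv)|exact: normV_coord].
Qed.

Lemma differentiable_increment f x (A : V) :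
  (forall e : R, 0 < e -> \forall v \near (0 : V),
     `|f (x + v) - f x - lform A v| <= e * `|v|) ->
  differentiable f x /\ 'd f x = lform A :> (V -> R).
Proof.
move=> h.
have E : f \o shift x = cst (f x) + lform A +o_ (0 : V) id.
  apply/eqaddoP => _/posnumP[e]; near=> v.
  rewrite !fctE /= opprD addrA [v + x]addrC.
  by near: v; apply: h.
have := diff_unique (@cont_lform A) E.
move=> dE; split => //; apply/diff_locallyP; rewrite dE; split => //.
exact: cont_lform.
Unshelve. all: by end_near. Qed.

Lemma differentiable_partials f (f1 : 'I_n.+1 -> V -> R) x :
  (\forall y \near x, forall i, is_derive y (e_ i) f (f1 i y)) ->
  (forall i, {for x, continuous (f1 i)}) ->
  differentiable f x /\ 'd f x = lform (\row_i f1 i x) :> (V -> R).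
Proof.
move=> fd cf1; apply: differentiable_increment => e e0.
have e'0 : 0 < e / n.+1%:R by rewrite divr_gt0.
have : \forall y \near x, forall i, `|f1 i y - f1 i x| <= e / n.+1%:R.
  apply: (@filter_forall _ _ (fun i y => `|f1 i y - f1 i x| <= e / n.+1%:R) (nbhs x) _) => i.
  have /cvgrPdist_le/(_ _ e'0) := cf1 i.
  by apply: filterS => y; rewrite distrC.
move=> /(filterI fd)/nbhs_ballP[r /= r0 hr].
have n0 : \forall v \near (0 : V), `|v| < r.
  by apply: (near_cont_lt (f := fun v => `|v|)); [exact: norm_continuous|rewrite normr0].
apply: filterS n0 => v vr.
have hy y : `|y - x| < r -> ball x r y.
  by rewrite -ball_normE /= distrC.
have := @increment_le f f1 x (\row_i f1 i x) r (e / n.+1%:R)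
  (fun y i yr => (hr y (hy y yr)).1 i) _ v vr.
rewrite [_ * (e / _)]mulrC divfK//; apply => y i yr.
by rewrite mxE; exact: ((hr y (hy y yr)).2 i).
Qed.

Lemma is_derive_diff f x v (A : V) : differentiable f x ->
  'd f x = lform A :> (V -> R) -> is_derive x v f (lform A v).
Proof.
move=> df dA; apply: DeriveDef; first exact: diff_derivable.
by rewrite deriveE// dA.
Qed.

Lemma is_derive_partials f (f1 : 'I_n.+1 -> V -> R) x v :
  (forall i y, is_derive y (e_ i) f (f1 i y)) -> (forall i, continuous (f1 i)) ->
  is_derive x v f (\sum_i v ord0 i * f1 i x).
Proof.
move=> fd cf1.
have [] := @differentiable_partials f f1 x _ (fun i => cf1 i x).
  by near=> y => i; exact: fd.
move=> df dA; apply: (drv_eq (is_derive_diff v df dA)).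
by apply: eq_bigr => i _; rewrite mxE.
Unshelve. all: by end_near. Qed.

Lemma grad_lform f x (A : V) : differentiable f x ->
  'd f x = lform A :> (V -> R) -> grad f x = A.
Proof.
move=> df dA; apply/rowP => i; rewrite mxE /partial.
by have [_ ->] := is_derive_diff (e_ i) df dA; rewrite lform_delta.
Qed.

Lemma diff_grad f x : differentiable f x -> 'd f x = lform (grad f x) :> (V -> R).
Proof.
move=> df; apply/funext => v.
rewrite [v in LHS]row_sum_delta linear_sum/= /lform; apply: eq_bigr => i _.
by rewrite linearZ/= -[_ *: _]/(_ * _) mxE /partial deriveE.
Qed.

End gradient.

Section step_derivatives.
Context {R : realType}.
Implicit Types t : R.

Definition dstep t : R := 'D_1 step t.
Definition ddstep t : R := 'D_1 dstep t.

Let step_C2 : [/\ forall t, is_derive t 1 step (dstep t),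
  forall t, is_derive t 1 dstep (ddstep t) & continuous ddstep].
Proof.
have [f1 h1 [f2 h2 c2]] := Ck_step (R := R) 2.
have E1 : dstep = f1 by apply/funext => t; have [_ <-] := h1 t.
have E2 : ddstep = f2 by apply/funext => t; have [_ <-] := h2 t; rewrite -E1.
by rewrite E1 E2.
Qed.

Lemma is_derive_step t : is_derive t 1 step (dstep t).
Proof. by case: step_C2. Qed.

Lemma is_derive_dstep t : is_derive t 1 dstep (ddstep t).
Proof. by case: step_C2. Qed.

Lemma cont_step : continuous (@step R).
Proof. exact: drv_continuous is_derive_step. Qed.

Lemma cont_dstep : continuous dstep.
Proof. exact: drv_continuous is_derive_dstep. Qed.

Lemma cont_ddstep : continuous ddstep.
Proof. by case: step_C2. Qed.

Lemma dstep_ge0 t : 0 <= dstep t.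
Proof. exact: derive_step_ge0 (is_derive_step t). Qed.

Let near_out t : t < 0 \/ 1 < t -> \forall s \near t, s < 0 \/ 1 < s.
Proof.
by case=> h; [apply: filterS (lt_nbhsl h) => s; left|apply: filterS (lt_nbhsr h) => s; right].
Qed.

Lemma dstep0 t : t < 0 \/ 1 < t -> dstep t = 0.
Proof.
move=> ht; have [c E] : exists c : R, {near t, cst c =1 step}.
  case: ht => h.
    by exists 0; apply: filterS (lt_nbhsl h) => s s0; rewrite step0// ltW.
  by exists 1; apply: filterS (lt_nbhsr h) => s s0; rewrite step1// ltW.
by rewrite /dstep -(near_eq_derive _ E) derive_cst.
Qed.

Lemma ddstep0 t : t < 0 \/ 1 < t -> ddstep t = 0.
Proof.
move=> ht; have E : {near t, cst 0 =1 dstep}.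
  by apply: filterS (near_out ht) => s hs; rewrite dstep0.
by rewrite /ddstep -(near_eq_derive _ E) derive_cst.
Qed.

Lemma step_bounds : exists2 C : R, 1 <= C &
  forall t, `|dstep t| <= C /\ `|ddstep t| <= C.
Proof.
have bnd (f : R -> R) : continuous f -> (forall t, t < 0 \/ 1 < t -> f t = 0) ->
    exists2 C, 0 <= C & forall t, `|f t| <= C.
  move=> cf f0.
  have : compact (f @` `[0, 1]).
    by apply: continuous_compact; [exact: continuous_subspaceT|exact: segment_compact].
  move/compact_bounded => -[C [_ CP]].
  exists (Num.max 0 (C + 1)); first by rewrite le_max lexx.
  move=> t; have [t0|t0] := ltP t 0; first by rewrite f0 ?normr0 ?le_max ?lexx//; left.
  have [t1|t1] := ltP 1 t; first by rewrite f0 ?normr0 ?le_max ?lexx//; right.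
  apply: CP; first by rewrite lt_max ltrDl ltr01 orbT.
  by exists t => //; rewrite /= in_itv/= t0.
have [C C0 hC] := bnd _ cont_dstep dstep0.
have [D D0 hD] := bnd _ cont_ddstep ddstep0.
exists (1 + C + D); first by rewrite -addrA lerDl addr_ge0.
by move=> t; have := hC t; have := hD t; split; lra.
Qed.

Lemma dstep_pos : exists2 t, 0 < t < 1 & 0 < dstep t.
Proof.
have [c] := @MVT R step dstep 0 1 ltr01 (fun t _ => is_derive_step t)
  (continuous_subspaceT cont_step).
rewrite in_itv/= [step 0]step0// [step 1]step1// !subr0 mulr1 => c01 E.
by exists c => //; rewrite -E.
Qed.

End step_derivatives.

(** * Functions of class C^2 and radial cut-offs *)

Section C2_functions.
Context {R : realType} {n : nat}.
Local Notation V := ('rV[R]_n.+1).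
Local Notation L := (lebesgue_space R n).
Local Notation mu := (lebesgueN R n).
Local Notation e_ i := (delta_mx ord0 i : V).
Implicit Types (x y v : V) (f : V -> R) (i j : 'I_n.+1).

Lemma drv_affine f (a y : V) (l d : R) i : is_derive (a + l *: y) (e_ i) f d ->
  is_derive y (e_ i) (fun z => f (a + l *: z)) (l * d).
Proof.
move/drv_line => hd; apply/drv_line.
have -> : (fun s : R => f (a + l *: (y + s *: e_ i))) =
          (fun s : R => (fun r : R => f (a + l *: y + r *: e_ i)) (l * s)).
  by apply/funext => s /=; rewrite scalerDr scalerA addrA.
have hl : is_derive (0 : R) 1 (fun s : R => l * s) l.
  by apply: (drv_eq (drvZ l (is_derive_id (0 : R) 1))); rewrite mulr1.
have hd' : is_derive (l * 0) 1 (fun r : R => f (a + l *: y + r *: e_ i)) d.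
  by rewrite mulr0.
by apply: (drv_eq (drv_comp hd' hl)); rewrite mulrC.
Qed.

Lemma cont_affine f (a : V) (l : R) : continuous f ->
  continuous (fun y => f (a + l *: y)).
Proof.
move=> cf y; apply: (@continuous_comp _ _ _ (fun y => a + l *: y) f); last exact: cf.
by apply: continuousD; [exact: cst_continuous|apply: continuousZr; exact: cvg_id].
Qed.

Lemma C2data_affine (h : V -> R) h1 h2 (a : V) (l : R) : C2data h h1 h2 ->
  C2data (fun y => h (a + l *: y)) (fun i y => l * h1 i (a + l *: y))
    (fun i j y => l ^+ 2 * h2 i j (a + l *: y)).
Proof.
case=> ch ch1 ch2 [hd hd1] hs; split.
- exact: cont_affine.
- by move=> i; apply: contM; [exact: contC|exact: cont_affine].
- by move=> i j; apply: contM; [exact: contC|exact: cont_affine].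
- split=> [i x|i j x]; first exact: drv_affine.
  by rewrite expr2 -mulrA; apply: drvZ; exact: drv_affine.
- by move=> i j x; rewrite hs.
Qed.

Lemma C2data_mul (g : V -> R) g1 g2 (h : V -> R) h1 h2 : C2data g g1 g2 -> C2data h h1 h2 ->
  C2data (fun x => g x * h x) (fun i x => g1 i x * h x + g x * h1 i x)
   (fun i j x => g2 i j x * h x + g1 j x * h1 i x + (g1 i x * h1 j x + g x * h2 i j x)).
Proof.
case=> cg cg1 cg2 [gd gd1] gs [ch ch1 ch2 [hd hd1] hs]; split.
- exact: contM.
- by move=> i; apply: contD; exact: contM.
- by move=> i j; apply: contD; apply: contD; exact: contM.
- split=> [i x|i j x]; first exact: drvM (gd i x) (hd i x).
  exact: drvD (drvM (gd1 i j x) (hd i x)) (drvM (gd i x) (hd1 i j x)).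
- by move=> i j x; rewrite gs hs; ring.
Qed.

(** For a < b, both squared radii, the function is 1 where sq x <= a and 0 where sq x >= b.
    Composition with [sq] keeps it smooth at the origin. *)
Definition cutoff (a b : R) x := 1 - step ((sq x - a) / (b - a)).
Definition cutoff1 (a b : R) i x := - (dstep ((sq x - a) / (b - a)) * (2 * x ord0 i / (b - a))).
Definition cutoff2 (a b : R) i j x := - (ddstep ((sq x - a) / (b - a)) * (2 * x ord0 i / (b - a))
   * (2 * x ord0 j / (b - a)) + dstep ((sq x - a) / (b - a)) * (2 * (j == i)%:R / (b - a))).

Let cont_arg (a b : R) : continuous (fun x => (sq x - a) / (b - a)).
Proof.
apply: contM; last exact: contC.
by apply: contD; [exact: cont_sq|exact: contC].
Qed.

Let drv_arg (a b : R) i x : is_derive x (e_ i) (fun x => (sq x - a) / (b - a)) (2 * x ord0 i / (b - a)).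
Proof.
apply: (drv_eq (drvM (drvB (drv_sq i x) (drvC a x (e_ i))) (drvC (b - a)^-1 x (e_ i)))).
by rewrite subr0 mulr0 addr0.
Qed.

Lemma cutoff_C2 (a b : R) : C2data (cutoff a b) (cutoff1 a b) (cutoff2 a b).
Proof.
have cx i : continuous (fun x : V => 2 * x ord0 i / (b - a)).
  apply: contM; last exact: contC.
  by apply: contM; [exact: contC|exact: cont_coord].
split.
- apply: contD; first exact: contC.
  by apply: contN; apply: cont_comp; [exact: cont_step|exact: cont_arg].
- move=> i; apply: contN; apply: contM => //.
  by apply: cont_comp; [exact: cont_dstep|exact: cont_arg].
- move=> i j; apply: contN; apply: contD.
    apply: contM => //; apply: contM => //.
    by apply: cont_comp; [exact: cont_ddstep|exact: cont_arg].
  apply: contM; last exact: contC.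
  by apply: cont_comp; [exact: cont_dstep|exact: cont_arg].
- split=> [i x|i j x].
    apply: (drv_eq (drvB (drvC 1 x (e_ i)) (drv_comp (is_derive_step _) (drv_arg a b i x)))).
    by rewrite sub0r.
  have hx := drvM (drvZ 2 (drv_coord i j x)) (drvC (b - a)^-1 x (e_ i)).
  apply: (drv_eq (drvN (drvM (drv_comp (is_derive_dstep _) (drv_arg a b i x)) hx))).
  by rewrite /cutoff2 mulr0 addr0.
- move=> i j x; rewrite /cutoff2 [j == i]eq_sym; congr (- (_ + _)); ring.
Qed.

Lemma cutoff_ge0 (a b : R) x : 0 <= cutoff a b x.
Proof. by rewrite subr_ge0 step_le1. Qed.

Lemma cutoff_le1 (a b : R) x : cutoff a b x <= 1.
Proof. by rewrite gerBl step_ge0. Qed.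

Lemma cutoff_eq1 (a b : R) x : a < b -> sq x <= a -> cutoff a b x = 1.
Proof.
by move=> ab xa; rewrite /cutoff step0 ?subr0// pmulr_lle0 ?invr_gt0 ?subr_gt0// subr_le0.
Qed.

Lemma cutoff_eq0 (a b : R) x : a < b -> b <= sq x -> cutoff a b x = 0.
Proof.
move=> ab xa; rewrite /cutoff step1 ?subrr// ler_pdivlMr ?subr_gt0//.
by rewrite mul1r lerD2r.
Qed.

Let out01 (a b : R) x : a < b -> sq x < a \/ b < sq x ->
  (sq x - a) / (b - a) < 0 \/ 1 < (sq x - a) / (b - a).
Proof.
move=> ab [xa|xb]; [left|right].
  by rewrite pmulr_llt0 ?invr_gt0 ?subr_gt0// subr_lt0.
by rewrite ltr_pdivlMr ?subr_gt0// mul1r ltrD2r.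
Qed.

Lemma cutoff1_eq0 (a b : R) i x : a < b -> sq x < a \/ b < sq x -> cutoff1 a b i x = 0.
Proof. by move=> ab hx; rewrite /cutoff1 dstep0 ?mul0r ?oppr0//; exact: out01. Qed.

Lemma cutoff2_eq0 (a b : R) i j x : a < b -> sq x < a \/ b < sq x -> cutoff2 a b i j x = 0.
Proof.
by move=> ab hx; rewrite /cutoff2 dstep0 ?ddstep0 ?mul0r ?addr0 ?oppr0//; exact: out01.
Qed.

Lemma coord_sq_le i x (c : R) : 0 <= c -> sq x <= c ^+ 2 -> `|x ord0 i| <= c.
Proof.
move=> c0 xc; rewrite -(ler_pXn2r (n := 2))// ?nnegrE//.
apply: le_trans xc; apply: le_trans (normV_sq x).
by rewrite ler_pXn2r ?nnegrE// normV_coord.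
Qed.

(** [w] dominates the inverse width of the transition, so each derivative costs a factor [w]; as b
    <= 16, the coordinates are at most 4 where the derivatives live, and the chain rule factors go
    into one constant. *)
Lemma cutoff_bounds : exists2 C : R, 1 <= C & forall (a b w : R) x, a < b -> b <= 16 ->
  1 <= w -> 1 <= w * (b - a) ->
  (forall i, `|cutoff1 a b i x| <= C * w) /\ (forall i j, `|cutoff2 a b i j x| <= C * w ^+ 2).
Proof.
have [C C1 hC] := step_bounds (R := R).
exists (100 * C); first by lra.
move=> a b w x ab b16 w1 wab.
have C0 : 0 <= C by lra.
have [xb|xb] := ltP b (sq x).
  split=> [i|i j].
    by rewrite cutoff1_eq0 ?normr0 ?mulr_ge0 ?(le_trans ler01 w1)//; right.
  rewrite cutoff2_eq0 ?normr0//; last by right.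
  by rewrite mulr_ge0 ?exprn_ge0 ?mulr_ge0 ?(le_trans ler01 w1).
have iw : 0 < (b - a)^-1 <= w.
  by rewrite invr_gt0 subr_gt0 ab/= -[leLHS]mul1r ler_pdivrMr ?subr_gt0.
have /andP[iw0 iw1] := iw.
have x4 i : `|x ord0 i| <= 4.
  by apply: coord_sq_le => //; rewrite (le_trans xb)// (le_trans b16)//; lra.
have hx i : `|2 * x ord0 i / (b - a)| <= 8 * w.
  rewrite !normrM (gtr0_norm iw0) ger0_norm//; have := x4 i.
  by have := normr_ge0 (x ord0 i); move: `|_| => z z0 z4; nra.
move: (hC ((sq x - a) / (b - a))); rewrite /cutoff1 /cutoff2.
move: (dstep _) (ddstep _) => u v [hu hv].
have u0 := normr_ge0 u; have v0 := normr_ge0 v.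
split=> [i|i j]; rewrite normrN.
  rewrite normrM; apply: (@le_trans _ _ (C * (8 * w))); first exact: ler_pM.
  by nra.
have hd : `|2 * (j == i)%:R / (b - a)| <= 2 * w.
  rewrite !normrM (gtr0_norm iw0) ger0_norm//.
  by case: (j == i); rewrite ?normr1 ?normr0; nra.
apply: le_trans (ler_normD _ _) _; rewrite !normrM -!normrM.
have h1 : `|v * (2 * x ord0 i / (b - a)) * (2 * x ord0 j / (b - a))| <= C * (8 * w) * (8 * w).
  rewrite [X in X <= _]normrM [X in X * _ <= _]normrM.
  by apply: ler_pM => //; exact: ler_pM.
have h2 : `|u * (2 * (j == i)%:R / (b - a))| <= C * (2 * w).
  by rewrite normrM; exact: ler_pM.
apply: (le_trans (lerD h1 h2)); rewrite expr2.
have : C * w <= C * (w * w) by rewrite ler_wpM2l// ler_peMl// (le_trans ler01).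
have : 0 <= C * (w * w) by rewrite !mulr_ge0// (le_trans ler01).
lra.
Qed.

Lemma bounded_cube f M : continuous f -> exists2 C, 0 < C & forall x, `|x| <= M -> `|f x| <= C.
Proof.
move=> cf; have : compact (f @` cubeN M).
  apply: continuous_compact; last exact: compact_normV_le.
  exact: continuous_subspaceT.
move/compact_bounded => -[C [_ CP]].
exists (Num.max 1 (C + 1)); first by rewrite lt_max ltr01.
move=> x xM; apply: CP; last by exists x.
by rewrite lt_max ltrDl ltr01 orbT.
Qed.

Lemma integrable_cube (c M : R) : mu.-integrable [set: L] (EFin \o (fun x => c * \1_(cubeN M) x)).
Proof.
apply: (@integrable_bsupp _ _ _ M `|c|).
- apply: measurable_funM; first exact: measurable_cst.
  apply: measurable_indic; exact: measurable_normV_le.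
- move=> x; rewrite indicE normrM; case: (x \in _); rewrite /= ?normr1 ?normr0 ?mulr1//.
  by rewrite mulr0.
- move=> x Mx; rewrite indicE memNset ?mulr0//=.
  by rewrite /cubeN/=; apply/negP; rewrite -ltNge.
Qed.

Definition volN (M : R) : R := fine (mu (cubeN M)).

Lemma volN_ge0 M : 0 <= volN M.
Proof. by apply: fine_ge0; exact: measure_ge0. Qed.

Lemma Rintegral_le_cube f (c M : R) : mu.-integrable [set: L] (EFin \o f) ->
  (forall x, f x <= c) -> (forall x, M < `|x| -> f x <= 0) ->
  \int[mu]_x f x <= c * volN M.
Proof.
move=> fi fc f0; apply: (@le_trans _ _ (\int[mu]_x (c * \1_(cubeN M) x))).
  apply: le_Rintegral => //; first exact: integrable_cube.
  move=> x _; rewrite indicE; case: (boolP (x \in _)) => [_|].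
    by rewrite mulr1.
  by move=> /negP; rewrite inE/= /cubeN/= => /negP; rewrite -ltNge mulr0 => /f0.
rewrite RintegralZl//; last first.
  by have := integrable_cube 1 M; under eq_fun do rewrite mul1r.
rewrite /Rintegral integral_indic//; last exact: measurable_normV_le.
by rewrite setIT.
Qed.

End C2_functions.

(** * Interior estimates *)

Section interior_estimates.
Context {R : realType} {n : nat}.
Local Notation V := ('rV[R]_n.+1).
Local Notation L := (lebesgue_space R n).
Local Notation mu := (lebesgueN R n).
Local Notation e_ i := (delta_mx ord0 i : V).
Implicit Types (x y v : V) (f : V -> R) (i j : 'I_n.+1).

Lemma integral_div0 (G dG : 'I_n.+1 -> V -> R) M :
  (forall i, continuous (G i)) -> (forall i, continuous (dG i)) ->
  (forall i x, is_derive x (e_ i) (G i) (dG i x)) ->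
  (forall i x, M < `|x| -> G i x = 0) ->
  mu.-integrable [set: L] (EFin \o (fun x => \sum_i dG i x)) /\
  \int[mu]_x (\sum_i dG i x) = 0.
Proof.
move=> cG cdG GdG G0.
have dG0 i x : M < `|x| -> dG i x = 0.
  move=> /near_lt_norm Mx; apply: is_derive_near0 (GdG i x).
  by apply: filterS Mx => y; exact: G0.
have idG i : mu.-integrable [set: L] (EFin \o dG i).
  exact: integrable_Cc (cdG i) (dG0 i).
split; first exact: integrable_sumN.
rewrite Rintegral_sumN// big1// => i _.
exact: integral_partial0 (cG i) (cdG i) (GdG i) (G0 i).
Qed.

Section caccioppoli.
Variables (h : V -> R) (h1 : 'I_n.+1 -> V -> R) (h2 : 'I_n.+1 -> 'I_n.+1 -> V -> R).
Variables (z : V -> R) (z1 : 'I_n.+1 -> V -> R) (z2 : 'I_n.+1 -> 'I_n.+1 -> V -> R).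
Hypothesis hC2 : C2data h h1 h2.
Hypothesis zC2 : C2data z z1 z2.
Variable M : R.
Hypothesis z0 : forall x, M < `|x| -> z x = 0.
Let lap x := \sum_i h2 i i x.

Let z10 i x : M < `|x| -> z1 i x = 0.
Proof.
case: zC2 => _ _ _ [zd _] _ /near_lt_norm Mx; apply: is_derive_near0 (zd i x).
by apply: filterS Mx => y; exact: z0.
Qed.

Let F x := z x ^+ 2 * h x ^+ 2 + z x ^+ 2 * lap x ^+ 2 + 4 * (h x ^+ 2 * \sum_i z1 i x ^+ 2).

Let cF : continuous F.
Proof.
case: hC2 zC2 => ch ch1 ch2 _ _ [cz cz1 cz2 _ _].
have clap : continuous lap by exact: contS.
apply: contD; first by apply: contD; apply: contM; exact: contX.
apply: contM; first exact: contC.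
by apply: contM; [exact: contX|apply: contS => i; exact: contX].
Qed.

Let F0 x : M < `|x| -> F x = 0.
Proof.
move=> Mx; rewrite /F z0// big1 => [|i _]; first by ring.
by rewrite z10// expr0n.
Qed.

(** Adding the divergence of 2 z^2 h grad h makes the inequality pointwise: the difference of the
    two sides becomes z^2 (h + lap)^2 plus the sum over i of (z h1_i + 2 h z1_i)^2. *)
Lemma caccioppoli : [/\
  mu.-integrable [set: L] (EFin \o F),
  mu.-integrable [set: L] (EFin \o (fun x => z x ^+ 2 * \sum_i h1 i x ^+ 2)) &
  \int[mu]_x (z x ^+ 2 * \sum_i h1 i x ^+ 2) <= \int[mu]_x F x].
Proof.
case: (hC2) (zC2) => ch ch1 ch2 [hd hd1] _ [cz cz1 cz2 [zd _] _].
pose G i x := 2 * (z x * z x * (h x * h1 i x)).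
pose dG i x := 2 * ((2 * z x * z1 i x) * (h x * h1 i x) + z x * z x * (h1 i x * h1 i x + h x * h2 i i x)).
have GdG i x : is_derive x (e_ i) (G i) (dG i x).
  have hh := drvM (hd i x) (hd1 i i x); have hz := drvM (zd i x) (zd i x).
  by apply: (drv_eq (drvZ 2 (drvM hz hh))); rewrite /dG; ring.
have cG i : continuous (G i).
  by apply: contM; [exact: contC|apply: contM; exact: contM].
have cdG i : continuous (dG i).
  apply: contM; first exact: contC.
  apply: contD; apply: contM; try exact: contM.
    by apply: contM => //; apply: contM => //; exact: contC.
  by apply: contD; exact: contM.
have G0 i x : M < `|x| -> G i x = 0 by move=> Mx; rewrite /G z0//; ring.
have [idG dG0] := integral_div0 cG cdG GdG G0.
have iF : mu.-integrable [set: L] (EFin \o F) by exact: integrable_Cc cF F0.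
have ig : mu.-integrable [set: L] (EFin \o (fun x => z x ^+ 2 * \sum_i h1 i x ^+ 2)).
  apply: (integrable_Cc (M := M)) => [|x Mx]; last by rewrite z0// expr0n mul0r.
  by apply: contM; [exact: contX|apply: contS => i; exact: contX].
split => //.
rewrite -[leRHS]addr0 -[X in _ <= _ + X]dG0 -RintegralD//; apply: le_Rintegral => //.
  exact: integrable_add.
move=> x _; rewrite /F.
have -> : \sum_i dG i x = \sum_i (4 * (z x * h x * z1 i x * h1 i x) + 2 * z x ^+ 2 * h1 i x ^+ 2)
   + 2 * z x ^+ 2 * h x * lap x.
  rewrite mulr_sumr -big_split/=; apply: eq_bigr => i _; rewrite /dG; ring.
have hs : \sum_i (z x ^+ 2 * h1 i x ^+ 2 - 4 * (h x ^+ 2 * z1 i x ^+ 2)) <=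
  \sum_i (4 * (z x * h x * z1 i x * h1 i x) + 2 * z x ^+ 2 * h1 i x ^+ 2).
  apply: ler_sum => i _; rewrite -subr_ge0.
  have := sqr_ge0 (z x * h1 i x + 2 * (h x * z1 i x)); move=> H; apply: le_trans H _.
  by rewrite le_eqVlt; apply/orP; left; apply/eqP; ring.
rewrite sumrB -!mulr_sumr in hs.
have h3 : 0 <= z x ^+ 2 * (h x + lap x) ^+ 2 by rewrite mulr_ge0 ?sqr_ge0.
have E : z x ^+ 2 * (h x + lap x) ^+ 2 = z x ^+ 2 * h x ^+ 2 + z x ^+ 2 * lap x ^+ 2 + 2 * z x ^+ 2 * h x * lap x.
  by ring.
rewrite E in h3; lra.
Qed.

End caccioppoli.

Section mean_value.
Hypothesis mu_pos : forall A : set V, open A -> A !=set0 -> (0 < mu A)%E.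

Lemma Rintegral_cont_gt0 f M x0 : continuous f -> (forall x, 0 <= f x) ->
  (forall x, M < `|x| -> f x = 0) -> 0 < f x0 -> 0 < \int[mu]_x f x.
Proof.
move=> cf f_ge0 f0 fx0.
have fi := integrable_Cc cf f0.
rewrite lt_neqAle Rintegral_ge0// andbT eq_sym; apply/negP => /eqP I0.
have I0' : (\int[mu]_x `|(EFin \o f) x| = 0)%E.
  under eq_integral do rewrite /= ger0_norm//.
  by rewrite -[LHS]fineK ?[fine _]I0//; exact: integrable_fin_num.
have mf : measurable_fun [set: L] (EFin \o f) := measurable_int _ fi.
have := ae_eq_integral_abs mu measurableT mf.
move=> [/(_ I0') [N [mN N0 fN]] _].
pose A := [set x : V | 0 < f x].
have oA : open A.
  rewrite (_ : A = f @^-1` [set r | 0 < r])//.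
  by apply: open_comp => [x _|]; [exact: cf|exact: open_gt].
have : (mu A <= mu N)%E.
  apply: le_measure; rewrite ?inE//; first exact: open_measurableN.
  move=> x Ax; apply: fN => /=; apply/not_implyP; split => //= -[] /eqP.
  by rewrite gt_eqF.
rewrite N0 leNgt => /negP; apply.
by apply: mu_pos => //; exists x0.
Qed.

(** The gradient of [Lam] is -2 y kap(y). The radial derivative of an average against [kap] can
    therefore be integrated by parts into an integral of the Laplacian against [Lam]. *)
Let kap (y : V) : R := dstep (sq y).
Let Lam (y : V) : R := 1 - step (sq y).

Let kap0 y : 1 < `|y| -> kap y = 0.
Proof.
move=> y1; rewrite /kap dstep0//; right; apply: lt_le_trans (normV_sq y).
by rewrite exprn_egt1.
Qed.

Let Lam0 y : 1 < `|y| -> Lam y = 0.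
Proof.
move=> y1; rewrite /Lam step1 ?subrr//; apply: le_trans (normV_sq y).
by rewrite exprn_ege1// ltW.
Qed.

Let Lam0' y : 1 <= sq y -> Lam y = 0.
Proof. by move=> y1; rewrite /Lam step1 ?subrr. Qed.

Let ckap : continuous kap.
Proof. by apply: cont_comp; [exact: cont_dstep|exact: cont_sq]. Qed.

Let cLam : continuous Lam.
Proof.
apply: contD; first exact: contC.
by apply: contN; apply: cont_comp; [exact: cont_step|exact: cont_sq].
Qed.

Let drv_Lam i y : is_derive y (e_ i) Lam (- (2 * y ord0 i * kap y)).
Proof.
apply: (drv_eq (drvB (drvC 1 y (e_ i)) (drv_comp (is_derive_step _) (drv_sq i y)))).
by rewrite sub0r mulrC.
Qed.

Let kap_int_gt0 : 0 < \int[mu]_y kap y.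
Proof.
have [t /andP[t0 t1] dt] := dstep_pos (R := R).
have kge0 y : 0 <= kap y by exact: dstep_ge0.
apply: (Rintegral_cont_gt0 (x0 := Num.sqrt t *: e_ ord0) ckap kge0 kap0).
have sqt : sq (Num.sqrt t *: e_ ord0) = t.
  rewrite /sq (bigD1 ord0)//= big1 => [|j /negbTE j0].
    by rewrite !mxE !eqxx mulr1 addr0 -expr2 sqr_sqrtr// ltW.
  by rewrite !mxE j0 mulr0 mul0r.
by rewrite /kap sqt.
Qed.

Section one_function.
Variables (h : V -> R) (h1 : 'I_n.+1 -> V -> R) (h2 : 'I_n.+1 -> 'I_n.+1 -> V -> R).
Hypothesis hC2 : C2data h h1 h2.
Let lap x := \sum_i h2 i i x.
Variables (x : V) (d b : R).
Hypothesis lapb : forall y, sq y <= 1 -> `|lap (x + d *: y)| <= b.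

Let F (t : R) y := h (x + (t * d) *: y) * kap y.
Let dF (t : R) y := (\sum_i d * y ord0 i * h1 i (x + (t * d) *: y)) * kap y.

Let FdF (t : R) y : setT y -> is_derive t 1 (F^~ y) (dF t y).
Proof.
case: hC2 => ch ch1 _ [hd _] _ _.
have hv : is_derive (x + t *: (d *: y)) (d *: y) h (\sum_i (d *: y) ord0 i * h1 i (x + t *: (d *: y))).
  exact: is_derive_partials.
have := drvM (is_derive_line hv) (drvC (kap y) t 1).
rewrite mulr0 addr0 /F /dF.
under eq_fun do rewrite scalerA.
move/drv_eq; apply; congr (_ * _).
by apply: eq_bigr => i _; rewrite mxE scalerA.
Qed.

Let iF (t : R) : mu.-integrable [set: L] (EFin \o F t).
Proof.
case: hC2 => ch _ _ _ _; apply: (@integrable_Cc _ _ (F t) 1).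
  by apply: contM => //; exact: cont_affine.
by move=> y y1; rewrite /F kap0 ?mulr0.
Qed.

Let derJ (t : R) : is_derive t 1 (fun t => \int[mu]_y F t y) (\int[mu]_y dF t y).
Proof.
case: hC2 => _ ch1 _ _ _.
pose r := `|x| + (`|t| + 1) * `|d|.
have /choice[C hC] : forall i, exists C : R, 0 < C /\ forall z, `|z| <= r -> `|h1 i z| <= C.
  by move=> i; have [C C0 hC] := bounded_cube r (ch1 i); exists C.
have [K K1 hK] := step_bounds (R := R).
pose G y := ((\sum_i `|d| * C i) * K) * \1_(cubeN 1) y.
have G1 : 0 <= (\sum_i `|d| * C i) * K.
  rewrite mulr_ge0//; last by lra.
  by apply: sumr_ge0 => i _; rewrite mulr_ge0// ltW// (hC i).1.
apply: (@is_derive_under_integral _ _ F dF setT t G) => //.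
- exact: integrable_cube.
- by move=> y; rewrite mulr_ge0// indicE; case: (y \in _).
move=> s y st _; rewrite /G indicE; case: (boolP (y \in _)); last first.
  move=> /negP; rewrite inE/= /cubeN/= => /negP; rewrite -ltNge mulr0 => y1.
  by rewrite /dF kap0// mulr0 normr0.
rewrite inE/= /cubeN/= => y1.
rewrite mulr1 /dF normrM; apply: ler_pM => //; last exact: (hK _).1.
apply: le_trans (ler_norm_sum _ _ _) _; apply: ler_sum => i _.
rewrite !normrM -mulrA; apply: ler_wpM2l => //.
have yi : `|y ord0 i| <= 1 by rewrite (le_trans (normV_coord y i)).
rewrite -[leRHS]mul1r; apply: ler_pM => //.
apply: (hC i).2; rewrite /r (le_trans (ler_normD _ _))// lerD2l normrZ normrM -mulrA.
have s1 : `|s| <= `|t| + 1.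
  by have := ler_normD (s - t) t; rewrite subrK; lra.
apply: ler_pM => //; by rewrite -[leRHS]mulr1 ler_pM.
Qed.

Let dJ (t : R) : \int[mu]_y dF t y = t * d ^+ 2 / 2 * \int[mu]_y (lap (x + (t * d) *: y) * Lam y).
Proof.
case: hC2 => ch ch1 ch2 [hd hd1] _.
pose G i y := - (d / 2) * (h1 i (x + (t * d) *: y) * Lam y).
pose dG i y := - (d / 2) * ((t * d) * h2 i i (x + (t * d) *: y) * Lam y
   + h1 i (x + (t * d) *: y) * (- (2 * y ord0 i * kap y))).
have GdG i y : is_derive y (e_ i) (G i) (dG i y).
  exact: (drvZ _ (drvM (drv_affine (hd1 i i _)) (drv_Lam i y))).
have cG i : continuous (G i).
  by apply: contM; [exact: contC|apply: contM => //; exact: cont_affine].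
have cdG i : continuous (dG i).
  apply: contM; first exact: contC.
  apply: contD.
    by apply: contM => //; apply: contM; [exact: contC|exact: cont_affine].
  apply: contM; first exact: cont_affine.
  apply: contN; apply: contM => //.
  by apply: contM; [exact: contC|exact: cont_coord].
have G0 i y : 1 < `|y| -> G i y = 0 by move=> y1; rewrite /G Lam0// !mulr0.
have [idG dG0] := integral_div0 cG cdG GdG G0.
have il : mu.-integrable [set: L] (EFin \o (fun y => lap (x + (t * d) *: y) * Lam y)).
  apply: (integrable_Cc (M := 1)) => [|y y1]; last by rewrite Lam0// mulr0.
  by apply: contM => //; apply: contS => i; exact: cont_affine.
rewrite -RintegralZl// -[RHS]addr0 -[X in _ = _ + X]dG0 -RintegralD//; last exact: integrable_scale.
apply: eq_Rintegral => y _; rewrite /dF /lap /dG.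
rewrite !mulr_suml !mulr_sumr -big_split/=; apply: eq_bigr => i _; by field.
Qed.

(** The mean value theorem in t for the average J(t) of h(x + t d y) against [kap]: J(0) is h(x)
    times the mass of [kap], and [dJ] expresses the derivative of J through the Laplacian. *)
Lemma mean_value_ineq : `|h x * (\int[mu]_y kap y)| <=
  `|\int[mu]_y (h (x + d *: y) * kap y)| + d ^+ 2 * b * \int[mu]_y Lam y.
Proof.
have Lam_ge0 y : 0 <= Lam y by rewrite subr_ge0 step_le1.
have iLam : mu.-integrable [set: L] (EFin \o Lam) := integrable_Cc cLam Lam0.
have ikap : mu.-integrable [set: L] (EFin \o kap) := integrable_Cc ckap kap0.
pose J (t : R) := \int[mu]_y F t y.
have [t] := MVT_segment ler01 (fun t _ => derJ t) (continuous_subspaceT (drv_continuous derJ)).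
rewrite in_itv/= => /andP[t0 t1]; rewrite -/(J 1) -/(J 0) subr0 mulr1 dJ => E.
have J0 : J 0 = h x * \int[mu]_y kap y.
  rewrite -RintegralZl//; apply: eq_Rintegral => y _.
  by rewrite /F mul0r scale0r addr0.
have J1 : J 1 = \int[mu]_y (h (x + d *: y) * kap y).
  by apply: eq_Rintegral => y _; rewrite /F mul1r.
rewrite -J0 -J1.
have hl : `|\int[mu]_y (lap (x + (t * d) *: y) * Lam y)| <= b * \int[mu]_y Lam y.
  case: hC2 => ch ch1 ch2 _ _.
  have il : mu.-integrable [set: L] (EFin \o (fun y => lap (x + (t * d) *: y) * Lam y)).
    apply: (integrable_Cc (M := 1)) => [|y y1]; last by rewrite Lam0// mulr0.
    by apply: contM => //; apply: contS => i; exact: cont_affine.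
  apply: le_trans (le_normr_Rintegral _ _) _ => //.
  rewrite -RintegralZl//; apply: le_Rintegral => //.
  - apply: (integrable_Cc (M := 1)) => [|y y1]; last by rewrite Lam0// mulr0 normr0.
    apply: (cont_comp (h := fun r : R => `|r|)); first exact: norm_continuous.
    by apply: contM => //; apply: contS => i; exact: cont_affine.
  - exact: integrable_scale.
  move=> y _; rewrite normrM (ger0_norm (Lam_ge0 y)).
  have [y1|y1] := leP (sq y) 1; last by rewrite Lam0' ?mulr0// ltW.
  apply: ler_wpM2r => //; rewrite mulrC -scalerA; apply: lapb.
  rewrite (_ : sq _ = t ^+ 2 * sq y); last first.
    by rewrite /sq mulr_sumr; apply: eq_bigr => i _; rewrite !mxE; ring.
  have t2 : t ^+ 2 <= 1 by rewrite expr_le1.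
  by rewrite mulr_ile1 ?sqr_ge0 ?sq_ge0.
have := ler_normB (J 1) (J 1 - J 0); rewrite opprB addrC subrK => h3.
apply: (le_trans h3); rewrite lerD2l E normrM.
set I := `|\int[mu]_y (lap _ * _)|; rewrite -/I in hl.
have -> : `|t * d ^+ 2 / 2| = t / 2 * d ^+ 2.
  rewrite ger0_norm; first by field.
  by apply: divr_ge0 => //; apply: mulr_ge0 => //; exact: sqr_ge0.
have I0 : 0 <= I by exact: normr_ge0.
have d0 := sqr_ge0 d; rewrite -[t / 2 * _ * I]mulrA -[d ^+ 2 * b * _]mulrA; apply: (le_trans (y := d ^+ 2 * I)).
  have : 0 <= d ^+ 2 * I by exact: mulr_ge0.
  by move: (d ^+ 2 * I) => D; nra.
by apply: ler_wpM2l.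
Qed.

End one_function.

Lemma mean_value : exists2 C : R, 0 < C & forall h h1 h2, C2data h h1 h2 ->
  forall (x : V) (d b : R), 0 <= b ->
  (forall y, sq y <= 1 -> `|\sum_i h2 i i (x + d *: y)| <= b) ->
  h x ^+ 2 <= C * (\int[mu]_y (h (x + d *: y) ^+ 2 * dstep (sq y)) + d ^+ 4 * b ^+ 2).
Proof.
pose c := \int[mu]_y kap y; pose v := \int[mu]_y Lam y.
have c0 : 0 < c := kap_int_gt0.
have v0 : 0 <= v by apply: Rintegral_ge0 => y _; rewrite subr_ge0 step_le1.
exists (2 / c + 2 * v ^+ 2 / c ^+ 2 + 1).
  by rewrite ltr_wpDl// addr_ge0// ?divr_ge0 ?mulr_ge0 ?sqr_ge0// ltW.
move=> h h1 h2 hC2 x d b b0 lapb.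
have := mean_value_ineq hC2 lapb.
set m := \int[mu]_y (h _ * kap y); set I := \int[mu]_y (h _ ^+ 2 * _).
rewrite -/c -/v => hm.
have ikap : mu.-integrable [set: L] (EFin \o kap) := integrable_Cc ckap kap0.
have ch : continuous (fun y => h (x + d *: y)) by apply: cont_affine; case: hC2.
have i1 : mu.-integrable [set: L] (EFin \o (fun y => h (x + d *: y) * kap y)).
  by apply: (integrable_Cc (M := 1)) => [|y y1]; [exact: contM|rewrite kap0// mulr0].
have i2 : mu.-integrable [set: L] (EFin \o (fun y => h (x + d *: y) ^+ 2 * kap y)).
  apply: (integrable_Cc (M := 1)) => [|y y1]; last by rewrite kap0// mulr0.
  by apply: contM => //; exact: contX.
(* Cauchy-Schwarz with weight [kap], read off from the nonnegative integral of (h - m/c)^2 kap. *)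
have jensen : m ^+ 2 <= c * I.
  have : 0 <= \int[mu]_y (h (x + d *: y) ^+ 2 * kap y + (- (2 * (m / c)) * (h (x + d *: y) * kap y)
       + (m / c) ^+ 2 * kap y)).
    apply: Rintegral_ge0 => y _.
    rewrite (_ : _ + _ = (h (x + d *: y) - m / c) ^+ 2 * kap y); last by ring.
    by rewrite mulr_ge0 ?sqr_ge0// dstep_ge0.
  rewrite RintegralD//; last first.
    by apply: integrable_add => //; exact: integrable_scale.
  rewrite RintegralD//; [|exact: integrable_scale|exact: integrable_scale].
  rewrite !RintegralZl// -/m -/c -/I => hI.
  rewrite -subr_ge0 (_ : _ - _ = c * (I + (- (2 * (m / c)) * m + (m / c) ^+ 2 * c))); last first.
    by field; rewrite gt_eqF.
  by rewrite mulr_ge0// ltW.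
have I0 : 0 <= I by apply: Rintegral_ge0 => y _; rewrite mulr_ge0 ?sqr_ge0// dstep_ge0.
have h4 : (h x * c) ^+ 2 <= 2 * m ^+ 2 + 2 * (d ^+ 2 * b * v) ^+ 2.
  rewrite -(real_normK (num_real (h x * c))) -(real_normK (num_real m)).
  have k0 : 0 <= d ^+ 2 * b * v by apply: mulr_ge0 => //; apply: mulr_ge0 => //; exact: sqr_ge0.
  move: (d ^+ 2 * b * v) k0 hm => k k0 hm.
  have := normr_ge0 (h x * c); have := normr_ge0 m; move: `|m| `|h x * c| hm => m' p hm m0 p0.
  have h5 : p ^+ 2 <= (m' + k) ^+ 2 by rewrite ler_pXn2r ?nnegrE// addr_ge0.
  apply: le_trans h5 _; have := sqr_ge0 (m' - k); rewrite !sqrrB sqrrD; lra.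
have h5 : h x ^+ 2 <= 2 / c * I + 2 * v ^+ 2 / c ^+ 2 * (d ^+ 4 * b ^+ 2).
  rewrite (_ : h x ^+ 2 = (h x * c) ^+ 2 / c ^+ 2); last by field; rewrite gt_eqF.
  rewrite ler_pdivrMr ?exprn_gt0//; apply: (le_trans h4).
  rewrite (_ : _ * c ^+ 2 = 2 * (c * I) + 2 * (d ^+ 2 * b * v) ^+ 2); last first.
    by field; rewrite gt_eqF.
  by rewrite lerD2r ler_wpM2l.
have A0 : 0 <= 2 / c by rewrite divr_ge0// ltW.
have B0 : 0 <= 2 * v ^+ 2 / c ^+ 2.
  by apply: divr_ge0; [apply: mulr_ge0 => //|]; exact: sqr_ge0.
have D0 : 0 <= d ^+ 4 * b ^+ 2.
  by apply: mulr_ge0; rewrite ?sqr_ge0// (exprM d 2 2) sqr_ge0.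
apply: (le_trans h5); rewrite mulrDr; move: (2 / c) (2 * v ^+ 2 / c ^+ 2) (d ^+ 4 * b ^+ 2) A0 B0 D0.
move=> A B D A0 B0 D0; nra.
Qed.

End mean_value.

End interior_estimates.

(** * From weighted integrals to pointwise bounds *)

Section sup_estimate.
Context {R : realType} {n : nat}.
Local Notation V := ('rV[R]_n.+1).
Local Notation L := (lebesgue_space R n).
Local Notation mu := (lebesgueN R n).
Local Notation e_ i := (delta_mx ord0 i : V).
Local Notation N := (n.+1%:R : R).
Implicit Types (x y z : V).
Hypothesis mu_pos : forall A : set V, open A -> A !=set0 -> (0 < mu A)%E.

Lemma sum_sqr_le k (a : 'I_k -> R) : (\sum_i a i) ^+ 2 <= k%:R * \sum_i a i ^+ 2.
Proof.
elim: k a => [|k IH] a; first by rewrite !big_ord0 expr0n mulr0.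
rewrite !big_ord_recr/=.
have := IH (fun i => a (widen_ord (leqnSn k) i)).
set s := \sum_(i < k) a _; set q := \sum_(i < k) a _ ^+ 2; set b := a ord_max => h.
have [k0|k0] := posnP k.
  have s0 : s = 0 by rewrite /s big1// => -[i hi]; exfalso; rewrite k0 in hi.
  have q0 : q = 0 by rewrite /q big1// => -[i hi]; exfalso; rewrite k0 in hi.
  by rewrite s0 q0 k0 !add0r mul1r.
have kp : 0 < k%:R :> R by rewrite ltr0n.
have h2 : 2 * (s * b) <= s ^+ 2 / k%:R + k%:R * b ^+ 2.
  rewrite -subr_ge0 (_ : _ - _ = (s - k%:R * b) ^+ 2 / k%:R); last by field; rewrite gt_eqF.
  by rewrite divr_ge0 ?sqr_ge0 ?ltW.
have h3 : s ^+ 2 / k%:R <= q by rewrite ler_pdivrMr// mulrC.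
by rewrite sqrrD -natr1 -mulr_natr; lra.
Qed.

(** By Bernoulli (1 - d)^m >= 1/2, while (1 + d)^m (1 - d)^m <= 1. *)
Lemma exprD1_le (d : R) m : 0 <= d -> m%:R * d <= 2^-1 -> (1 + d) ^+ m <= 2.
Proof.
move=> d0 md.
have bern (j : nat) : (j <= m)%N -> 1 - j%:R * d <= (1 - d) ^+ j.
  elim: j => [|j IH] jm; first by rewrite mul0r subr0 expr0.
  have := IH (ltnW jm); rewrite exprSr -natr1.
  have d1 : d <= 1.
    have : 1 <= m%:R :> R by rewrite ler1n (leq_trans _ jm).
    by move: (m%:R : R) md => M; nra.
  have j0 : 0 <= j%:R :> R by [].
  move: (j%:R : R) ((1 - d) ^+ j) j0 => J P j0 hP.
  have : (1 - J * d) * (1 - d) <= P * (1 - d) by apply: ler_wpM2r => //; lra.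
  have : 0 <= J * d * d by rewrite !mulr_ge0.
  lra.
have := bern m (leqnn m) => hm.
have p2 : 2^-1 <= (1 - d) ^+ m by lra.
have : ((1 + d) * (1 - d)) ^+ m <= 1.
  have [->|m0] := eqVneq m 0%N; first by rewrite expr0.
  have d1 : d <= 1.
    have : 1 <= m%:R :> R by rewrite ler1n lt0n.
    by move: (m%:R : R) md => M; nra.
  rewrite exprn_ile1//; first by apply: mulr_ge0; lra.
  nra.
rewrite exprMn; have : 0 <= (1 + d) ^+ m by rewrite exprn_ge0// addr_ge0.
move: ((1 + d) ^+ m) ((1 - d) ^+ m) p2 => P Q; nra.
Qed.

Let cst_ge0 (C : R) : 0 <= 48 + 48 * (N ^+ 2 * C ^+ 2) + 192 * (N * C ^+ 2) + 768 * (N * C ^+ 2) ^+ 2.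
Proof.
have h1 : 0 <= N ^+ 2 * C ^+ 2 by rewrite mulr_ge0 ?sqr_ge0.
have h2 : 0 <= N * C ^+ 2 by rewrite mulr_ge0 ?sqr_ge0.
have h3 := sqr_ge0 (N * C ^+ 2).
have m (k : nat) (t : R) : 0 <= t -> 0 <= k%:R * t by move=> t0; rewrite mulr_ge0.
apply: addr_ge0; last exact: m.
apply: addr_ge0; last exact: m.
by apply: addr_ge0; [exact: ler0n|exact: m].
Qed.

Section setup.
Variables (h : V -> R) (h1 : 'I_n.+1 -> V -> R) (h2 : 'I_n.+1 -> 'I_n.+1 -> V -> R).
Variables (r g : R) (k : nat) (S A B : R).
Hypothesis hC2 : C2data h h1 h2.
Let lap x := \sum_i h2 i i x.
Let gr x := \sum_i h1 i x ^+ 2.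
Hypothesis k0 : (0 < k)%N.
Hypothesis h0 : forall x, sq x < 1 -> h x = 0.
Hypothesis r1 : 1 <= r.
Hypothesis g0 : 0 < g.
Hypothesis rg4 : r + g <= 4.
Hypothesis S0 : 0 <= S.
Hypothesis A0 : 0 <= A.
Hypothesis B0 : 0 <= B.
Hypothesis lapS : forall x, sq x <= (r + g) ^+ 2 -> lap x ^+ 2 <= S * sq x ^+ k.
Hypothesis hA : forall x, sq x <= (r + g) ^+ 2 -> h x ^+ 2 <= A.
Hypothesis lapB : forall x, sq x <= (r + g) ^+ 2 -> lap x ^+ 2 <= B.

(** Squared radii. [chi] falls from 1 to 0 between r + g/4 and r + g/2; [zeta] is still 1 there,
    falls between r + g/2 and r + g, and localises the energy estimate for the gradient. [Z]
    dominates 1 and the inverse widths of both transitions, and [om] bounds the weight where [chi]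
    varies. *)
Let a1 := (r + g / 4) ^+ 2.
Let a2 := (r + g / 2) ^+ 2.
Let a3 := (r + g) ^+ 2.
Let Z := 3 / g.
Let chi := cutoff (n := n) a1 a2.
Let zeta := cutoff (n := n) a2 a3.
Let om := a1 ^- k.

Let a12 : a1 < a2. Proof. by rewrite /a1 /a2 !expr2; have := g0; have := r1; nra. Qed.
Let a23 : a2 < a3. Proof. by rewrite /a2 /a3 !expr2; have := g0; have := r1; nra. Qed.
Let a3_16 : a3 <= 16. Proof. by rewrite /a3 !expr2; have := g0; have := r1; have := rg4; nra. Qed.
Let a2_16 : a2 <= 16. Proof. exact: le_trans (ltW a23) a3_16. Qed.
Let a1_1 : 1 <= a1. Proof. by rewrite /a1 !expr2; have := g0; have := r1; nra. Qed.
Let Z1 : 1 <= Z.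
Proof. by rewrite /Z ler_pdivlMr// mul1r; have := r1; have := rg4; lra. Qed.
Let Zg : Z * g = 3. Proof. by rewrite /Z divfK// gt_eqF. Qed.
Let Za12 : 1 <= Z * (a2 - a1).
Proof.
have : a2 - a1 >= g / 2 by rewrite /a1 /a2 !expr2; have := g0; have := r1; nra.
by have := Zg; have := Z1; nra.
Qed.
Let Za23 : 1 <= Z * (a3 - a2).
Proof.
have : a3 - a2 >= g by rewrite /a3 /a2 !expr2; have := g0; have := r1; nra.
by have := Zg; have := Z1; nra.
Qed.
Let om0 : 0 <= om. Proof. by rewrite invr_ge0 exprn_ge0// sqr_ge0. Qed.

Let H x := chi x * h x.
Let H1 i x := cutoff1 a1 a2 i x * h x + chi x * h1 i x.
Let H2 i j x := cutoff2 a1 a2 i j x * h x + cutoff1 a1 a2 j x * h1 i x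
  + (cutoff1 a1 a2 i x * h1 j x + chi x * h2 i j x).
Let HC2 : C2data H H1 H2. Proof. exact: C2data_mul (cutoff_C2 a1 a2) hC2. Qed.
Let lapH x := \sum_i H2 i i x.

Let near_sq1 x : sq x < 1 -> \forall y \near x, sq y < 1.
Proof. exact: near_cont_lt cont_sq. Qed.

Let h10 i x : sq x < 1 -> h1 i x = 0.
Proof.
case: hC2 => _ _ _ [hd _] _ x1; apply: is_derive_near0 (hd i x).
by apply: filterS (near_sq1 x1) => y; exact: h0.
Qed.

Let h20 i j x : sq x < 1 -> h2 i j x = 0.
Proof.
case: hC2 => _ _ _ [_ hd] _ x1; apply: is_derive_near0 (hd i j x).
by apply: filterS (near_sq1 x1) => y; exact: h10.
Qed.

Let out4 x : 4 < `|x| -> 16 < sq x.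
Proof.
move=> x4; apply: lt_le_trans (normV_sq x).
by rewrite expr2; move: `|x| x4 => t; nra.
Qed.

Variable C : R.
Hypothesis C1 : 1 <= C.
Hypothesis HC : forall (a b w : R) x, a < b -> b <= 16 -> 1 <= w -> 1 <= w * (b - a) ->
  (forall i, `|cutoff1 a b i x| <= C * w) /\ (forall i j, `|cutoff2 a b i j x| <= C * w ^+ 2).

Let sqr_norm_le (u v : R) : `|u| <= v -> u ^+ 2 <= v ^+ 2.
Proof.
move=> uv; rewrite -(real_normK (num_real u)) ler_pXn2r ?nnegrE//.
exact: le_trans uv.
Qed.

Let chi1 i x : cutoff1 a1 a2 i x ^+ 2 <= C ^+ 2 * Z ^+ 2.
Proof. by rewrite -exprMn; apply: sqr_norm_le; exact: (HC x a12 a2_16 Z1 Za12).1. Qed.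
Let zeta1 i x : cutoff1 a2 a3 i x ^+ 2 <= C ^+ 2 * Z ^+ 2.
Proof. by rewrite -exprMn; apply: sqr_norm_le; exact: (HC x a23 a3_16 Z1 Za23).1. Qed.
Let chi2 x : (\sum_i cutoff2 a1 a2 i i x) ^+ 2 <= N ^+ 2 * (C ^+ 2 * Z ^+ 4).
Proof.
rewrite (_ : _ * _ = (N * (C * Z ^+ 2)) ^+ 2); last by ring.
apply: sqr_norm_le; apply: le_trans (ler_norm_sum _ _ _) _.
apply: (@le_trans _ _ (\sum_(i < n.+1) C * Z ^+ 2)).
  by apply: ler_sum => i _; exact: (HC x a12 a2_16 Z1 Za12).2.
by rewrite sumr_const card_ord -[leLHS]mulr_natl.
Qed.

(** [Q] collects the equation and the error h times the Laplacian of [chi], [P] the error grad chi .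
    grad h. The factor 48 is 16, for sq x, times 3, for the square of a sum of three terms; 192 is 4
    times 48 because the cross term comes with a factor 2. *)
Let Q := 48 * (S + om * (N ^+ 2 * (C ^+ 2 * Z ^+ 4) * A)).
Let P := 192 * (N * (C ^+ 2 * Z ^+ 2)) * om.

Let Q0 : 0 <= Q.
Proof.
rewrite /Q mulr_ge0// addr_ge0// mulr_ge0// mulr_ge0// mulr_ge0 ?exprn_ge0//.
by rewrite mulr_ge0 ?exprn_ge0// (le_trans ler01).
Qed.
Let P0 : 0 <= P.
Proof.
have hN : 0 <= N * (C ^+ 2 * Z ^+ 2) by rewrite mulr_ge0// mulr_ge0 ?sqr_ge0.
by apply: mulr_ge0; [apply: mulr_ge0; [exact: ler0n|exact: hN]|exact: om0].
Qed.

Let lapH_sqr x : lapH x * lapH x <= 3 * ((chi x * lap x) ^+ 2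
  + 4 * (\sum_i cutoff1 a1 a2 i x * h1 i x) ^+ 2 + h x ^+ 2 * (\sum_i cutoff2 a1 a2 i i x) ^+ 2).
Proof.
have -> : lapH x = chi x * lap x + 2 * (\sum_i cutoff1 a1 a2 i x * h1 i x)
    + h x * \sum_i cutoff2 a1 a2 i i x.
  rewrite /lapH /lap !mulr_sumr -!big_split/=; apply: eq_bigr => i _; rewrite /H2; ring.
move: (chi x * lap x) (\sum_i cutoff1 a1 a2 i x * h1 i x) (\sum_i cutoff2 a1 a2 i i x) (h x) => a b c d.
rewrite -subr_ge0.
rewrite (_ : _ - _ = (a - 2 * b) ^+ 2 + (a - d * c) ^+ 2 + (2 * b - d * c) ^+ 2); last by ring.
by rewrite !addr_ge0// sqr_ge0.
Qed.

Let gr_ge0 x : 0 <= gr x. Proof. by apply: sumr_ge0 => i _; exact: sqr_ge0. Qed.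

Let pointwise x : wt k (fun x => sq x * (lapH x * lapH x)) x <=
  Q * \1_(cubeN 4) x + P * (zeta x ^+ 2 * gr x).
Proof.
have rhs0 : 0 <= Q * \1_(cubeN 4) x + P * (zeta x ^+ 2 * gr x).
  apply: addr_ge0; apply: mulr_ge0 => //; by rewrite mulr_ge0 ?sqr_ge0.
have [x1|x1] := ltP (sq x) 1.
  rewrite /wt (_ : lapH x = 0) ?mulr0//.
  by rewrite /lapH big1// => i _; rewrite /H2 h0// h10// h20//; ring.
have [x2|x2] := ltP a2 (sq x).
  rewrite /wt (_ : lapH x = 0) ?mulr0//.
  rewrite /lapH big1// => i _; rewrite /H2 /chi cutoff1_eq0; [|by []|by right].
  by rewrite cutoff2_eq0; [rewrite cutoff_eq0// ?(ltW x2)//; ring|by []|by right].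
have x16 : sq x <= 16 by exact: le_trans a2_16.
have xcube : x \in cubeN 4.
  rewrite inE /cubeN/= leNgt; apply/negP => /out4; by rewrite ltNge x16.
rewrite indicE xcube mulr1.
have s0 : 0 < sq x by exact: lt_le_trans x1.
have x3 : sq x <= (r + g) ^+ 2 by apply: le_trans x2 _; exact: ltW a23.
have tS : (sq x)^-1 ^+ k * lap x ^+ 2 <= S.
  by rewrite exprVn mulrC ler_pdivrMr ?exprn_gt0// lapS.
have tk0 : 0 <= (sq x)^-1 ^+ k by rewrite exprn_ge0// invr_ge0 ltW.
have chisq : (chi x * lap x) ^+ 2 <= lap x ^+ 2.
  rewrite exprMn -[leRHS]mul1r ler_wpM2r ?sqr_ge0//.
  by rewrite expr_le1 ?cutoff_le1// cutoff_ge0.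
have c2A : h x ^+ 2 * (\sum_i cutoff2 a1 a2 i i x) ^+ 2 <= N ^+ 2 * (C ^+ 2 * Z ^+ 4) * A.
  by rewrite mulrC ler_pM ?sqr_ge0// hA.
have c1g : (\sum_i cutoff1 a1 a2 i x * h1 i x) ^+ 2 <= N * (C ^+ 2 * Z ^+ 2) * gr x.
  apply: le_trans (sum_sqr_le _) _; rewrite -mulrA ler_wpM2l// /gr mulr_sumr.
  by apply: ler_sum => i _; rewrite exprMn ler_wpM2r ?sqr_ge0.
have hl : wt k (fun x => sq x * (lapH x * lapH x)) x <=
   48 * ((sq x)^-1 ^+ k * (lap x ^+ 2 + 4 * (\sum_i cutoff1 a1 a2 i x * h1 i x) ^+ 2
     + h x ^+ 2 * (\sum_i cutoff2 a1 a2 i i x) ^+ 2)).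
  rewrite /wt mulrCA [48 * _]mulrCA [leRHS](_ : _ = (sq x)^-1 ^+ k * (16 * (3 * (lap x ^+ 2 + 4 * (\sum_i cutoff1 a1 a2 i x * h1 i x) ^+ 2
     + h x ^+ 2 * (\sum_i cutoff2 a1 a2 i i x) ^+ 2)))); last by ring.
  rewrite mulrCA; apply: ler_wpM2l => //.
  apply: ler_pM => //; first exact: ltW.
    by rewrite -expr2 sqr_ge0.
  by apply: le_trans (lapH_sqr x) _; rewrite ler_wpM2l// lerD2r lerD2r.
apply: le_trans hl _.
(* Where sq x < a1 the cut-off is constant and only the equation contributes; farther out the weight
   is at most [om] and [zeta] is 1. *)
have [xa|xa] := ltP (sq x) a1.
  rewrite big1 => [|i _]; last by rewrite cutoff1_eq0 ?mul0r//; left.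
  rewrite big1 => [|i _]; last by rewrite cutoff2_eq0//; left.
  rewrite expr0n !mulr0 !addr0; apply: (@le_trans _ _ (48 * S)); first by rewrite ler_wpM2l.
  rewrite /Q mulrDr -addrA lerDl addr_ge0//.
    rewrite mulr_ge0// mulr_ge0// mulr_ge0// mulr_ge0 ?exprn_ge0//.
    by rewrite mulr_ge0 ?exprn_ge0// (le_trans ler01).
  by rewrite mulr_ge0// mulr_ge0 ?sqr_ge0.
have tom : (sq x)^-1 ^+ k <= om.
  have a10 : 0 < a1 := lt_le_trans ltr01 a1_1.
  rewrite exprVn /om lef_pV2; [|rewrite posrE; exact: exprn_gt0..].
  by apply: lerXn2r (xa); rewrite nnegrE ltW.
rewrite (_ : zeta x = 1); last by rewrite /zeta cutoff_eq1.
rewrite expr1n mul1r.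
have e1 : (sq x)^-1 ^+ k * (4 * (\sum_i cutoff1 a1 a2 i x * h1 i x) ^+ 2) <=
   om * (4 * (N * (C ^+ 2 * Z ^+ 2) * gr x)).
  by apply: ler_pM => //; [rewrite mulr_ge0 ?sqr_ge0|rewrite ler_wpM2l].
have e2 : (sq x)^-1 ^+ k * (h x ^+ 2 * (\sum_i cutoff2 a1 a2 i i x) ^+ 2) <=
   om * (N ^+ 2 * (C ^+ 2 * Z ^+ 4) * A).
  by apply: ler_pM => //; rewrite mulr_ge0 ?sqr_ge0.
rewrite !mulrDr /Q /P; lra.
Qed.

Let int_gr : \int[mu]_x (zeta x ^+ 2 * gr x) <= (A + B + 4 * (N * (C ^+ 2 * Z ^+ 2)) * A) * @volN R n 4 /\
  mu.-integrable [set: L] (EFin \o (fun x => zeta x ^+ 2 * gr x)).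
Proof.
have z40 x : 4 < `|x| -> zeta x = 0.
  move=> /out4 x4; rewrite /zeta cutoff_eq0//; exact: le_trans (ltW x4).
have [iF ig hF] := caccioppoli hC2 (cutoff_C2 a2 a3) z40.
split => //; apply: le_trans hF _; apply: Rintegral_le_cube => //.
- move=> x; have [x3|x3] := leP (sq x) a3.
    have z1 : zeta x ^+ 2 <= 1 by rewrite expr_le1 ?cutoff_le1// cutoff_ge0.
    have := hA x3; have := lapB x3; rewrite -/(lap x) => hb ha.
    have s1 : \sum_i cutoff1 a2 a3 i x ^+ 2 <= N * (C ^+ 2 * Z ^+ 2).
      apply: (@le_trans _ _ (\sum_(i < n.+1) (C ^+ 2 * Z ^+ 2))).
        by apply: ler_sum.
      by rewrite sumr_const card_ord -[leLHS]mulr_natl.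
    have z0 := sqr_ge0 (zeta x).
    apply: lerD; last first.
      rewrite -mulrA ler_wpM2l// mulrC ler_pM ?sqr_ge0//.
      by apply: sumr_ge0 => i _; exact: sqr_ge0.
    by apply: lerD; rewrite -[leRHS]mul1r ler_pM ?sqr_ge0.
  rewrite cutoff_eq0//; last exact: ltW.
  rewrite [X in h x ^+ 2 * X]big1 => [|i _]; last by rewrite cutoff1_eq0 ?expr0n//; right.
  rewrite expr0n !mul0r !mulr0 !addr0 addr_ge0 ?addr_ge0// mulr_ge0// mulr_ge0//.
  by rewrite mulr_ge0// mulr_ge0 ?sqr_ge0.
- move=> x x4; have x3 : a3 < sq x by exact: le_lt_trans (out4 x4).
  rewrite -/(zeta x) z40// [X in h x ^+ 2 * X]big1 => [|i _]; last by rewrite cutoff1_eq0 ?expr0n//; right.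
  by rewrite expr0n !mul0r !mulr0 !addr0.
Qed.

Let I := \int[mu]_x wt k (fun x => H x * H x) x.

(** The Carleman estimate for chi h, with outer radius 4, followed by the energy estimate for the
    gradient on the transition. The error terms live where sq x >= a1 and carry [om]; [S] bounds the
    Laplacian with the weight already included. *)
Lemma sup_estimate_weighted : I <= 16 * ((48 + 48 * (N ^+ 2 * C ^+ 2) + 192 * (N * C ^+ 2) +
   768 * (N * C ^+ 2) ^+ 2) * @volN R n 4 * (Z ^+ 4 * (S + om * (A + B)))).
Proof.
have Hout x : sq x < 1 \/ 16 < sq x -> H x = 0.
  case=> hx; first by rewrite /H h0 ?mulr0.
  by rewrite /H /chi cutoff_eq0 ?mul0r//; exact: le_trans (ltW hx).
have hI : I <= 16 * \int[mu]_x wt k (fun x => sq x * (lapH x * lapH x)) x.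
  by apply: (carleman HC2 _ k0 Hout); rewrite ler1n.
apply: le_trans hI _; rewrite ler_wpM2l//.
have [gI ig] := int_gr.
have v0 : 0 <= @volN R n 4 by exact: volN_ge0.
have clapH : continuous lapH by case: HC2 => _ _ c2 _ _; exact: contS.
have lapH0 x : 4 < `|x| -> lapH x = 0.
  move=> /out4 x4; have x2 : a2 < sq x by exact: le_lt_trans a2_16 x4.
  rewrite /lapH big1// => i _; rewrite /H2 /chi cutoff1_eq0; [|by []|by right].
  by rewrite cutoff2_eq0; [rewrite cutoff_eq0// ?(ltW x2)//; ring|by []|by right].
have lapH1 x : sq x < 1 -> sq x * (lapH x * lapH x) = 0.
  move=> x1; rewrite (_ : lapH x = 0) ?mulr0//.
  by rewrite /lapH big1// => i _; rewrite /H2 h0// h10// h20//; ring.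
have cw : continuous (wt k (fun x => sq x * (lapH x * lapH x))).
  apply: (@cont_wt _ _ _ _ 1) => //; apply: contM; first exact: cont_sq.
  exact: contM.
have iw : mu.-integrable [set: L] (EFin \o wt k (fun x => sq x * (lapH x * lapH x))).
  by apply: (integrable_Cc (M := 4)) => // x x4; rewrite /wt lapH0 ?mulr0.
have i1 := integrable_cube (n := n) Q 4.
have i2 : mu.-integrable [set: L] (EFin \o (fun x => P * (zeta x ^+ 2 * gr x))).
  exact: integrable_scale.
apply: (@le_trans _ _ (Q * @volN R n 4 + P * ((A + B + 4 * (N * (C ^+ 2 * Z ^+ 2)) * A) * @volN R n 4))).
  apply: (@le_trans _ _ (\int[mu]_x (Q * \1_(cubeN 4) x + P * (zeta x ^+ 2 * gr x)))).
    by apply: le_Rintegral; [by []|exact: iw|exact: (integrable_add i1 i2)|move=> x _; exact: pointwise].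
  have -> : \int[mu]_x (Q * \1_(cubeN 4) x + P * (zeta x ^+ 2 * gr x)) =
      \int[mu]_x (Q * \1_(cubeN 4) x) + P * \int[mu]_x (zeta x ^+ 2 * gr x).
    by rewrite RintegralD//; congr (_ + _); exact: RintegralZl.
  apply: lerD; last by rewrite ler_wpM2l.
  apply: Rintegral_le_cube => // x.
    by rewrite -[leRHS]mulr1 ler_wpM2l// indicE; case: (x \in _).
  by move=> x4; rewrite indicE memNset ?mulr0// /cubeN/=; apply/negP; rewrite -ltNge.
rewrite mulrA -mulrDl -mulrA [leRHS]mulrAC ler_wpM2r//.
rewrite /Q /P -![in leLHS](mulrA 192) (_ : Z ^+ 4 = (Z ^+ 2) ^+ 2); last by rewrite -exprM.
have Z2 : 1 <= Z ^+ 2 by rewrite exprn_ege1.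
have om0' := om0.
move: (Z ^+ 2) om om0' Z2 => p o o0 p1.
have NC0 : 0 <= N * C ^+ 2 by rewrite mulr_ge0 ?sqr_ge0.
have NC1 : 0 <= N ^+ 2 * C ^+ 2 by rewrite mulr_ge0 ?sqr_ge0.
have p0 : 0 <= p by exact: le_trans p1.
have oA : 0 <= o * A by exact: mulr_ge0.
have oB : 0 <= o * B by exact: mulr_ge0.
have pp : p <= p ^+ 2 by rewrite expr2 ler_peMl.
have pp1 : 1 <= p ^+ 2 by exact: le_trans pp.
rewrite [leLHS](_ : _ = 48 * S + 48 * (N ^+ 2 * C ^+ 2) * (p ^+ 2 * (o * A)) + 192 * (N * C ^+ 2) * (p * (o * A + o * B))
   + 768 * (N * C ^+ 2) ^+ 2 * (p ^+ 2 * (o * A))); last by ring.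
rewrite [leRHS](_ : _ = 48 * (p ^+ 2 * (S + o * A + o * B)) + 48 * (N ^+ 2 * C ^+ 2) * (p ^+ 2 * (S + o * A + o * B))
  + 192 * (N * C ^+ 2) * (p ^+ 2 * (S + o * A + o * B)) + 768 * (N * C ^+ 2) ^+ 2 * (p ^+ 2 * (S + o * A + o * B))); last by ring.
move: (o * A) (o * B) oA oB => a b a_ge0 b_ge0.
have p20 : 0 <= p ^+ 2 by exact: sqr_ge0.
have aS : a <= S + a + b by rewrite -addrA addrCA lerDl addr_ge0.
have abS : a + b <= S + a + b by rewrite -addrA lerDr.
apply: lerD; first apply: lerD; first apply: lerD.
- rewrite ler_wpM2l//; apply: (@le_trans _ _ (1 * (S + a + b))); first by lra.
  by rewrite ler_wpM2r// !addr_ge0.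
- apply: ler_wpM2l; first by apply: mulr_ge0; [exact: ler0n|exact: NC1].
  exact: (ler_wpM2l p20 aS).
- apply: ler_wpM2l; first by apply: mulr_ge0; [exact: ler0n|exact: NC0].
  by apply: ler_pM => //; exact: addr_ge0.
- apply: ler_wpM2l; first by apply: mulr_ge0; [exact: ler0n|exact: sqr_ge0].
  exact: (ler_wpM2l p20 aS).
Qed.

(** The radius of the averages taken around x. It is at most g/48, so that they only see points
    where [chi] is 1, and at most 1/(16 k), so that |.|^(2k) exceeds its value at x by at most a
    factor 2. *)
Let d := (16 * k%:R * Z)^-1.

Let kZ1 : 1 <= k%:R * Z.
Proof. by rewrite mulr_ege1// ler1n. Qed.
Let d_gt0 : 0 < d.
Proof.
have hp : 0 < 16 * (k%:R * Z) by apply: mulr_gt0; [exact: ltr0Sn|exact: lt_le_trans kZ1].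
by rewrite invr_gt0 -mulrA.
Qed.
Let d0 : 0 <= d := ltW d_gt0.
Let kd : k%:R * d <= 1 / 16.
Proof.
have kp : 0 < k%:R :> R by rewrite ltr0n.
have Zp : 0 < Z by exact: lt_le_trans Z1.
rewrite (_ : k%:R * d = 1 / 16 / Z); last by rewrite /d; field; rewrite !gt_eqF.
by rewrite ler_pdivrMr// ler_peMr.
Qed.
Let d_g : d <= g / 48.
Proof.
have k1 : 1 <= k%:R :> R by rewrite ler1n.
rewrite /d invf_ple ?posrE ?divr_gt0//; last by rewrite -mulrA mulr_gt0// (lt_le_trans ltr01).
rewrite invf_div (_ : 48 / g = 16 * 1 * Z); last by rewrite /Z; field; rewrite gt_eqF.
by rewrite ler_wpM2r ?(le_trans ler01)// ler_wpM2l.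
Qed.

Let sq_shift x y : 1 <= sq x -> sq y <= 1 -> sq (x + d *: y) <= (1 + d) ^+ 2 * sq x.
Proof.
move=> x1 y1.
have -> : sq (x + d *: y) = sq x + d * (\sum_i 2 * (x ord0 i * y ord0 i)) + d ^+ 2 * sq y.
  rewrite /sq !mulr_sumr -!big_split/=; apply: eq_bigr => i _; rewrite !mxE; ring.
have h3 : \sum_i 2 * (x ord0 i * y ord0 i) <= sq x + sq y.
  rewrite /sq -big_split/=; apply: ler_sum => i _; rewrite -subr_ge0.
  by rewrite (_ : _ - _ = (x ord0 i - y ord0 i) ^+ 2) ?sqr_ge0//; ring.
have dd := d0; have d2 := sqr_ge0 d.
have h4 : d * (\sum_i 2 * (x ord0 i * y ord0 i)) <= d * (2 * sq x).
  by rewrite ler_wpM2l//; lra.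
have h5 : d ^+ 2 * sq y <= d ^+ 2 * sq x by rewrite ler_wpM2l//; lra.
rewrite sqrrD expr1n mul1r -[d *+ 2]mulr_natr !mulrDl mul1r; lra.
Qed.

Let d1_le : (1 + d) ^+ 2 ^+ k <= 2.
Proof.
rewrite -exprM; apply: exprD1_le => //; rewrite natrM -mulrA.
by have := kd; lra.
Qed.

Let shift_a1 x y : 1 <= sq x -> sq x <= r ^+ 2 -> sq y <= 1 -> sq (x + d *: y) <= a1.
Proof.
move=> x1 xr y1; apply: le_trans (sq_shift x1 y1) _.
have dg := d_g; have dd := d0; have rr := r1; have rg := rg4; have gg := g0.
apply: (@le_trans _ _ (((1 + d) * r) ^+ 2)).
  by rewrite exprMn ler_wpM2l// sqr_ge0.
rewrite /a1 ler_pXn2r ?nnegrE//; [nra|nra|].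
nra.
Qed.

Let shift_k x y : 1 <= sq x -> sq y <= 1 -> sq (x + d *: y) ^+ k <= 2 * sq x ^+ k.
Proof.
move=> x1 y1.
apply: (@le_trans _ _ (((1 + d) ^+ 2 * sq x) ^+ k)).
  have l1 := sq_shift x1 y1.
  have s0 := sq_ge0 (x + d *: y).
  by apply: lerXn2r (l1); rewrite nnegrE//; exact: le_trans l1.
by rewrite exprMn ler_wpM2r// exprn_ge0// sq_ge0.
Qed.

Variable Cm : R.
Hypothesis Cm0 : 0 < Cm.
Hypothesis HCm : forall (h : V -> R) h1 h2, C2data h h1 h2 ->
  forall (x : V) (d b : R), 0 <= b ->
  (forall y, sq y <= 1 -> `|\sum_i h2 i i (x + d *: y)| <= b) ->
  h x ^+ 2 <= Cm * (\int[mu]_y (h (x + d *: y) ^+ 2 * dstep (sq y)) + d ^+ 4 * b ^+ 2).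
Hypothesis HK : forall t : R, `|dstep t| <= C.

Let I0 : 0 <= I.
Proof.
apply: Rintegral_ge0 => x _; rewrite /wt mulr_ge0//.
  by rewrite exprn_ge0// invr_ge0 sq_ge0.
by rewrite -expr2 sqr_ge0.
Qed.

Let C1' := 16 * ((48 + 48 * (N ^+ 2 * C ^+ 2) + 192 * (N * C ^+ 2) +
   768 * (N * C ^+ 2) ^+ 2) * @volN R n 4).

(** The mean value inequality on the ball of radius [d] turns the weighted integral into a bound at
    x. In the exponent, n.+1 counts the powers of 1/d produced by the change of variables, and 4
    those of [Z] due to the cut-offs. *)
Lemma sup_estimate_pointwise x : sq x <= r ^+ 2 ->
  h x ^+ 2 <= Cm * (2 * C * 16 ^+ n.+1 * C1' + 2) * (k%:R * Z) ^+ (n.+1 + 4) *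
    (S + om * (A + B)) * sq x ^+ k.
Proof.
move=> xr.
have C10 : 0 <= C1'.
  by apply: mulr_ge0; [exact: ler0n|apply: mulr_ge0; [exact: cst_ge0|exact: volN_ge0]].
have W0 : 0 <= S + om * (A + B) by rewrite addr_ge0// mulr_ge0// addr_ge0.
have kZ0 : 0 <= k%:R * Z by exact: le_trans kZ1.
have C0 : 0 <= C by exact: le_trans C1.
have X0 : 0 <= sq x ^+ k by rewrite exprn_ge0// sq_ge0.
have E0 : 0 <= 2 * C * 16 ^+ n.+1 * C1' by rewrite mulr_ge0// mulr_ge0 ?exprn_ge0// mulr_ge0.
have [x1|x1] := ltP (sq x) 1.
  rewrite h0// expr0n mulr_ge0// mulr_ge0// mulr_ge0 ?exprn_ge0// mulr_ge0 ?(ltW Cm0)//.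
  by rewrite addr_ge0.
have a13 : a1 <= a3 by exact: le_trans (ltW a12) (ltW a23).
pose b := Num.sqrt (2 * S * sq x ^+ k).
have lapb y : sq y <= 1 -> `|lap (x + d *: y)| <= b.
  move=> y1; rewrite -sqrtr_sqr ler_wsqrtr//.
  apply: (le_trans (lapS _)); first by apply: le_trans (shift_a1 x1 xr y1) a13.
  by rewrite [2 * S]mulrC -mulrA ler_wpM2l// shift_k.
have := HCm hC2 (sqrtr_ge0 _) lapb; rewrite /b sqr_sqrtr; last by rewrite mulr_ge0// mulr_ge0.
move=> hx; apply: (le_trans hx).
have iw : mu.-integrable [set: L] (EFin \o wt k (fun x => H x * H x)).
  apply: (integrable_Cc (M := 4)).
    apply: (@cont_wt _ _ _ _ 1) => // [y y1|]; first by rewrite /H h0// !mulr0.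
    by case: HC2 => cH _ _ _ _; exact: contM.
  move=> y /out4 y4; rewrite /wt /H /chi cutoff_eq0 ?mul0r ?mulr0//.
  exact: le_trans a2_16 (ltW y4).
have iwd : mu.-integrable [set: L] (EFin \o (fun y => wt k (fun x => H x * H x) (x + d *: y))).
  exact: (integrable_affineN x d_gt0 iw).
have hI : \int[mu]_y (h (x + d *: y) ^+ 2 * dstep (sq y)) <=
    2 * C * sq x ^+ k * (d ^- n.+1 * I).
  rewrite -(Rintegral_affineN x d_gt0 iw).
  rewrite -RintegralZl//; apply: le_Rintegral => //.
  - apply: (integrable_Cc (M := 1)) => [|y y1].
      apply: contM; first by apply: contX; apply: cont_affine; case: hC2.
      by apply: cont_comp; [exact: cont_dstep|exact: cont_sq].
    rewrite dstep0 ?mulr0//; right; apply: lt_le_trans (normV_sq y).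
    by rewrite exprn_egt1.
  - exact: integrable_scale.
  move=> y _.
  have wt0 z : 0 <= wt k (fun x => H x * H x) z.
    rewrite /wt mulr_ge0//; first by rewrite exprn_ge0// invr_ge0 sq_ge0.
    by rewrite -expr2 sqr_ge0.
  have [y1|y1] := leP (sq y) 1; last first.
    rewrite dstep0 ?mulr0; last by right.
    by apply: mulr_ge0; [rewrite !mulr_ge0|exact: wt0].
  have hz : h (x + d *: y) ^+ 2 <= 2 * sq x ^+ k * wt k (fun x => H x * H x) (x + d *: y).
    have [z1|z1] := ltP (sq (x + d *: y)) 1.
      by rewrite h0// expr0n mulr_ge0// mulr_ge0.
    have -> : h (x + d *: y) ^+ 2 = sq (x + d *: y) ^+ k * wt k (fun x => H x * H x) (x + d *: y).
      rewrite /wt exprVn mulrA mulfV ?mul1r; last by rewrite expf_neq0// gt_eqF// (lt_le_trans ltr01).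
      by rewrite /H /chi cutoff_eq1 ?mul1r ?expr2// shift_a1.
    by rewrite ler_wpM2r// shift_k.
  rewrite [leRHS](_ : _ = (2 * sq x ^+ k * wt k (fun x => H x * H x) (x + d *: y)) * C); last by ring.
  by apply: ler_pM => //; [exact: sqr_ge0|exact: dstep_ge0|exact: le_trans (ler_norm _) (HK _)].
have dI : d ^- n.+1 * I <= 16 ^+ n.+1 * (k%:R * Z) ^+ n.+1 * (C1' * ((k%:R * Z) ^+ 4 * (S + om * (A + B)))).
  rewrite -exprVn /d invrK -mulrA exprMn.
  apply: ler_wpM2l; first by rewrite mulr_ge0 ?exprn_ge0.
  apply: le_trans sup_estimate_weighted _.
  rewrite /C1' -[in leRHS]mulrA ler_wpM2l//.
  have C1'' : 0 <= (48 + 48 * (N ^+ 2 * C ^+ 2) + 192 * (N * C ^+ 2) + 768 * (N * C ^+ 2) ^+ 2) * @volN R n 4.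
    by apply: mulr_ge0; [exact: cst_ge0|exact: volN_ge0].
  apply: ler_wpM2l => //; apply: ler_wpM2r => //.
  rewrite ler_pXn2r ?nnegrE// ?(le_trans ler01 Z1)//.
  by rewrite ler_peMl ?ler1n// (le_trans ler01).
rewrite exprD; set K1 := (k%:R * Z) ^+ n.+1; set K4 := (k%:R * Z) ^+ 4.
have K11 : 1 <= K1 by rewrite exprn_ege1.
have K41 : 1 <= K4 by rewrite exprn_ege1.
have d41 : d ^+ 4 <= 1.
  rewrite exprn_ile1//; have := d_g; have := g0; have := rg4; have := r1; lra.
have SW : S <= S + om * (A + B) by rewrite lerDl mulr_ge0// addr_ge0.
set W := S + om * (A + B) in W0 hI dI SW *; set X := sq x ^+ k in X0 hI hx *.
set E16 := 16 ^+ n.+1 in E0 dI *.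
rewrite [leRHS](_ : _ = Cm * (2 * C * X * (E16 * K1 * (C1' * (K4 * W))) + K1 * K4 * (2 * W * X))); last by ring.
apply: ler_wpM2l; first exact: ltW.
apply: lerD.
  by apply: le_trans hI _; apply: ler_wpM2l => //; rewrite mulr_ge0// mulr_ge0.
have SX : 0 <= 2 * S * X by rewrite mulr_ge0// mulr_ge0.
apply: (@le_trans _ _ (1 * (2 * S * X))); first exact: ler_wpM2r.
apply: ler_pM => //; first by rewrite mulr_ege1.
by apply: ler_wpM2r => //; apply: ler_wpM2l.
Qed.

End setup.

(** [S] measures the Laplacian against |x|^(2k), whereas [A] and [B] merely bound h and its
    Laplacian on the larger ball. For |x| <= r these two are multiplied by (|x| / (r + g/4))^(2k),
    which for large k beats the polynomial loss. The powers of 3 in the constant come from Z =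
    3/g. *)
Lemma sup_estimate : exists2 C0 : R, 0 < C0 &
  forall (h : V -> R) h1 h2, C2data h h1 h2 -> (forall x, sq x < 1 -> h x = 0) ->
  forall (r g : R) (k : nat) (S A B : R), (0 < k)%N -> 1 <= r -> 0 < g -> r + g <= 4 ->
    0 <= S -> 0 <= A -> 0 <= B ->
  (forall x, sq x <= (r + g) ^+ 2 -> (\sum_i h2 i i x) ^+ 2 <= S * sq x ^+ k) ->
  (forall x, sq x <= (r + g) ^+ 2 -> h x ^+ 2 <= A) ->
  (forall x, sq x <= (r + g) ^+ 2 -> (\sum_i h2 i i x) ^+ 2 <= B) ->
  forall x, sq x <= r ^+ 2 ->
  h x ^+ 2 <= C0 * (k%:R / g) ^+ (n.+1 + 4) *
    (S + (A + B) / ((r + g / 4) ^+ 2) ^+ k) * sq x ^+ k.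
Proof.
have [C2 C21 hC2] := step_bounds (R := R).
have [C3 C31 hC3] := cutoff_bounds (R := R) (n := n).
have [Cm Cm0 hCm] := mean_value mu_pos.
pose C := C2 + C3.
have C1 : 1 <= C by rewrite /C; lra.
set c := 16 * ((48 + 48 * (N ^+ 2 * C ^+ 2) + 192 * (N * C ^+ 2) +
   768 * (N * C ^+ 2) ^+ 2) * @volN R n 4).
have c0 : 0 <= c.
  by apply: mulr_ge0; [exact: ler0n|apply: mulr_ge0; [exact: cst_ge0|exact: volN_ge0]].
exists (Cm * (2 * C * 16 ^+ n.+1 * c + 2) * 3 ^+ (n.+1 + 4)).
  rewrite mulr_gt0 ?exprn_gt0// mulr_gt0// ltr_wpDl// mulr_ge0// mulr_ge0 ?exprn_ge0// mulr_ge0//.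
  by rewrite (le_trans ler01).
move=> h h1 h2 hh h0 r g k S A B k0 r1 g0 rg4 S0 A0 B0 hS hA hB x xr.
have := @sup_estimate_pointwise h h1 h2 r g k S A B hh k0 h0 r1 g0 rg4 S0 A0 B0 hS hA hB C C1
  _ Cm Cm0 hCm _ x xr.
rewrite -/c [(A + B) / _]mulrC -[in X in _ -> _ <= X](mulrA _ (3 ^+ _)) -exprMn.
rewrite (_ : 3 * (k%:R / g) = k%:R * (3 / g)); last by ring.
apply.
- move=> a b w y ab b16 w1 wab; have [q1 q2] := hC3 a b w y ab b16 w1 wab.
  have w0 : 0 <= w by exact: le_trans w1.
  split=> [i|i j]; [apply: le_trans (q1 i) _|apply: le_trans (q2 i j) _].
    by rewrite ler_wpM2r// /C; lra.
  by rewrite ler_wpM2r ?exprn_ge0// /C; lra.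
- by move=> t; apply: le_trans (hC2 t).1 _; rewrite /C; lra.
Qed.

End sup_estimate.

(** * Mollification *)

Section iterated_derivative.
Context {R : realType}.
Implicit Types (f g : R -> R).

Definition cinf f := forall k, Ck k f.

Definition der k f : R -> R := iter k (fun g t => 'D_1 g t) f.

Lemma cinf_derive f : cinf f ->
  (forall t : R, is_derive t 1 f ('D_1 f t)) /\ cinf (fun t : R => 'D_1 f t).
Proof.
move=> cf; split=> [t|k].
  by have [f' ff' _] := cf 1%N; have [d1 d2] := ff' t; rewrite d2.
have [f' ff' hf] := cf k.+1; apply: Ck_ext hf => t.
by have [_ ->] := ff' t.
Qed.

Lemma cinf_der k f : cinf f -> cinf (der k f).
Proof. by move=> cf; elim: k => [//|k IH]; exact: (cinf_derive IH).2. Qed.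

Lemma drv_der k f : cinf f -> forall t : R, is_derive t 1 (der k f) (der k.+1 f t).
Proof. by move=> cf t; apply: (cinf_derive _).1; exact: cinf_der. Qed.

Lemma cont_der k f : cinf f -> continuous (der k f).
Proof. by move=> /(cinf_der k)/(_ 0%N). Qed.

Lemma der1 f (f' : R -> R) : (forall t : R, is_derive t 1 f (f' t)) -> der 1 f = f'.
Proof. by move=> ff'; apply/funext => t /=; have [_ ->] := ff' t. Qed.

Lemma der_affine k f (a b t : R) : cinf f ->
  der k (fun s => f (a * s + b)) t = a ^+ k * der k f (a * t + b).
Proof.
move=> cf; elim: k t => [t|k IH t]; first by rewrite expr0 mul1r.
rewrite /= -/(der k _) (funext IH).
have h : is_derive t 1 (fun s => a * s + b) (a * 1 + 0).
  exact: (drvD (drvZ a (is_derive_id t 1)) (drvC b t 1)).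
have [_ ->] := drvZ (a ^+ k) (drv_comp (f := fun s : R => a * s + b) (drv_der k cf (a * t + b)) h).
by rewrite addr0 mulr1 exprSr; rewrite -!mulrA [_ * a]mulrC.
Qed.

Lemma derB f g : cinf f -> cinf g -> cinf (fun t => f t - g t) /\
  der 1 (fun t => f t - g t) = (fun t => der 1 f t - der 1 g t).
Proof.
move=> cf cg; split.
  move=> k; apply: (@Ck_ext _ _ (fun t => f t + (-1) * g t)) => [t|].
    by rewrite mulN1r.
  by apply: CkD => //; apply: CkM => //; exact: Ck_cst.
by apply: der1 => t; apply: drvB; exact: (drv_der 0).
Qed.

Lemma cinf_step : cinf (@step R). Proof. by move=> k; exact: Ck_step. Qed.

Lemma cinf_affine f (a b : R) : cinf f -> cinf (fun t => f (a * t + b)).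
Proof. by move=> cf k; exact: Ck_affine. Qed.

End iterated_derivative.

(** * Tensor-product test functions and mollifications *)

Section product_functions.
Context {R : realType} {n : nat}.
Local Notation V := ('rV[R]_n.+1).
Local Notation L := (lebesgue_space R n).
Local Notation mu := (lebesgueN R n).
Local Notation e_ i := (delta_mx ord0 i : V).
Implicit Types (x y z : V) (E : 'I_n.+1 -> R -> R) (c : 'I_n.+1 -> nat).

Lemma contP k (f : 'I_k -> V -> R) : (forall j : 'I_k, continuous (f j)) ->
  continuous (fun x => \prod_(i < k) f i x).
Proof.
elim: k f => [|k IH] f cf.
  by under eq_fun do rewrite big_ord0; exact: contC.
by under eq_fun do rewrite big_ord_recr/=; apply: contM => //; exact: IH.
Qed.

Definition cinfs E := forall j, cinf (E j).

(** Tensor products of derivatives of one-variable functions, [c] being the multi-index. A partial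
    derivative only raises one entry of [c], so the family is closed under differentiation; it
    supplies the smooth test functions. *)
Definition prodf E c y : R := \prod_j der (c j) (E j) (y ord0 j).

Definition cS c (i : 'I_n.+1) : 'I_n.+1 -> nat := fun j => (c j + (j == i))%N.

Lemma sum_cS c i : (\sum_j cS c i j = (\sum_j c j).+1)%N.
Proof.
rewrite /cS big_split/= (bigD1 (F := fun j => nat_of_bool (j == i)) i)//= eqxx.
by rewrite [X in (_ + (_ + X))%N]big1 ?addn1// => j /negbTE ->.
Qed.

Lemma cont_prodf E c : cinfs E -> continuous (prodf E c).
Proof.
move=> cE; apply: contP => j; apply: cont_comp; last exact: cont_coord.
exact: cont_der.
Qed.

Lemma drv_prodf E c i y : cinfs E ->
  is_derive y (e_ i) (prodf E c) (prodf E (cS c i) y).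
Proof.
move=> cE; apply/drv_line.
have -> : (fun s : R => prodf E c (y + s *: e_ i)) = fun s : R =>
    (\prod_(j < n.+1 | j != i) der (c j) (E j) (y ord0 j)) * der (c i) (E i) (y ord0 i + s).
  apply/funext => s; rewrite /prodf (bigD1 i)//= mulrC; congr (_ * _).
    by apply: eq_bigr => j ji; rewrite !mxE eqxx/= (negbTE ji) mulr0 addr0.
  by rewrite !mxE !eqxx mulr1.
have h : is_derive (0 : R) 1 (fun s : R => y ord0 i + s) (0 + 1).
  exact: (drvD (drvC _ _ _) (is_derive_id _ _)).
apply: (drv_eq (drvZ _ (drv_comp (drv_der (c i) (cE i) _) h))).
rewrite add0r mulr1 addr0 /prodf [RHS](bigD1 i)//= mulrC /cS eqxx addn1.
by congr (_ * _); apply: eq_bigr => j /negbTE ->; rewrite addn0.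
Qed.

Lemma diff_prodf E c y : cinfs E -> differentiable (prodf E c) y.
Proof.
move=> cE; apply: (differentiable_partials (f1 := fun i => prodf E (cS c i)) _ _).1.
  exact: (@filterE _ (nbhs y) _ _ (fun z i => drv_prodf c i z cE)).
by move=> i; exact: cont_prodf.
Qed.

Lemma iter_partial_prodf I E c : cinfs E ->
  iter_partial I (prodf E c) = prodf E (fun j => (c j + count_mem j I)%N).
Proof.
move=> cE; elim: I => [|i I IH] /=.
  by congr prodf; apply/funext => j; rewrite addn0.
rewrite IH; apply/funext => y; rewrite /partial; have [_ ->] := drv_prodf (fun j => c j + count_mem j I)%N i y cE.
congr prodf; apply/funext => j; rewrite /cS/= [in RHS]eq_sym; lia.
Qed.

Lemma smooth_prodf E c : cinfs E -> smooth (prodf E c).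
Proof. by move=> cE I x; rewrite iter_partial_prodf//; exact: diff_prodf. Qed.

Definition aff (e : R) x E : 'I_n.+1 -> R -> R :=
  fun j t => E j (e^-1 * (t - x ord0 j)).

Lemma affE (e : R) x E j : aff e x E j = fun t => E j (e^-1 * t + - (e^-1 * x ord0 j)).
Proof. by apply/funext => t; rewrite /aff mulrBr. Qed.

Lemma cinfs_aff (e : R) x E : cinfs E -> cinfs (aff e x E).
Proof. by move=> cE j; rewrite affE; exact: cinf_affine. Qed.

Lemma prodf_aff (e : R) x E c y : cinfs E ->
  prodf (aff e x E) c y = e^-1 ^+ (\sum_j c j) * prodf E c (e^-1 *: (y - x)).
Proof.
move=> cE; rewrite /prodf -prodrXr -big_split; apply: eq_bigr => j _ /=.
by rewrite affE der_affine// !mxE -mulrBr.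
Qed.

(** The kernel depends on y - x only, so derivatives in the centre and in the variable differ by a
    sign. *)
Lemma drv_prodf_aff (e : R) E c i x y : cinfs E ->
  is_derive x (e_ i) (fun x => prodf (aff e x E) c y) (- prodf (aff e x E) (cS c i) y).
Proof.
move=> cE.
have -> : (fun x => prodf (aff e x E) c y) =
    (fun x => e^-1 ^+ (\sum_j c j) * prodf E c (e^-1 *: y + (- e^-1) *: x)).
  by apply/funext => z; rewrite prodf_aff// scaleNr -scalerBr.
apply: (drv_eq (drvZ _ (drv_affine (drv_prodf c i _ cE)))).
rewrite prodf_aff// sum_cS exprSr scaleNr -scalerBr.
by rewrite mulNr mulrN mulrA.
Qed.

Lemma prodf_supp E c i (M : R) : cinfs E -> (forall z, M < `|z| -> prodf E c z = 0) ->
  forall z, M < `|z| -> prodf E (cS c i) z = 0.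
Proof.
move=> cE h z /near_lt_norm Mz; apply: is_derive_near0 (drv_prodf c i z cE).
by apply: filterS Mz => y; exact: h.
Qed.

Lemma prodf_aff_bounded (e : R) E c (M : R) : cinfs E ->
  (forall z, M < `|z| -> prodf E c z = 0) ->
  exists2 C, 0 < C & forall x y, `|prodf (aff e x E) c y| <= C.
Proof.
move=> cE h; have [C C0 hC] := bounded_bsupp (cont_prodf cE) h.
exists (`|e^-1 ^+ (\sum_j c j)| * C + 1).
  by rewrite ltr_wpDl// mulr_ge0// ltW.
move=> x y; rewrite prodf_aff// normrM -[leLHS]addr0 lerD//.
by rewrite ler_wpM2l.
Qed.

Lemma near_dist x (d : R) : 0 < d -> \forall y \near x, `|y - x| < d.
Proof.
move=> d0; apply/nbhs_ballP; exists d => //= y.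
by rewrite -ball_normE /= distrC.
Qed.

(** Bounded partial derivatives make [f] Lipschitz. For mollifications such bounds are immediate at
    every order, and the continuity of all their derivatives follows. *)
Lemma bounded_partials_cont f (f1 : 'I_n.+1 -> V -> R) (C : R) :
  (forall y i, is_derive y (e_ i) f (f1 i y)) -> (forall y i, `|f1 i y| <= C) ->
  continuous f.
Proof.
move=> fd fC x; apply/(@cvgrPdist_le R R^o V (nbhs x) _ f (f x)) => e e0.
have C0 : 0 <= C by exact: le_trans (fC x ord0).
pose d := e / (n.+1%:R * C + 1).
have den : 0 < n.+1%:R * C + 1 by rewrite ltr_wpDl// mulr_ge0.
have d0 : 0 < d by rewrite divr_gt0.
near=> y.
have yx : `|y - x| < d.
  by near: y; exact: near_dist.
have h : `|f (x + (y - x)) - f x - lform 0 (y - x)| <= n.+1%:R * C * `|y - x|.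
  apply: (increment_le (f1 := f1) (r := `|y - x| + 1)); last by rewrite ltrDl.
  by move=> z i _; rewrite mxE subr0.
have l0 : lform 0 (y - x) = 0.
  by rewrite /lform big1// => i _; rewrite [X in _ * X]mxE mulr0.
move: h; rewrite l0 subr0 (addrCA x) subrr addr0 distrC => h; apply: le_trans h _.
apply: (@le_trans _ _ ((n.+1%:R * C + 1) * d)).
  apply: ler_pM => //; [exact: mulr_ge0|by rewrite lerDl].
by rewrite /d mulrC divfK// gt_eqF.
Unshelve. all: by end_near. Qed.

Lemma integrable_mulb (A : set L) (u f : V -> R) (C : R) : measurable A -> mu.-integrable A (EFin \o u) ->
  measurable_fun A (f : L -> R) -> (forall x, `|f x| <= C) ->
  mu.-integrable A (EFin \o (fun x => u x * f x)).
Proof.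
move=> mA iu mf fC.
have mu' : measurable_fun A (u : L -> R) by apply/measurable_EFinP; exact: measurable_int iu.
have iCu : mu.-integrable A (EFin \o (fun x => C * u x)) by exact: integrable_scale.
apply: (le_integrable mA _ _ iCu).
  by apply/measurable_EFinP; exact: measurable_funM.
move=> x _; rewrite /= lee_fin !normrM mulrC; apply: ler_pM => //.
exact: le_trans (fC x) (ler_norm _).
Qed.

Section mo.
Variables (u : V -> R) (e : R).
Hypothesis iu : mu.-integrable [set: L] (EFin \o u).

(* For c = 1 this is, at scale e, the convolution of u with the kernel
   prod_j (E j)'; every E j will climb from 0 to 1, so that all these kernels
   have the same mass. *)
Definition mo E c x : R := \int[mu]_y (u y * prodf (aff e x E) c y).

Lemma integrable_mo E c (M : R) x : cinfs E -> (forall z, M < `|z| -> prodf E c z = 0) ->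
  mu.-integrable [set: L] (EFin \o (fun y => u y * prodf (aff e x E) c y)).
Proof.
move=> cE h; have [C C0 hC] := prodf_aff_bounded e cE h.
apply: (integrable_mulb _ iu) (hC x) => //.
by apply: continuous_measurableN; apply: cont_prodf; exact: cinfs_aff.
Qed.

Lemma drv_mo E c i (M : R) x : cinfs E -> (forall z, M < `|z| -> prodf E c z = 0) ->
  is_derive x (e_ i) (mo E c) (- mo E (cS c i) x).
Proof.
move=> cE h; have h' := prodf_supp i cE h.
have [C C0 hC] := prodf_aff_bounded e cE h'.
apply/drv_line.
have D := @is_derive_under_integral R n (fun (t : R) y => u y * prodf (aff e (x + t *: e_ i) E) c y)
  (fun (t : R) y => u y * (- prodf (aff e (x + t *: e_ i) E) (cS c i) y)) setT 0
  (fun y => `|u y| * C).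
apply: (drv_eq (D _ _ _ _ _ _)).
- by [].
- by move=> t; exact: integrable_mo h.
- move=> t y _; apply: drvZ.
  exact: (is_derive_line (f := fun x => prodf (aff e x E) c y) (drv_prodf_aff e c i _ y cE)).
- have := integrable_scale C (integrable_norm iu) measurableT.
  by apply: eq_integrable => // y _ /=; rewrite mulrC.
- by move=> y; rewrite mulr_ge0// ltW.
- by move=> t y _ _; rewrite normrM normrN ler_wpM2l.
rewrite scale0r addr0.
have -> : (fun y => u y * - prodf (aff e x E) (cS c i) y) =
   (fun y => (-1) * (u y * prodf (aff e x E) (cS c i) y)).
  by apply/funext => y; rewrite mulN1r mulrN.
by rewrite RintegralZl// ?mulN1r//; exact: integrable_mo h'.
Qed.

Lemma mo_bounded E c (M : R) : cinfs E -> (forall z, M < `|z| -> prodf E c z = 0) ->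
  exists C, forall x, `|mo E c x| <= C.
Proof.
move=> cE h; have [C C0 hC] := prodf_aff_bounded e cE h.
exists (C * \int[mu]_y `|u y|) => x.
apply: le_trans (le_normr_Rintegral _ _) _ => //; first exact: integrable_mo h.
rewrite -RintegralZl//; last exact: integrable_norm.
apply: le_Rintegral => //.
- exact: (integrable_norm (integrable_mo x cE h)).
- by apply: (integrable_scale C (f := fun y => `|u y|)) => //; exact: integrable_norm.
by move=> y _; rewrite normrM mulrC ler_wpM2r.
Qed.

Lemma cont_mo E c (M : R) : cinfs E -> (forall z, M < `|z| -> prodf E c z = 0) ->
  continuous (mo E c).
Proof.
move=> cE h.
have hb i := mo_bounded cE (prodf_supp i cE h).
have [C hC] := choice hb.
apply: (@bounded_partials_cont _ (fun i x => - mo E (cS c i) x) (\sum_i `|C i|)).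
  by move=> y i; exact: drv_mo h.
move=> y i; rewrite normrN; apply: le_trans (hC i y) _.
by apply: le_trans (ler_norm _) _; rewrite (bigD1 i)//= lerDl sumr_ge0.
Qed.

Lemma C2data_mo E c (M : R) : cinfs E -> (forall z, M < `|z| -> prodf E c z = 0) ->
  C2data (mo E c) (fun i x => - mo E (cS c i) x) (fun i j x => mo E (cS (cS c j) i) x).
Proof.
move=> cE h; split.
- exact: cont_mo h.
- by move=> i; apply: contN; apply: cont_mo (prodf_supp i cE h).
- by move=> i j; apply: cont_mo (prodf_supp i cE (prodf_supp j cE h)).
- split=> [i x|i j x]; first exact: drv_mo h.
  by rewrite -[mo _ _ x]opprK; apply: drvN; exact: drv_mo (prodf_supp j cE h).
- move=> i j x; congr (mo _ _ x); apply/funext => k; rewrite /cS; lia.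
Qed.

End mo.

End product_functions.

(** * Step kernels and their mass *)

Section step_kernels.
Context {R : realType} {n : nat}.
Local Notation V := ('rV[R]_n.+1).
Local Notation L := (lebesgue_space R n).
Local Notation mu := (lebesgueN R n).
Local Notation e_ i := (delta_mx ord0 i : V).
Implicit Types (x y z : V) (E F : 'I_n.+1 -> R -> R) (c : 'I_n.+1 -> nat).
Implicit Types lo hi : 'I_n.+1 -> R.

Lemma integrable_subf (A : set L) (f g : V -> R) : measurable A ->
  mu.-integrable A (EFin \o f) -> mu.-integrable A (EFin \o g) ->
  mu.-integrable A (EFin \o (fun x => f x - g x)).
Proof.
move=> mA fi gi; have := integrable_add fi (integrable_scale (-1) gi mA) mA.
by under eq_fun do rewrite mulN1r.
Qed.

Lemma telescope_prod k (a b : 'I_k -> R) : \prod_j a j - \prod_j b j =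
  \sum_(i < k) \prod_(j < k) (if (j < i)%N then a j else if j == i then a j - b j else b j).
Proof.
elim: k a b => [|k IH] a b; first by rewrite !big_ord0 subrr.
rewrite !big_ord_recr/=.
set a' := fun i => a (widen_ord (leqnSn k) i); set b' := fun i => b (widen_ord (leqnSn k) i).
have -> : \prod_(i < k) a (widen_ord (leqnSn k) i) * a ord_max -
   \prod_(i < k) b (widen_ord (leqnSn k) i) * b ord_max =
   (\prod_i a' i - \prod_i b' i) * b ord_max + \prod_i a' i * (a ord_max - b ord_max).
  by rewrite /a' /b'; ring.
rewrite IH mulr_suml; congr (_ + _).
  apply: eq_bigr => i _; rewrite big_ord_recr/=; congr (_ * _).
  by rewrite ltnNge (ltnW (ltn_ord i))/= ifF//; apply/negbTE; rewrite -val_eqE/= neq_ltn (ltn_ord i) orbT.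
rewrite ltnn eqxx; congr (_ * _); apply: eq_bigr => i _.
by rewrite ltn_ord.
Qed.

(** Between [lo j] and [hi j] the functions may oscillate, so the kernels built on them may change
    sign; the end values 0 and 1 alone fix the mass. *)
Definition stepfuns lo hi E := cinfs E /\
  forall j (t : R), (t <= lo j -> E j t = 0) /\ (hi j <= t -> E j t = 1).

Definition c1 : 'I_n.+1 -> nat := fun=> 1%N.

Lemma der_const (f : R -> R) (a t : R) k : (0 < k)%N ->
  (\forall s \near t, f s = a) -> der k f t = 0.
Proof.
have h1 (g : R -> R) b (s : R) : (\forall r \near s, g r = b) -> 'D_1 g s = 0.
  by move=> h; rewrite (near_eq_derive (g := cst b)) ?oner_neq0// derive_cst.
case: k => // k _; elim: k t => [|k IH] t h; first exact: h1 h.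
apply: (h1 _ 0); have := near_join h.
by apply: filterS => s; exact: IH.
Qed.

Lemma der_step0 lo hi E j (t : R) k : (0 < k)%N -> stepfuns lo hi E ->
  t < lo j \/ hi j < t -> der k (E j) t = 0.
Proof.
move=> k0 [_ sE] [tl|th].
  apply: (der_const (a := 0) k0); have := lt_nbhsl tl.
  by apply: filterS => s sl; exact: (sE j s).1 (ltW sl).
apply: (der_const (a := 1) k0); have := lt_nbhsr th.
by apply: filterS => s sl; exact: (sE j s).2 (ltW sl).
Qed.

Definition outbox lo hi z := exists j, z ord0 j < lo j \/ hi j < z ord0 j.

Lemma prodf_step0 lo hi E c z : stepfuns lo hi E -> (forall j, (0 < c j)%N) ->
  outbox lo hi z -> prodf E c z = 0.
Proof.
move=> sE c0 [j h]; rewrite /prodf (bigD1 j)//= (der_step0 _ sE)// ?mul0r//.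
Qed.

Definition boxM lo hi : R := \sum_j (`|lo j| + `|hi j|).

Lemma boxM_ge lo hi j : `|lo j| + `|hi j| <= boxM lo hi.
Proof. by rewrite /boxM (bigD1 j)//= lerDl sumr_ge0// => i _; rewrite addr_ge0. Qed.

Lemma boxM_ge0 lo hi : 0 <= boxM lo hi.
Proof. by rewrite sumr_ge0// => i _; rewrite addr_ge0. Qed.

Lemma outboxM lo hi z : boxM lo hi < `|z| -> outbox lo hi z.
Proof.
move=> Mz; apply: contrapT => nz.
have : `|z| <= boxM lo hi.
  apply/(normV_leP _ (boxM_ge0 lo hi)) => j; apply: le_trans (boxM_ge lo hi j).
  have h1 : lo j <= z ord0 j by rewrite leNgt; apply/negP => h; apply: nz; exists j; left.
  have h2 : z ord0 j <= hi j by rewrite leNgt; apply/negP => h; apply: nz; exists j; right.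
  have := ler_norm (hi j); have := ler_norm (- lo j); rewrite normrN.
  by rewrite ler_norml; have := normr_ge0 (lo j); have := normr_ge0 (hi j); move=> ? ? ? ?; lra.
by rewrite leNgt Mz.
Qed.

Lemma stepfuns_aff lo hi E (e : R) x : 0 < e -> stepfuns lo hi E ->
  stepfuns (fun j => x ord0 j + e * lo j) (fun j => x ord0 j + e * hi j) (aff e x E).
Proof.
move=> e0 [cE sE]; split; first exact: cinfs_aff.
move=> j t; rewrite /aff; split=> h; [apply: (sE j _).1|apply: (sE j _).2].
  by rewrite mulrC ler_pdivrMr//; rewrite mulrC lerBlDl.
by rewrite mulrC ler_pdivlMr//; rewrite mulrC lerBrDl.
Qed.

(* The kernels built on E and F differ by the sum over i of the derivatives along
   the axis i of the functions built on mixf E F i. *)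
Definition mixf E F (i : 'I_n.+1) : 'I_n.+1 -> R -> R := fun j =>
  if (j < i)%N then E j else if j == i then (fun t => E j t - F j t) else F j.

(** Order 0 along i and 1 along the other axes: E i - F i itself vanishes beyond both ends, so these
    functions are supported in the box, and one derivative along i leads to [c1]. *)
Definition cmix (i : 'I_n.+1) : 'I_n.+1 -> nat := fun j => nat_of_bool (j != i).

Lemma cS_cmix i : cS (cmix i) i = c1.
Proof. by apply/funext => j; rewrite /cS /cmix /c1; case: (j == i). Qed.

Lemma cinfs_mix lo hi E F i : stepfuns lo hi E -> stepfuns lo hi F -> cinfs (mixf E F i).
Proof.
move=> [cE _] [cF _] j; rewrite /mixf; case: ifP => // _; case: ifP => // _.
exact: (derB (cE j) (cF j)).1.
Qed.

Lemma prodf_mix lo hi E F z : stepfuns lo hi E -> stepfuns lo hi F ->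
  prodf E c1 z - prodf F c1 z = \sum_i prodf (mixf E F i) c1 z.
Proof.
move=> [cE _] [cF _]; rewrite /prodf telescope_prod; apply: eq_bigr => i _.
apply: eq_bigr => j _; rewrite /mixf; case: ifP => // _; case: ifP => // _.
by rewrite [in RHS](derB (cE j) (cF j)).2.
Qed.

Lemma prodf_mix0 lo hi E F i z : stepfuns lo hi E -> stepfuns lo hi F ->
  outbox lo hi z -> prodf (mixf E F i) (cmix i) z = 0.
Proof.
move=> sE sF [j h]; rewrite /prodf (bigD1 j)//= /mixf /cmix.
case: (ltngtP j i) => ji.
- have -> : (j != i) by rewrite -val_eqE/= (ltn_eqF ji).
  by rewrite (der_step0 _ sE)// mul0r.
- have -> : (j == i) = false by rewrite -val_eqE/= (gtn_eqF ji).
  by rewrite (der_step0 _ sF)// mul0r.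
- rewrite -val_eqE/= ji eqxx/=; case: h => h.
    by rewrite (sE.2 j _).1 ?(ltW h)// (sF.2 j _).1 ?(ltW h)// subrr mul0r.
  by rewrite (sE.2 j _).2 ?(ltW h)// (sF.2 j _).2 ?(ltW h)// subrr mul0r.
Qed.

Lemma prodf_mix0M lo hi E F i z : stepfuns lo hi E -> stepfuns lo hi F ->
  boxM lo hi < `|z| -> prodf (mixf E F i) (cmix i) z = 0.
Proof. by move=> sE sF /outboxM; exact: prodf_mix0. Qed.

Lemma prodf_step0M lo hi E c z : stepfuns lo hi E -> (forall j, (0 < c j)%N) ->
  boxM lo hi < `|z| -> prodf E c z = 0.
Proof. by move=> sE c0 /outboxM; exact: prodf_step0. Qed.

Lemma integrable_prodf lo hi E c : stepfuns lo hi E -> (forall j, (0 < c j)%N) ->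
  mu.-integrable [set: L] (EFin \o prodf E c).
Proof.
move=> sE c0; apply: (integrable_Cc (M := boxM lo hi)).
  by apply: cont_prodf; case: sE.
by move=> z; exact: prodf_step0M.
Qed.

(** The difference of the two kernels is a divergence of functions supported in the box. *)
Lemma integral_prodf_eq lo hi E F : stepfuns lo hi E -> stepfuns lo hi F ->
  \int[mu]_y prodf E c1 y = \int[mu]_y prodf F c1 y.
Proof.
move=> sE sF; apply/eqP; rewrite -subr_eq0 -RintegralB//; [|exact: integrable_prodf sE _|exact: integrable_prodf sF _].
have -> : (fun y => prodf E c1 y - prodf F c1 y) = (fun y => \sum_i prodf (mixf E F i) c1 y).
  by apply/funext => y; exact: (prodf_mix y sE sF).
have cm i := cinfs_mix i sE sF.
have dm i x : is_derive x (e_ i) (prodf (mixf E F i) (cmix i)) (prodf (mixf E F i) c1 x).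
  by rewrite -(cS_cmix i); exact: drv_prodf.
have [_ ->//] := integral_div0 (fun i => cont_prodf (cm i)) (fun i => cont_prodf (cm i)) dm
  (fun i x => @prodf_mix0M lo hi E F i x sE sF).
Qed.

Lemma stepfuns_widen lo hi lo' hi' E : (forall j, lo' j <= lo j) -> (forall j, hi j <= hi' j) ->
  stepfuns lo hi E -> stepfuns lo' hi' E.
Proof.
move=> hl hh [cE sE]; split=> // j t; split=> h.
  exact: (sE j t).1 (le_trans h (hl j)).
exact: (sE j t).2 (le_trans (hh j) h).
Qed.

Definition step_mass : R := \int[mu]_y prodf (fun=> @step R) c1 y.

Lemma stepfuns_step : stepfuns (fun=> 0) (fun=> 1) (fun=> @step R).
Proof.
split; first by move=> j; exact: cinf_step.
by move=> j t; split; [exact: step0|exact: step1].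
Qed.

Lemma integral_prodf lo hi E : stepfuns lo hi E -> \int[mu]_y prodf E c1 y = step_mass.
Proof.
move=> sE; apply: (@integral_prodf_eq (fun j => Num.min (lo j) 0) (fun j => Num.max (hi j) 1)).
  by apply: stepfuns_widen sE => j; rewrite ?ge_min ?le_max lexx.
by apply: stepfuns_widen stepfuns_step => j; rewrite ?ge_min ?le_max lexx orbT.
Qed.

Lemma der1_step : der 1 (@step R) = @dstep R.
Proof. by apply: der1 => t; exact: is_derive_step. Qed.

Lemma step_mass_gt0 : (forall A : set V, open A -> A !=set0 -> (0 < mu A)%E) ->
  0 < step_mass.
Proof.
move=> mu_pos; have [t t01 t0] := @dstep_pos R.
have sE := stepfuns_step.
apply: (Rintegral_cont_gt0 mu_pos (M := boxM (fun=> 0) (fun=> 1)) (x0 := const_mx t)).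
- by apply: cont_prodf; case: sE.
- by move=> x; apply: prodr_ge0 => j _; rewrite /c1 der1_step dstep_ge0.
- by move=> z; exact: prodf_step0M.
- by apply: prodr_gt0 => j _; rewrite /c1 der1_step mxE.
Qed.

(** The L^1 norm of the kernel, invariant under translation and dilation; it takes the place of the
    mass in estimates, since kernels may change sign. *)
Definition step_norm E : R := \int[mu]_y `|prodf E c1 y|.

Lemma step_norm_ge0 E : 0 <= step_norm E.
Proof. by apply: Rintegral_ge0. Qed.

Lemma sum_c1 : (\sum_j c1 j = n.+1)%N.
Proof. by rewrite sum_nat_const card_ord muln1. Qed.

Lemma step_norm_aff lo hi E (e : R) x : 0 < e -> stepfuns lo hi E ->
  step_norm (aff e x E) = step_norm E.
Proof.
move=> e0 sE; rewrite /step_norm.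
have iE : mu.-integrable [set: L] (EFin \o (fun y => `|prodf E c1 y|)).
  exact: (integrable_norm (integrable_prodf sE _)).
have e1 : 0 < e^-1 by rewrite invr_gt0.
have -> : (fun y => `|prodf (aff e x E) c1 y|) =
   (fun y => e^-1 ^+ n.+1 * `|prodf E c1 (- (e^-1 *: x) + e^-1 *: y)|).
  apply/funext => y; rewrite prodf_aff; last by case: sE.
  by rewrite sum_c1 normrM ger0_norm ?exprn_ge0 ?ltW// scalerBr addrC.
rewrite RintegralZl//; last exact: (integrable_affineN _ e1 iE).
by rewrite (Rintegral_affineN _ e1 iE) mulrA divff ?mul1r// gt_eqF// exprn_gt0.
Qed.

Lemma mo_dist lo hi E (u : V -> R) (e : R) x (a d : R) :
  mu.-integrable [set: L] (EFin \o u) -> 0 < e -> stepfuns lo hi E ->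
  (forall z, ~ outbox lo hi z -> `|u (x + e *: z) - a| <= d) ->
  `|mo u e E c1 x - step_mass * a| <= d * step_norm E.
Proof.
move=> iu e0 sE ua.
have sA := stepfuns_aff x e0 sE.
have iA : mu.-integrable [set: L] (EFin \o prodf (aff e x E) c1) by exact: integrable_prodf sA _.
have cE : cinfs E by case: sE.
have iuA := integrable_mo e iu x cE (fun z => prodf_step0M (c := c1) sE (fun=> isT)).
have iB : mu.-integrable [set: L] (EFin \o (fun y => a * prodf (aff e x E) c1 y)).
  exact: integrable_scale.
rewrite /mo -(integral_prodf sA) [_ * a]mulrC -RintegralZl// -RintegralB//.
apply: le_trans (le_normr_Rintegral _ _) _ => //.
  exact: (integrable_subf measurableT iuA iB).
rewrite -(step_norm_aff x e0 sE) /step_norm -RintegralZl//; last exact: (integrable_norm iA).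
apply: le_Rintegral => //.
- exact: (integrable_norm (integrable_subf measurableT iuA iB)).
- by apply: (integrable_scale d (f := fun y => `|prodf (aff e x E) c1 y|)) => //; exact: (integrable_norm iA).
move=> y _; rewrite -mulrBl normrM.
have [out|nout] := pselect (outbox lo hi (e^-1 *: (y - x))).
  by rewrite prodf_aff// (prodf_step0 sE)// mulr0 normr0 !mulr0.
apply: ler_wpM2r => //; have := ua _ nout.
by rewrite scalerA divff ?gt_eqF// scale1r addrCA subrr addr0.
Qed.

End step_kernels.

(** * The pointwise estimate for weak solutions *)

Section weak_sup_estimate.
Context {R : realType} {n : nat}.
Local Notation V := ('rV[R]_n.+1).
Local Notation L := (lebesgue_space R n).
Local Notation mu := (lebesgueN R n).
Local Notation e_ i := (delta_mx ord0 i : V).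
Local Notation N := (n.+1%:R : R).
Local Notation M0 := (@step_mass R n).
Implicit Types (x y z : V) (c : 'I_n.+1 -> nat).

Lemma sqZ (a : R) x : sq (a *: x) = a ^+ 2 * sq x.
Proof. by rewrite /sq mulr_sumr; apply: eq_bigr => i _; rewrite !mxE; ring. Qed.

Lemma sq_eq0 x : sq x <= 0 -> x = 0.
Proof.
move=> x0; apply/eqP; rewrite -normr_eq0 -sqrf_eq0 eq_le sqr_ge0 andbT.
exact: le_trans (normV_sq x) x0.
Qed.

(** The triangle inequality of the Euclidean norm in squared form; the cross term is bounded through
    the squares (b x_i - a y_i)^2. *)
Lemma sq_add_le x y (a b : R) : 0 <= a -> 0 <= b -> sq x <= a ^+ 2 -> sq y <= b ^+ 2 ->
  sq (x + y) <= (a + b) ^+ 2.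
Proof.
rewrite le_eqVlt => /predU1P[<- _|a0].
  by rewrite expr0n => /sq_eq0 ->; rewrite !add0r.
rewrite le_eqVlt => /predU1P[<- xa|b0 xa yb].
  by rewrite expr0n => /sq_eq0 ->; rewrite !addr0.
pose d := \sum_i x ord0 i * y ord0 i.
have E : sq (x + y) = sq x + 2 * d + sq y.
  rewrite /sq /d mulr_sumr -!big_split; apply: eq_bigr => i _ /=; rewrite !mxE; ring.
have D : 2 * (a * b) * d <= b ^+ 2 * sq x + a ^+ 2 * sq y.
  rewrite /sq /d !mulr_sumr -big_split; apply: ler_sum => i _ /=; rewrite -subr_ge0.
  by rewrite (_ : _ - _ = (b * x ord0 i - a * y ord0 i) ^+ 2) ?sqr_ge0//; ring.
have ab : 0 < a * b by rewrite mulr_gt0.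
have dab : d <= a * b.
  rewrite -(ler_pM2l ab).
  have h1 : b ^+ 2 * sq x <= b ^+ 2 * a ^+ 2 by rewrite ler_wpM2l// sqr_ge0.
  have h2 : a ^+ 2 * sq y <= a ^+ 2 * b ^+ 2 by rewrite ler_wpM2l// sqr_ge0.
  have e1 : b ^+ 2 * a ^+ 2 = a * b * (a * b) by ring.
  have e2 : a ^+ 2 * b ^+ 2 = a * b * (a * b) by ring.
  rewrite e1 in h1; rewrite e2 in h2; rewrite -mulrA in D.
  by move: (a * b * d) (a * b * (a * b)) D h1 h2 => p q; lra.
by rewrite E sqrrD -mulr_natl; lra.
Qed.

(** The step rescaled to [-1, 1]; its kernel is nonnegative and lives on the closed unit cube. *)
Definition bumpf : 'I_n.+1 -> R -> R := fun _ t => step (2^-1 * t + 2^-1).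

Lemma stepfuns_bumpf : stepfuns (fun=> -1) (fun=> 1) bumpf.
Proof.
split=> [j|j t]; first exact: cinf_affine cinf_step.
by split=> h; [apply: step0|apply: step1]; lra.
Qed.

Lemma bumpf_ge0 x : 0 <= prodf bumpf c1 x.
Proof.
apply: prodr_ge0 => j _; rewrite /c1 /bumpf der_affine; last exact: cinf_step.
by rewrite der1_step mulr_ge0// ?dstep_ge0// expr1 invr_ge0.
Qed.

Lemma step_norm_bumpf : @step_norm R n bumpf = M0.
Proof.
rewrite -(integral_prodf stepfuns_bumpf) /step_norm.
by apply: eq_Rintegral => x _; rewrite ger0_norm// bumpf_ge0.
Qed.

Lemma nout1 z : ~ outbox (fun=> -1) (fun=> 1) z -> `|z| <= 1.
Proof.
move=> h; apply/normV_leP => // j; rewrite ler_norml; apply/andP; split; rewrite leNgt;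
  apply/negP => k; apply: h; exists j; by [left|right].
Qed.

Lemma mo_eq0 (u : V -> R) (e : R) c x : 0 < e -> (forall j, (0 < c j)%N) ->
  (forall z, `|z| <= 1 -> u (x + e *: z) = 0) -> mo u e bumpf c x = 0.
Proof.
move=> e0 c0 h; rewrite /mo /Rintegral (@eq_integral _ _ _ _ _ (cst 0%E)) ?integral0// => y _.
congr EFin => /=.
have sA := stepfuns_aff x e0 stepfuns_bumpf.
have [ob|nb] := pselect (outbox (fun=> -1) (fun=> 1) (e^-1 *: (y - x))).
  rewrite prodf_aff; last by case: stepfuns_bumpf.
  by rewrite (prodf_step0 stepfuns_bumpf)// !mulr0.
have := h _ (nout1 nb); rewrite scalerA divff ?gt_eqF// scale1r addrCA subrr addr0.
by move=> ->; rewrite mul0r.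
Qed.

(* Lap u = F in W, tested only against the translates and dilates of one bump. *)
Definition weak_eq (W : set V) (u F : V -> R) := forall x (e : R), 0 < e ->
  (forall z, `|z| <= 1 -> W (x + e *: z)) ->
  \sum_i mo u e bumpf (cS (cS c1 i) i) x = mo F e bumpf c1 x.

(** A cube of half-side [e] lies in a Euclidean ball of radius N e around its centre. Once the
    centre is pulled to (1 - N e) y, the cube reaches at most to (1 - N e) |y| + N e, an average of
    |y| and 1. *)
Lemma sq_contract (e : R) y z : 0 < e -> N * e < 1 -> `|z| <= 1 ->
  (sq y < 1 -> sq ((1 - N * e) *: y + e *: z) < 1) /\
  (1 <= sq y -> sq ((1 - N * e) *: y + e *: z) <= sq y).
Proof.
move=> e0 Ne z1.
pose t := Num.sqrt (sq y); have t0 : 0 <= t := sqrtr_ge0 _.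
have tt : t ^+ 2 = sq y by rewrite sqr_sqrtr// sq_ge0.
have N1 : 1 <= N by rewrite ler1n.
have l0' : 0 < 1 - N * e by lra.
have l0 := ltW l0'.
have h1 : sq ((1 - N * e) *: y) <= ((1 - N * e) * t) ^+ 2 by rewrite sqZ exprMn tt.
have h2 : sq (e *: z) <= (N * e) ^+ 2.
  rewrite sqZ exprMn mulrC ler_wpM2r ?sqr_ge0//; apply: le_trans (sq_normV z) _.
  by rewrite [leRHS]expr2 ler_wpM2l//; apply: le_trans N1; rewrite expr_le1.
have ne0 : 0 <= N * e by rewrite mulr_ge0// ltW.
have := sq_add_le (mulr_ge0 l0 t0) ne0 h1 h2.
move: (sq (_ + _)) => Q hQ; rewrite -tt.
have n0 : 0 < N * e by rewrite mulr_gt0// (lt_le_trans ltr01).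
split=> ht.
  have t1 : t < 1 by rewrite -(@ltr_pXn2r _ 2) ?nnegrE// expr1n.
  apply: le_lt_trans hQ _; rewrite expr_lt1//; last by rewrite addr_ge0// mulr_ge0.
  have : 0 < (1 - N * e) * (1 - t) by rewrite mulr_gt0//; lra.
  lra.
have t1 : 1 <= t by rewrite -(@ler_pXn2r _ 2) ?nnegrE// expr1n.
apply: le_trans hQ _; rewrite ler_pXn2r ?nnegrE//; last by rewrite addr_ge0// mulr_ge0.
have : 0 <= N * e * (t - 1) by rewrite mulr_ge0//; lra.
lra.
Qed.

Lemma sqr_le_norm (a b : R) : 0 <= b -> a ^+ 2 <= b -> `|a| <= Num.sqrt b.
Proof. by move=> b0 ab; rewrite -sqrtr_sqr ler_wsqrtr. Qed.

Lemma norm_sqr_le (a b : R) : 0 <= b -> `|a| <= Num.sqrt b -> a ^+ 2 <= b.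
Proof.
move=> b0 ab; rewrite -(sqr_sqrtr b0) -(real_normK (num_real a)).
by rewrite ler_pXn2r ?nnegrE// sqrtr_ge0.
Qed.

Hypothesis mu_pos : forall A : set V, open A -> A !=set0 -> (0 < mu A)%E.

Lemma mo_bound (u : V -> R) (e b : R) x : mu.-integrable [set: L] (EFin \o u) -> 0 < e ->
  0 <= b -> (forall z, `|z| <= 1 -> u (x + e *: z) ^+ 2 <= b) ->
  (M0^-1 * mo u e bumpf c1 x) ^+ 2 <= b.
Proof.
move=> iu e0 b0 h; have c0 := step_mass_gt0 mu_pos.
have := @mo_dist _ _ _ _ _ u e x 0 (Num.sqrt b) iu e0 stepfuns_bumpf.
rewrite mulr0 subr0 step_norm_bumpf => H.
apply: norm_sqr_le => //; rewrite normrM gtr0_norm ?invr_gt0// ler_pdivrMl// mulrC.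
by apply: H => z /nout1 z1; rewrite subr0; apply: sqr_le_norm => //; exact: h.
Qed.

(** [sup_estimate] is applied to the normalised mollification of [u] composed with the contraction
    by 1 - N e. The contraction makes it vanish on the unit ball, and the bounds on [u] and [F] pass
    to it because only points no farther from the origin are averaged. Continuity of [u] allows e to
    tend to 0. *)
Lemma weak_sup_estimate : exists2 C0 : R, 0 < C0 &
  forall (W : set V) (u F : V -> R), (forall x, sq x <= 16 -> W x) ->
  mu.-integrable [set: L] (EFin \o u) -> mu.-integrable [set: L] (EFin \o F) ->
  weak_eq W u F -> (forall x, sq x <= 16 -> {for x, continuous u}) ->
  (forall x, sq x < 1 -> u x = 0) ->
  forall (r g : R) (k : nat) (S A B : R), (0 < k)%N -> 1 <= r -> 0 < g -> r + g <= 4 ->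
    0 <= S -> 0 <= A -> 0 <= B ->
  (forall x, sq x <= (r + g) ^+ 2 -> F x ^+ 2 <= S * sq x ^+ k) ->
  (forall x, sq x <= (r + g) ^+ 2 -> u x ^+ 2 <= A) ->
  (forall x, sq x <= (r + g) ^+ 2 -> F x ^+ 2 <= B) ->
  forall x, sq x <= r ^+ 2 ->
  u x ^+ 2 <= C0 * (k%:R / g) ^+ (n.+1 + 4) *
    (S + (A + B) / ((r + g / 4) ^+ 2) ^+ k) * sq x ^+ k.
Proof.
have [C0 C00 est] := @sup_estimate R n mu_pos.
have c0 := step_mass_gt0 mu_pos.
have N1 : 1 <= N by rewrite ler1n.
exists C0 => // W u F W16 iu iF we cu u0 r g k S A B k0 r1 g0 rg4 S0 A0 B0 hS hA hB x xr.
set K := C0 * _ * _ * _.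
have rg16 : (r + g) ^+ 2 <= 16.
  have h : (r + g) ^+ 2 <= 4 ^+ 2 by rewrite ler_pXn2r ?nnegrE//; lra.
  by apply: le_trans h _; rewrite -natrX ler_nat.
have K0 : 0 <= K.
  rewrite /K mulr_ge0 ?exprn_ge0 ?sq_ge0// mulr_ge0//.
    by rewrite mulr_ge0 ?(ltW C00)// exprn_ge0// divr_ge0// ltW.
  by rewrite addr_ge0// divr_ge0 ?addr_ge0// exprn_ge0// sqr_ge0.
apply: norm_sqr_le => //; apply/ler_addgt0Pr => eta eta0.
have x16 : sq x <= 16.
  apply: le_trans xr (le_trans _ rg16).
  by rewrite ler_pXn2r ?nnegrE//; lra.
have /(@cvgrPdist_le R R^o V (nbhs x) _ u (u x)) /(_ _ eta0) := cu x x16.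
move=> /nbhs_ballP[d /= d0 hd].
(* The first bound gives N e < 1. The second puts the points l x + e z with |z| <= 1 within [d] of
   [x], as x - (l x + e z) = e (N x - z). *)
pose e := Num.min ((2 * N)^-1) (d / (2 * (N * `|x| + 1))).
have den : 0 < N * `|x| + 1 by rewrite ltr_wpDl// mulr_ge0.
have e0 : 0 < e by rewrite lt_min invr_gt0 mulr_gt0// divr_gt0// mulr_gt0.
have Ne : N * e < 1.
  have : e <= (2 * N)^-1 by rewrite ge_min lexx.
  rewrite -div1r ler_pdivlMr ?mulr_gt0//; lra.
have ed : e * (N * `|x| + 1) < d.
  have : e <= d / (2 * (N * `|x| + 1)) by rewrite ge_min lexx orbT.
  rewrite ler_pdivlMr ?mulr_gt0// => h.
  have := mulr_gt0 e0 den; lra.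
pose l := 1 - N * e.
have l0 : 0 <= l by rewrite /l; lra.
have l1 : l <= 1 by rewrite /l gerBl mulr_ge0// ltW.
have sB := stepfuns_bumpf; have cB : cinfs bumpf by case: sB.
have hC2 := C2data_affine 0 l (C2data_mo e iu cB (fun z => prodf_step0M (c := c1) sB (fun=> isT))).
have kC2 : C2data (fun _ : V => M0^-1 : R) (fun _ _ => 0) (fun _ _ _ => 0).
  split=> //; [exact: contC|by move=> i; exact: contC|by move=> i j; exact: contC|].
  by split=> [i y|i j y]; exact: drvC.
have := est _ _ _ (C2data_mul kC2 hC2) _ r g k S A B k0 r1 g0 rg4 S0 A0 B0 _ _ _ x xr.
rewrite -/K.
have lapE y : \sum_i ((0 : R) * mo u e bumpf c1 (0 + l *: y) + 0 * (l * - mo u e bumpf (cS c1 i) (0 + l *: y))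
   + (0 * (l * - mo u e bumpf (cS c1 i) (0 + l *: y)) + M0^-1 * (l ^+ 2 * mo u e bumpf (cS (cS c1 i) i) (0 + l *: y))))
   = l ^+ 2 * (M0^-1 * \sum_i mo u e bumpf (cS (cS c1 i) i) (l *: y)).
  rewrite !mulr_sumr; apply: eq_bigr => i _; by rewrite !mul0r !add0r mulrCA.
(* In the unit ball the Laplacian of the mollification vanishes because [u] does; the equation
   enters only for sq y >= 1. *)
have lap0 y : sq y < 1 -> \sum_i mo u e bumpf (cS (cS c1 i) i) (l *: y) = 0.
  move=> y1; rewrite big1// => i _; apply: mo_eq0 => // z z1; apply: u0.
  exact: (sq_contract y e0 Ne z1).1.
have lap1 y : 1 <= sq y -> sq y <= (r + g) ^+ 2 ->
    \sum_i mo u e bumpf (cS (cS c1 i) i) (l *: y) = mo F e bumpf c1 (l *: y).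
  move=> y1 yr; apply: we => // z z1; apply: W16; apply: le_trans rg16.
  by apply: le_trans yr; exact: (sq_contract y e0 Ne z1).2.
have l2 (t b : R) : t ^+ 2 <= b -> (l ^+ 2 * t) ^+ 2 <= b.
  move=> tb; apply: le_trans tb; rewrite exprMn -[leRHS]mul1r ler_wpM2r ?sqr_ge0//.
  by rewrite exprn_ile1 ?sqr_ge0// exprn_ile1.
have lapb (b : R) y : sq y <= (r + g) ^+ 2 -> 0 <= b -> (1 <= sq y -> forall z, `|z| <= 1 -> F (l *: y + e *: z) ^+ 2 <= b) ->
    (l ^+ 2 * (M0^-1 * \sum_i mo u e bumpf (cS (cS c1 i) i) (l *: y))) ^+ 2 <= b.
  move=> yr b0 hb; apply: l2; have [y1|y1] := ltP (sq y) 1.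
    by rewrite lap0// mulr0 expr0n.
  by rewrite lap1//; apply: mo_bound => //; exact: hb.
move=> H; have {}H : (M0^-1 * mo u e bumpf c1 (l *: x)) ^+ 2 <= K.
  rewrite -[l *: x]add0r; apply: H.
  - move=> y y1; rewrite add0r mo_eq0 ?mulr0// => z z1; apply: u0.
    exact: (sq_contract y e0 Ne z1).1.
  - move=> y yr; rewrite lapE; apply: lapb => //.
      by rewrite mulr_ge0// exprn_ge0// sq_ge0.
    move=> y1 z z1; have h := (sq_contract y e0 Ne z1).2 y1.
    apply: le_trans (hS _ (le_trans h yr)) _; rewrite ler_wpM2l//.
    by apply: lerXn2r (h); rewrite nnegrE sq_ge0.
  - move=> y yr; rewrite add0r; apply: mo_bound => // z z1.
    have [y1|y1] := ltP (sq y) 1.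
      by rewrite u0 ?expr0n//; exact: (sq_contract y e0 Ne z1).1.
    by apply: hA; apply: le_trans yr; exact: (sq_contract y e0 Ne z1).2.
  - move=> y yr; rewrite lapE; apply: lapb => // y1 z z1.
    by apply: hB; apply: le_trans yr; exact: (sq_contract y e0 Ne z1).2.
have D := @mo_dist _ _ _ _ _ u e (l *: x) (u x) eta iu e0 sB.
have {}D : `|mo u e bumpf c1 (l *: x) - M0 * u x| <= eta * M0.
  rewrite step_norm_bumpf in D; apply: D => z /nout1 z1; rewrite distrC; apply: hd.
  rewrite -ball_normE /=.
  rewrite (_ : x - (l *: x + e *: z) = e *: (N *: x - z)); last first.
    by rewrite /l scalerBl scale1r scalerBr scalerA [N * e]mulrC opprD addrA opprB addrCA subrr addr0.
  rewrite normrZ gtr0_norm//; apply: le_lt_trans ed; rewrite ler_wpM2l ?(ltW e0)//.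
  by apply: le_trans (ler_normB _ _) _; rewrite normrZ ger0_norm// lerD2l.
have hm : `|M0^-1 * mo u e bumpf c1 (l *: x) - u x| <= eta.
  rewrite -[X in _ - X](mulKf (lt0r_neq0 c0)) -mulrBr normrM gtr0_norm ?invr_gt0//.
  by rewrite ler_pdivrMl// [M0 * eta]mulrC.
have := sqr_le_norm K0 H; move: (M0^-1 * _) hm => h hm hK.
have -> : u x = h - (h - u x) by rewrite opprB addrCA subrr addr0.
by apply: le_trans (ler_normB _ _) _; exact: lerD.
Qed.

End weak_sup_estimate.

(** * Unique continuation *)

Section absorption.
Context {R : realType} {n : nat}.
Local Notation V := ('rV[R]_n.+1).
Local Notation L := (lebesgue_space R n).
Local Notation mu := (lebesgueN R n).
Local Notation M := (n.+1 + 4)%N.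
Implicit Types (x y z : V) (W : set V) (u v F : V -> R).

Lemma half_expn_le (a : R) : 0 < a -> exists i : nat, 2^-1 ^+ i <= a.
Proof.
move=> a0; have [i hi] : exists i : nat, a^-1 <= i%:R.
  by exists (Num.bound a^-1); apply: ltW; apply: archi_boundP; rewrite invr_ge0 ltW.
exists i; rewrite exprVn invf_ple ?posrE ?exprn_gt0//; apply: le_trans hi _.
by rewrite -natrX ler_nat ltnW// ltn_expl.
Qed.

Lemma bernoulli_inv (t : R) m : 0 <= t -> t <= 1 -> (1 - t) ^+ m * (1 + m%:R * t) <= 1.
Proof.
move=> t0 t1; elim: m => [|m IH]; first by rewrite expr0 mul0r addr0 mulr1.
apply: le_trans IH; rewrite exprSr -mulrA ler_wpM2l//; first by rewrite exprn_ge0//; lra.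
have m0 : 0 <= m%:R :> R by [].
have : 0 <= m%:R * (t * t) by rewrite mulr_ge0// mulr_ge0.
have := mulr_ge0 t0 t0; rewrite -natr1; move: (m%:R) m0 => p p0; nra.
Qed.

Variable C0 : R.
Hypothesis C00 : 0 < C0.
Hypothesis est : forall W u F, (forall x, sq x <= 16 -> W x) ->
  mu.-integrable [set: L] (EFin \o u) -> mu.-integrable [set: L] (EFin \o F) ->
  weak_eq W u F -> (forall x, sq x <= 16 -> {for x, continuous u}) ->
  (forall x, sq x < 1 -> u x = 0) ->
  forall (r g : R) (k : nat) (S A B : R), (0 < k)%N -> 1 <= r -> 0 < g -> r + g <= 4 ->
    0 <= S -> 0 <= A -> 0 <= B ->
  (forall x, sq x <= (r + g) ^+ 2 -> F x ^+ 2 <= S * sq x ^+ k) ->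
  (forall x, sq x <= (r + g) ^+ 2 -> u x ^+ 2 <= A) ->
  (forall x, sq x <= (r + g) ^+ 2 -> F x ^+ 2 <= B) ->
  forall x, sq x <= r ^+ 2 ->
  u x ^+ 2 <= C0 * (k%:R / g) ^+ M * (S + (A + B) / ((r + g / 4) ^+ 2) ^+ k) * sq x ^+ k.

(** The estimate is used with k = b t, so that |x|^(2k) is the b-th power of |x|^(2t). The
    contribution of the equation carries the small factor [al], which outweighs the loss [G] with
    2^(b+1) to spare and lets the multiplier [th] be halved. The bounds on the larger ball impose
    the floor (1 + 2 G (1 + C2)) a / r^(2t). *)
Lemma absorb_one W u F (r g G C2 al a th th' : R) (b t : nat) :
  (forall x, sq x <= 16 -> W x) ->
  mu.-integrable [set: L] (EFin \o u) -> mu.-integrable [set: L] (EFin \o F) ->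
  weak_eq W u F -> (forall x, sq x <= 16 -> {for x, continuous u}) ->
  (forall x, sq x < 1 -> u x = 0) ->
  (0 < b)%N -> (0 < t)%N -> 1 <= r -> 0 < g -> r + g <= 4 ->
  0 <= C2 -> 0 <= al -> 0 <= a -> 0 <= th ->
  C0 * ((b * t)%:R / g) ^+ M <= G -> G * C2 * al * 2 ^+ b.+1 <= 1 ->
  (forall x, sq x <= (r + g) ^+ 2 -> F x ^+ 2 <= C2 * al * (th * sq x ^+ t) ^+ b) ->
  (forall x, sq x <= (r + g) ^+ 2 -> u x ^+ 2 <= a ^+ b) ->
  (forall x, sq x <= (r + g) ^+ 2 -> F x ^+ 2 <= C2 * a ^+ b) ->
  th / 2 <= th' -> (1 + 2 * G * (1 + C2)) * a / (r ^+ 2) ^+ t <= th' ->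
  forall x, sq x <= r ^+ 2 -> u x ^+ 2 <= (th' * sq x ^+ t) ^+ b.
Proof.
move=> W16 iu iF we cu u0 b0 t0 r1 g0 rg4 C20 al0 a0 th0 hG sm hF hu hF2 th2 tha x xr.
have bt0 : (0 < b * t)%N by rewrite muln_gt0 b0.
have S0 : 0 <= C2 * al * th ^+ b by rewrite mulr_ge0 ?exprn_ge0// mulr_ge0.
have A0 : 0 <= a ^+ b by rewrite exprn_ge0.
have B0 : 0 <= C2 * a ^+ b by rewrite mulr_ge0.
have hS y : sq y <= (r + g) ^+ 2 -> F y ^+ 2 <= C2 * al * th ^+ b * sq y ^+ (b * t).
  by move=> /hF; rewrite exprMn -exprM [(t * b)%N]mulnC mulrA.
have := est W16 iu iF we cu u0 bt0 r1 g0 rg4 S0 A0 B0 hS hu hF2 xr.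
move=> h; apply: le_trans h _.
have -> : (th' * sq x ^+ t) ^+ b = th' ^+ b * sq x ^+ (b * t) by rewrite exprMn -exprM [(t * b)%N]mulnC.
apply: ler_wpM2r; first by rewrite exprn_ge0// sq_ge0.
have r0 : 0 < r by lra.
have rt0 : 0 < (r ^+ 2) ^+ t by rewrite !exprn_gt0.
set L0 := 1 + 2 * G * (1 + C2) in tha *.
have G0 : 0 <= G.
  by apply: le_trans hG; rewrite mulr_ge0 ?(ltW C00)// exprn_ge0// divr_ge0// ltW.
have GC : 0 <= G * (1 + C2) by rewrite mulr_ge0// addr_ge0.
have L1 : 1 <= L0 by rewrite /L0; lra.
pose q := a / (r ^+ 2) ^+ t.
have q0 : 0 <= q by rewrite divr_ge0// ltW.
have Lq : L0 * q <= th' by rewrite /q mulrA.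
have th'0 : 0 <= th' by apply: le_trans th2; rewrite divr_ge0.
have h1 : (a ^+ b + C2 * a ^+ b) / ((r + g / 4) ^+ 2) ^+ (b * t) <= (1 + C2) * q ^+ b.
  rewrite -[X in X + _]mul1r -mulrDl -mulrA; apply: ler_wpM2l; first by rewrite addr_ge0.
  rewrite /q [leRHS]exprMn; apply: ler_wpM2l => //; rewrite [leRHS]exprVn -[(_ ^+ t) ^+ b]exprM [(t * b)%N]mulnC.
  rewrite lef_pV2 ?posrE; [|by rewrite !exprn_gt0//; lra|by rewrite exprn_gt0// exprn_gt0].
  by rewrite !lerXn2r ?nnegrE ?sqr_ge0//; lra.
clearbody q.
apply: (@le_trans _ _ (G * (C2 * al * th ^+ b + (1 + C2) * q ^+ b))).
  apply: ler_pM => //.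
  - by rewrite mulr_ge0 ?(ltW C00)// exprn_ge0// divr_ge0// ltW.
  - by rewrite addr_ge0// divr_ge0 ?addr_ge0// exprn_ge0// sqr_ge0.
  - by rewrite lerD2l.
(* The two contributions take half of th'^b each. *)
have e1 : G * (C2 * al * th ^+ b) <= 2^-1 * th' ^+ b.
  have h2 : (th / 2) ^+ b <= th' ^+ b by rewrite lerXn2r ?nnegrE// divr_ge0.
  apply: (@le_trans _ _ (2^-1 * (th / 2) ^+ b)); last by rewrite ler_wpM2l.
  have p2 : 0 < 2 ^+ b.+1 :> R by rewrite exprn_gt0.
  rewrite [leRHS](_ : _ = (2 ^+ b.+1)^-1 * th ^+ b); last by rewrite exprMn exprVn exprS invfM; ring.
  rewrite !mulrA; apply: ler_wpM2r; first by rewrite exprn_ge0.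
  by rewrite -[leRHS]mul1r ler_pdivlMr.
have e2 : G * ((1 + C2) * q ^+ b) <= 2^-1 * th' ^+ b.
  have h2 : (L0 * q) ^+ b <= th' ^+ b by rewrite lerXn2r ?nnegrE// mulr_ge0// (le_trans ler01).
  apply: (@le_trans _ _ (2^-1 * (L0 * q) ^+ b)); last by rewrite ler_wpM2l.
  rewrite mulrA exprMn mulrA; apply: ler_wpM2r; first by rewrite exprn_ge0.
  have : L0 <= L0 ^+ b by rewrite -[leLHS]expr1 ler_weXn2l.
  rewrite /L0; lra.
rewrite mulrDr; lra.
Qed.

Section pair.
Variables (b c e : nat) (C2 : R).
Hypothesis b0 : (0 < b)%N.
Hypothesis c0 : (0 < c)%N.
Hypothesis C20 : 0 <= C2.
Variables (W : set V) (u v F1 F2 : V -> R).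
Hypothesis W16 : forall x, sq x <= 16 -> W x.
Hypothesis iu : mu.-integrable [set: L] (EFin \o u).
Hypothesis iv : mu.-integrable [set: L] (EFin \o v).
Hypothesis iF1 : mu.-integrable [set: L] (EFin \o F1).
Hypothesis iF2 : mu.-integrable [set: L] (EFin \o F2).
Hypothesis weu : weak_eq W u F1.
Hypothesis wev : weak_eq W v F2.
Hypothesis cu : forall x, sq x <= 16 -> {for x, continuous u}.
Hypothesis cv : forall x, sq x <= 16 -> {for x, continuous v}.
Hypothesis u0 : forall x, sq x < 1 -> u x = 0.
Hypothesis v0 : forall x, sq x < 1 -> v x = 0.
(** Superlinearity with integer exponents: [y] stands for max(|u|, |v|^(1/s))^(2/b) with s = c/b,
    and [al] is the part of the surplus power of [y] that is kept as a small factor. *)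
Hypothesis growth : forall x, sq x <= 16 -> forall al y : R, 0 <= al -> al <= 1 ->
  0 <= y -> y <= al ^+ e ->
  (v x ^+ 2 <= y ^+ c -> F1 x ^+ 2 <= C2 * al * y ^+ b) /\
  (u x ^+ 2 <= y ^+ b -> F2 x ^+ 2 <= C2 * al * y ^+ c).

Let bd (rho : R) (Y : V -> R) := forall x, sq x <= rho ^+ 2 ->
  u x ^+ 2 <= Y x ^+ b /\ v x ^+ 2 <= Y x ^+ c.

(** Decay like |x|^(2t) is obtained from a constant bound: every use of the two equations halves the
    multiplier until it reaches the floor [th0], which does not depend on the number of uses. *)
Lemma absorb_step (r g al : R) (t : nat) : (0 < t)%N -> 1 <= r -> 0 < g -> r + g <= 4 ->
  0 < al -> al <= 1 -> bd (r + g) (fun=> al ^+ e) ->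
  let G := C0 * (((b + c) * t)%:R / g) ^+ M in
  G * C2 * al * 2 ^+ (b + c).+1 <= 1 ->
  bd r (fun x => (1 + 2 * G * (1 + C2)) * al ^+ e / (r ^+ 2) ^+ t * sq x ^+ t).
Proof.
move=> t0 r1 g0 rg4 al0 al1 hbd G sm.
have r0 : 0 < r by lra.
have rt0 : 0 < (r ^+ 2) ^+ t by rewrite !exprn_gt0.
set th0 := (1 + 2 * G * (1 + C2)) * al ^+ e / (r ^+ 2) ^+ t.
set a := al ^+ e in hbd th0 *.
have a0 : 0 < a by rewrite exprn_gt0.
have tg0 : 0 <= ((b + c) * t)%:R / g by rewrite divr_ge0// ltW.
have G0 : 0 <= G by rewrite mulr_ge0 ?(ltW C00)// exprn_ge0.
have GC : 0 <= G * (1 + C2) by rewrite mulr_ge0// addr_ge0.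
have L1 : 1 <= 1 + 2 * G * (1 + C2) by lra.
have th00 : 0 < th0 by rewrite divr_gt0// mulr_gt0// (lt_le_trans ltr01).
have rg16 : (r + g) ^+ 2 <= 16.
  have h : (r + g) ^+ 2 <= 4 ^+ 2 by rewrite ler_pXn2r ?nnegrE//; lra.
  by apply: le_trans h _; rewrite -natrX ler_nat.
have Gle d : (d <= b + c)%N -> C0 * ((d * t)%:R / g) ^+ M <= G.
  move=> db; rewrite ler_wpM2l ?(ltW C00)// lerXn2r ?nnegrE//.
    by rewrite divr_ge0// ltW.
  by rewrite ler_pM2r ?invr_gt0// ler_nat leq_mul2r db orbT.
have sm' d : (d <= b + c)%N -> G * C2 * al * 2 ^+ d.+1 <= 1.
  move=> db; apply: le_trans sm; apply: ler_wpM2l.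
    by apply: mulr_ge0; [exact: mulr_ge0|exact: ltW].
  by rewrite ler_weXn2l// ler1n.
(* To start, the constant [a] is below a |x|^(2t) where |x| >= 1, and both functions vanish
   elsewhere. *)
have key (i : nat) : bd r (fun x => Num.max (a * 2^-1 ^+ i) th0 * sq x ^+ t).
  elim: i => [|i IH] x xr.
    have [x1|x1] := ltP (sq x) 1.
      rewrite u0// v0// !expr0n/=.
      by split; rewrite exprn_ge0// mulr_ge0 ?exprn_ge0 ?sq_ge0// le_max (ltW th00) orbT.
    have xt : 1 <= sq x ^+ t by rewrite exprn_ege1.
    have ax : a <= Num.max (a * 2^-1 ^+ 0) th0 * sq x ^+ t.
      apply: (@le_trans _ _ (a * 1)); first by rewrite mulr1.
      by apply: ler_pM => //; [exact: ltW|rewrite expr0 mulr1 le_max lexx].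
    have xrg : sq x <= (r + g) ^+ 2.
      by apply: le_trans xr _; rewrite lerXn2r ?nnegrE//; lra.
    have [h1 h2] := hbd x xrg.
    have ax0 := le_trans (ltW a0) ax.
    by split; [apply: le_trans h1 _|apply: le_trans h2 _]; rewrite lerXn2r ?nnegrE// ltW.
  set th := Num.max (a * 2^-1 ^+ i) th0 in IH.
  set th' := Num.max (a * 2^-1 ^+ i.+1) th0.
  have thp : 0 < th by rewrite lt_max th00 orbT.
  have th2 : th / 2 <= th'.
    rewrite ler_pdivrMr// ge_max; apply/andP; split.
      have : a * 2^-1 ^+ i.+1 <= th' by rewrite le_max lexx.
      by rewrite exprSr; move: (2^-1 ^+ i) => p; lra.
    have : th0 <= th' by rewrite le_max lexx orbT.
    by have := th00; lra.
  have tha : th0 <= th' by rewrite le_max lexx orbT.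
  (* Between the radii r and r + g only the constant bound is available; it is below th |x|^(2t)
     there because [th] is at least the floor. *)
  have ath : a <= th * (r ^+ 2) ^+ t.
    rewrite -ler_pdivrMr//; apply: (@le_trans _ _ th0); last by rewrite le_max lexx orbT.
    by rewrite /th0 -mulrA ler_peMl// divr_ge0// ltW.
  have big y : sq y <= (r + g) ^+ 2 ->
      u y ^+ 2 <= (th * sq y ^+ t) ^+ b /\ v y ^+ 2 <= (th * sq y ^+ t) ^+ c.
    move=> yr; have [yr'|yr'] := leP (sq y) (r ^+ 2); first exact: IH.
    have ay : a <= th * sq y ^+ t.
      apply: le_trans ath _; rewrite ler_wpM2l ?(ltW thp)// lerXn2r ?nnegrE ?sqr_ge0 ?sq_ge0//.
      exact: ltW.
    have [h1 h2] := hbd y yr; have ay0 := le_trans (ltW a0) ay.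
    by split; [apply: le_trans h1 _|apply: le_trans h2 _]; rewrite lerXn2r ?nnegrE// ltW.
  have grow y : sq y <= (r + g) ^+ 2 ->
     [/\ F1 y ^+ 2 <= C2 * al * (th * sq y ^+ t) ^+ b, F1 y ^+ 2 <= C2 * a ^+ b,
         F2 y ^+ 2 <= C2 * al * (th * sq y ^+ t) ^+ c & F2 y ^+ 2 <= C2 * a ^+ c].
    move=> yr; have [h1 h2] := hbd y yr; have [h3 h4] := big y yr.
    have y16 := le_trans yr rg16.
    have s0 : 0 <= th * sq y ^+ t by rewrite mulr_ge0 ?(ltW thp)// exprn_ge0// sq_ge0.
    have aal d : C2 * al * a ^+ d <= C2 * a ^+ d.
      rewrite -mulrA ler_wpM2l// -[leRHS]mul1r ler_wpM2r// exprn_ge0//; exact: ltW.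
    have gr (w : R) : 0 <= w -> w <= a -> (v y ^+ 2 <= w ^+ c -> F1 y ^+ 2 <= C2 * al * w ^+ b) /\
      (u y ^+ 2 <= w ^+ b -> F2 y ^+ 2 <= C2 * al * w ^+ c).
      by move=> w0 wa; exact: (growth y16 (ltW al0) al1).
    have [g1 g2] := gr a (ltW a0) (lexx _).
    have [sa|sa] := leP (th * sq y ^+ t) a.
      have [g3 g4] := gr _ s0 sa.
      by split; [exact: g3|exact: le_trans (g1 h2) (aal _)|exact: g4|exact: le_trans (g2 h1) (aal _)].
    have mon d : C2 * al * a ^+ d <= C2 * al * (th * sq y ^+ t) ^+ d.
      rewrite ler_wpM2l ?mulr_ge0 ?(ltW al0)// lerXn2r ?nnegrE//; exact: ltW.
    by split; [exact: le_trans (g1 h2) (mon _)|exact: le_trans (g1 h2) (aal _)|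
       exact: le_trans (g2 h1) (mon _)|exact: le_trans (g2 h1) (aal _)].
  split.
    apply: (absorb_one W16 iu iF1 weu cu u0 b0 t0 r1 g0 rg4 C20 (ltW al0) (ltW a0) (ltW thp)
      (Gle b (leq_addr c b)) (sm' b (leq_addr c b)) _ _ _ th2 tha xr) => y yr.
    - by have [] := grow y yr.
    - by have [] := hbd y yr.
    - by have [] := grow y yr.
  apply: (absorb_one W16 iv iF2 wev cv v0 c0 t0 r1 g0 rg4 C20 (ltW al0) (ltW a0) (ltW thp)
      (Gle c (leq_addl b c)) (sm' c (leq_addl b c)) _ _ _ th2 tha xr) => y yr.
  - by have [] := grow y yr.
  - by have [] := hbd y yr.
  - by have [] := grow y yr.
have [i hi] := half_expn_le (divr_gt0 th00 a0).
have mi : Num.max (a * 2^-1 ^+ i) th0 = th0.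
  by apply/max_idPr; rewrite mulrC -ler_pdivlMr.
by move=> x xr; have := key i x xr; rewrite mi.
Qed.

(** The radii are 2 + 2 2^-j, with gaps g = 2^-j / 2, and t is proportional to 8^j. Then k/g grows
    like 16^j and the loss like K^j, which the factor K^-j inside [al] compensates exactly. On the
    ball of radius r - g the gain (|x|/r)^(2t) absorbs the loss and divides [al] by K once more,
    provided [T] is large. *)
Lemma absorb_iterate (al0 : R) (T : nat) : (0 < e)%N -> 0 < al0 -> al0 <= 1 ->
  let m' := (2 * M)%N in let D1 := C0 * (2 * (b + c) * m')%:R ^+ M in
  let D2 := 1 + 2 * D1 * (1 + C2) in let K : R := 16 ^+ M in
  D2 * K ^+ e.+1 <= T%:R -> D1 * T%:R ^+ M * C2 * al0 * 2 ^+ (b + c).+1 <= 1 ->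
  bd 4 (fun=> al0 ^+ e) ->
  forall j : nat, bd (2 + 2 * 2^-1 ^+ j) (fun=> (al0 * K^-1 ^+ j) ^+ e).
Proof.
move=> e0 al00 al01 m' D1 D2 K hT hal h4.
have K1 : 1 <= K by rewrite exprn_ege1// ler1n.
have K0 : 0 < K by exact: lt_le_trans K1.
have D10 : 0 <= D1 by rewrite mulr_ge0 ?(ltW C00)// exprn_ge0.
have DC : 0 <= D1 * (1 + C2) by rewrite mulr_ge0// addr_ge0.
have D21 : 1 <= D2 by rewrite /D2; lra.
have T1 : 1 <= T%:R :> R.
  by apply: le_trans hT; rewrite mulr_ege1// exprn_ege1.
have T0 : (0 < T)%N by rewrite -(ltr_nat R) (lt_le_trans ltr01).
elim=> [|j IH]; first by rewrite !expr0 !mulr1 (_ : 2 + 2 = 4)// -natrD.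
set h := 2^-1 ^+ j in IH.
have h0 : 0 < h by rewrite exprn_gt0.
have h1 : h <= 1 by rewrite exprn_ile1// invf_le1// ler1n.
pose g := h / 2; pose r := 2 + 2 * h - g.
pose al := al0 * K^-1 ^+ j.
pose t := (m' * (T * 8 ^ j))%N.
have t0 : (0 < t)%N by rewrite !muln_gt0 T0 expn_gt0.
have Kj0 : 0 < K ^+ j by rewrite exprn_gt0.
have Kj1 : 1 <= K ^+ j by rewrite exprn_ege1.
have al_gt0 : 0 < al by rewrite mulr_gt0// exprVn invr_gt0.
have al_le1 : al <= 1.
  by rewrite /al exprVn ler_pdivrMr// mul1r (le_trans al01).
have g0 : 0 < g by rewrite divr_gt0.
have rE : r + g = 2 + 2 * h by rewrite /r subrK.
have rE' : r - g = 2 + 2 * 2^-1 ^+ j.+1 by rewrite exprS -/h /r /g; field.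
have r1 : 1 <= r by rewrite /r /g; lra.
have r4 : r <= 4 by rewrite /r /g; lra.
have := @absorb_step r g al t t0 r1 g0 _ al_gt0 al_le1.
rewrite rE => /(_ ltac:(lra) IH).
have h16 : h * (8 ^ j)%:R^-1 = (16 ^ j)%:R^-1.
  rewrite /h exprVn -invfM -natrX -natrM -expnMn; congr (_%:R^-1); lia.
have tg : ((b + c) * t)%:R / g = (2 * (b + c) * m')%:R * T%:R * 16 ^+ j.
  have -> : g^-1 = 2 * 2 ^+ j by rewrite /g /h exprVn invfM !invrK mulrC.
  have -> : (16 : R) ^+ j = 2 ^+ j * 8 ^+ j by rewrite -exprMn; congr (_ ^+ j); rewrite -natrM.
  rewrite /t !natrM natrX; ring.
have GE : C0 * (((b + c) * t)%:R / g) ^+ M = D1 * T%:R ^+ M * K ^+ j.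
  rewrite tg exprMn exprMn -exprM [(j * M)%N]mulnC exprM /D1 -/K.
  move: (_%:R ^+ _) (T%:R ^+ _) (K ^+ j) => p1 p2 p3; ring.
rewrite GE => H.
have sm : D1 * T%:R ^+ M * K ^+ j * C2 * al * 2 ^+ (b + c).+1 <= 1.
  apply: le_trans hal; rewrite /al exprVn.
  rewrite [leLHS](_ : _ = D1 * T%:R ^+ M * C2 * al0 * 2 ^+ (b + c).+1)//.
  by field; rewrite gt_eqF.
have {H}step := H sm.
rewrite -rE' => x xr.
have xr2 : sq x <= r ^+ 2.
  by apply: le_trans xr _; rewrite lerXn2r ?nnegrE//; rewrite /r /g; lra.
have [] := step x xr2.
set Y := _ / _ * _ => hu hv.
have r0 : 0 < r by lra.
have Lp : 0 <= D1 * T%:R ^+ M * K ^+ j * (1 + C2).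
  apply: mulr_ge0; last by rewrite addr_ge0.
  by apply: mulr_ge0; [apply: mulr_ge0; [exact: D10|exact: exprn_ge0]|exact: ltW].
have YY : 0 <= Y.
  apply: mulr_ge0; last by rewrite exprn_ge0// sq_ge0.
  apply: divr_ge0; last by rewrite exprn_ge0// sqr_ge0.
  by apply: mulr_ge0; [lra|rewrite exprn_ge0// ltW].
suff Yle : Y <= (al0 * K^-1 ^+ j.+1) ^+ e.
  by split; [apply: le_trans hu _|apply: le_trans hv _]; rewrite lerXn2r ?nnegrE// (le_trans YY).
have -> : al0 * K^-1 ^+ j.+1 = al * K^-1 by rewrite /al exprSr mulrA.
rewrite exprMn exprVn ler_pdivlMr ?exprn_gt0//.
have -> : Y * K ^+ e = al ^+ e * ((1 + 2 * (D1 * T%:R ^+ M * K ^+ j) * (1 + C2)) * (sq x / r ^+ 2) ^+ t * K ^+ e).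
  have -> : (sq x / r ^+ 2) ^+ t = sq x ^+ t / (r ^+ 2) ^+ t by rewrite expr_div_n.
  rewrite /Y; move: (1 + _) ((r ^+ 2) ^+ t)^-1 (al ^+ e) (sq x ^+ t) (K ^+ e) => p1 p2 p3 p4 p5; ring.
rewrite -[leRHS]mulr1 ler_wpM2l ?exprn_ge0 ?(ltW al_gt0)//.
have TM : 1 <= T%:R ^+ M :> R by rewrite exprn_ege1.
have TK : 1 <= T%:R ^+ M * K ^+ j by rewrite mulr_ege1.
have LD : 1 + 2 * (D1 * T%:R ^+ M * K ^+ j) * (1 + C2) <= D2 * (T%:R ^+ M * K ^+ j).
  rewrite /D2 [leRHS](_ : _ = T%:R ^+ M * K ^+ j + 2 * (D1 * T%:R ^+ M * K ^+ j) * (1 + C2)); last by ring.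
  by rewrite lerD2r.
(* |x|/r <= 1 - g/4 since r <= 4, and Bernoulli bounds (1 - g/4)^(2 T 8^j) by 4 / (T 4^j), because g
   8^j = 4^j / 2. The factor m' = 2 M in [t] raises this to the power 2 M. *)
have q : (sq x / r ^+ 2) ^+ t <= (16 / (T%:R ^+ 2 * 16 ^+ j)) ^+ M.
  have x0 : 0 <= sq x / r ^+ 2 by rewrite divr_ge0 ?sq_ge0 ?sqr_ge0.
  have e1 : sq x / r ^+ 2 <= (1 - g / 4) ^+ 2.
    rewrite ler_pdivrMr ?exprn_gt0// -exprMn; apply: le_trans xr _.
    rewrite lerXn2r ?nnegrE//; [rewrite /r /g; lra|rewrite /r /g; nra|].
    have : 0 <= g * (4 - r) by rewrite mulr_ge0//; [exact: ltW|lra].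
    by lra.
  have g4 : 0 <= 1 - g / 4 by rewrite /g; lra.
  apply: (@le_trans _ _ (((1 - g / 4) ^+ 2) ^+ t)); first by rewrite lerXn2r ?nnegrE// sqr_ge0.
  have -> : ((1 - g / 4) ^+ 2) ^+ t = (((1 - g / 4) ^+ (2 * (T * 8 ^ j))) ^+ 2) ^+ M.
    have tE : (2 * t = 2 * (T * 8 ^ j) * 2 * M)%N.
      by rewrite /t /m'; move: (T * 8 ^ j)%N => s; ring.
    by rewrite -[LHS]exprM tE exprM exprM.
  apply: lerXn2r; first by rewrite nnegrE sqr_ge0.
    by rewrite nnegrE divr_ge0// mulr_ge0 ?exprn_ge0.
  have B := @bernoulli_inv (g / 4) (2 * (T * 8 ^ j)) ltac:(lra) ltac:(rewrite /g; lra).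
  have den : T%:R * 4 ^+ j / 4 <= 1 + (2 * (T * 8 ^ j))%:R * (g / 4).
    have -> : (2 * (T * 8 ^ j))%:R * (g / 4) = T%:R * 4 ^+ j / 4 :> R.
      have -> : (4 : R) ^+ j = 8 ^+ j * h.
        by rewrite /h -exprMn; congr (_ ^+ j); field.
      by rewrite /g !natrM natrX; field.
    by rewrite lerDr.
  have d0 : 0 < T%:R * 4 ^+ j / 4 :> R.
    by rewrite divr_gt0// mulr_gt0 ?exprn_gt0// ltr0n.
  have z0 : 0 <= (1 - g / 4) ^+ (2 * (T * 8 ^ j)) by rewrite exprn_ge0.
  have z1 : (1 - g / 4) ^+ (2 * (T * 8 ^ j)) <= (T%:R * 4 ^+ j / 4)^-1.
    rewrite -[leRHS]div1r ler_pdivlMr//; apply: le_trans B; exact: ler_wpM2l.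
  have -> : 16 / (T%:R ^+ 2 * 16 ^+ j) = ((T%:R * 4 ^+ j / 4)^-1) ^+ 2 :> R.
    have -> : (16 : R) ^+ j = (4 ^+ j) ^+ 2 by rewrite -exprM mulnC exprM; congr (_ ^+ j); rewrite -natrX.
    have -> : (16 : R) = 4 ^+ 2 by rewrite -natrX.
    by rewrite -[T%:R ^+ 2 * _]exprMn -expr_div_n [in RHS]invfM invrK [in RHS]mulrC.
  by rewrite lerXn2r ?nnegrE// invr_ge0 ltW.
apply: (@le_trans _ _ (D2 * (T%:R ^+ M * K ^+ j) * (16 / (T%:R ^+ 2 * 16 ^+ j)) ^+ M * K ^+ e)).
  apply: ler_wpM2r; first by rewrite exprn_ge0// ltW.
  apply: ler_pM => //; last by rewrite exprn_ge0// divr_ge0 ?sq_ge0 ?sqr_ge0.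
  lra.
have Tp : 0 < T%:R ^+ M :> R by rewrite exprn_gt0// ltr0n.
have -> : D2 * (T%:R ^+ M * K ^+ j) * (16 / (T%:R ^+ 2 * 16 ^+ j)) ^+ M * K ^+ e = D2 * K ^+ e.+1 / T%:R ^+ M.
  have -> : (16 / (T%:R ^+ 2 * 16 ^+ j)) ^+ M = K / ((T%:R ^+ M) ^+ 2 * K ^+ j).
    by rewrite exprMn exprVn exprMn -!exprM [(2 * _)%N]mulnC [(j * _)%N]mulnC.
  rewrite [K ^+ e.+1]exprS; move: (K) (T%:R ^+ M) (K ^+ j) (K ^+ e) Tp Kj0 => p4 p1 p2 p3 p10 p20.
  by field; rewrite !gt_eqF.
rewrite ler_pdivrMr// mul1r; apply: le_trans hT _.
by rewrite -[leLHS]expr1 ler_weXn2l.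
Qed.

End pair.

End absorption.

(** * From a zero ball of radius 1 to one of radius 2 *)

Section zero_ball_doubling.
Context {R : realType} {n : nat}.
Local Notation V := ('rV[R]_n.+1).
Local Notation L := (lebesgue_space R n).
Local Notation mu := (lebesgueN R n).
Implicit Types (x y z : V) (W : set V) (u v F : V -> R).
Hypothesis mu_pos : forall A : set V, open A -> A !=set0 -> (0 < mu A)%E.

(** The bounds of the iteration hold on the ball of radius 2 for every j and tend to 0. The
    threshold [delta] is fixed before the solutions and the domain, which is what rescaling
    arguments require. *)
Lemma zero_unit_ball (b c e : nat) (C2 : R) : (0 < b)%N -> (0 < c)%N -> (0 < e)%N -> 0 <= C2 ->
  exists2 delta : R, 0 < delta & forall W u v F1 F2,
  (forall x, sq x <= 16 -> W x) ->
  mu.-integrable [set: L] (EFin \o u) -> mu.-integrable [set: L] (EFin \o v) ->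
  mu.-integrable [set: L] (EFin \o F1) -> mu.-integrable [set: L] (EFin \o F2) ->
  weak_eq W u F1 -> weak_eq W v F2 ->
  (forall x, sq x <= 16 -> {for x, continuous u}) ->
  (forall x, sq x <= 16 -> {for x, continuous v}) ->
  (forall x, sq x < 1 -> u x = 0) -> (forall x, sq x < 1 -> v x = 0) ->
  (forall x, sq x <= 16 -> forall al y : R, 0 <= al -> al <= 1 -> 0 <= y -> y <= al ^+ e ->
    (v x ^+ 2 <= y ^+ c -> F1 x ^+ 2 <= C2 * al * y ^+ b) /\
    (u x ^+ 2 <= y ^+ b -> F2 x ^+ 2 <= C2 * al * y ^+ c)) ->
  (forall x, sq x <= 16 -> `|u x| <= delta /\ `|v x| <= delta) ->
  forall x, sq x <= 4 -> u x = 0 /\ v x = 0.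
Proof.
move=> b0 c0 e0 C20; have [C0 C00 est] := @weak_sup_estimate R n mu_pos.
pose m' := (2 * (n.+1 + 4))%N; pose D1 := C0 * (2 * (b + c) * m')%:R ^+ (n.+1 + 4).
pose K : R := 16 ^+ (n.+1 + 4).
pose B : R := (1 + 2 * D1 * (1 + C2)) * K ^+ e.+1.
have K1 : 1 <= K by rewrite exprn_ege1// ler1n.
have K2 : 2 <= K by apply: (@le_trans _ _ (16 ^+ 1)); [rewrite expr1 ler_nat|rewrite ler_weXn2l// ler1n].
have D10 : 0 <= D1 by rewrite mulr_ge0 ?(ltW C00)// exprn_ge0.
have DC : 0 <= D1 * (1 + C2) by rewrite mulr_ge0// addr_ge0.
have B0 : 0 <= B by rewrite mulr_ge0 ?exprn_ge0//; lra.
(* [T] is determined by the loss alone; [al0] is then taken small in terms of [T], and [delta] so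
   small that its square is below both al0^(e b) and al0^(e c). *)
pose T := Num.bound B.
have hT : B <= T%:R by apply: ltW; exact: archi_boundP.
pose q := D1 * T%:R ^+ (n.+1 + 4) * C2 * 2 ^+ (b + c).+1.
have q0 : 0 <= q.
  by apply: mulr_ge0; [apply: mulr_ge0; [apply: mulr_ge0|]|]; rewrite ?exprn_ge0.
pose al0 := (1 + q)^-1.
have al00 : 0 < al0 by rewrite invr_gt0; lra.
have al01 : al0 <= 1 by rewrite invf_le1; lra.
exists (al0 ^+ (e * (b + c))); first by rewrite exprn_gt0.
move=> W u v F1 F2 W16 iu iv iF1 iF2 weu wev cu cv u0 v0 growth small.
have hal : D1 * T%:R ^+ (n.+1 + 4) * C2 * al0 * 2 ^+ (b + c).+1 <= 1.
  rewrite (_ : _ * _ = q * al0); last by rewrite /q; ring.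
  by rewrite ler_pdivrMr; lra.
have d01 d : (0 < d)%N -> (d <= b + c)%N -> (al0 ^+ (e * (b + c))) ^+ 2 <= (al0 ^+ e) ^+ d.
  move=> d0 db; rewrite -!exprM ler_wiXn2l// ?(ltW al00)//.
  by rewrite -mulnA leq_mul// (leq_trans db)// leq_pmulr.
have h4 x : sq x <= 4 ^+ 2 -> u x ^+ 2 <= (al0 ^+ e) ^+ b /\ v x ^+ 2 <= (al0 ^+ e) ^+ c.
  rewrite -natrX => /small[hu hv].
  have sm w : `|w| <= al0 ^+ (e * (b + c)) -> w ^+ 2 <= (al0 ^+ (e * (b + c))) ^+ 2.
    by move=> hw; rewrite -(real_normK (num_real w)) lerXn2r ?nnegrE// exprn_ge0// ltW.
  split; [apply: le_trans (sm _ hu) _|apply: le_trans (sm _ hv) _]; apply: d01 => //.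
    exact: leq_addr.
  exact: leq_addl.
have it := absorb_iterate C00 est b0 c0 C20 W16 iu iv iF1 iF2 weu wev cu cv u0 v0 growth
  e0 al00 al01 hT hal h4.
move=> x x4.
have xj (j : nat) : u x ^+ 2 <= 2^-1 ^+ j /\ v x ^+ 2 <= 2^-1 ^+ j.
  have hj : 0 <= 2^-1 ^+ j :> R by rewrite exprn_ge0.
  have [h1 h2] : u x ^+ 2 <= ((al0 * K^-1 ^+ j) ^+ e) ^+ b /\ v x ^+ 2 <= ((al0 * K^-1 ^+ j) ^+ e) ^+ c.
    apply: (it j); apply: le_trans x4 _; rewrite (_ : 4 = 2 ^+ 2); last by rewrite -natrX.
    by rewrite lerXn2r ?nnegrE//; lra.
  have aK0 : 0 <= al0 * K^-1 ^+ j by rewrite mulr_ge0 ?(ltW al00)// exprn_ge0// invr_ge0 (le_trans ler01).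
  have Kj : K^-1 ^+ j <= 2^-1 ^+ j.
    have Kp : 0 < K by exact: lt_le_trans K2.
    have KV : K^-1 <= 2^-1 by rewrite lef_pV2 ?posrE.
    by apply: lerXn2r (KV); rewrite nnegrE invr_ge0// ltW.
  have aK : al0 * K^-1 ^+ j <= 2^-1 ^+ j.
    by apply: le_trans Kj; rewrite ler_piMl// exprn_ge0// invr_ge0 (le_trans ler01).
  have j1 : 2^-1 ^+ j <= 1 :> R by rewrite exprn_ile1// invf_le1// ler1n.
  have aK1 := le_trans aK j1.
  have pw d : (0 < d)%N -> ((al0 * K^-1 ^+ j) ^+ e) ^+ d <= 2^-1 ^+ j.
    move=> d0; rewrite -exprM; apply: le_trans aK; rewrite -[leRHS]expr1.
    by rewrite ler_wiXn2l// muln_gt0 e0.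
  by split; [apply: le_trans h1 _|apply: le_trans h2 _]; exact: pw.
have z (w : R) : (forall j : nat, w ^+ 2 <= 2^-1 ^+ j) -> w = 0.
  move=> hw; apply/eqP; rewrite -sqrf_eq0 eq_le sqr_ge0 andbT leNgt; apply/negP => w0.
  have w20 : 0 < w ^+ 2 / 2 by rewrite divr_gt0.
  have [j hj] := half_expn_le w20.
  by have := le_trans (hw j) hj; lra.
by split; apply: z => j; have [] := xj j.
Qed.

End zero_ball_doubling.

(** * Propagation of zeros in a connected open set *)

Section unique_continuation.
Context {R : realType} {n : nat}.
Local Notation V := ('rV[R]_n.+1).
Local Notation L := (lebesgue_space R n).
Local Notation mu := (lebesgueN R n).
Local Notation N := (n.+1%:R : R).
Implicit Types (x y z : V) (W : set V) (u v F : V -> R).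

(** [c] is the integer just above b/q; it lies below b p as soon as b (p - 1/q) > 1, and this is
    where p q > 1 enters. Thus s = c/b is strictly between 1/q and p, and [e] is chosen to make e
    times each surplus at least 1. *)
Lemma exponents (p q : R) : 0 < p -> 0 < q -> 1 < p * q -> exists b c e : nat,
  [/\ (0 < b)%N, (0 < c)%N, (0 < e)%N, 1 <= e%:R * (c%:R * q - b%:R) &
      1 <= e%:R * (b%:R * p - c%:R)].
Proof.
move=> p0 q0 pq.
have pq' : q^-1 < p by rewrite -div1r ltr_pdivrMr.
have d0 : 0 < p - q^-1 by rewrite subr_gt0.
pose b := (Num.bound (p - q^-1)^-1).+1.
have bb : 1 < b%:R * (p - q^-1).
  rewrite -ltr_pdivrMr// div1r; apply: lt_trans (archi_boundP _) _; first by rewrite invr_ge0 ltW.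
  by rewrite ltr_nat.
have bp0 : 0 <= b%:R * q^-1 by rewrite mulr_ge0// invr_ge0 ltW.
pose c := (Num.truncn (b%:R * q^-1)).+1.
have /andP[c1 c2] := truncn_itv bp0.
have c3 : b%:R * q^-1 < c%:R by exact: c2.
have c4 : c%:R < b%:R * p by rewrite -[c]addn1 natrD; move: bb; rewrite mulrBr; lra.
have k1 : 0 < c%:R * q - b%:R by rewrite subr_gt0 -ltr_pdivrMr.
have k2 : 0 < b%:R * p - c%:R by rewrite subr_gt0.
pose e := (maxn (Num.bound (c%:R * q - b%:R)^-1) (Num.bound (b%:R * p - c%:R)^-1)).+1.
have he (k : R) : 0 < k -> (Num.bound k^-1 <= e)%N -> 1 <= e%:R * k.
  move=> k0 ke; rewrite -ler_pdivrMr// div1r; apply: ltW.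
  apply: lt_le_trans (archi_boundP _) _; first by rewrite invr_ge0 ltW.
  by rewrite ler_nat.
exists b, c, e; split=> //; apply: he => //; rewrite leqW// leq_max leqnn ?orbT//.
Qed.

(** (v^2)^q <= y^(c q) = y^(c q - b) y^b, and the surplus factor is at most al^(e (c q - b)) <=
    al. *)
Lemma growth_powR (q C F v al y : R) (b c e : nat) : 0 < q -> 0 <= C -> (0 < c)%N ->
  1 <= e%:R * (c%:R * q - b%:R) -> `|F| <= C * `|v| `^ q ->
  0 <= al -> al <= 1 -> 0 <= y -> y <= al ^+ e -> v ^+ 2 <= y ^+ c ->
  F ^+ 2 <= C ^+ 2 * al * y ^+ b.
Proof.
move=> q0 C0 c0 k1 Fv al0 al1 y0 ye vy.
have F2 : F ^+ 2 <= C ^+ 2 * (v ^+ 2) `^ q.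
  have -> : (v ^+ 2) `^ q = (`|v| `^ q) ^+ 2.
    have e1 : (`|v| ^+ 2) `^ q = `|v| `^ (2%:R * q) by rewrite powRrM powR_mulrn.
    have e2 : (`|v| `^ q) ^+ 2 = `|v| `^ (q * 2%:R) by rewrite powRrM powR_mulrn ?powR_ge0.
    by rewrite e2 -(real_normK (num_real v)) e1 mulrC.
  rewrite -(real_normK (num_real F)) -exprMn.
  by apply: lerXn2r => //; rewrite nnegrE mulr_ge0// powR_ge0.
apply: le_trans F2 _; rewrite -mulrA ler_wpM2l ?sqr_ge0//.
apply: (@le_trans _ _ ((y ^+ c) `^ q)).
  by rewrite ge0_ler_powR ?nnegrE ?sqr_ge0 ?exprn_ge0// ltW.
have [->|yn0] := eqVneq y 0.
  by rewrite expr0n gtn_eqF// powR0 ?gt_eqF// mulr_ge0// exprn_ge0.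
have yp : 0 < y by rewrite lt_neqAle eq_sym yn0.
rewrite -powR_mulrn// -powRrM.
have -> : c%:R * q = (c%:R * q - b%:R) + b%:R by rewrite subrK.
rewrite powRD ?yn0 ?implybT// powR_mulrn// ler_wpM2r ?exprn_ge0//.
set k := _ - _ in k1 *.
have k0 : 0 < k by rewrite ltNge; apply/negP => kn; have := mulr_ge0_le0 (ler0n R e) kn; lra.
apply: (@le_trans _ _ ((al ^+ e) `^ k)).
  by rewrite ge0_ler_powR ?nnegrE ?exprn_ge0// ltW.
have alp : 0 < al.
  rewrite lt_neqAle eq_sym al0 andbT; apply/negP => /eqP al_0.
  have e0 : (0 < e)%N by rewrite lt0n; apply/negP => /eqP e_0; move: k1; rewrite e_0 mul0r; lra.
  by move: ye; rewrite al_0 expr0n gtn_eqF// leNgt yp.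
rewrite -powR_mulrn// -powRrM -[leRHS]powRr1//.
by rewrite ger_powR// alp.
Qed.

Lemma mo_affine u (rho e : R) z c x : mu.-integrable [set: L] (EFin \o u) -> 0 < rho -> 0 < e ->
  (forall j, (0 < c j)%N) ->
  mo (fun y => u (z + rho *: y)) e bumpf c x =
  rho ^+ (\sum_j c j) * rho ^- n.+1 * mo u (rho * e) bumpf c (z + rho *: x).
Proof.
move=> iu r0 e0 cp; have cB : cinfs (bumpf : 'I_n.+1 -> R -> R) by case: (@stepfuns_bumpf R n).
have re0 : 0 < rho * e by rewrite mulr_gt0.
rewrite /mo -mulrA -(@Rintegral_affineN _ _ z rho (fun y => u y * prodf (aff (rho * e) (z + rho *: x) bumpf) c y))//.
  have iA := integrable_affineN z r0 (integrable_mo (rho * e) iu (z + rho *: x) cB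
    (fun z => prodf_step0M (c := c) stepfuns_bumpf cp)).
  rewrite -RintegralZl//; apply: eq_Rintegral => y _.
  have -> : prodf (aff e x bumpf) c y = rho ^+ (\sum_j c j) * prodf (aff (rho * e) (z + rho *: x) bumpf) c (z + rho *: y).
    rewrite !prodf_aff// mulrA.
    have -> : e^-1 ^+ (\sum_j c j) = rho ^+ (\sum_j c j) * (rho * e)^-1 ^+ (\sum_j c j).
      by rewrite -exprMn; congr (_ ^+ _); field; rewrite !gt_eqF.
    congr (_ * prodf _ _ _).
    rewrite opprD addrACA subrr add0r -scalerBr scalerA; congr (_ *: _).
    by field; rewrite !gt_eqF.
  by rewrite mulrCA.
exact: (integrable_mo (rho * e) iu _ cB (fun z => prodf_step0M (c := c) stepfuns_bumpf cp)).
Qed.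

(** Dilation multiplies the two sides of the tested identity by the same power of [rho], except for
    the two additional derivatives on the left; they account for rho^2. *)
Lemma weak_eq_affine W u F (rho : R) z : 0 < rho -> mu.-integrable [set: L] (EFin \o u) ->
  mu.-integrable [set: L] (EFin \o F) -> weak_eq W u F ->
  weak_eq [set x | W (z + rho *: x)] (fun y => u (z + rho *: y))
    (fun y => rho ^+ 2 * F (z + rho *: y)).
Proof.
move=> r0 iu iF we x e e0 We.
have re0 : 0 < rho * e by rewrite mulr_gt0.
have {}We y : `|y| <= 1 -> W (z + rho *: x + (rho * e) *: y).
  by move=> /We /=; rewrite scalerDr scalerA addrA.
have -> : mo (fun y => rho ^+ 2 * F (z + rho *: y)) e bumpf c1 x =
   rho ^+ 2 * mo (fun y => F (z + rho *: y)) e bumpf c1 x.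
  have cB : cinfs (bumpf : 'I_n.+1 -> R -> R) by case: (@stepfuns_bumpf R n).
  rewrite /mo -RintegralZl//; first by apply: eq_Rintegral => y _; rewrite mulrA.
  exact: (integrable_mo e (integrable_affineN z r0 iF) x cB (fun z => prodf_step0M (c := c1) stepfuns_bumpf (fun=> isT))).
rewrite mo_affine// sum_c1 mulfV ?mul1r; last by rewrite expf_neq0// gt_eqF.
rewrite -(we _ _ re0 We) mulr_sumr; apply: eq_bigr => i _.
rewrite mo_affine//.
by rewrite !sum_cS sum_c1 -[n.+3]addn2 exprD [_ / _]mulrC mulKf// expf_neq0// gt_eqF.
Qed.

Lemma cont_affine_at (w : V -> R) (z x : V) (rho : R) : {for z + rho *: x, continuous w} ->
  {for x, continuous (fun y => w (z + rho *: y))}.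
Proof.
move=> cw; apply: (@continuous_comp _ _ _ (fun y => z + rho *: y) w); last exact: cw.
by apply: continuousD; [exact: cst_continuous|apply: continuousZr; exact: cvg_id].
Qed.

Hypothesis mu_pos : forall A : set V, open A -> A !=set0 -> (0 < mu A)%E.
Variables (p q C : R).
Hypothesis p0 : 0 < p.
Hypothesis q0 : 0 < q.
Hypothesis pq : 1 < p * q.
Hypothesis C0 : 0 <= C.

Variables (W : set V) (u v F1 F2 : V -> R).
Hypothesis iu : mu.-integrable [set: L] (EFin \o u).
Hypothesis iv : mu.-integrable [set: L] (EFin \o v).
Hypothesis iF1 : mu.-integrable [set: L] (EFin \o F1).
Hypothesis iF2 : mu.-integrable [set: L] (EFin \o F2).
Hypothesis weu : weak_eq W u F1.
Hypothesis wev : weak_eq W v F2.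
Hypothesis cu : forall x, W x -> {for x, continuous u}.
Hypothesis cv : forall x, W x -> {for x, continuous v}.
Hypothesis grow1 : forall x, W x -> `|F1 x| <= C * `|v x| `^ q.
Hypothesis grow2 : forall x, W x -> `|F2 x| <= C * `|u x| `^ p.

(** [zero_unit_ball] after rescaling. For rho <= 1 the factor rho^2 on the right-hand sides
    preserves the growth condition with the same [C], so one [delta] serves all centres and
    radii. *)
Lemma zero_ball_double : exists2 delta : R, 0 < delta & forall z (rho : R), 0 < rho -> rho <= 1 ->
  (forall x, sq (x - z) <= 16 * rho ^+ 2 -> [/\ W x, `|u x| <= delta & `|v x| <= delta]) ->
  (forall x, sq (x - z) < rho ^+ 2 -> u x = 0 /\ v x = 0) ->
  forall x, sq (x - z) <= 4 * rho ^+ 2 -> u x = 0 /\ v x = 0.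
Proof.
have [b [c [e [b0 c0 e0 k1 k2]]]] := exponents p0 q0 pq.
have [delta d0 zub] := zero_unit_ball mu_pos b0 c0 e0 (sqr_ge0 C).
exists delta => // z rho r0 r1 hW hz.
have toW x : sq x <= 16 -> sq (z + rho *: x - z) <= 16 * rho ^+ 2.
  by move=> x16; rewrite addrAC subrr add0r sqZ mulrC ler_wpM2r// sqr_ge0.
have r2 : rho ^+ 2 <= 1 by rewrite exprn_ile1// ltW.
have Fle (F : R) B : `|F| <= C * B -> 0 <= B -> `|rho ^+ 2 * F| <= C * B.
  move=> FB B0; rewrite normrM ger0_norm ?sqr_ge0//; apply: le_trans FB.
  by rewrite ler_piMl.
have fin := zub [set x | W (z + rho *: x)] (fun x => u (z + rho *: x)) (fun x => v (z + rho *: x))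
  (fun x => rho ^+ 2 * F1 (z + rho *: x)) (fun x => rho ^+ 2 * F2 (z + rho *: x)).
have {}fin y : sq y <= 4 -> u (z + rho *: y) = 0 /\ v (z + rho *: y) = 0.
  apply: fin.
  - by move=> x /toW/hW[].
  - exact: integrable_affineN.
  - exact: integrable_affineN.
  - by apply: (integrable_scale _ (f := fun x => F1 (z + rho *: x))) => //; exact: integrable_affineN.
  - by apply: (integrable_scale _ (f := fun x => F2 (z + rho *: x))) => //; exact: integrable_affineN.
  - exact: weak_eq_affine.
  - exact: weak_eq_affine.
  - by move=> x /toW/hW[Wx _ _]; apply: cont_affine_at; exact: cu.
  - by move=> x /toW/hW[Wx _ _]; apply: cont_affine_at; exact: cv.
  - by move=> x x1; apply: (hz _ _).1; rewrite addrAC subrr add0r sqZ gtr_pMr// exprn_gt0.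
  - by move=> x x1; apply: (hz _ _).2; rewrite addrAC subrr add0r sqZ gtr_pMr// exprn_gt0.
  - move=> x /toW/hW[Wx _ _] al w al0 al1 w0 we; split=> h.
      apply: (growth_powR q0 C0 c0 k1 (Fle _ _ (grow1 Wx) (powR_ge0 _ _)) al0 al1 w0 we h).
    apply: (growth_powR p0 C0 b0 k2 (Fle _ _ (grow2 Wx) (powR_ge0 _ _)) al0 al1 w0 we h).
  - by move=> x /toW/hW[].
move=> x xz; have := fin (rho^-1 *: (x - z)).
rewrite scalerA divff ?gt_eqF// scale1r addrCA subrr addr0; apply.
by rewrite sqZ exprVn mulrC ler_pdivrMr// exprn_gt0.
Qed.

Hypothesis oW : open W.
Hypothesis coW : connected W.

Let Z := [set x | W x /\ \forall y \near x, u y = 0 /\ v y = 0].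

Let ballN x (e : R) : 0 < e -> nbhs x [set y | `|y - x| < e].
Proof. exact: near_dist. Qed.

Let closure_zero z (w : V -> R) : {for z, continuous w} ->
  (forall x, Z x -> w x = 0) -> closure Z z -> w z = 0.
Proof.
move=> cw wZ clz; apply/eqP; rewrite -normr_le0; apply/ler_addgt0Pr => e e0.
have /(@cvgrPdist_le R R^o V (nbhs z) _ w (w z)) /(_ _ e0) := cw.
move=> H; have [y [Zy]] := clz _ H.
by rewrite /= (wZ y Zy) subr0 add0r.
Qed.

(** A point z' of [Z] close to z may have only a tiny zero ball. But near z both functions are below
    [delta], so that ball can be doubled until its radius is 2 [rho0]; it then contains a
    neighbourhood of z. *)
Let Z_closed z : W z -> closure Z z -> Z z.
Proof.
move=> Wz clz.
have uz : u z = 0 by apply: closure_zero (cu Wz) _ clz => x [_ /nbhs_singleton[]].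
have vz : v z = 0 by apply: closure_zero (cv Wz) _ clz => x [_ /nbhs_singleton[]].
have [delta d0 dbl] := zero_ball_double.
have : \forall y \near z, [/\ W y, `|u y| <= delta & `|v y| <= delta].
  have h1 : \forall y \near z, W y by exact: open_nbhs_nbhs.
  have h2 : \forall y \near z, `|u y| <= delta.
    have /(@cvgrPdist_le R R^o V (nbhs z) _ u (u z)) /(_ _ d0) := cu Wz.
    by apply: filterS => y; rewrite uz sub0r normrN.
  have h3 : \forall y \near z, `|v y| <= delta.
    have /(@cvgrPdist_le R R^o V (nbhs z) _ v (v z)) /(_ _ d0) := cv Wz.
    by apply: filterS => y; rewrite vz sub0r normrN.
  exact: filterS3 h1 h2 h3.
move=> /nbhs_ballP[eta /= eta0 heta].
have N1 : 1 <= N by rewrite ler1n.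
(* The balls of radius 4 [rho0] around z' must stay within [eta] of z, which 10 guarantees; dividing
   by N below makes the Euclidean distance from z' to z less than 2 [rho0]. *)
pose rho0 := Num.min 1 (eta / 10).
have r00 : 0 < rho0 by rewrite lt_min ltr01 divr_gt0.
have r01 : rho0 <= 1 by rewrite ge_min lexx.
have r0e : rho0 <= eta / 10 by rewrite ge_min lexx orbT.
have rN0 : 0 < rho0 / N by rewrite divr_gt0// (lt_le_trans ltr01).
have rN1 : rho0 / N <= rho0 by rewrite ler_pdivrMr ?(lt_le_trans ltr01)// ler_peMr// ltW.
clearbody rho0.
have [z' [[Wz' /nbhs_ballP[r /= r_gt0 hr]] /= zz']] := clz _ (ballN z rN0).
have inW (rho : R) (x : V) : 0 < rho -> rho <= rho0 -> sq (x - z') <= 16 * rho ^+ 2 ->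
    [/\ W x, `|u x| <= delta & `|v x| <= delta].
  move=> rp rr xz; apply: heta; rewrite -ball_normE /= distrC.
  have h1 : `|x - z'| <= 4 * rho.
    have h2 : `|x - z'| ^+ 2 <= (4 * rho) ^+ 2.
      apply: le_trans (normV_sq _) _; apply: le_trans xz _.
      by rewrite exprMn -natrX.
    by rewrite -(@ler_pXn2r _ 2) ?nnegrE// mulr_ge0// ltW.
  rewrite -(subrKA z'); apply: le_lt_trans (ler_normD _ _) _.
  apply: le_lt_trans (lerD h1 (le_trans (ltW zz') rN1)) _.
  have h2 : 4 * rho <= 4 * rho0 by rewrite ler_pM2l.
  apply: le_lt_trans (lerD h2 (lexx rho0)) _; lra.
have [k hk] := half_expn_le (divr_gt0 r_gt0 r00).
(* Each doubling turns a zero ball of radius rho0 2^-(j+1) into one of radius rho0 2^-j, and the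
   last one reaches 2 [rho0]. *)
have dk (j : nat) : (forall x, sq (x - z') < (rho0 * 2^-1 ^+ j) ^+ 2 -> u x = 0 /\ v x = 0) ->
    forall x, sq (x - z') <= 4 * rho0 ^+ 2 -> u x = 0 /\ v x = 0.
  elim: j => [|j IH] hj.
    apply: dbl => // [x|x xz]; first exact: inW.
    by apply: hj; rewrite expr0 mulr1.
  apply: IH => x xz.
  have j0 : 0 < 2^-1 ^+ j.+1 :> R by rewrite exprn_gt0.
  have j1 : rho0 * 2^-1 ^+ j.+1 <= rho0.
    by rewrite ler_piMr ?(ltW r00)// exprn_ile1// invf_le1// ler1n.
  have j2 : 0 < rho0 * 2^-1 ^+ j.+1 by rewrite mulr_gt0.
  apply: (dbl z' (rho0 * 2^-1 ^+ j.+1)) => //.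
  - exact: le_trans r01.
  - by move=> y; exact: inW.
  - apply: le_trans (ltW xz) _; rewrite [2^-1 ^+ j.+1]exprSr le_eqVlt; apply/orP; left; apply/eqP.
    by move: (2^-1 ^+ j) => s; field.
have zero2 : forall x, sq (x - z') <= 4 * rho0 ^+ 2 -> u x = 0 /\ v x = 0.
  apply: (dk k) => x xz; apply: hr; rewrite -ball_normE /= distrC.
  have h1 : `|x - z'| ^+ 2 < r ^+ 2.
    apply: le_lt_trans (normV_sq _) _; apply: lt_le_trans xz _.
    rewrite lerXn2r ?nnegrE ?(ltW r_gt0)//; first by rewrite mulr_ge0 ?exprn_ge0// ltW.
    by rewrite mulrC -ler_pdivlMr.
  by rewrite -(@ltr_pXn2r _ 2) ?nnegrE// ltW.
split => //.
have cs : continuous (fun x => sq (x - z')).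
  have -> : (fun x => sq (x - z')) = (fun x => sq (- z' + 1 *: x)).
    by apply/funext => x; rewrite scale1r addrC.
  by apply: (@cont_affine R n sq); exact: cont_sq.
have sz : sq (z - z') < 4 * rho0 ^+ 2.
  apply: le_lt_trans (sq_normV _) _.
  apply: (@le_lt_trans _ _ (rho0 ^+ 2)); last first.
    by have := exprn_gt0 2 r00; lra.
  have h2 : `|z - z'| ^+ 2 <= (rho0 / N) ^+ 2.
    by rewrite lerXn2r ?nnegrE ?(ltW rN0)// distrC ltW.
  apply: (@le_trans _ _ (N * (rho0 / N) ^+ 2)); first by rewrite ler_wpM2l.
  have N0 : N != 0 by rewrite gt_eqF// (lt_le_trans ltr01).
  rewrite [X in _ * X]expr2 mulrA (mulrC N) divfK// [leRHS]expr2.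
  exact: (ler_wpM2r (ltW r00) rN1).
by have := near_cont_lt cs sz; apply: filterS => x /ltW; exact: zero2.
Qed.

Lemma unique_continuation : Z !=set0 -> forall x, W x -> u x = 0 /\ v x = 0.
Proof.
move=> Z0.
have -> : W = Z.
  apply/esym; apply: coW => //.
    exists [set x | \forall y \near x, u y = 0 /\ v y = 0].
      by rewrite openE => x /= /near_join.
    by apply/seteqP; split => x [].
  exists (closure Z); first exact: closed_closure.
  apply/seteqP; split => x; first by move=> Zx; split; [case: Zx|exact: subset_closure].
  by case; exact: Z_closed.
by move=> x [_ /nbhs_singleton].
Qed.

End unique_continuation.

(** * Morrey's estimate *)

Section morrey.
Context {R : realType} {n : nat}.
Local Notation V := ('rV[R]_n.+1).
Local Notation L := (lebesgue_space R n).
Local Notation mu := (lebesgueN R n).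
Implicit Types (x y z : V) (u g : V -> R) (E F : 'I_n.+1 -> R -> R) (c : 'I_n.+1 -> nat).
Implicit Types lo hi : 'I_n.+1 -> R.

(** The intervals with centre a_k and half-length D th^k, where D = C/(1 - th), are nested; the
    limit is the supremum of their left ends. *)
Lemma geometric_cvg (a : nat -> R) (C th : R) k0 : 0 <= C -> 0 <= th -> th < 1 ->
  (forall k, (k0 <= k)%N -> `|a k.+1 - a k| <= C * th ^+ k) ->
  exists l, forall k, (k0 <= k)%N -> `|a k - l| <= C / (1 - th) * th ^+ k.
Proof.
move=> C0 th0 th1 ha; have t1 : 0 < 1 - th by lra.
pose D := C / (1 - th); have D0 : 0 <= D by rewrite divr_ge0// ltW.
have CD : C = D * (1 - th) by rewrite /D divfK// gt_eqF.
have step k : (k0 <= k)%N -> a k - D * th ^+ k <= a k.+1 - D * th ^+ k.+1 /\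
    a k.+1 + D * th ^+ k.+1 <= a k + D * th ^+ k.
  by move=> /ha; rewrite CD exprS ler_norml => /andP[h1 h2]; move: (th ^+ k) h1 h2 => p h1 h2; split; lra.
have mono k j : (k0 <= k)%N -> a k - D * th ^+ k <= a (k + j)%N - D * th ^+ (k + j) /\
    a (k + j)%N + D * th ^+ (k + j) <= a k + D * th ^+ k.
  move=> k0k; elim: j => [|j [IH1 IH2]]; first by rewrite addn0.
  have [s1 s2] := step (k + j)%N (leq_trans k0k (leq_addr _ _)).
  by rewrite addnS; split; [exact: le_trans IH1 s1|exact: le_trans s2 IH2].
have le_ik i k : (k0 <= i)%N -> (k0 <= k)%N -> a i - D * th ^+ i <= a k + D * th ^+ k.
  move=> hi hk; have Dp j : 0 <= D * th ^+ j by rewrite mulr_ge0// exprn_ge0.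
  have [ik|/ltnW ki] := leqP i k.
    have := (mono i (k - i)%N hi).1; rewrite subnKC// => h; apply: le_trans h _.
    by have := Dp k; lra.
  have := (mono k (i - k)%N hk).2; rewrite subnKC// => h; apply: le_trans h.
  by have := Dp i; lra.
pose A := [set r | exists2 k, (k0 <= k)%N & r = a k - D * th ^+ k].
have A0 : A !=set0 by exists (a k0 - D * th ^+ k0); exists k0.
have ubA k : (k0 <= k)%N -> ubound A (a k + D * th ^+ k).
  by move=> hk _ [i hi ->]; exact: le_ik.
have sA : has_sup A by split => //; exists (a k0 + D * th ^+ k0); exact: ubA.
exists (sup A) => k hk; rewrite ler_norml; apply/andP; split.
  have := ge_sup A0 (ubA k hk); rewrite -/D; lra.
have : a k - D * th ^+ k <= sup A by apply: ub_le_sup; [case: sA|exists k].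
rewrite -/D; lra.
Qed.

Lemma geometric_to0 (C th eps : R) : 0 <= th -> th < 1 -> 0 < eps ->
  exists k0, forall k, (k0 <= k)%N -> C * th ^+ k <= eps.
Proof.
move=> th0 th1 eps0.
have h : (fun k => C * th ^+ k) @ \oo --> C * 0.
  by apply: cvgMr; apply: cvg_expr; rewrite ger0_norm.
rewrite mulr0 in h.
have /cvgrPdist_le /(_ _ eps0) [k0 _ hk] := h.
exists k0 => k /hk /=; rewrite sub0r normrN; apply: le_trans; exact: ler_norm.
Qed.

Definition box_in (Om : set V) lo hi x (e : R) := forall z, ~ outbox lo hi z -> Om (x + e *: z).

(** The functions live on the whole space, extended by zero in the applications; the support of the
    test function does the localisation to [Om]. *)
Definition wderiv (Om : set V) i u g := forall E c (K : set V), cinfs E -> compact K ->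
  K `<=` Om -> (forall x, ~ K x -> prodf E c x = 0) ->
  \int[mu]_x (u x * prodf E (cS c i) x) = - \int[mu]_x (g x * prodf E c x).

Lemma compact_box lo hi : compact [set z : V | ~ outbox lo hi z].
Proof.
apply: bounded_closed_compact.
  exists (boxM lo hi); split; first exact: num_real.
  move=> r Mr z /= hz; rewrite leNgt; apply/negP => rz; apply: hz.
  exact: (outboxM (lt_trans Mr rz)).
have -> : [set z : V | ~ outbox lo hi z] =
    \bigcap_(j in [set: 'I_n.+1]) ([set z : V | lo j <= z ord0 j] `&` [set z | z ord0 j <= hi j]).
  apply/seteqP; split => z /=.
    move=> h j _; split; rewrite /= leNgt; apply/negP => k; apply: h; exists j; by [left|right].
  by move=> h [j]; have [/= h1 h2] := h j I; rewrite !ltNge h1 h2 => -[].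
apply: closed_bigI => j _; apply: closedI.
  have -> : [set z : V | lo j <= z ord0 j] = (fun z : V => z ord0 j) @^-1` [set r : R | lo j <= r] by [].
  by apply: closed_comp (@closed_ge _ (lo j)) => z _; exact: cont_coord.
have h : closed ((fun z : V => z ord0 j) @^-1` [set r : R | r <= hi j]).
  by apply: closed_comp (@closed_le _ (hi j)) => z _; exact: cont_coord.
exact: h.
Qed.

Lemma outbox_aff lo hi x y (e : R) : 0 < e ->
  outbox (fun j => x ord0 j + e * lo j) (fun j => x ord0 j + e * hi j) y <->
  outbox lo hi (e^-1 *: (y - x)).
Proof.
move=> e0; have E j : (e^-1 *: (y - x)) ord0 j = (y ord0 j - x ord0 j) / e.
  by rewrite !mxE mulrC.
by split=> -[j h]; exists j; move: h; rewrite E ltr_pdivrMr// ltr_pdivlMr// ltrBlDl ltrBrDl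
  ![_ * e]mulrC.
Qed.

Lemma aff_mix (e : R) x E F i : aff e x (mixf E F i) = mixf (aff e x E) (aff e x F) i.
Proof.
by apply/funext => j; apply/funext => t; rewrite /aff /mixf; case: ifP => // _; case: ifP.
Qed.

(** The kernels differ by a sum of derivatives of functions supported in the box, and the weak
    derivatives of [u] can be tested there because the box lies in [Om]. *)
Lemma mo_compare Om lo hi E F (u : V -> R) (g : 'I_n.+1 -> V -> R) x (e : R) : 0 < e -> stepfuns lo hi E -> stepfuns lo hi F ->
  mu.-integrable [set: L] (EFin \o u) -> (forall i, wderiv Om i u (g i)) ->
  box_in Om lo hi x e ->
  mo u e E c1 x - mo u e F c1 x =
  - \sum_i \int[mu]_y (g i y * prodf (mixf (aff e x E) (aff e x F) i) (cmix i) y).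
Proof.
move=> e0 sE sF iu ug bx.
have [sE' sF'] := (stepfuns_aff x e0 sE, stepfuns_aff x e0 sF).
have [cE cF] : cinfs E /\ cinfs F by split; [case: sE|case: sF].
have iE := integrable_mo e iu x cE (fun z => prodf_step0M (c := c1) sE (fun=> isT)).
have iF := integrable_mo e iu x cF (fun z => prodf_step0M (c := c1) sF (fun=> isT)).
rewrite /mo -RintegralB// -sumrN.
have im i : mu.-integrable [set: L] (EFin \o (fun y => u y * prodf (mixf (aff e x E) (aff e x F) i) c1 y)).
  rewrite -aff_mix -(cS_cmix i); apply: (@integrable_mo _ _ _ _ iu _ _ (boxM lo hi)).
    exact: cinfs_mix sE sF.
  apply: prodf_supp; first exact: cinfs_mix sE sF.
  by move=> z; exact: prodf_mix0M.
have -> : (fun y => u y * prodf (aff e x E) c1 y - u y * prodf (aff e x F) c1 y) =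
    (fun y => \sum_i u y * prodf (mixf (aff e x E) (aff e x F) i) c1 y).
  by apply/funext => y; rewrite -mulrBr (prodf_mix _ sE' sF') mulr_sumr.
rewrite (Rintegral_sumN (f := fun i y => u y * prodf (mixf (aff e x E) (aff e x F) i) c1 y))//.
apply: eq_bigr => i _; rewrite -[in LHS](cS_cmix i).
apply: (ug i _ _ [set y | ~ outbox (fun j => x ord0 j + e * lo j) (fun j => x ord0 j + e * hi j) y]).
- exact: cinfs_mix sE' sF'.
- exact: compact_box.
- move=> y /= /(contra_not (outbox_aff _ _ _ _ e0).2) /bx.
  by rewrite scalerA divff ?gt_eqF// scale1r addrCA subrr addr0.
- by move=> y /contrapT; exact: prodf_mix0.
Qed.

(** A form of the Holder inequality with a free threshold: where |t| > A, the factor (|t|/A)^(m - 1)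
    is at least 1. *)
Lemma le_powR_split (m A t : R) : 1 < m -> 0 < A -> `|t| <= A + A `^ (1 - m) * `|t| `^ m.
Proof.
move=> m1 A0; have P0 : 0 <= A `^ (1 - m) * `|t| `^ m by rewrite mulr_ge0 ?powR_ge0.
have [tA|tA] := leP `|t| A; first by lra.
have t0 : 0 < `|t| by exact: lt_trans tA.
have -> : `|t| = `|t| `^ (1 - m) * `|t| `^ m :> R.
  rewrite -powRD; last by rewrite (gt_eqF t0) implybT.
  by rewrite subrK powRr1.
apply: (@le_trans _ _ (A `^ (1 - m) * (`|t| `^ (1 - m) * `|t| `^ m) `^ m)); last first.
  by rewrite lerDr ltW.
have -> : `|t| `^ (1 - m) * `|t| `^ m = `|t|.
  rewrite -powRD; last by rewrite (gt_eqF t0) implybT.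
  by rewrite subrK powRr1.
rewrite -[leLHS]powRr1// -[in leLHS](subrK m 1) powRD; last by rewrite (gt_eqF t0) implybT.
apply: ler_wpM2r; first exact: powR_ge0.
rewrite -opprB !powRN lef_pV2 ?posrE ?powR_gt0//.
by rewrite ge0_ler_powR ?nnegrE ?subr_ge0 ?ltW.
Qed.

(** The mixed kernels carry n derivatives, hence the factor e^-n, and their support has volume of
    order e^(n+1). So the threshold [A] for the gradient costs e A, and the part of the gradient
    above it costs e^-n A^(1-m). *)
Lemma mo_compare_le Om lo hi E F (m : R) : 1 < m -> stepfuns lo hi E -> stepfuns lo hi F ->
  exists2 C, 0 <= C & forall (u : V -> R) (g : 'I_n.+1 -> V -> R), mu.-integrable [set: L] (EFin \o u) ->
  (forall i, wderiv Om i u (g i)) ->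
  (forall i, mu.-integrable [set: L] (EFin \o g i)) ->
  (forall i, mu.-integrable [set: L] (EFin \o (fun x => `|g i x| `^ m))) ->
  forall x (e A : R), 0 < e -> 0 < A -> box_in Om lo hi x e ->
  `|mo u e E c1 x - mo u e F c1 x| <= C * (1 + \sum_i \int[mu]_y (`|g i y| `^ m)) *
     (e * A + e^-1 ^+ n * A `^ (1 - m)).
Proof.
move=> m1 sE sF; have cm i := cinfs_mix i sE sF.
have supp i := fun z => @prodf_mix0M _ _ lo hi E F i z sE sF.
have bnd i : exists C, 0 < C /\ forall z, `|prodf (mixf E F i) (cmix i) z| <= C.
  by have [C C0 hC] := bounded_bsupp (cont_prodf (cm i)) (supp i); exists C.
have [C hC] := choice bnd.
pose C' := \sum_i C i; pose M := boxM lo hi.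
have C0 i : 0 <= C i by have [/ltW] := hC i.
have CC i : C i <= C' by rewrite /C' (bigD1 i)//= lerDl sumr_ge0.
have C'0 : 0 <= C' by rewrite sumr_ge0.
have v0 : 0 <= @volN R n M by exact: volN_ge0.
exists (C' * (n.+1%:R * @volN R n M + 1)); first by rewrite mulr_ge0// addr_ge0// mulr_ge0.
move=> u g iu ug ig igm x e A e0 A0 bx.
rewrite (mo_compare e0 sE sF iu ug bx) normrN.
pose G i := \int[mu]_y (`|g i y| `^ m).
have G0 i : 0 <= G i by apply: Rintegral_ge0 => y _; exact: powR_ge0.
have ei : 0 < e^-1 by rewrite invr_gt0.
have scm (i : 'I_n.+1) : (\sum_j cmix i j = n)%N.
  by have := sum_cS (cmix i) i; rewrite (cS_cmix i) sum_c1 => /succn_inj/esym.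
have one i : `|\int[mu]_y (g i y * prodf (mixf (aff e x E) (aff e x F) i) (cmix i) y)| <=
    C' * e^-1 ^+ n * (A * (e ^+ n.+1 * @volN R n M) + A `^ (1 - m) * G i).
  have iK : mu.-integrable [set: L] (EFin \o (fun y => A * \1_(cubeN M) (- (e^-1 *: x) + e^-1 *: y))).
    exact: (integrable_affineN (f := fun z => A * \1_(cubeN M) z) _ ei (integrable_cube A M)).
  have iP : mu.-integrable [set: L] (EFin \o (fun y => A `^ (1 - m) * `|g i y| `^ m)).
    exact: (integrable_scale _ (igm i)).
  have iS := integrable_add iK iP measurableT.
  have ib : mu.-integrable [set: L] (EFin \o (fun y => g i y * prodf (mixf (aff e x E) (aff e x F) i) (cmix i) y)).
    rewrite -aff_mix; exact: (@integrable_mo _ _ _ e (ig i) _ _ M x (cm i) (supp i)).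
  apply: le_trans (le_normr_Rintegral _ ib) _ => //.
  apply: (@le_trans _ _ (\int[mu]_y (C' * e^-1 ^+ n * (A * \1_(cubeN M) (- (e^-1 *: x) + e^-1 *: y) + A `^ (1 - m) * `|g i y| `^ m)))).
    apply: le_Rintegral => //.
    - exact: (integrable_norm ib).
    - exact: (integrable_scale _ iS).
    move=> y _; rewrite normrM -aff_mix prodf_aff// scm.
    have -> : - (e^-1 *: x) + e^-1 *: y = e^-1 *: (y - x) by rewrite scalerBr addrC.
    have [My|My] := ltP M `|e^-1 *: (y - x)|.
      rewrite supp// mulr0 normr0 mulr0 mulr_ge0//; first by rewrite mulr_ge0// exprn_ge0// ltW.
      by rewrite addr_ge0// mulr_ge0 ?powR_ge0// ?ltW// indicE; case: (_ \in _).
    rewrite indicE mem_set// mulr1 normrM [`|e^-1 ^+ n|]ger0_norm ?exprn_ge0 ?(ltW ei)//.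
    rewrite mulrC; apply: ler_pM => //; last exact: le_powR_split.
      by rewrite mulr_ge0// exprn_ge0// ltW.
    rewrite mulrC ler_wpM2r ?exprn_ge0 ?(ltW ei)//.
    by apply: le_trans (CC i); case: (hC i).
  rewrite RintegralZl// RintegralD//.
  have iK1 := integrable_cube (n := n) A M.
  rewrite (Rintegral_affineN _ ei iK1).
  have -> : \int[mu]_y (A `^ (1 - m) * `|g i y| `^ m) = A `^ (1 - m) * G i by exact: RintegralZl.
  have -> : \int[mu]_x0 (A * \1_(cubeN M) x0) = A * @volN R n M.
    rewrite RintegralZl//; last first.
      by have := integrable_cube (n := n) 1 M; under eq_fun do rewrite mul1r.
    by rewrite /Rintegral integral_indic ?setIT//; exact: measurable_normV_le.
  by rewrite -[(e^-1 ^+ n.+1)^-1]exprVn invrK [e ^+ n.+1 * (A * _)]mulrCA lexx.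
apply: le_trans (ler_norm_sum _ _ _) _.
apply: le_trans (ler_sum _ (fun i _ => one i)) _.
rewrite -mulr_sumr big_split/= sumr_const card_ord -mulr_sumr.
set SG := \sum_i G i.
have SG0 : 0 <= SG by rewrite sumr_ge0.
have P0 : 0 <= A `^ (1 - m) by exact: powR_ge0.
have En0 : 0 <= e^-1 ^+ n by rewrite exprn_ge0// ltW.
rewrite -!mulrA ler_wpM2l// -[_ *+ n.+1]mulr_natl mulrDr.
have -> : e^-1 ^+ n * (n.+1%:R * (A * (e ^+ n.+1 * @volN R n M))) = n.+1%:R * @volN R n M * (e * A).
  have -> : e ^+ n.+1 = e ^+ n * e by rewrite exprSr.
  have <- : (e ^+ n)^-1 = e^-1 ^+ n by rewrite exprVn.
  by field; rewrite expf_neq0// gt_eqF.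
have X0 : 0 <= e * A by rewrite mulr_ge0// ltW.
have Y0 : 0 <= e^-1 ^+ n * A `^ (1 - m) by rewrite mulr_ge0.
have W0 : 0 <= n.+1%:R * @volN R n M by rewrite mulr_ge0.
rewrite [e^-1 ^+ n * (_ * SG)]mulrA; move: (e * A) (e^-1 ^+ n * _) (n.+1%:R * _) X0 Y0 W0 => X Y W X0 Y0 W0.
have h1 : 0 <= W * SG by rewrite mulr_ge0.
have h2 : 0 <= W * Y by rewrite mulr_ge0.
have h3 : 0 <= W * SG * X by rewrite mulr_ge0.
have h4 : 0 <= W * SG * Y by rewrite mulr_ge0.
have h5 : 0 <= SG * X by rewrite mulr_ge0.
rewrite [leRHS](_ : _ = W * X + W * Y + W * SG * X + W * SG * Y + (X + SG * X + Y + SG * Y)); last by ring.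
lra.
Qed.

Lemma ltr_powR2 (a b : R) : a < b -> (2 : R) `^ a < 2 `^ b.
Proof.
move=> ab; rewrite /powR pnatr_eq0/= ltr_expR ltr_pM2r//.
by apply: ln_gt0; rewrite ltr1n.
Qed.

(** With e = 2^-k and A = lam^k both terms of [mo_compare_le] must decay geometrically. For lam =
    2^s this means n/(m - 1) < s < 1, which is possible exactly because m > n + 1; [s] is the
    midpoint. *)
Lemma morrey_ratio (m : R) : n.+1%:R < m -> exists lam th : R,
  [/\ 0 < lam, 0 <= th, th < 1, lam / 2 <= th & 2 ^+ n * lam `^ (1 - m) <= th].
Proof.
move=> mn; have m1 : 0 < m - 1 by rewrite subr_gt0 (le_lt_trans _ mn)// ler1n.
pose s := (n%:R / (m - 1) + 1) / 2.
have nm : n%:R / (m - 1) < 1 by rewrite ltr_pdivrMr// mul1r; move: mn; rewrite -natr1; lra.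
have s1 : s < 1 by rewrite /s; lra.
have s2 : n%:R < s * (m - 1) by rewrite -ltr_pdivrMr// /s; lra.
pose lam := 2 `^ s.
have lam0 : 0 < lam by rewrite powR_gt0.
have l1 : lam / 2 < 1.
  by rewrite ltr_pdivrMr// mul1r -[ltRHS]powRr1//; exact: ltr_powR2.
have l2 : 2 ^+ n * lam `^ (1 - m) < 1.
  rewrite /lam -powRrM -[2 ^+ n]powR_mulrn// -powRD ?pnatr_eq0 ?implybT//.
  by rewrite -[ltRHS](powRr0 2); apply: ltr_powR2; rewrite -opprB mulrN subr_lt0.
exists lam, (Num.max (lam / 2) (2 ^+ n * lam `^ (1 - m))); split => //.
- by rewrite le_max divr_ge0// ltW.
- by rewrite gt_max l1.
- by rewrite le_max lexx.
- by rewrite le_max lexx orbT.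
Qed.

Lemma morrey_rate Om lo hi E F (m : R) : n.+1%:R < m -> stepfuns lo hi E -> stepfuns lo hi F ->
  forall (u : V -> R) (g : 'I_n.+1 -> V -> R), mu.-integrable [set: L] (EFin \o u) ->
  (forall i, wderiv Om i u (g i)) ->
  (forall i, mu.-integrable [set: L] (EFin \o g i)) ->
  (forall i, mu.-integrable [set: L] (EFin \o (fun x => `|g i x| `^ m))) ->
  exists C th : R, [/\ 0 <= C, 0 <= th, th < 1 & forall x k, box_in Om lo hi x (2^-1 ^+ k) ->
  `|mo u (2^-1 ^+ k) E c1 x - mo u (2^-1 ^+ k) F c1 x| <= C * th ^+ k].
Proof.
move=> mn sE sF u g iu ug ig igm.
have m1 : 1 < m by apply: le_lt_trans mn; rewrite ler1n.
have [lam [th [lam0 th0 th1 l1 l2]]] := morrey_ratio mn.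
have [C C0 hC] := mo_compare_le Om m1 sE sF.
set D := C * (1 + \sum_i \int[mu]_y (`|g i y| `^ m)).
have D0 : 0 <= D.
  rewrite mulr_ge0// addr_ge0// sumr_ge0// => i _; apply: Rintegral_ge0 => y _.
  exact: powR_ge0.
exists (D * 2), th; split=> //; first by rewrite mulr_ge0.
move=> x k bx; have e0 : 0 < 2^-1 ^+ k :> R by rewrite exprn_gt0.
have A0 : 0 < lam ^+ k by rewrite exprn_gt0.
apply: le_trans (hC u g iu ug ig igm x _ _ e0 A0 bx) _; rewrite -/D -[leRHS]mulrA.
apply: ler_wpM2l => //.
rewrite mulrDl mul1r; apply: lerD.
  rewrite -exprMn mulrC lerXn2r ?nnegrE//; first by rewrite mulr_ge0 ?invr_ge0// ltW.
rewrite -[(2^-1 ^+ k)^-1]exprVn invrK.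
have -> : (2 ^+ k) ^+ n * (lam ^+ k) `^ (1 - m) = (2 ^+ n * lam `^ (1 - m)) ^+ k.
  rewrite exprMn -!exprM mulnC; congr (_ * _).
  by rewrite -powR_mulrn ?(ltW lam0)// -powRrM mulrC powRrM powR_mulrn// powR_ge0.
by rewrite lerXn2r ?nnegrE// mulr_ge0 ?exprn_ge0 ?powR_ge0.
Qed.

End morrey.

Lemma common_bound6 (a b c d e f : nat) : exists k, [/\ (a <= k)%N, (b <= k)%N & (c <= k)%N] /\
  [/\ (d <= k)%N, (e <= k)%N & (f <= k)%N].
Proof. by exists (a + b + c + d + e + f)%N; split; split; lia. Qed.

Lemma three_dist (R : realDomainType) (a b l1 l2 K : R) :
  `|a - l1| <= K -> `|b - l2| <= K -> `|b - a| <= K -> `|l1 - l2| <= K + K + K.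
Proof.
by rewrite !ler_norml => /andP[? ?] /andP[? ?] /andP[? ?]; apply/andP; split; lra.
Qed.

Lemma subr_insert (R : comPzRingType) (a b c d l : R) :
  a - b - l = (c - d - l) + ((d - b) - (c - a)).
Proof. ring. Qed.

(** * The representative as a limit of dyadic averages *)

Section representative.
Context {R : realType} {n : nat}.
Local Notation V := ('rV[R]_n.+1).
Local Notation L := (lebesgue_space R n).
Local Notation mu := (lebesgueN R n).
Local Notation e_ i := (delta_mx ord0 i : V).
Local Notation M0 := (@step_mass R n).
Local Notation one := (fun=> 1 : R).
Local Notation none := (fun=> -1 : R).
Implicit Types (x y z : V) (u w : V -> R) (E F : 'I_n.+1 -> R -> R).
Implicit Types lo hi : 'I_n.+1 -> R.

(** Dilating the kernel by 1/2 is the same as passing from scale 2^-k to 2^-(k+1), so consecutive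
    averages are compared as two kernels at one scale. *)
Definition dilf E : 'I_n.+1 -> R -> R := aff 2^-1 0 E.

Lemma aff_dilf k x E : aff (2^-1 ^+ k) x (dilf E) = aff (2^-1 ^+ k.+1) x E.
Proof.
apply/funext => j; apply/funext => t; rewrite /dilf /aff mxE subr0 exprS invfM mulrA.
by [].
Qed.

Lemma stepfuns_dilf lo hi E : stepfuns lo hi E ->
  stepfuns (fun j => 2^-1 * lo j) (fun j => 2^-1 * hi j) (dilf E).
Proof.
move=> /(@stepfuns_aff _ _ lo hi E 2^-1 0); rewrite invr_gt0 => /(_ (ltr0n _ _)).
by under [X in stepfuns X _ _]eq_fun do rewrite mxE add0r;
   under [X in stepfuns _ X _]eq_fun do rewrite mxE add0r.
Qed.

Definition good (Om : set V) x (k : nat) := forall z, `|z| <= 2^-1 ^+ k -> Om (x + z).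

Lemma good_box Om x k j : good Om x k -> (k <= j)%N -> box_in Om none one x (2^-1 ^+ j).
Proof.
move=> gx kj z /nout1 z1; apply: gx; rewrite normrZ ger0_norm ?exprn_ge0//.
apply: (@le_trans _ _ (2^-1 ^+ j)); first by rewrite ler_piMr ?exprn_ge0.
by rewrite ler_wiXn2l// invf_le1// ler1n.
Qed.

Lemma good_mono Om x k j : good Om x k -> (k <= j)%N -> good Om x j.
Proof.
move=> gx kj z zj; apply: gx; apply: le_trans zj _.
by rewrite ler_wiXn2l// invf_le1// ler1n.
Qed.

Lemma near_good Om x : open Om -> Om x ->
  exists k, \forall y \near x, good Om y k.
Proof.
move=> oO Ox; have /nbhs_ballP[r /= r0 hr] : nbhs x Om by exact: open_nbhs_nbhs.
have [k hk] := half_expn_le (divr_gt0 r0 (ltr0n R 3)).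
exists k; have r2 : 0 < r / 2 by rewrite divr_gt0.
have := near_dist x r2; apply: filterS => y yx z zk; apply: hr.
rewrite -ball_normE /= distrC.
have -> : y + z - x = (y - x) + z by rewrite addrAC.
apply: le_lt_trans (ler_normD _ _) _.
have h : r / 3 < r / 2 by rewrite ltr_pM2l// ltf_pV2 ?posrE// ltr_nat.
by move: (le_trans zk hk) => h2; lra.
Qed.

Lemma box_in_interior Om lo hi x : open Om -> Om x ->
  exists k0, forall k, (k0 <= k)%N -> box_in Om lo hi x (2^-1 ^+ k).
Proof.
move=> oO Ox; have [k hk] := near_good oO Ox.
have gk := nbhs_singleton hk.
pose B := boxM lo hi + 1.
have B0 : 0 < B by rewrite ltr_wpDl// boxM_ge0.
have [i hi'] := half_expn_le (divr_gt0 (exprn_gt0 k (divr_gt0 ltr01 (ltr0n R 2))) B0).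
exists i => j ij z zo; apply: gk.
have zB : `|z| <= B.
  rewrite leNgt; apply/negP => Bz; apply: zo; apply: outboxM.
  by apply: lt_trans Bz; rewrite ltrDl.
rewrite normrZ ger0_norm ?exprn_ge0//.
apply: (@le_trans _ _ (2^-1 ^+ i * B)).
  by apply: ler_pM => //; rewrite ler_wiXn2l// invf_le1// ler1n.
by rewrite -ler_pdivlMr// -[X in X ^+ k]mul1r.
Qed.

Lemma stepfuns_bumpf_dilf : stepfuns none one (dilf (bumpf : 'I_n.+1 -> R -> R)).
Proof.
apply: stepfuns_widen (stepfuns_dilf stepfuns_bumpf) => j; lra.
Qed.

(* A kernel that sees only Om from every point of closure Om near x0. *)
Definition cone_at (Om : set V) x0 := exists lo hi E (r : R) (k0 : nat),
  [/\ stepfuns lo hi E, stepfuns lo hi (dilf E), 0 < r &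
   forall y k, closure Om y -> `|y - x0| < r -> (k0 <= k)%N -> box_in Om lo hi y (2^-1 ^+ k)].

Lemma cone_interior Om x : open Om -> Om x -> cone_at Om x.
Proof.
move=> oO Ox; have [k hk] := near_good oO Ox.
have /nbhs_ballP[r /= r0 hr] := hk.
exists none, one, bumpf, r, k; split => //.
- exact: stepfuns_bumpf.
- exact: stepfuns_bumpf_dilf.
move=> y j _ yx kj; apply: good_box kj; apply: hr.
by rewrite -ball_normE /= distrC.
Qed.

Lemma mo_dilf u k E x : mo u (2^-1 ^+ k) (dilf E) c1 x = mo u (2^-1 ^+ k.+1) E c1 x.
Proof. by rewrite /mo aff_dilf. Qed.

Hypothesis mu_pos : forall A : set V, open A -> A !=set0 -> (0 < mu A)%E.
Variables (Om : set V) (m : R).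
Hypothesis mn : n.+1%:R < m.
Hypothesis oO : open Om.

Definition wpair u (g : 'I_n.+1 -> V -> R) := [/\ mu.-integrable [set: L] (EFin \o u),
  (forall i, wderiv Om i u (g i)), (forall i, mu.-integrable [set: L] (EFin \o g i)) &
  (forall i, mu.-integrable [set: L] (EFin \o (fun x => `|g i x| `^ m)))].

Lemma geometric_lim (a : nat -> R) (C th : R) k0 : 0 <= C -> 0 <= th -> th < 1 ->
  (forall k, (k0 <= k)%N -> `|a k.+1 - a k| <= C * th ^+ k) ->
  forall k, (k0 <= k)%N -> `|a k - lim (a @ \oo)| <= C / (1 - th) * th ^+ k.
Proof.
move=> C0 th0 th1 ha; have [l hl] := geometric_cvg C0 th0 th1 ha.
suff -> : lim (a @ \oo) = l by [].
apply: cvg_lim => //; apply/cvgrPdist_le => e e0.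
have [k1 hk1] := geometric_to0 (C / (1 - th)) th0 th1 e0.
exists (maxn k0 k1) => //= k /=; rewrite geq_max => /andP[h0 h1].
by rewrite distrC; apply: le_trans (hl k h0) (hk1 k h1).
Qed.

Definition limE u E x : R := lim ((fun k => mo u (2^-1 ^+ k) E c1 x) @ \oo).

Lemma limE_rate u g lo hi E : wpair u g -> stepfuns lo hi E -> stepfuns lo hi (dilf E) ->
  exists C th : R, [/\ 0 <= C, 0 <= th, th < 1 & forall x k0,
    (forall k, (k0 <= k)%N -> box_in Om lo hi x (2^-1 ^+ k)) ->
    forall k, (k0 <= k)%N -> `|mo u (2^-1 ^+ k) E c1 x - limE u E x| <= C * th ^+ k].
Proof.
move=> [iu ug ig igm] sE sD.
have [C [th [C0 th0 th1 hC]]] := morrey_rate mn sE sD iu ug ig igm.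
exists (C / (1 - th)), th; split => //; first by rewrite divr_ge0// subr_ge0 ltW.
move=> x k0 bx; apply: geometric_lim => // k hk.
by rewrite -mo_dilf distrC; apply: hC; exact: bx.
Qed.

(** At an interior point every box fits in [Om] at small scales, in particular one containing both
    supports, and the two averages are compared there scale by scale. So the representative, defined
    with [bumpf], can be computed with the kernel of a cone. *)
Lemma limE_eq u g lo hi E lo' hi' F x : wpair u g -> stepfuns lo hi E -> stepfuns lo hi (dilf E) ->
  stepfuns lo' hi' F -> stepfuns lo' hi' (dilf F) -> Om x -> limE u E x = limE u F x.
Proof.
move=> ug sE sDE sF sDF Ox.
have [C1 [t1 [C10 t10 t11 h1]]] := limE_rate ug sE sDE.
have [C2 [t2 [C20 t20 t21 h2]]] := limE_rate ug sF sDF.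
pose l j := Num.min (lo j) (lo' j); pose h j := Num.max (hi j) (hi' j).
have sE' : stepfuns l h E by apply: stepfuns_widen sE => j; rewrite ?ge_min ?le_max lexx.
have sF' : stepfuns l h F by apply: stepfuns_widen sF => j; rewrite ?ge_min ?le_max lexx orbT.
have [iu wd ig igm] := ug.
have [C3 [t3 [C30 t30 t31 h3]]] := morrey_rate mn sE' sF' iu wd ig igm.
have [k1 b1] := box_in_interior lo hi oO Ox.
have [k2 b2] := box_in_interior lo' hi' oO Ox.
have [k3 b3] := box_in_interior l h oO Ox.
apply/eqP; rewrite -subr_eq0 -normr_le0; apply/ler_addgt0Pr => e e0; rewrite add0r.
have e3 : 0 < e / 3 by rewrite divr_gt0.
have [j1 q1] := geometric_to0 C1 t10 t11 e3.
have [j2 q2] := geometric_to0 C2 t20 t21 e3.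
have [j3 q3] := geometric_to0 C3 t30 t31 e3.
have [k [[kk1 kk2 kk3] [kj1 kj2 kj3]]] := common_bound6 k1 k2 k3 j1 j2 j3.
have r1 := le_trans (h1 x k1 b1 k kk1) (q1 k kj1).
have r2 := le_trans (h2 x k2 b2 k kk2) (q2 k kj2).
have r3 := le_trans (h3 x k (b3 k kk3)) (q3 k kj3).
rewrite distrC in r3; have := three_dist r1 r2 r3; move=> H; apply: le_trans H _.
by rewrite [leRHS](_ : _ = e / 3 + e / 3 + e / 3)//; field.
Qed.

(** Total, with the default value of [lim] where the averages do not converge; at points of [Om]
    they do, for the weakly differentiable functions at hand. *)
Definition c0repr u x : R := limE u bumpf x / M0.

Lemma repr_rate u g : wpair u g -> exists C th : R, [/\ 0 <= C, 0 <= th, th < 1 &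
  forall x k, good Om x k -> `|mo u (2^-1 ^+ k) bumpf c1 x / M0 - c0repr u x| <= C * th ^+ k].
Proof.
move=> ug; have [C [th [C0 th0 th1 h]]] := limE_rate ug stepfuns_bumpf stepfuns_bumpf_dilf.
have m0 := step_mass_gt0 mu_pos.
exists (C / M0), th; split=> //; first by rewrite divr_ge0// ltW.
move=> x k gx; rewrite /c0repr -mulrBl normrM [`|M0^-1|]gtr0_norm ?invr_gt0// mulrAC.
rewrite ler_pM2r ?invr_gt0//; apply: (h x k) => // j kj; exact: good_box gx kj.
Qed.

(** With the cone kernel the averages converge at a rate uniform over the points of the closure near
    [x0], and each average is continuous in its centre; hence the limits are continuous at [x0]. *)
Lemma repr_limit u g x0 : wpair u g -> closure Om x0 -> cone_at Om x0 ->
  exists l, forall e : R, 0 < e -> exists2 d, 0 < d &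
    forall y, Om y -> `|y - x0| < d -> `|c0repr u y - l| <= e.
Proof.
move=> ug clx [lo [hi [E [r [k0 [sE sD r0 hc]]]]]].
have m0 := step_mass_gt0 mu_pos.
have [C [th [C0 th0 th1 h]]] := limE_rate ug sE sD.
exists (limE u E x0 / M0) => e e0.
have e3 : 0 < M0 * e / 3 by rewrite divr_gt0// mulr_gt0.
have [j q] := geometric_to0 C th0 th1 e3.
pose k := (k0 + j)%N.
have kk0 : (k0 <= k)%N by exact: leq_addr.
have iu : mu.-integrable [set: L] (EFin \o u) by case: ug.
have cE : cinfs E by case: sE.
have cm := @cont_mo R n u (2^-1 ^+ k) iu E c1 (boxM lo hi) cE (fun z => prodf_step0M (c := c1) sE (fun=> isT)).
have /(@cvgrPdist_le R R^o V (nbhs x0) _ _ _) /(_ _ e3) := cm x0.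
move=> /nbhs_ballP[d /= d0 hd].
exists (Num.min r d); first by rewrite lt_min r0.
move=> y Oy; rewrite lt_min => /andP[yr yd].
have y1 := h y k0 (fun k => hc y k (subset_closure Oy) yr) k kk0.
have x1 : forall k, (k0 <= k)%N -> box_in Om lo hi x0 (2^-1 ^+ k).
  by move=> i; apply: hc => //; rewrite subrr normr0.
have {}x1 := h x0 k0 x1 k kk0.
have kq := q k (leq_addl _ _).
have yx : `|mo u (2^-1 ^+ k) E c1 x0 - mo u (2^-1 ^+ k) E c1 y| <= M0 * e / 3.
  by apply: hd; rewrite -ball_normE /= distrC.
rewrite /c0repr -(limE_eq ug sE sD stepfuns_bumpf stepfuns_bumpf_dilf Oy) -mulrBl normrM.
rewrite [`|M0^-1|]gtr0_norm ?invr_gt0// ler_pdivrMr// mulrC.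
have := three_dist (le_trans y1 kq) (le_trans x1 kq) yx; move=> H; apply: le_trans H _.
by rewrite [leRHS](_ : _ = M0 * e / 3 + M0 * e / 3 + M0 * e / 3)//; move: (M0) => t; field.
Qed.

(** At a point y of the closure the extension is compared with its value at x through a nearby point
    of [Om], where [w] is close to both limits. *)
Lemma extend_closure w : (forall x, closure Om x -> exists l, forall e : R, 0 < e ->
    exists2 d, 0 < d & forall y, Om y -> `|y - x| < d -> `|w y - l| <= e) ->
  exists w' : V -> R, {within closure Om, continuous w'} /\ forall x, Om x -> w' x = w x.
Proof.
move=> hw.
have [w' hw'] : {w' : V -> R & forall x, closure Om x -> forall e : R, 0 < e ->
    exists2 d, 0 < d & forall y, Om y -> `|y - x| < d -> `|w y - w' x| <= e}.
  apply: (@choice _ _ (fun x l => closure Om x -> forall e : R, 0 < e ->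
    exists2 d, 0 < d & forall y, Om y -> `|y - x| < d -> `|w y - l| <= e)) => x.
  have [/hw[l hl]|nx] := pselect (closure Om x); last by exists 0.
  by exists l.
exists w'; split; last first.
  move=> x Ox; apply/eqP; rewrite -subr_eq0 -normr_le0; apply/ler_addgt0Pr => e e0.
  have [d d0 hd] := hw' x (subset_closure Ox) e e0.
  by rewrite add0r distrC; apply: hd => //; rewrite subrr normr0.
apply/subspace_continuousP => x clx; apply/(@cvgrPdist_le R R^o) => e e0.
have e2 : 0 < e / 2 by rewrite divr_gt0.
have [d d0 hd] := hw' x clx _ e2.
have d2 : 0 < d / 2 by rewrite divr_gt0.
have := near_dist x d2.
apply: filterS => y yx cly.
have [d' d'0 hd'] := hw' y cly _ e2.
have d3 : 0 < Num.min d' (d / 2) by rewrite lt_min d'0.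
have [z [Oz /=]] := cly _ (near_dist y d3); rewrite lt_min => /andP[zd' zd].
have h1 := hd' z Oz zd'.
have h2 : `|w z - w' x| <= e / 2.
  apply: hd => //; have -> : z - x = (z - y) + (y - x) by rewrite addrA subrK.
  by apply: le_lt_trans (ler_normD _ _) _; rewrite [ltRHS]splitr ltrD.
have -> : w' x - w' y = (w z - w' y) - (w z - w' x).
  by rewrite opprB [RHS]addrC addrA subrK.
apply: le_trans (ler_normB _ _) _; rewrite [leRHS]splitr.
exact: (lerD h1 h2).
Qed.

Lemma repr_cont u g x : wpair u g -> Om x -> forall e : R, 0 < e ->
  \forall y \near x, `|c0repr u y - c0repr u x| <= e.
Proof.
move=> ug Ox e e0; have e2 : 0 < e / 2 by rewrite divr_gt0.
have [l hl] := repr_limit ug (subset_closure Ox) (cone_interior oO Ox).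
have [d d0 hd] := hl _ e2.
have h1 := near_dist x d0.
have h2 : \forall y \near x, Om y by exact: open_nbhs_nbhs.
apply: filterS2 h1 h2 => y yx Oy.
have a1 := hd y Oy yx; have a2 := hd x Ox _; rewrite subrr normr0 in a2.
have -> : c0repr u y - c0repr u x = (c0repr u y - l) - (c0repr u x - l) by rewrite opprB addrA subrK.
apply: le_trans (ler_normB _ _) _; rewrite [leRHS]splitr.
exact: (lerD a1 (a2 d0)).
Qed.

Lemma mo_wderiv u g i x k : (forall i, wderiv Om i u (g i)) -> good Om x k ->
  - mo u (2^-1 ^+ k) bumpf (cS c1 i) x = mo (g i) (2^-1 ^+ k) bumpf c1 x.
Proof.
move=> wd gx; have e0 : 0 < 2^-1 ^+ k :> R by rewrite exprn_gt0.
have sA := stepfuns_aff x e0 (@stepfuns_bumpf R n).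
have cB : cinfs (bumpf : 'I_n.+1 -> R -> R) by case: (@stepfuns_bumpf R n).
rewrite /mo (wd i _ _ [set y | ~ outbox (fun j => x ord0 j + 2^-1 ^+ k * -1) (fun j => x ord0 j + 2^-1 ^+ k * 1) y]) ?opprK//.
- exact: cinfs_aff.
- exact: compact_box.
- move=> y /= /(contra_not (outbox_aff _ _ _ _ e0).2) /nout1 h.
  have -> : y = x + (y - x) by rewrite addrCA subrr addr0.
  apply: gx; move: h; rewrite normrZ ger0_norm ?invr_ge0 ?(ltW e0)//.
  by rewrite ler_pdivrMl// mulr1.
- by move=> y /contrapT; exact: (prodf_step0 sA).
Qed.

(** Near x the mollification of [u] has the mollifications of the [g i] as partial derivatives. On a
    fixed ball and for large k these are within [e'] of their values in the limit at x;
    [increment_le] then bounds the increment of the mollification, and the bound passes to the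
    limit. *)
Lemma repr_diff u g h x : wpair u g -> (forall i, wpair (g i) (h i)) -> Om x ->
  differentiable (c0repr u) x /\ grad (c0repr u) x = \row_i c0repr (g i) x.
Proof.
move=> ug gh Ox; have m0 := step_mass_gt0 mu_pos.
set A : V := \row_i c0repr (g i) x.
suff H : forall e : R, 0 < e -> \forall v \near (0 : V),
     `|c0repr u (x + v) - c0repr u x - lform A v| <= e * `|v|.
  have [d1 d2] := differentiable_increment H.
  by split => //; exact: (grad_lform d1 d2).
move=> e e0.
have N0 : 0 < n.+1%:R :> R by rewrite ltr0n.
pose e' := e / n.+1%:R; have e'0 : 0 < e' by rewrite divr_gt0.
have [k0 hk0] := near_good oO Ox.
have e2 : 0 < e' / 2 by rewrite divr_gt0.
have near_i i : \forall y \near x, `|c0repr (g i) y - c0repr (g i) x| <= e' / 2.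
  exact: (repr_cont (gh i) Ox e2).
have nearA : \forall y \near x, forall i, `|c0repr (g i) y - c0repr (g i) x| <= e' / 2.
  exact: (@filter_forall _ _ (fun i y => `|c0repr (g i) y - c0repr (g i) x| <= e' / 2) (nbhs x) _).
have /nbhs_ballP[r /= r0 hr] : nbhs x [set y | good Om y k0 /\ forall i, `|c0repr (g i) y - c0repr (g i) x| <= e' / 2].
  exact: filterS2 hk0 nearA.
have rates i := repr_rate (gh i).
have [Cu [tu [Cu0 tu0 tu1 hu]]] := repr_rate ug.
have r_ball y : `|y - x| < r -> good Om y k0 /\ forall i, `|c0repr (g i) y - c0repr (g i) x| <= e' / 2.
  by move=> yx; apply: hr; rewrite -ball_normE /= distrC.
have := near_dist (0 : V) r0; apply: filterS => v; rewrite subr0 => vr.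
(* The margin [eta] pays for replacing [u] by its mollification at two points; the scale depends on
   [eta], whereas the radius [r] does not. *)
apply/ler_addgt0Pr => eta eta0.
have eta2 : 0 < eta / 2 by rewrite divr_gt0.
have [ku qu] := geometric_to0 Cu tu0 tu1 eta2.
have [ki qi] : exists ki, forall i k y, (ki <= k)%N -> good Om y k ->
    `|mo (g i) (2^-1 ^+ k) bumpf c1 y / M0 - c0repr (g i) y| <= e' / 2.
  have : forall i, exists ki, forall k y, (ki <= k)%N -> good Om y k ->
      `|mo (g i) (2^-1 ^+ k) bumpf c1 y / M0 - c0repr (g i) y| <= e' / 2.
    move=> i; have [C [t [C0 t0 t1 hC]]] := rates i.
    have [j q] := geometric_to0 C t0 t1 e2.
    by exists j => k y jk gy; apply: le_trans (hC y k gy) (q k jk).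
  move=> /choice[f hf]; exists (\sum_i f i)%N => i k y fk; apply: hf.
  by apply: leq_trans fk; rewrite (bigD1 i)//= leq_addr.
have [k [[kk0 kku kki] _]] := common_bound6 k0 ku ki 0 0 0.
pose H y := M0^-1 * mo u (2^-1 ^+ k) bumpf c1 y.
have HE y : H y = mo u (2^-1 ^+ k) bumpf c1 y / M0 by rewrite /H mulrC.
pose H1 i y := M0^-1 * (- mo u (2^-1 ^+ k) bumpf (cS c1 i) y).
have iu : mu.-integrable [set: L] (EFin \o u) by case: ug.
have wd : forall i, wderiv Om i u (g i) by case: ug.
have cB : cinfs (bumpf : 'I_n.+1 -> R -> R) by case: (@stepfuns_bumpf R n).
have dH y i : `|y - x| < r -> is_derive y (e_ i) H (H1 i y).
  move=> _; apply: drvZ.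
  exact: (drv_mo (2^-1 ^+ k) iu i y cB (fun z => prodf_step0M (c := c1) (@stepfuns_bumpf R n) (fun=> isT))).
have H1A y i : `|y - x| < r -> `|H1 i y - A ord0 i| <= e'.
  move=> yx; have [gy hy] := r_ball y yx.
  have gyk := good_mono gy kk0.
  rewrite /H1 (mo_wderiv i wd gyk) mulrC mxE.
  have a1 := qi i k y kki gyk; have a2 := hy i.
  rewrite -(subrKA (c0repr (g i) y)).
  apply: le_trans (ler_normD _ _) _; rewrite [leRHS]splitr.
  exact: (lerD a1 a2).
have inc := increment_le dH H1A vr.
have [gx _] := r_ball x ltac:(by rewrite subrr normr0).
have [gv _] := r_ball (x + v) ltac:(by rewrite addrAC subrr add0r).
have b1 := le_trans (hu x k (good_mono gx kk0)) (qu k kku).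
have b2 := le_trans (hu (x + v) k (good_mono gv kk0)) (qu k kku).
rewrite -HE in b1; rewrite -HE in b2; clearbody H.
rewrite (subr_insert _ _ (H (x + v)) (H x)).
apply: le_trans (ler_normD _ _) _; apply: lerD.
  by apply: le_trans inc _; rewrite /e' mulrC [n.+1%:R * _]mulrC divfK ?gt_eqF// mulrC.
apply: le_trans (ler_normB _ _) _; rewrite [leRHS]splitr.
exact: (lerD b1 b2).
Qed.

End representative.

(** * Representatives *)

Section fundamental_lemma.
Context {R : realType} {n : nat}.
Local Notation V := ('rV[R]_n.+1).
Local Notation L := (lebesgue_space R n).
Local Notation mu := (lebesgueN R n).
Implicit Types (x y z : V) (f g phi : V -> R) (A U : set V) (M : R).

Lemma Rintegral_dominated_cvg (f_ : nat -> V -> R) f g :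
  (forall k, measurable_fun [set: L] (f_ k : L -> R)) ->
  measurable_fun [set: L] (f : L -> R) ->
  {ae mu, forall x, f_ ^~ x @ \oo --> f x} ->
  mu.-integrable [set: L] (EFin \o g) -> (forall k x, `|f_ k x| <= g x) ->
  (fun k => \int[mu]_x f_ k x) @ \oo --> \int[mu]_x f x.
Proof.
move=> mf_ mf cf ig fg.
have a1 : {ae mu, forall x, setT x -> (fun k => (EFin \o f_ k) x) @ \oo --> (EFin \o f) x}.
  by apply: (@filterS _ _ (ae_filter_ringOfSetsType mu) _ _ _ cf) => x cx _; apply: cvg_comp cx _; exact: cvg_id.
have a2 : {ae mu, forall x k, setT x -> (`|(EFin \o f_ k) x| <= (EFin \o g) x)%E}.
  by apply: aeW => x k _; rewrite /= lee_fin.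
have [h1 _ h2] := @dominated_convergence _ L R mu setT (@measurableT _ L)
  (fun k => EFin \o f_ k) (EFin \o f) (EFin \o g)
  (fun k => proj2 (measurable_EFinP _ _) (mf_ k)) (proj2 (measurable_EFinP _ _) mf) a1 ig a2.
apply: fine_cvg; rewrite fineK//.
exact: integrable_fin_num.
Qed.

Lemma Rintegral_restrict A f : \int[mu]_(x in (A : set L)) f x = \int[mu]_x (f x * \1_A x).
Proof.
rewrite /Rintegral integral_mkcond; congr fine; apply: eq_integral => x _.
by rewrite patchE indicE; case: ifPn => _; rewrite ?mulr1 ?mulr0.
Qed.

(** An enumeration of rational balls; a code that is invalid, or whose closed ball is not contained
    in [A], gets radius -1 and so denotes the empty ball. *)
Lemma open_rational_balls A : open A -> exists (c : nat -> V) (r : nat -> R),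
  (forall k x, `|x - c k| <= r k -> A x) /\
  (forall x, A x -> exists k, `|x - c k| < r k).
Proof.
move=> oA.
pose cc (z : 'rV[rat]_n.+1) : V := map_mx ratr z.
pose rr k : R := k.+1%:R^-1.
pose P (zk : 'rV[rat]_n.+1 * nat) := `[< forall x, `|x - cc zk.1| <= rr zk.2 -> A x >].
pose F k := if unpickle k is Some zk then (if P zk then (cc zk.1, rr zk.2) else (0, -1)) else (0, -1).
exists (fun k => (F k).1), (fun k => (F k).2); split.
  move=> k x; rewrite /F; case: (unpickle k) => [zk|]; last first.
    by move=> /= h; have := normr_ge0 (x - 0); lra.
  case: ifPn => [/asboolP h|_]; first exact: h.
  by move=> /= h; have := normr_ge0 (x - 0); lra.
move=> x Ax.
have /nbhs_ballP[e /= e0 eA] : nbhs x A by exact: open_nbhs_nbhs.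
have [k ke] : exists k, rr k < e / 2.
  exists (Num.truncn (e / 2)^-1).
  rewrite /rr invf_plt ?posrE ?divr_gt0//.
  exact: truncnS_gt.
have rk0 : 0 < rr k by rewrite invr_gt0.
have /choice[z zP] : forall i : 'I_n.+1, exists q : rat, x ord0 i - rr k < ratr q < x ord0 i + rr k.
  move=> i; have [q] := @rat_in_itvoo R (x ord0 i - rr k) (x ord0 i + rr k) ltac:(lra).
  by rewrite in_itv => ?; exists q.
have xz : `|x - cc (\row_i z i)| < rr k.
  have : ball (cc (\row_i z i)) (rr k) x.
    apply/ballNP => i; rewrite !mxE; have := zP i.
    by move=> /andP[h1 h2]; rewrite ltr_norml; apply/andP; split; lra.
  by rewrite -ball_normE /= distrC.
exists (pickle (\row_i z i, k)); rewrite /F pickleK.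
case: ifPn => //= /asboolP h; exfalso; apply: h => y /= yz; apply: eA.
rewrite -ball_normE /=.
rewrite (_ : x - y = (x - cc (\row_i z i)) - (y - cc (\row_i z i))); last by rewrite opprB addrA subrK.
apply: (le_lt_trans (ler_normB _ _)).
by move: xz yz ke; set a := `|_|; set b := `|_|; set t := rr k; clearbody a b t; lra.
Qed.

Definition tent (c : V) (r : R) x : R := Num.max 0 (r - `|x - c|).

Lemma cont_tent c r : continuous (tent c r).
Proof.
move=> x; rewrite /tent.
apply: (@continuous_max R V (fun=> 0) (fun x => r - `|x - c|)); first exact: cst_continuous.
apply: (@continuousB _ _ _ (fun=> r) (fun x => `|x - c|)); first exact: cst_continuous.
apply: continuous_comp; last exact: norm_continuous.
by apply: (@continuousB _ _ _ id (fun=> c)); [exact: id|exact: cst_continuous].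
Qed.

Lemma tent_ge0 c r x : 0 <= tent c r x.
Proof. by rewrite /tent le_max lexx. Qed.

Lemma tent_gt0 c r x : (0 < tent c r x) = (`|x - c| < r).
Proof. by rewrite /tent lt_max ltxx subr_gt0. Qed.

(** Each approximation is the minimum of 1 and k times a finite sum of tents on balls filling [U]:
    at a point of [U] some tent is positive, and the factor k drives the minimum to 1. *)
Lemma open_indic_cvg U : open U -> exists phi : nat -> V -> R,
  [/\ forall k, continuous (phi k), forall k x, 0 <= phi k x <= 1 &
   forall x, phi ^~ x @ \oo --> (\1_U x : R)].
Proof.
move=> oU; have [c [r [cr1 cr2]]] := open_rational_balls oU.
pose s k x := k%:R * \sum_(i < k) tent (c i) (r i) x.
have s0 k x : 0 <= s k x.
  by apply: mulr_ge0 => //; apply: sumr_ge0 => i _; exact: tent_ge0.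
exists (fun k x => Num.min 1 (s k x)); split.
- move=> k x; apply: (@continuous_min R V (fun=> 1) (s k)); first exact: cst_continuous.
  apply: (@continuousM R V (fun=> k%:R) (fun x => \sum_(i < k) tent (c i) (r i) x)).
    exact: cst_continuous.
  have: continuous (fun x => \sum_(i < k) tent (c i) (r i) x).
    by apply: contS => i; exact: cont_tent.
  exact.
- by move=> k x; rewrite le_min ler01 s0/= ge_min lexx.
- move=> x; rewrite indicE; case: (boolP (x \in U)) => [|xU].
    rewrite inE => /cr2[k kx].
    have t0 : 0 < tent (c k) (r k) x by rewrite tent_gt0.
    apply: cvg_near_cst; near=> j.
    apply/eqP; rewrite eq_le ge_min lexx/= le_min lexx/=.
    have kj : (k < j)%N by near: j; exists k.+1.
    have jt : (tent (c k) (r k) x)^-1 <= j%:R.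
      by near: j; exact: nbhs_infty_ger.
    rewrite /s (bigD1 (Ordinal kj))//= mulrDr.
    apply: (@le_trans _ _ (j%:R * tent (c k) (r k) x)).
      by rewrite -ler_pdivrMr// div1r.
    rewrite lerDl; apply: mulr_ge0 => //; apply: sumr_ge0 => i _; exact: tent_ge0.
  apply: cvg_near_cst; apply: nearW => j; rewrite /s big1 ?mulr0 ?(min_idPr _) ?ler01//.
  move=> i _; apply/eqP; rewrite eq_le tent_ge0 andbT leNgt; apply/negP.
  rewrite tent_gt0 => h; move/negP: xU; apply; rewrite inE.
  by apply: (cr1 i); exact: ltW.
Unshelve. all: by end_near. Qed.

Lemma le_norm_mul1 (a b : R) : `|b| <= 1 -> `|a * b| <= `|a|.
Proof. by move=> b1; rewrite normrM -[leRHS]mulr1 ler_wpM2l. Qed.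

Lemma norm_indic1 A x : `|\1_A x : R| <= 1.
Proof. by rewrite indicE; case: (_ \in _); rewrite ?normr1 ?normr0. Qed.

Lemma integral_open0 f U : mu.-integrable [set: L] (EFin \o f) ->
  (forall phi, continuous phi -> (forall x, 0 <= phi x <= 1) -> \int[mu]_x (f x * phi x) = 0) ->
  open U -> \int[mu]_x (f x * \1_U x) = 0.
Proof.
move=> i_f f0 oU; have [phi [cphi phi01 phic]] := open_indic_cvg oU.
have mf : measurable_fun [set: L] (f : L -> R).
  by apply/measurable_EFinP; exact: measurable_int i_f.
have h : (fun k => \int[mu]_x (f x * phi k x)) @ \oo --> \int[mu]_x (f x * \1_U x).
  apply: (@Rintegral_dominated_cvg _ _ (fun x => `|f x|)).
  - by move=> k; apply: measurable_funM => //; exact: continuous_measurableN.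
  - by apply: (measurable_funM mf); apply: measurable_indic; exact: open_measurableN.
  - apply: nearW => x; apply: cvgM; [exact: cvg_cst|exact: phic].
  - exact: (integrable_norm i_f).
  - move=> k x; apply: le_norm_mul1; have /andP[a b] := phi01 k x.
    by rewrite ger0_norm.
have := cvg_lim _ h; rewrite (_ : (fun k => _) = fun=> 0); last first.
  by apply/funext => k; exact: f0.
by rewrite lim_cst// => <-.
Qed.

Lemma open_forall (T : topologicalType) (I : finType) (F : I -> set T) :
  (forall i, open (F i)) -> open [set x | forall i, F i x].
Proof.
move=> oF; rewrite openE => x Fx; apply: filter_forall => i.
by apply: open_nbhs_nbhs; split.
Qed.

Definition open_box (a b : V) : set V := [set x | forall j, a ord0 j < x ord0 j < b ord0 j].

Lemma open_open_box a b : open (open_box a b).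
Proof.
have oj j : open ((fun x : V => x ord0 j) @^-1` `]a ord0 j, b ord0 j[%classic).
  have /continuousP/(_ `]a ord0 j, b ord0 j[%classic) := @cont_coord R n j.
  by apply; exact: interval_open.
rewrite (_ : open_box a b = [set x : V | forall j, ((fun x : V => x ord0 j) @^-1` `]a ord0 j, b ord0 j[%classic) x]).
  exact: (open_forall oj).
by apply/seteqP; split => x h j; have := h j; rewrite /= in_itv.
Qed.

(** Boxes are open on the lower side, so only the upper corner moves, and the volume is continuous
    in the shift. *)
Lemma box_enlarge (b : V * V) (e : R) : 0 < e ->
  exists b' : V, box b `<=` open_box b.1 b' /\ box_volume (b.1, b') <= box_volume b + e.
Proof.
move=> e0; pose w (t : R) := \prod_(i < n.+1) Num.max 0 (b.2 ord0 i + t - b.1 ord0 i).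
have cw : {for 0, continuous w}.
  rewrite /w /prop_for /=.
  have: forall s : seq 'I_n.+1,
      continuous (fun t : R => \prod_(i <- s) Num.max 0 (b.2 ord0 i + t - b.1 ord0 i)).
    elim=> [|i s IH].
      rewrite (_ : (fun t : R => _) = fun=> 1); first exact: cst_continuous.
      by apply/funext => r; rewrite big_nil.
    rewrite (_ : (fun t : R => _) = fun t : R => Num.max 0 (b.2 ord0 i + t - b.1 ord0 i) *
      \prod_(i <- s) Num.max 0 (b.2 ord0 i + t - b.1 ord0 i)); last first.
      by apply/funext => r; rewrite big_cons.
    move=> t; apply: cvgM; last exact: IH.
      apply: (@continuous_max R R (fun=> 0) _ t); first exact: cst_continuous.
      apply: (@continuousB _ _ _ (fun t : R => b.2 ord0 i + t) (fun=> b.1 ord0 i)); last exact: cst_continuous.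
      by apply: (@continuousD _ _ _ (fun=> b.2 ord0 i) id); [exact: cst_continuous|exact: id].
  exact.
have /(_ _ _ e0)[d /= d0 dw] := proj1 (@cvgrPdist_lt R R^o R (nbhs 0) _ w (w 0)) cw.
exists (\row_i (b.2 ord0 i + d / 2)); split.
  by move=> x h j; have := h j; rewrite !mxE => /andP[-> h2]/=; lra.
have := dw (d / 2); rewrite /= sub0r normrN gtr0_norm ?divr_gt0//.
move=> /(_ ltac:(lra)) h.
have -> : box_volume (b.1, \row_i (b.2 ord0 i + d / 2)) = w (d / 2).
  by rewrite /box_volume; apply: eq_bigr => i _; rewrite mxE.
have -> : box_volume b = w 0 by rewrite /box_volume; apply: eq_bigr => i _; rewrite addr0.
move: h; rewrite distrC => /ltr_normlW; lra.
Qed.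

Lemma open_cover A (e : R) : 0 < e -> (mu A < +oo)%E ->
  exists U, [/\ open U, A `<=` U & (mu U <= mu A + e%:E)%E].
Proof.
move=> e0 Aoo.
have e20 : 0 < e / 2 by rewrite divr_gt0.
have [B AB sB] := lebesgueN_leP e20 Aoo.
have /choice[b' bP] : forall k, exists b' : V, box (B k) `<=` open_box (B k).1 b' /\
    box_volume ((B k).1, b') <= box_volume (B k) + e / 2 / (2 ^ k.+1)%:R.
  by move=> k; apply: box_enlarge; rewrite divr_gt0// ltr0n expn_gt0.
exists (\bigcup_k open_box (B k).1 (b' k)); split.
- by apply: bigcup_open => k _; exact: open_open_box.
- by move=> x /AB[k _ xk]; exists k => //; exact: (bP k).1.
apply: (@le_trans _ _ (\sum_(k <oo) (box_volume ((B k).1, b' k))%:E)%E).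
  apply: ereal_inf_lbound; exists (fun k => ((B k).1, b' k)) => //.
  by move=> x [k _ h]; exists k => // j; have /andP[-> /ltW->] := h j.
apply: (@le_trans _ _ (\sum_(k <oo) ((box_volume (B k))%:E + (e / 2 / (2 ^ k.+1)%:R)%:E))%E).
  apply: lee_nneseries => k _; first by rewrite lee_fin box_volume_ge0.
  by rewrite -EFinD lee_fin (bP k).2.
apply: (le_trans (epsilon_trick _ _ _)) => //.
- by move=> k; rewrite lee_fin box_volume_ge0.
- exact: ltW.
apply: (@le_trans _ _ (mu A + (e / 2)%:E + (e / 2)%:E)%E); first exact: leeD2r.
by rewrite -addeA -EFinD -splitr.
Qed.

(** The vanishing of the integrals passes from continuous functions to open sets by
    [open_indic_cvg], and from open sets to measurable ones by outer regularity. *)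
Lemma ae_eq0_test f M : mu.-integrable [set: L] (EFin \o f) -> (forall x, M < `|x| -> f x = 0) ->
  (forall phi, continuous phi -> (forall x, 0 <= phi x <= 1) -> \int[mu]_x (f x * phi x) = 0) ->
  {ae mu, forall x, f x = 0}.
Proof.
move=> i_f fM f0.
have mf : measurable_fun [set: L] (f : L -> R).
  by apply/measurable_EFinP; exact: measurable_int i_f.
have mD := @measurable_normV_le R n M.
suff : ae_eq mu (cubeN M : set L) (EFin \o f) (cst 0%E).
  apply: filterS => x h; case: (leP `|x : V| M) => [xM|/fM//].
  by have /= [] := h xM.
apply: integral_ae_eq => //.
  by apply: integrableS i_f => //; exact: measurableT.
move=> E ED mE.
rewrite integral0.
have Eoo : (mu E < +oo)%E.
  apply: le_lt_trans (lebesgueN_normV_lty M); apply: le_measure => //; rewrite inE//.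
have i_fE : mu.-integrable (E : set L) (EFin \o f) by apply: integrableS i_f => //; exact: measurableT.
suff h : \int[mu]_(x in (E : set L)) f x = 0.
  rewrite -[LHS]fineK; last exact: integrable_fin_num.
  by rewrite -[fine _]/(\int[mu]_(x in (E : set L)) f x) h.
rewrite Rintegral_restrict.
have /choice[U UP] : forall k : nat, exists U, [/\ open U, E `<=` U & (mu U <= mu E + (k.+1%:R^-1)%:E)%E].
  by move=> k; apply: open_cover.
(* Finite intersections make the open sets decrease; their indicators converge to that of [E]
   outside a null set. *)
pose W k := \bigcap_(i in [set i | (i <= k)%N]) U i.
have oW k : open (W k).
  rewrite (_ : W k = [set x | forall i : 'I_k.+1, U i x]).
    by apply: open_forall => i; have [] := UP i.
  apply/seteqP; split => x h i; first by apply: h => /=; rewrite -ltnS.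
  by move=> /= ik; have := h (Ordinal (ik : (i < k.+1)%N)).
have h : (fun k => \int[mu]_x (f x * \1_(W k) x)) @ \oo --> \int[mu]_x (f x * \1_E x).
  apply: (@Rintegral_dominated_cvg _ _ (fun x => `|f x|)).
  - by move=> k; apply: (measurable_funM mf); apply: measurable_indic; exact: open_measurableN.
  - by apply: measurable_funM => //; exact: measurable_indic.
  - exists ((\bigcap_k U k) `\` E); split.
    + apply: measurableD => //; apply: bigcapT_measurable => k; apply: open_measurableN.
      by have [] := UP k.
    + apply/eqP; rewrite eq_le measure_ge0 andbT.
      apply/lee_addgt0Pr => e e0; rewrite add0e.
      have [k ke] : exists k : nat, k.+1%:R^-1 < e.
        by exists (Num.truncn e^-1); rewrite invf_plt ?posrE// truncnS_gt.
      have [oU EU mU] := UP k.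
      apply: (@le_trans _ _ (mu (U k `\` E))).
        apply: le_measure; rewrite ?inE.
        - apply: measurableD => //; apply: bigcapT_measurable => j; apply: open_measurableN.
          by have [] := UP j.
        - by apply: measurableD => //; exact: open_measurableN.
        - by apply: setSD => x h; exact: (h k).
      rewrite measureD//; last 2 first.
      - exact: open_measurableN.
      - by apply: (le_lt_trans mU); rewrite lte_add_pinfty// ltry.
      rewrite (setIidr EU) leeBlDr; last by rewrite ge0_fin_numE.
      apply: (le_trans mU); rewrite [leRHS]addeC; apply: leeD2l.
      by rewrite lee_fin ltW.
    + move=> x /= nx; apply: contrapT => nUE; apply: nx.
      apply: cvgM; first exact: cvg_cst.
      case: (pselect (E x)) => Ex.
        rewrite indicE mem_set//; apply: cvg_near_cst; apply: nearW => k.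
        rewrite indicE mem_set// => i _; by have [_ + _] := UP i; apply.
      have [i nUi] : exists i, ~ U i x.
        apply: contrapT => /forallNP h; apply: nUE; split => // i _.
        by apply: contrapT; exact: h.
      rewrite [\1_E x]indicE memNset//; apply: cvg_near_cst; near=> k.
      rewrite indicE memNset// => /(_ i) h; apply: nUi; apply: h => /=.
      by near: k; exists i.
  - exact: (integrable_norm i_f).
  - move=> k x; apply: le_norm_mul1; exact: norm_indic1.
have := cvg_lim _ h; rewrite (_ : (fun k => _) = fun=> 0); last first.
  by apply/funext => k; exact: integral_open0.
by rewrite lim_cst// => <-.
Unshelve. all: by end_near. Qed.

End fundamental_lemma.

Section sigma_finite_lebesgueN.
Context {R : realType} {n : nat}.
Local Notation L := (lebesgue_space R n).
Local Notation mu := (lebesgueN R n).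

Lemma sigma_finite_lebesgueN : sigma_finite [set: L] mu.
Proof.
exists (fun k : nat => (cubeN k%:R : set L)).
  apply/seteqP; split => // x _; exists (Num.bound `|x : 'rV[R]_n.+1|) => //.
  by rewrite /cubeN /=; apply: ltW; exact: archi_boundP.
by move=> k; split; [exact: measurable_normV_le|exact: lebesgueN_normV_lty].
Qed.

(* A copy of mu that carries the sigma-finite structure needed by Fubini; the
   integrals with respect to both are convertible. *)
Definition sf_lebesgueN : set L -> \bar R := mu.
Let sf0 : sf_lebesgueN set0 = 0%E. Proof. exact: measure0. Qed.
Let sf_ge0 A : (0 <= sf_lebesgueN A)%E. Proof. exact: measure_ge0. Qed.
Let sf_additive : semi_sigma_additive sf_lebesgueN.
Proof. exact: measure_semi_sigma_additive. Qed.
HB.instance Definition _ := isMeasure.Build _ L R sf_lebesgueN sf0 sf_ge0 sf_additive.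
HB.instance Definition _ :=
  Measure_isSigmaFinite.Build _ L R sf_lebesgueN sigma_finite_lebesgueN.

End sigma_finite_lebesgueN.

(** * Fubini for a bounded kernel *)

Section fubini_kernel.
Context d (T : measurableType d) (R : realType) (m : {sigma_finite_measure set T -> \bar R}).
Variables (f phi : T -> R) (k : T * T -> R) (C : R).
Hypothesis i_f : m.-integrable setT (EFin \o f).
Hypothesis iphi : m.-integrable setT (EFin \o phi).
Hypothesis mk : measurable_fun setT k.
Hypothesis kC : forall z, `|k z| <= C.

Let mf : measurable_fun setT f.
Proof. by apply/measurable_EFinP; exact: measurable_int i_f. Qed.

Let mphi : measurable_fun setT phi.
Proof. by apply/measurable_EFinP; exact: measurable_int iphi. Qed.

Let h (xy : T * T) : \bar R := (f xy.2 * k xy * phi xy.1)%:E.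

Let mh : measurable_fun setT h.
Proof.
apply/measurable_EFinP; apply: measurable_funM; last exact: measurableT_comp mphi measurable_fst.
by apply: measurable_funM => //; exact: measurableT_comp mf measurable_snd.
Qed.

Let abs_int (g : T -> R) : m.-integrable setT (EFin \o g) ->
  [/\ measurable_fun setT (fun x => `|(g x)%:E|)%E, (\int[m]_x `|(g x)%:E| < +oo)%E &
   (\int[m]_x `|(g x)%:E|)%E \is a fin_num].
Proof.
move=> /integrableP[mg goo]; split => //; first exact: measurableT_comp.
by rewrite ge0_fin_numE// integral_ge0.
Qed.

(** Since [k] is bounded, f(y) k(x, y) phi(x) is integrable over the product by Tonelli, and Fubini
    exchanges the integrals. *)
Lemma fubini_kernel :
  \int[m]_x ((\int[m]_y (f y * k (x, y))) * phi x) =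
  \int[m]_y (f y * \int[m]_x (phi x * k (x, y))).
Proof.
have [mfa fa_oo fa_fin] := abs_int i_f.
have [mphia phia_oo phia_fin] := abs_int iphi.
have kC' z : `|k z| <= `|C| by apply: (le_trans (kC z)); exact: ler_norm.
have Cnorm x : (\int[m]_y `|h (x, y)| <= (`|C| * `|phi x|)%:E * \int[m]_y `|(f y)%:E|)%E.
  rewrite -ge0_integralZl//; apply: ge0_le_integral => //.
  - by apply: measurableT_comp => //; apply: measurableT_comp mh _; exact: measurable_pair1.
  - exact: measurable_funeM.
  - move=> y _; rewrite /h /= -EFinM lee_fin !normrM.
    rewrite (mulrC `|f y|) mulrAC; apply: ler_wpM2r => //.
    by apply: ler_wpM2r.
have ih : (m \x m)%E.-integrable setT h.
  apply/(integrable12ltyP _ _ mh).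
  apply: (@le_lt_trans _ _ (\int[m]_x ((`|C| * fine (\int[m]_y `|(f y)%:E|))%:E * `|(phi x)%:E|))%E).
    apply: ge0_le_integral => //.
    - by move=> x _; exact: integral_ge0.
    - apply: (@measurable_fun_fubini_tonelli_F _ _ _ _ _ m (fun z => `|h z|%E)) => //.
      exact: measurableT_comp.
    - exact: measurable_funeM.
    - move=> x _; apply: (le_trans (Cnorm x)).
      by rewrite -[X in (_ * X <= _)%E]fineK// -!EFinM lee_fin mulrAC.
  have C1 : (0 <= (`|C| * fine (\int[m]_y `|(f y)%:E|))%:E)%E.
    by rewrite lee_fin mulr_ge0// fine_ge0// integral_ge0.
  by rewrite ge0_integralZl//; apply: lte_mul_pinfty.
have ifk x : m.-integrable setT (EFin \o (fun y => f y * k (x, y))).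
  apply: (@le_integrable _ _ _ _ _ _ _ (EFin \o (fun y => `|C| * f y))) => //.
  - apply/measurable_EFinP; apply: measurable_funM => //.
    by apply: measurableT_comp mk _; exact: measurable_pair1.
  - by move=> y _; rewrite /= lee_fin !normrM normr_id mulrC; apply: ler_wpM2r.
  - by apply: (@integrableZl _ _ _ _ _ _ `|C| (EFin \o f)).
have ipk y : m.-integrable setT (EFin \o (fun x => phi x * k (x, y))).
  apply: (@le_integrable _ _ _ _ _ _ _ (EFin \o (fun y => `|C| * phi y))) => //.
  - apply/measurable_EFinP; apply: measurable_funM => //.
    by apply: measurableT_comp mk _; exact: measurable_pair2.
  - by move=> x _; rewrite /= lee_fin !normrM normr_id mulrC; apply: ler_wpM2r.
  - by apply: (@integrableZl _ _ _ _ _ _ `|C| (EFin \o phi)).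
have key := Fubini ih.
have -> : \int[m]_x ((\int[m]_y (f y * k (x, y))) * phi x) = fine (\int[m]_x \int[m]_y h (x, y)).
  congr fine; apply: eq_integral => x _; rewrite /h /=.
  rewrite -(RintegralZr (phi x) measurableT (ifk x)) /Rintegral fineK//.
  exact: (integrable_fin_num measurableT (integrableZr measurableT (phi x) (ifk x))).
have -> : \int[m]_y (f y * \int[m]_x (phi x * k (x, y))) = fine (\int[m]_y \int[m]_x h (x, y)).
  congr fine; apply: eq_integral => y _; rewrite /h /=.
  rewrite -(RintegralZl (f y) measurableT (ipk y)) /Rintegral fineK; last first.
    exact: (integrable_fin_num measurableT (integrableZl measurableT (f y) (ipk y))).
  by apply: eq_integral => x _; rewrite -mulrA (mulrC (phi x)).
by congr fine.
Qed.

End fubini_kernel.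

(** * Weak convergence of mollifications *)

Section mollification.
Context {R : realType} {n : nat}.
Local Notation V := ('rV[R]_n.+1).
Local Notation L := (lebesgue_space R n).
Local Notation mu := (lebesgueN R n).
Local Notation M0 := (@step_mass R n).
Implicit Types (x y z : V) (f g phi : V -> R) (E : 'I_n.+1 -> R -> R).
Implicit Types lo hi : 'I_n.+1 -> R.

(** 1 - E(-t) climbs from 0 to 1 again, and its kernel is the reflection of the kernel of [E]. *)
Definition reff E : 'I_n.+1 -> R -> R := fun j t => 1 - E j (-1 * t + 0).

Lemma stepfuns_reff lo hi E : stepfuns lo hi E ->
  stepfuns (fun j => - hi j) (fun j => - lo j) (reff E).
Proof.
move=> [cE sE]; split.
  move=> j; apply: (proj1 (derB _ _)); first by move=> k; exact: Ck_cst.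
  exact: cinf_affine.
move=> j t; rewrite /reff addr0 mulN1r; have [h1 h2] := sE j (- t); split => h.
  by rewrite h2 ?subrr// lerNr.
by rewrite h1 ?subr0// lerNl.
Qed.

Lemma prodf_reff lo hi E z : stepfuns lo hi E -> prodf (reff E) c1 z = prodf E c1 (- z).
Proof.
move=> [cE _]; apply: eq_bigr => j _; rewrite /c1.
have cc : cinf (fun _ : R => 1 : R) by move=> k; exact: Ck_cst.
rewrite /reff (proj2 (derB cc (cinf_affine (-1) 0 (cE j)))).
have -> : der 1 (fun _ : R => 1 : R) = fun=> 0 by apply: der1 => t; exact: drvC.
by rewrite der_affine// expr1 mulN1r sub0r opprK addr0 mxE mulN1r.
Qed.

Lemma prodf_aff_reff lo hi E (e : R) x y : stepfuns lo hi E ->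
  prodf (aff e x E) c1 y = prodf (aff e y (reff E)) c1 x.
Proof.
move=> sE; rewrite prodf_aff; last exact: sE.1.
rewrite prodf_aff; last exact: (stepfuns_reff sE).1.
by rewrite (prodf_reff _ sE) -scalerN opprB.
Qed.

Lemma measurable_kernel E (e : R) : cinfs E -> measurable_fun [set: L * L]
  ((fun xy => prodf (aff e xy.1 E) c1 xy.2) : L * L -> R).
Proof.
move=> cE.
have -> : ((fun xy => prodf (aff e xy.1 E) c1 xy.2) : L * L -> R) =
  (fun xy => e^-1 ^+ (\sum_j @c1 n j) *
    \prod_j der 1 (E j) (e^-1 * ((xy.2 : V) ord0 j - (xy.1 : V) ord0 j))).
  apply/funext => xy; rewrite prodf_aff//; congr (_ * _); apply: eq_bigr => j _.
  by rewrite !mxE.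
apply: measurable_funM; first exact: measurable_cst.
apply: measurable_prod => j _.
apply: (@measurableT_comp _ _ _ _ _ _ (der 1 (E j))).
  by apply: continuous_measurable_fun; exact: cont_der.
apply: measurable_funM; first exact: measurable_cst.
apply: measurable_funB.
  apply: (@measurableT_comp _ _ _ _ _ _ (fun y : L => (y : V) ord0 j)); last exact: measurable_snd.
  exact: measurable_coord.
apply: (@measurableT_comp _ _ _ _ _ _ (fun y : L => (y : V) ord0 j)); last exact: measurable_fst.
exact: measurable_coord.
Qed.

(** Fubini moves the mollifier onto [phi]; the kernel is reflected because centre and variable
    exchange their roles. *)
Lemma mo_swap lo hi E (e : R) f phi : 0 < e -> stepfuns lo hi E ->
  mu.-integrable [set: L] (EFin \o f) -> mu.-integrable [set: L] (EFin \o phi) ->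
  \int[mu]_x (mo f e E c1 x * phi x) = \int[mu]_y (f y * mo phi e (reff E) c1 y).
Proof.
move=> e0 sE i_f iphi.
have supp z : boxM lo hi < `|z| -> prodf E c1 z = 0 by exact: (prodf_step0M sE).
have [C _ kC] := prodf_aff_bounded e sE.1 supp.
pose kk (xy : L * L) := prodf (aff e xy.1 E) c1 xy.2.
have kC' (xy : L * L) : `|kk xy| <= C by exact: kC.
have h := @fubini_kernel _ L R (@sf_lebesgueN R n) f phi kk C i_f iphi (measurable_kernel e sE.1) kC'.
 have mE y : mo phi e (reff E) c1 y = \int[mu]_x (phi x * kk (x, y)).
  rewrite /mo; congr (Rintegral _ _ _); apply/funext => x.
  by rewrite /kk (prodf_aff_reff _ _ _ sE).
rewrite (_ : (fun y => f y * mo phi e (reff E) c1 y) = fun y => f y * \int[mu]_x (phi x * kk (x, y))).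
  exact: h.
by apply/funext => y; rewrite mE.
Qed.

Lemma half_to0 (d : R) : 0 < d -> exists k0, forall k, (k0 <= k)%N -> (2^-1 : R) ^+ k <= d.
Proof.
move=> d0; have [k0 h] := @geometric_to0 R 1 2^-1 d ltac:(lra) ltac:(lra) d0.
by exists k0 => k /h; rewrite mul1r.
Qed.

Lemma mo_cvg_cont lo hi E phi x : stepfuns lo hi E -> mu.-integrable [set: L] (EFin \o phi) ->
  {for x, continuous phi} ->
  (fun k => mo phi (2^-1 ^+ k) E c1 x) @ \oo --> M0 * phi x.
Proof.
move=> sE iphi cphi; apply/(@cvgrPdist_le R R^o) => eps eps0.
pose d := eps / (step_norm E + 1).
have N0 : 0 < step_norm E + 1 by have := step_norm_ge0 E; lra.
have d0 : 0 < d by rewrite divr_gt0.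
move: (cphi) => /(@cvgrPdist_le R R^o V (nbhs x) _ phi (phi x)) /(_ _ d0) /nbhs_ballP[r /= r0 hr].
have B0 := boxM_ge0 lo hi.
have [k0 hk] := half_to0 (divr_gt0 r0 (ltr_wpDl B0 ltr01)).
near=> k.
have kk : (k0 <= k)%N by near: k; exists k0.
rewrite distrC; have e0 : 0 < (2^-1 : R) ^+ k by apply: exprn_gt0; lra.
apply: (@le_trans _ _ (d * step_norm E)).
  apply: (mo_dist iphi e0 sE) => z nz.
  rewrite distrC; apply: hr; rewrite -ball_normE /= opprD addNKr normrN normrZ (gtr0_norm e0).
  have zM : `|z| <= boxM lo hi by rewrite leNgt; apply/negP => /outboxM.
  apply: (@le_lt_trans _ _ (r / (boxM lo hi + 1) * boxM lo hi)).
    by apply: ler_pM => //; exact: hk.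
  rewrite mulrAC ltr_pdivrMr; last lra.
  by rewrite (ltr_pM2l r0); lra.
rewrite /d mulrAC ler_pdivrMr//; apply: ler_wpM2l; [exact: ltW|lra].
Unshelve. all: by end_near.
Qed.

(** Once the mollifier acts on [phi], it converges pointwise by continuity and stays bounded
    uniformly in k, so dominated convergence against |f| applies. *)
Lemma mo_weak_cvg lo hi E f phi (M : R) : stepfuns lo hi E ->
  mu.-integrable [set: L] (EFin \o f) -> continuous phi -> (forall x, M < `|x| -> phi x = 0) ->
  (fun k => \int[mu]_x (mo f (2^-1 ^+ k) E c1 x * phi x)) @ \oo --> M0 * \int[mu]_x (f x * phi x).
Proof.
move=> sE i_f cphi phiM.
have iphi := integrable_Cc cphi phiM.
have sE' := stepfuns_reff sE.
have [C C0 phiC] := bounded_bsupp cphi phiM.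
have mf : measurable_fun [set: L] (f : L -> R).
  by apply/measurable_EFinP; exact: measurable_int i_f.
have mphi : measurable_fun [set: L] (phi : L -> R) by exact: continuous_measurableN.
have e0 k : 0 < (2^-1 : R) ^+ k by apply: exprn_gt0; lra.
have -> : (fun k => \int[mu]_x (mo f (2^-1 ^+ k) E c1 x * phi x)) =
  fun k => \int[mu]_y (f y * mo phi (2^-1 ^+ k) (reff E) c1 y).
  by apply/funext => k; exact: (mo_swap (e0 k) sE i_f iphi).
have -> : M0 * \int[mu]_x (f x * phi x) = \int[mu]_x (f x * (M0 * phi x)).
  have ifp : mu.-integrable [set: L] (EFin \o (fun x => f x * phi x)).
    exact: (integrable_mulb (@measurableT _ L) i_f mphi phiC).
  have <- : \int[mu]_x (M0 * (f x * phi x)) = M0 * \int[mu]_x (f x * phi x) by exact: RintegralZl.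
  by congr (Rintegral _ _ _); apply/funext => x; rewrite mulrCA.
have cmo k : continuous (mo phi (2^-1 ^+ k) (reff E) c1).
  exact: (@cont_mo R n phi (2^-1 ^+ k) iphi (reff E) c1 _ sE'.1 (fun z => @prodf_step0M R n _ _ _ c1 z sE' (fun=> isT))).
apply: (@Rintegral_dominated_cvg _ _ _ _ (fun x => (C * step_norm (reff E)) * `|f x|)).
- by move=> k; apply: (measurable_funM mf); exact: continuous_measurableN.
- by apply: (measurable_funM mf); apply: measurable_funM => //; exact: measurable_cst.
- apply: aeW => x; apply: cvgM; first exact: cvg_cst.
  exact: (mo_cvg_cont sE' iphi (cphi x)).
- exact: (integrable_scale (C * step_norm (reff E)) (integrable_norm i_f)).
- move=> k x; rewrite normrM mulrC; apply: ler_wpM2r => //.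
  have := @mo_dist R n _ _ _ phi _ x 0 C iphi (e0 k) sE'.
  by rewrite mulr0 subr0; apply => z _; rewrite subr0; exact: phiC.
Qed.

End mollification.

(** * Almost everywhere equality with the representative *)

Section representative_ae.
Context {R : realType} {n : nat}.
Local Notation V := ('rV[R]_n.+1).
Local Notation L := (lebesgue_space R n).
Local Notation mu := (lebesgueN R n).
Local Notation M0 := (@step_mass R n).
Implicit Types (x y z : V) (u phi : V -> R) (K : set V).
Hypothesis mu_pos : forall A : set V, open A -> A !=set0 -> (0 < mu A)%E.
Variables (Om : set V) (m : R).
Hypothesis mn : n.+1%:R < m.
Hypothesis oO : open Om.
Local Notation wpair := (@wpair R n Om m).

Lemma dist_scale (a M w K : R) : 0 < M -> `|a / M - w| <= K -> `|a - M * w| <= M * K.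
Proof.
move=> M1; rewrite -(ler_pM2l M1); apply: le_trans.
by rewrite -[X in _ <= X * _](gtr0_norm M1) -normrM mulrBr mulrCA mulfV ?mulr1// gt_eqF.
Qed.

Lemma compact_good K : compact K -> K `<=` Om -> exists k, forall x, K x -> good Om x k.
Proof.
move=> /compact_near_coveringP cK KO.
suff h : forall x, K x -> \forall y \near x & k \near \oo, good Om y k.
  have [k0 _ hk] := cK nat \oo (fun k x => good Om x k) _ h.
  by exists k0 => x Kx; apply: (hk k0 (leqnn _)).
move=> x Kx; have [k hk] := near_good oO (KO _ Kx).
exists ([set y | good Om y k], [set j | (k <= j)%N]); first by split => //; exists k.
by move=> [y j] /= [gy kj]; exact: good_mono gy kj.
Qed.

Lemma compact_boundedN K : compact K -> exists M : R, forall x, K x -> `|x| <= M.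
Proof.
move=> /compact_bounded[M [_ h]]; exists (M + 1) => x Kx.
by apply: (h (M + 1)) => //; rewrite ltrDl.
Qed.

Lemma cont_mul_supp (w phi : V -> R) K : (forall x, K x -> {for x, continuous w}) ->
  continuous phi -> compact K -> (forall x, ~ K x -> phi x = 0) ->
  continuous (fun x => w x * phi x).
Proof.
move=> cw cphi cK K0 x; case: (pselect (K x)) => Kx.
  by apply: (@continuousM R V w phi); [exact: cw|exact: cphi].
have nK : \forall y \near x, ~ K y.
  apply: open_nbhs_nbhs; split => //; apply: closed_openC.
  exact: (compact_closed (@norm_hausdorff _ _) cK).
apply/(@cvgrPdist_le R R^o V (nbhs (x : V)) _ (fun x => w x * phi x) (w x * phi x)) => e e0.
apply: filterS nK => y nKy.
by rewrite (K0 x Kx) (K0 y nKy) !mulr0 subrr normr0 ltW.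
Qed.

Lemma cont_repr_mul u g phi K : wpair u g -> continuous phi -> compact K -> K `<=` Om ->
  (forall x, ~ K x -> phi x = 0) -> continuous (fun x => c0repr u x * phi x).
Proof.
move=> ug cphi cK KO K0; apply: cont_mul_supp cphi cK K0 => x Kx.
apply/(@cvgrPdist_le R R^o V (nbhs (x : V)) _ (c0repr u) (c0repr u x)) => e e0.
apply: filterS (repr_cont mu_pos mn oO ug (KO _ Kx) e0) => y h; rewrite distrC; exact: h.
Qed.

(** Multiplied by the mass, both sides are limits of the same integrals of mollifications: one by
    weak convergence, the other by the uniform rate on [K]. *)
Lemma repr_weak u g phi K : wpair u g -> continuous phi -> compact K -> K `<=` Om ->
  (forall x, ~ K x -> phi x = 0) ->
  \int[mu]_x (u x * phi x) = \int[mu]_x (c0repr u x * phi x).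
Proof.
move=> ug cphi cK KO K0.
have m0 : 0 < M0 := step_mass_gt0 mu_pos.
have [M KM] := compact_boundedN cK.
have phiM x : M < `|x| -> phi x = 0.
  by move=> Mx; apply: K0 => /KM; rewrite leNgt Mx.
have [k0 gk] := compact_good cK KO.
have [C [th [C0 th0 th1 rate]]] := repr_rate mu_pos mn ug.
have iu : mu.-integrable [set: L] (EFin \o u) by case: ug.
have iphi := integrable_Cc cphi phiM.
have mphi : measurable_fun [set: L] (phi : L -> R) by exact: continuous_measurableN.
have h1 := mo_weak_cvg (@stepfuns_bumpf R n) iu cphi phiM.
have crp := cont_repr_mul ug cphi cK KO K0.
have irp : mu.-integrable [set: L] (EFin \o (fun x => c0repr u x * phi x)).
  by apply: (integrable_Cc crp (M := M)) => x /phiM ->; rewrite mulr0.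
have supp (z : V) : @boxM R n (fun=> -1) (fun=> 1) < `|z| -> prodf (bumpf : 'I_n.+1 -> R -> R) c1 z = 0.
  exact: (prodf_step0M (@stepfuns_bumpf R n)).
move: (c0repr u) crp irp rate => w crp irp rate.
pose P : R := \int[mu]_x `|phi x|.
have P0 : 0 <= P by apply: Rintegral_ge0.
have i_mo k : mu.-integrable [set: L] (EFin \o (fun x => mo u (2^-1 ^+ k) bumpf c1 x * phi x)).
  have cm := @cont_mo R n u (2^-1 ^+ k) iu _ c1 _ (@stepfuns_bumpf R n).1 supp.
  apply: (integrable_Cc (M := M)); last by move=> x /phiM ->; rewrite mulr0.
  by move=> x; apply: (@continuousM R V _ phi); [exact: cm|exact: cphi].
have bnd k : (k0 <= k)%N -> `|\int[mu]_x (mo u (2^-1 ^+ k) bumpf c1 x * phi x) -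
    M0 * \int[mu]_x (w x * phi x)| <= M0 * P * C * th ^+ k.
  move=> kk.
  have E1 : M0 * \int[mu]_x (w x * phi x) = \int[mu]_x (M0 * (w x * phi x)).
    by apply: esym; exact: RintegralZl.
  have i2 := integrable_scale M0 irp (@measurableT _ L).
  rewrite E1 -RintegralB//.
  apply: (le_trans (le_normr_Rintegral _ _)) => //; first exact: integrable_subf.
  have -> : M0 * P * C * th ^+ k = \int[mu]_x ((M0 * C * th ^+ k) * `|phi x|).
    have alg (a b c d : R) : a * b * c * d = a * c * d * b by ring.
    rewrite (alg M0 P C).
    by apply: esym; apply: RintegralZl => //; exact: (integrable_norm iphi).
  apply: le_Rintegral => //.
  - by apply: integrable_norm; exact: integrable_subf.
  - exact: (integrable_scale _ (integrable_norm iphi)).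
  - move=> x _; case: (pselect (K x)) => Kx; last first.
      by rewrite (K0 _ Kx) !mulr0 subrr normr0 mulr0.
    rewrite mulrA -mulrBl normrM; apply: ler_wpM2r => //.
    rewrite -(mulrA M0 C); apply: dist_scale => //.
    exact: (rate x k (good_mono (gk _ Kx) kk)).
have h2 : (fun k => \int[mu]_x (mo u (2^-1 ^+ k) bumpf c1 x * phi x)) @ \oo -->
    M0 * \int[mu]_x (w x * phi x).
  apply/(@cvgrPdist_le R R^o) => e e0.
  have [k1 hk] := geometric_to0 (M0 * P * C) th0 th1 e0.
  near=> k; rewrite distrC; apply: (le_trans (bnd k _)).
    by near: k; exists k0.
  by apply: hk; near: k; exists k1.
have e := @cvg_unique _ (@norm_hausdorff _ R^o) _ _ _ _ h1 h2.
by apply: (mulfI (lt0r_neq0 m0)); apply: e.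
Unshelve. all: by end_near. Qed.

(** Only compact subsets of [Om] are under control, so the difference is multiplied by tents on
    countably many balls filling [Om]; each product vanishes almost everywhere by [repr_weak]. *)
Lemma repr_ae u g : wpair u g -> {ae mu, forall x, Om x -> c0repr u x = u x}.
Proof.
move=> ug; have iu : mu.-integrable [set: L] (EFin \o u) by case: ug.
have [c [r [cr1 cr2]]] := open_rational_balls oO.
pose K k : set V := [set x | `|x - c k| <= r k].
have cK k : compact (K k).
  rewrite (_ : K k = (fun x => x - c k) @^-1` cubeN (r k))//.
  apply: bounded_closed_compact.
    exists (r k + `|c k|); split; first exact: num_real.
    move=> M rM x /= Kx; apply: ltW; apply: le_lt_trans rM.
    rewrite -[X in `|X|](subrK (c k)); apply: (le_trans (ler_normD _ _)).
    by apply: lerD.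
  apply: closed_comp; last by apply: (compact_closed (@norm_hausdorff _ _)); exact: compact_normV_le.
  by move=> x _; apply: (@continuousB _ _ _ id (fun=> c k)); [exact: id|exact: cst_continuous].
have tK k x : ~ K k x -> tent (c k) (r k) x = 0.
  move=> nK; apply/eqP; rewrite eq_le tent_ge0 andbT leNgt tent_gt0.
  by apply/negP => /ltW.
suff h k : {ae mu, forall x, (u x - c0repr u x) * tent (c k) (r k) x = 0}.
  apply: (@filterS _ _ (ae_filter_ringOfSetsType mu) _ _ _ (ae_foralln h)) => x hx Ox.
  have [k xk] := cr2 _ Ox.
  have := hx k => /eqP; rewrite mulf_eq0 => /orP[|]; last by rewrite gt_eqF// tent_gt0.
  by rewrite subr_eq0 => /eqP.
have [M KM] := compact_boundedN (cK k).
have ct := @cont_tent R n (c k) (r k).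
have [B B0 tB] := bounded_bsupp (M := M) ct (fun x Mx => tK k x (fun Kx => ltac:(by
  have := KM _ Kx; rewrite leNgt Mx))).
have crp := cont_repr_mul ug ct (cK k) (cr1 k) (tK k).
have phiM x : M < `|x| -> tent (c k) (r k) x = 0.
  by move=> Mx; apply: tK => /KM; rewrite leNgt Mx.
have it : mu.-integrable [set: L] (EFin \o (fun x => (u x - c0repr u x) * tent (c k) (r k) x)).
  rewrite (_ : (fun x => _) = fun x => u x * tent (c k) (r k) x - c0repr u x * tent (c k) (r k) x); last first.
    by apply/funext => x; rewrite mulrBl.
  apply: integrable_subf => //.
    by apply: (integrable_mulb (@measurableT _ L) iu _ tB); exact: continuous_measurableN.
  by apply: (integrable_Cc crp (M := M)) => x /phiM ->; rewrite mulr0.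
apply: (ae_eq0_test (M := M)) it _ _.
  by move=> x /phiM ->; rewrite mulr0.
move=> phi cphi phi01.
have cp : continuous (fun x => tent (c k) (r k) x * phi x) by exact: contM.
have pK x : ~ K k x -> tent (c k) (r k) x * phi x = 0 by move=> /tK ->; rewrite mul0r.
have e := repr_weak ug cp (cK k) (cr1 k) pK.
have -> : (fun x => (u x - c0repr u x) * tent (c k) (r k) x * phi x) =
  fun x => u x * (tent (c k) (r k) x * phi x) - c0repr u x * (tent (c k) (r k) x * phi x).
  by apply/funext => x; rewrite mulrBl mulrBl !mulrA.
have pM x : M < `|x| -> tent (c k) (r k) x * phi x = 0 by move=> /phiM ->; rewrite mul0r.
have [B' _ pB] := bounded_bsupp cp pM.
rewrite RintegralB//; first by rewrite e subrr.
- by apply: (integrable_mulb (@measurableT _ L) iu _ pB); exact: continuous_measurableN.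
- apply: (integrable_Cc (cont_repr_mul ug cp (cK k) (cr1 k) pK) (M := M)) => x /pM ->.
  by rewrite mulr0.
Qed.

End representative_ae.

(** * Boundary charts *)

Section graph_function.
Context {R : realType} {n : nat}.
Local Notation V := ('rV[R]_n.+1).
Local Notation e_ i := (delta_mx ord0 i : V).
Variables (i : 'I_n.+1) (s : bool) (gam : 'rV[R]_n -> R).
Hypothesis gamC1 : C1 gam.
Local Notation psi := (graph_fun i s gam).

Definition graph_partial (j : 'I_n.+1) (y : V) : R :=
  if unlift i j is Some k then partial k gam (col' i y) else - (-1) ^+ s.

Lemma norm_col' (y : V) : `|col' i y| <= `|y|.
Proof.
rewrite [leLHS]/Num.norm /= mx_normrE; apply: bigmax_le => // -[a b] _ /=.
by rewrite mxE ord1; exact: normV_coord.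
Qed.

Lemma cont_col' : continuous (fun y : V => col' i y).
Proof.
move=> x; apply/(@cvgrPdist_lt R 'rV[R]_n V (nbhs (x : V)) _ (fun y => col' i y) (col' i x)) => e e0.
apply: filterS (near_dist x e0) => y yx.
have -> : col' i x - col' i y = col' i (x - y) by apply/rowP => l; rewrite !mxE.
apply: le_lt_trans (norm_col' _) _.
by rewrite distrC.
Qed.

Lemma cont_graph_partial j : continuous (graph_partial j).
Proof.
rewrite /graph_partial; case: unliftP => [k _|_]; last exact: cst_continuous.
have -> : (fun y : V => partial k gam (col' i y)) = (fun z => (grad gam z) ord0 k) \o (fun y => col' i y).
  by apply/funext => y; rewrite /= mxE.
move=> y; apply: continuous_comp; first exact: cont_col'.
apply: (@continuous_comp _ _ _ (grad gam) (fun z : 'rV[R]_n => z ord0 k)).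
  exact: gamC1.2.
exact: coord_continuous.
Qed.

Lemma drv_graph j y : is_derive y (e_ j) psi (graph_partial j y).
Proof.
apply/drv_line; rewrite /graph_partial /graph_fun.
have [k ->|->] := unliftP i j.
  have -> : (fun t : R => gam (col' i (y + t *: e_ (lift i k))) -
      (-1) ^+ s * (y + t *: e_ (lift i k)) ord0 i) =
    fun t => gam (col' i y + t *: delta_mx ord0 k) - (-1) ^+ s * y ord0 i.
    apply/funext => t; congr (gam _ - _ * _).
      by apply/rowP => l; rewrite !mxE eqxx/= (inj_eq lift_inj).
    by rewrite !mxE eqxx/= (negbTE (neq_lift _ _)) mulr0 addr0.
  have h : is_derive (0 : R) 1 (fun t : R => gam (col' i y + t *: delta_mx ord0 k)) (partial k gam (col' i y)).
    apply/(@drv_line R 'rV[R]_n); apply: DeriveDef => //.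
    by apply: diff_derivable; exact: gamC1.1.
  exact: (drv_eq (drvB h (drvC _ _ _)) (subr0 _)).
have -> : (fun t : R => gam (col' i (y + t *: e_ i)) - (-1) ^+ s * (y + t *: e_ i) ord0 i) =
    fun t => gam (col' i y) - (-1) ^+ s * (y ord0 i + t).
  apply/funext => t; congr (gam _ - _ * _).
    by apply/rowP => l; rewrite !mxE eqxx/= eq_sym (negbTE (neq_lift _ _)) mulr0 addr0.
  by rewrite !mxE !eqxx/= mulr1.
have h := drvD (drvC (y ord0 i) (0 : R) 1) (is_derive_id (0 : R) 1).
apply: (drv_eq (drvB (drvC _ _ _) (drvZ ((-1) ^+ s) h))).
by rewrite (add0r (1 : R)) mulr1 sub0r.
Qed.

Lemma graph_partial_axis y : graph_partial i y = - (-1) ^+ s.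
Proof. by rewrite /graph_partial unlift_none. Qed.

Lemma diff_graph y : differentiable psi y /\ 'd psi y = lform (\row_j graph_partial j y) :> (V -> R).
Proof.
apply: differentiable_partials => [|j]; last exact: cont_graph_partial.
exact: (@filterE _ (nbhs y) _ _ (fun z j => drv_graph j z)).
Qed.

Lemma cont_graph : continuous psi.
Proof. by move=> y; apply: differentiable_continuous; exact: (diff_graph y).1. Qed.

(** The linear part is frozen at [x0] while the base point y varies, by continuity of the partial
    derivatives; the cone at [x0] has to serve all nearby points of the closure. *)
Lemma graph_increment x0 (e : R) : 0 < e -> exists2 r, 0 < r &
  forall y v, `|y - x0| < r -> `|v| < r ->
  `|psi (y + v) - psi y - lform (\row_j graph_partial j x0) v| <= e * `|v|.
Proof.
move=> e0; have e'0 : 0 < e / n.+1%:R by rewrite divr_gt0.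
have : \forall y \near x0, forall j, `|graph_partial j y - graph_partial j x0| <= e / n.+1%:R.
  apply: (@filter_forall _ _ (fun j y => `|graph_partial j y - graph_partial j x0| <= e / n.+1%:R) (nbhs x0) _) => j.
  have /(@cvgrPdist_le R R^o V (nbhs x0) _ _ (graph_partial j x0))/(_ _ e'0) := @cont_graph_partial j x0.
  by apply: filterS => y; rewrite distrC.
move=> /nbhs_ballP[r /= r0 hr].
exists (r / 2); first by rewrite divr_gt0.
move=> y v yx vr.
have := @increment_le R n psi graph_partial y (\row_j graph_partial j x0) (r / 2) (e / n.+1%:R)
  (fun z j _ => drv_graph j z) _ v vr.
rewrite [_ * (e / _)]mulrC divfK//; apply => z j zy; rewrite mxE.
apply: (hr z); rewrite -ball_normE /= distrC.
rewrite (_ : z - x0 = (z - y) + (y - x0)); last by rewrite addrA subrK.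
by apply: (le_lt_trans (ler_normD _ _)); lra.
Qed.

End graph_function.

(** * Kernels pointing into the domain *)

Section cone_condition.
Context {R : realType} {n : nat}.
Local Notation V := ('rV[R]_n.+1).
Local Notation e_ i := (delta_mx ord0 i : V).
Implicit Types (Om : set V) (x y z : V).

Lemma stepfuns_exist (lo hi : 'I_n.+1 -> R) : (forall j, lo j < hi j) ->
  exists E, stepfuns lo hi E.
Proof.
move=> lh; exists (fun j t => step ((hi j - lo j)^-1 * t + - (lo j / (hi j - lo j)))); split.
  by move=> j; apply: cinf_affine; exact: cinf_step.
move=> j t; have d0 : 0 < hi j - lo j by rewrite subr_gt0.
rewrite (_ : _ + _ = (t - lo j) / (hi j - lo j)); last by rewrite mulrBl mulrC.
split => h.
  by rewrite step0// pmulr_lle0 ?invr_gt0// subr_le0.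
by rewrite step1// ler_pdivlMr// mul1r lerB.
Qed.

Lemma chart_closure Om x0 i s gam : boundary_chart Om x0 i s gam ->
  exists2 r, 0 < r & (forall y, `|y - x0| < r -> Om y <-> graph_fun i s gam y < 0) /\
   (forall y, `|y - x0| < r -> closure Om y -> graph_fun i s gam y <= 0).
Proof.
move=> [gC1 /nbhs_ballP[r /= r0 hr]].
have hr' y : `|y - x0| < r -> Om y <-> graph_fun i s gam y < 0.
  by move=> yx; apply: (hr y); rewrite -ball_normE /= distrC.
exists r => //; split => // y yr cly.
rewrite leNgt; apply/negP => p0.
have h1 : \forall z \near y, 0 < graph_fun i s gam z.
  by apply: near_cont_gt p0; exact: cont_graph.
have h2 : \forall z \near y, `|z - x0| < r.
  have d0 : 0 < r - `|y - x0| by rewrite subr_gt0.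
  apply: filterS (near_dist y d0) => z zy.
  rewrite (_ : z - x0 = (z - y) + (y - x0)); last by rewrite addrA subrK.
  by apply: (le_lt_trans (ler_normD _ _)); lra.
have [z [Oz [z1 z2]]] := cly _ (filterI h1 h2).
by have := (hr' z z2).1 Oz; rewrite ltNge (ltW z1).
Qed.

(** The box is shifted inwards along the axis of the graph: [Lam] outweighs the slopes [S] in the
    other directions, so that the linear part is at most -1 on the box. Heights from Lam/2 to 2 Lam
    contain both the support of [E], with heights from Lam to 2 Lam, and that of its dilation by
    1/2. *)
Lemma cone_boundary Om x0 i s gam : boundary_chart Om x0 i s gam -> cone_at Om x0.
Proof.
move=> ch; have gC1 := ch.1; have [r r0 [rO rc]] := chart_closure ch.
pose A : V := \row_j graph_partial i s gam j x0.
pose S := \sum_(j < n.+1 | j != i) `|A ord0 j|.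
have S0 : 0 <= S by exact: sumr_ge0.
pose Lam := 2 * S + 2.
have Lam0 : 0 < Lam by rewrite /Lam; lra.
pose BM := 2 * Lam + 1.
have BM0 : 0 < BM by rewrite /BM; lra.
have BM1 : 0 < (2 * BM)^-1 by rewrite invr_gt0 mulr_gt0.
have [r1 r10 inc] := graph_increment i s gC1 x0 BM1.
pose sg : R := (-1) ^+ s.
pose lo j : R := if j == i then (if s then - (2 * Lam) else Lam / 2) else -1.
pose hi j : R := if j == i then (if s then - (Lam / 2) else 2 * Lam) else 1.
pose lo1 j : R := if j == i then (if s then - (2 * Lam) else Lam) else -1.
pose hi1 j : R := if j == i then (if s then - Lam else 2 * Lam) else 1.
have [E sE] : exists E, stepfuns lo1 hi1 E.
  apply: stepfuns_exist => j; rewrite /lo1 /hi1; case: eqP => _; last by lra.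
  by case: (s); lra.
pose rr := Num.min (r / 2) r1.
have rr0 : 0 < rr by rewrite lt_min r10 andbT; lra.
have [k0 hk] := half_to0 (divr_gt0 rr0 (ltr_wpDl (ltW BM0) ltr01)).
exists lo, hi, E, rr, k0; split => //.
- apply: stepfuns_widen sE => j; rewrite /lo /lo1 /hi /hi1; case: eqP => // _;
    case: (s); clear - Lam0; lra.
- apply: stepfuns_widen (stepfuns_dilf sE) => j; rewrite /lo /lo1 /hi /hi1; case: eqP => // _;
    try (case: (s)); clear - Lam0; lra.
move=> y k cly yr kk z nz.
set e := 2^-1 ^+ k.
have e0 : 0 < e by apply: exprn_gt0; lra.
have yr' : `|y - x0| < r / 2 /\ `|y - x0| < r1 by move: yr; rewrite lt_min => /andP.
have zj j : lo j <= z ord0 j <= hi j.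
  by apply/andP; split; rewrite leNgt; apply/negP => h; apply: nz; exists j; [left|right].
have zB : `|z| <= BM.
  apply/normV_leP; first exact: ltW.
  move=> j; have /andP[] := zj j; rewrite /lo /hi ler_norml /BM.
  by case: eqP => _; [case: (s)|]; move=> h1 h2; clear - h1 h2 Lam0; apply/andP; split; lra.
have ez : `|e *: z| < rr.
  rewrite normrZ (gtr0_norm e0).
  apply: (@le_lt_trans _ _ (rr / (BM + 1) * BM)); first by apply: ler_pM => //; [exact: ltW|exact: hk].
  by rewrite mulrAC ltr_pdivrMr ?(ltr_pM2l rr0); lra.
have ez' : `|e *: z| < r / 2 /\ `|e *: z| < r1 by move: ez; rewrite lt_min => /andP.
apply/rO.
  rewrite (_ : y + e *: z - x0 = (y - x0) + e *: z); last by rewrite addrAC.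
  apply: (le_lt_trans (ler_normD _ _)).
  by move: yr'.1 ez'.1; move: `|y - x0| `|e *: z| => a b; lra.
have y0 : graph_fun i s gam y <= 0.
  by apply: rc => //; move: yr'.1; move: `|y - x0| => a; lra.
have := inc y (e *: z) yr'.2 ez'.2.
rewrite -/A linearZ/= -[_ *: lform A z]/(e * lform A z).
have lA : lform A z <= - 1.
  rewrite /lform (bigD1 i)//=.
  have Ai : A ord0 i = - (-1) ^+ s by rewrite mxE graph_partial_axis.
  have h1 : z ord0 i * A ord0 i <= - (Lam / 2).
    rewrite Ai; have := zj i; rewrite /lo /hi eqxx; case: (s) => /andP[h1 h2].
      by rewrite expr1 opprK mulr1; lra.
    by rewrite expr0 mulrN1; lra.
  have h2 : \sum_(j < n.+1 | j != i) z ord0 j * A ord0 j <= S.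
    apply: ler_sum => j ji; apply: (le_trans (ler_norm _)); rewrite normrM.
    rewrite -[leRHS]mul1r; apply: ler_wpM2r => //.
    by have := zj j; rewrite /lo /hi (negbTE ji) ler_norml.
  apply: (le_trans (lerD h1 h2)); rewrite /Lam; lra.
(* [BM] bounds the box, so the error of the linearisation is at most e/2, which the gain e of the
   linear part exceeds. *)
have eB : (2 * BM)^-1 * `|e *: z| <= e / 2.
  rewrite normrZ (gtr0_norm e0) invfM mulrC -!mulrA ler_pM2l//.
  by rewrite mulrCA -[leRHS]mulr1 ler_pM2l ?invr_gt0// ler_pdivrMr// mul1r.
move: (graph_fun i s gam _) eB (lform A z) lA => P eB l lA.
move: y0 eB; move: (graph_fun i s gam y) ((2 * BM)^-1 * _) => Q b Q0 be.
rewrite ler_norml => /andP[_ h].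
have : e * l <= e * -1 by rewrite ler_pM2l.
lra.
Qed.

Lemma cone_domain Om x0 : C1_domain Om -> closure Om x0 -> cone_at Om x0.
Proof.
move=> [oO _ bO] cl0; case: (pselect (Om x0)) => Ox; first exact: cone_interior.
have [|i [s [gam ch]]] := bO x0; last exact: cone_boundary ch.
by split => // /interior_subset.
Qed.

End cone_condition.

(** * C^1 representatives of Sobolev functions *)

Section sobolev_representative.
Context {R : realType} {n : nat}.
Local Notation V := ('rV[R]_n.+1).
Local Notation L := (lebesgue_space R n).
Local Notation mu := (lebesgueN R n).
Local Notation e_ i := (delta_mx ord0 i : V).
Implicit Types (x y z : V) (u g w phi : V -> R) (K : set V).
Variables (Om : set V) (m : R).
Hypothesis mn : n.+1%:R < m.
Hypothesis Ob : bounded_set Om.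
Hypothesis oO : open Om.

Let m1 : 1 <= m.
Proof. by apply: ltW; apply: le_lt_trans mn; rewrite ler1n. Qed.

Lemma bounded_sub_cube : exists M : R, Om `<=` cubeN M.
Proof.
case: Ob => M [_ h]; exists (M + 1) => x Ox.
by apply: (h (M + 1)) => //; rewrite ltrDl.
Qed.

Lemma integrable_indic_bounded : mu.-integrable [set: L] (EFin \o (\1_Om : V -> R)).
Proof.
have [M OM] := bounded_sub_cube.
apply: (@integrable_bsupp _ _ _ M 1).
- by apply: measurable_indic; exact: open_measurableN.
- move=> x; exact: norm_indic1.
- move=> x Mx; rewrite indicE memNset// => /OM; rewrite /cubeN/= leNgt Mx //.
Qed.

(** On a bounded set L^m is contained in L^1, from |u| <= |u|^m + 1. *)
Lemma Lp_integrable u : Lp Om m u -> mu.-integrable [set: L] (EFin \o (u \_ Om)) /\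
  mu.-integrable [set: L] (EFin \o (fun x => `|(u \_ Om) x| `^ m)).
Proof.
move=> uL; have im := Lfun_integrable m1 uL; split => //.
have mu_ : measurable_fun [set: L] (u \_ Om : L -> R).
  by have := sub_Lfun_mfun uL; rewrite inE.
apply: (@le_integrable _ _ _ _ _ (@measurableT _ L) _ _ _ _ (integrable_add im integrable_indic_bounded (@measurableT _ L))).
  exact/measurable_EFinP.
move=> x _; rewrite /= lee_fin.
rewrite [leRHS]ger0_norm; last first.
  by apply: addr_ge0; [exact: powR_ge0|rewrite indicE; case: (_ \in _)].
rewrite patchE indicE; case: (x \in Om); last first.
  by rewrite normr0; apply: addr_ge0; [exact: powR_ge0|].
have [h|h] := leP 1 `|u x|.
  rewrite -[leLHS]addr0; apply: lerD => //.
  by rewrite -[leLHS]powRr1//; apply: ler_powR.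
by rewrite -[leLHS]add0r; apply: lerD; [exact: powR_ge0|exact: ltW].
Qed.

Lemma prodf_cS_off E c i K : cinfs E -> compact K -> (forall x, ~ K x -> prodf E c x = 0) ->
  forall x, ~ K x -> prodf E (cS c i) x = 0.
Proof.
move=> cE cK K0 x nK.
apply: (@is_derive_near0 R n (prodf E c) x i _ _ (drv_prodf c i x cE)).
have : \forall y \near x, ~ K y.
  apply: open_nbhs_nbhs; split => //; apply: closed_openC.
  exact: (compact_closed (@norm_hausdorff _ _) cK).
by apply: filterS => y; exact: K0.
Qed.

Lemma weak_deriv_prodf I u g E c K : is_weak_deriv Om I u g -> cinfs E -> compact K ->
  K `<=` Om -> (forall x, ~ K x -> prodf E c x = 0) ->
  \int[mu]_x ((u \_ Om) x * prodf E (fun j => (c j + count_mem j I)%N) x) =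
  (-1) ^+ size I * \int[mu]_x ((g \_ Om) x * prodf E c x).
Proof.
move=> [_ _ h] cE cK KO K0.
have := h (prodf E c); rewrite iter_partial_prodf// => /(_ _).
have mk (f : V -> R) : \int[mu]_(x in (Om : set L)) f x = \int[mu]_x (f \_ Om) x.
  exact: Rintegral_mkcond.
rewrite (mk (fun x => u x * _)) (mk (fun x => g x * _)).
have pM (f k : V -> R) : (fun x => f x * k x) \_ Om = fun x => (f \_ Om) x * k x.
  by apply/funext => x; rewrite !patchE; case: ifP => // _; rewrite mul0r.
rewrite !pM; apply; split; first exact: smooth_prodf.
by exists K.
Qed.

Lemma weak_deriv_wderiv i u g : is_weak_deriv Om [:: i] u g -> wderiv Om i (u \_ Om) (g \_ Om).
Proof.
move=> h E c K cE cK KO K0.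
have := weak_deriv_prodf h cE cK KO K0; rewrite expr1 mulN1r => <-.
congr (Rintegral _ _ _); apply/funext => x; congr (_ * prodf _ _ _); apply/funext => j.
by rewrite /cS /= addn0 eq_sym.
Qed.

(** Testing [g] against a derivative along i of a test function is, up to sign, testing [u] against
    a second derivative of it, where [h] appears by definition. *)
Lemma weak_deriv2_wderiv i j u g h : is_weak_deriv Om [:: j] u g ->
  is_weak_deriv Om [:: i; j] u h -> wderiv Om i (g \_ Om) (h \_ Om).
Proof.
move=> wg wh E c K cE cK KO K0.
have := weak_deriv_prodf wh cE cK KO K0; rewrite expr2 mulrNN mulr1 mul1r => <-.
have := weak_deriv_wderiv wg cE cK KO (fun x => @prodf_cS_off E c i K cE cK K0 x).
have -> : cS (cS c i) j = fun k => (c k + count_mem k [:: i; j])%N.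
  by apply/funext => k; rewrite /cS /= addn0 addnA (eq_sym i) (eq_sym j).
by move=> ->; rewrite opprK.
Qed.

Lemma sobolev_wpair u : sobolev Om 2 m u -> exists (g : 'I_n.+1 -> V -> R)
  (h : 'I_n.+1 -> 'I_n.+1 -> V -> R),
  wpair Om m (u \_ Om) g /\ forall i, wpair Om m (g i) (h i).
Proof.
move=> [uL Wu].
have /choice[g gP] : forall j, exists g, Lp Om m g /\ is_weak_deriv Om [:: j] u g by move=> j; exact: Wu.
have /choice[h hP] : forall ij : 'I_n.+1 * 'I_n.+1, exists g, Lp Om m g /\ is_weak_deriv Om [:: ij.1; ij.2] u g.
  by move=> ij; exact: Wu.
exists (fun j => (g j) \_ Om), (fun j i => (h (i, j)) \_ Om); split.
  split; first exact: (Lp_integrable uL).1.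
  - by move=> j; exact: weak_deriv_wderiv (gP j).2.
  - by move=> j; exact: (Lp_integrable (gP j).1).1.
  - by move=> j; exact: (Lp_integrable (gP j).1).2.
move=> j; split; first exact: (Lp_integrable (gP j).1).1.
- move=> i; exact: weak_deriv2_wderiv (gP j).2 (hP (i, j)).2.
- by move=> i; exact: (Lp_integrable (hP (i, j)).1).1.
- by move=> i; exact: (Lp_integrable (hP (i, j)).1).2.
Qed.

Lemma within_cont_row (A : set V) (G : 'I_n.+1 -> V -> R) :
  (forall i, {within A, continuous G i}) ->
  {within A, continuous (fun x : V => \row_i G i x : V)}.
Proof.
move=> cG; apply/subspace_continuousP => x Ax.
apply/(@cvgrPdist_lt R V V) => e e0.
have : \forall y \near within A (nbhs x), forall i, `|G i x - G i y| < e.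
  apply: (@filter_forall _ _ (fun i y => `|G i x - G i y| < e) (within A (nbhs x)) _) => i.
  have /subspace_continuousP/(_ _ Ax) := cG i.
  by move=> /(@cvgrPdist_lt R R^o V (within A (nbhs x)) _ (G i) (G i x))/(_ _ e0).
apply: filterS => y h.
have : ball (\row_i G i x : V) e (\row_i G i y).
  by apply/ballNP => i; rewrite !mxE.
by rewrite -ball_normE.
Qed.

Lemma near_eq_differentiable w w' x : (\forall y \near x, w y = w' y) -> differentiable w x ->
  differentiable w' x /\ grad w' x = grad w x.
Proof.
move=> /nbhs_ballP[r /= r0 hr] dw.
have wx : w x = w' x by apply: hr; exact: ballxx.
have h : differentiable w' x /\ 'd w' x = lform (grad w x) :> (V -> R).
  apply: differentiable_increment => e e0.
  have dl := diff_locally dw; rewrite diff_grad// in dl.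
  have /eqaddoP/(_ _ e0) := dl.
  have n0 : \forall v \near (0 : V), `|v| < r.
    by have := near_dist (0 : V) r0; apply: filterS => v; rewrite subr0.
  move=> hh; near=> v.
  have vr : `|v| < r by near: v; exact: n0.
  rewrite -wx -(hr (x + v)); last by rewrite -ball_normE /= opprD addNKr normrN.
  have : `|(w \o shift x) v - (cst (w x) v + lform (grad w x) v)| <= e * `|v| by near: v.
  by rewrite /= opprD addrA [v + x]addrC.
by split; [exact: h.1|exact: (grad_lform h.1 h.2)].
Unshelve. all: by end_near. Qed.

Hypothesis mu_pos : forall A : set V, open A -> A !=set0 -> (0 < mu A)%E.
Hypothesis cone : forall x, closure Om x -> cone_at Om x.

(** [u] and its weak partial derivatives are treated alike: the cone kernels give each of them a
    continuous extension to the closure, and [repr_diff] identifies the gradient of the first with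
    the others. *)
Lemma C1_repr_exists u : sobolev Om 2 m u -> exists wG : (V -> R) * (V -> V),
  C1_closure Om wG.1 wG.2 /\ {ae mu, forall x, Om x -> wG.1 x = u x}.
Proof.
move=> /sobolev_wpair[g [h [ug gh]]].
have ext v k : wpair Om m v k -> exists w, {within closure Om, continuous w} /\
    forall x, Om x -> w x = c0repr v x.
  move=> vk; apply: extend_closure => x cx.
  exact: (repr_limit mu_pos mn oO vk cx (cone cx)).
have [w [cw wE]] := ext _ _ ug.
have /choice[G GP] : forall i, exists w, {within closure Om, continuous w} /\
    forall x, Om x -> w x = c0repr (g i) x by move=> i; exact: ext (gh i).
exists (w, fun x => \row_i G i x); split; last first.
  apply: (@filterS _ _ (ae_filter_ringOfSetsType mu) _ _ _ (repr_ae mu_pos mn oO ug)) => x hx Ox /=.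
  by rewrite (wE x Ox) (hx Ox) patchE mem_set.
split => //=; first by apply: within_cont_row => i; exact: (GP i).1.
move=> x Ox.
have [d1 d2] := repr_diff mu_pos mn oO ug gh Ox.
have nr : \forall y \near x, c0repr (u \_ Om) y = w y.
  have : \forall y \near x, Om y by apply: open_nbhs_nbhs.
  by apply: filterS => y Oy; rewrite wE.
have [e1 e2] := near_eq_differentiable nr d1.
split => //; rewrite e2 d2; apply/rowP => i; rewrite !mxE.
exact: ((GP i).2 x Ox).
Qed.

Lemma C1_reprP u : sobolev Om 2 m u ->
  C1_closure Om (C1_repr Om u).1 (C1_repr Om u).2 /\
  {ae mu, forall x, Om x -> (C1_repr Om u).1 x = u x}.
Proof.
move=> /C1_repr_exists[wG wGP].
by have := @getPex _ [set wG : (V -> R) * (V -> V) | C1_closure Om wG.1 wG.2 /\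
  {ae mu, forall x, Om x -> wG.1 x = u x}] (ex_intro _ wG wGP).
Qed.

End sobolev_representative.

(** * Extension by zero *)

Section divergence_identity.
Context {R : realType} {n : nat}.
Local Notation V := ('rV[R]_n.+1).
Local Notation L := (lebesgue_space R n).
Local Notation mu := (lebesgueN R n).
Local Notation e_ i := (delta_mx ord0 i : V).
Local Notation M0 := (@step_mass R n).
Implicit Types (x y z : V) (phi : V -> R) (K W Om : set V) (k : nat).

(** The equation div h = f in the weak sense. A weak derivative is the case of a field along one
    axis, the Laplacian that of a gradient field, so a single extension result serves both. *)
Definition wdiv W (h : 'I_n.+1 -> V -> R) (f : V -> R) :=
  forall E c K, cinfs E -> compact K -> K `<=` W -> (forall x, ~ K x -> prodf E c x = 0) ->
  \sum_i \int[mu]_x (h i x * prodf E (cS c i) x) = - \int[mu]_x (f x * prodf E c x).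

Lemma cvg_sumr p (a : 'I_p -> nat -> R) (l : 'I_p -> R) :
  (forall i, a i @ \oo --> l i) -> (fun k => \sum_i a i k) @ \oo --> \sum_i l i.
Proof.
elim: p a l => [|p IH] a l h.
  rewrite big_ord0 (_ : (fun k => _) = fun=> 0); first exact: cvg_cst.
  by apply/funext => k; rewrite big_ord0.
rewrite big_ord_recr/= (_ : (fun k => _) = fun k => \sum_(i < p) a (widen_ord (leqnSn p) i) k + a ord_max k).
  by apply: cvgD; [apply: IH => i; exact: h|exact: h].
by apply/funext => k; rewrite big_ord_recr.
Qed.

Lemma mo_wdiv W (h : 'I_n.+1 -> V -> R) f x k : wdiv W h f -> good W x k ->
  \sum_i mo (h i) (2^-1 ^+ k) bumpf (cS c1 i) x = - mo f (2^-1 ^+ k) bumpf c1 x.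
Proof.
move=> wd gx; have e0 : 0 < 2^-1 ^+ k :> R by rewrite exprn_gt0.
have sA := stepfuns_aff x e0 (@stepfuns_bumpf R n).
have cB : cinfs (bumpf : 'I_n.+1 -> R -> R) by case: (@stepfuns_bumpf R n).
apply: (wd _ _ [set y | ~ outbox (fun j => x ord0 j + 2^-1 ^+ k * -1) (fun j => x ord0 j + 2^-1 ^+ k * 1) y]).
- exact: cinfs_aff.
- exact: compact_box.
- move=> y /= /(contra_not (outbox_aff _ _ _ _ e0).2) /nout1 h1.
  have -> : y = x + (y - x) by rewrite addrCA subrr addr0.
  apply: gx; move: h1; rewrite normrZ ger0_norm ?invr_ge0 ?(ltW e0)//.
  by rewrite ler_pdivrMl// mulr1.
- by move=> y /contrapT; exact: (prodf_step0 sA).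
Qed.

Hypothesis mu_pos : forall A : set V, open A -> A !=set0 -> (0 < mu A)%E.

(** Cut-offs along a C^1 graph are only C^1 and not of product form. Rather than the test function,
    the field and [f] are mollified: they satisfy the equation classically on [K], integration by
    parts applies, and the integrals converge weakly. *)
Lemma wdiv_C1 W (h : 'I_n.+1 -> V -> R) f phi (phi1 : 'I_n.+1 -> V -> R) K : open W -> wdiv W h f ->
  (forall i, mu.-integrable [set: L] (EFin \o h i)) -> mu.-integrable [set: L] (EFin \o f) ->
  continuous phi -> (forall i, continuous (phi1 i)) ->
  (forall i x, is_derive x (e_ i) phi (phi1 i x)) ->
  compact K -> K `<=` W -> (forall x, ~ K x -> phi x = 0) ->
  \sum_i \int[mu]_x (h i x * phi1 i x) = - \int[mu]_x (f x * phi x).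
Proof.
move=> oW wd ih i_f cphi cphi1 dphi cK KW K0.
have m0 : 0 < M0 := step_mass_gt0 mu_pos.
have [M KM] := compact_boundedN cK.
have phiM x : M < `|x| -> phi x = 0.
  by move=> Mx; apply: K0 => /KM; rewrite leNgt Mx.
have phi1M i x : M < `|x| -> phi1 i x = 0.
  move=> /near_lt_norm Mx; apply: is_derive_near0 (dphi i x).
  by apply: filterS Mx => y; exact: phiM.
have [k0 gk] := compact_good oW cK KW.
have sB := @stepfuns_bumpf R n.
have supp c (z : V) : (forall j, (0 < c j)%N) -> @boxM R n (fun=> -1) (fun=> 1) < `|z| ->
    prodf (bumpf : 'I_n.+1 -> R -> R) c z = 0.
  by move=> c0; exact: (prodf_step0M sB).
have cS0 i j : (0 < cS (@c1 n) i j)%N by [].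
pose mk (g : V -> R) k c := mo g (2^-1 ^+ k) bumpf c.
have cm g k c : mu.-integrable [set: L] (EFin \o g) -> (forall j, (0 < c j)%N) -> continuous (mk g k c).
  by move=> ig c0; exact: (@cont_mo R n g (2^-1 ^+ k) ig _ c _ sB.1 (fun z => supp c z c0)).
have dm g k i x : mu.-integrable [set: L] (EFin \o g) ->
    is_derive x (e_ i) (mk g k c1) (- mk g k (cS c1 i) x).
  by move=> ig; exact: (@drv_mo R n g (2^-1 ^+ k) ig _ c1 i _ x sB.1 (fun z => supp c1 z (fun=> isT))).
have mwd k : (k0 <= k)%N -> forall x, K x -> \sum_i mk (h i) k (cS c1 i) x = - mk f k c1 x.
  by move=> kk x Kx; apply: mo_wdiv wd _; exact: good_mono (gk _ Kx) kk.
have lim1 i := mo_weak_cvg sB (ih i) (cphi1 i) (phi1M i).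
have lim2 := mo_weak_cvg sB i_f cphi phiM.
have {lim1} lim1 i : (fun k => \int[mu]_x (mk (h i) k c1 x * phi1 i x)) @ \oo -->
  M0 * \int[mu]_x (h i x * phi1 i x) by exact: lim1.
have {lim2} lim2 : (fun k => \int[mu]_x (mk f k c1 x * phi x)) @ \oo -->
  M0 * \int[mu]_x (f x * phi x) by exact: lim2.
clearbody mk.
have icc (a b : V -> R) : continuous a -> continuous b -> (forall x, M < `|x| -> b x = 0) ->
    mu.-integrable [set: L] (EFin \o (fun x => a x * b x)).
  move=> ca cb b0; apply: (integrable_Cc (M := M)); first exact: contM.
  by move=> x /b0 ->; rewrite mulr0.
have E k : (k0 <= k)%N ->
    \sum_i \int[mu]_x (mk (h i) k c1 x * phi1 i x) = - \int[mu]_x (mk f k c1 x * phi x).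
  move=> kk.
  have E1 i : \int[mu]_x (mk (h i) k c1 x * phi1 i x) = \int[mu]_x (mk (h i) k (cS c1 i) x * phi x).
    have c_1 := cm _ k c1 (ih i) (fun=> isT).
    have c_2 := cm _ k (cS c1 i) (ih i) (cS0 i).
    have := @integral_partial0 R n (fun x => mk (h i) k c1 x * phi x)
      (fun x => - mk (h i) k (cS c1 i) x * phi x + mk (h i) k c1 x * phi1 i x) i M
      (contM c_1 cphi) (contD (contM (contN c_2) cphi) (contM c_1 (cphi1 i)))
      (fun x => drvM (dm _ k i x (ih i)) (dphi i x)) (fun x Mx => etrans (congr1 _ (phiM x Mx)) (mulr0 _)).
    rewrite RintegralD//; last 2 first.
    - exact: (icc _ _ (contN c_2) cphi phiM).
    - exact: (icc _ _ c_1 (cphi1 i) (phi1M i)).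
    have -> : \int[mu]_x (- mk (h i) k (cS c1 i) x * phi x) = - \int[mu]_x (mk (h i) k (cS c1 i) x * phi x).
      rewrite -mulN1r; have <- : \int[mu]_x (-1 * (mk (h i) k (cS c1 i) x * phi x)) =
          -1 * \int[mu]_x (mk (h i) k (cS c1 i) x * phi x).
        by apply: RintegralZl => //; exact: (icc _ _ c_2 cphi phiM).
      by congr (Rintegral _ _ _); apply/funext => x; rewrite mulN1r mulNr.
    by move=> e; apply/eqP; rewrite -subr_eq0 addrC e.
  rewrite (eq_bigr _ (fun i _ => E1 i)).
  have <- : \int[mu]_x (\sum_i (mk (h i) k (cS c1 i) x * phi x)) =
      \sum_i \int[mu]_x (mk (h i) k (cS c1 i) x * phi x).
    by apply: Rintegral_sumN => // i; exact: (icc _ _ (cm _ k (cS c1 i) (ih i) (cS0 i)) cphi phiM).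
  have -> : (- \int[mu]_x (mk f k c1 x * phi x)) = \int[mu]_x (-1 * (mk f k c1 x * phi x)).
    rewrite -[LHS]mulN1r; apply: esym; apply: RintegralZl => //.
    exact: (icc _ _ (cm _ k c1 i_f (fun=> isT)) cphi phiM).
  congr (Rintegral _ _ _); apply/funext => x.
  rewrite -mulr_suml; case: (pselect (K x)) => Kx.
    by rewrite (mwd k kk x Kx) mulN1r mulNr.
  by rewrite (K0 x Kx) !mulr0.
have l1 := cvg_sumr lim1.
have l2 : (fun k => \sum_i \int[mu]_x (mk (h i) k c1 x * phi1 i x)) @ \oo --> - (M0 * \int[mu]_x (f x * phi x)).
  apply: cvg_trans (cvgN lim2); apply: near_eq_cvg; near=> k.
  by rewrite E//; near: k; exists k0.
have e := @cvg_unique _ (@norm_hausdorff _ R^o) _ _ _ _ l1 l2.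
apply: (mulfI (lt0r_neq0 m0)); rewrite mulr_sumr mulrN; apply: e.
Unshelve. all: by end_near. Qed.

(* Extension across the boundary: the test function is cut off at depth t below
   the graph, and the error term is bounded by sup |h| over the strip times the
   integral of the cutoff derivative, which an integration by parts along the
   axis of the graph bounds independently of t. *)
Section extension.
Unset Implicit Arguments.
Variables (Om B : set V) (psi : V -> R) (psi1 : 'I_n.+1 -> V -> R) (i0 : 'I_n.+1) (s : R).
Variables (h : 'I_n.+1 -> V -> R) (f : V -> R).
Hypothesis oO : open Om.
Hypothesis cpsi1 : forall i, continuous (psi1 i).
Hypothesis dpsi : forall i x, is_derive x (e_ i) psi (psi1 i x).
Hypothesis psi_axis : forall x, psi1 i0 x = s.
Hypothesis s1 : `|s| = 1.
Hypothesis BO : forall x, B x -> Om x <-> psi x < 0.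
Hypothesis wd : wdiv Om h f.
Hypothesis ih : forall i, mu.-integrable [set: L] (EFin \o h i).
Hypothesis i_f : mu.-integrable [set: L] (EFin \o f).
Hypothesis h0 : forall i x, ~ Om x -> h i x = 0.
Hypothesis f0 : forall x, ~ Om x -> f x = 0.
Hypothesis h_bd : forall i x, B x -> psi x = 0 -> forall e : R, 0 < e ->
  \forall y \near x, `|h i y| <= e.

Let cpsi : continuous psi.
Proof.
move=> x; apply: differentiable_continuous.
apply: (differentiable_partials (f1 := psi1) _ (fun i => cpsi1 i x)).1.
exact: (@filterE _ (nbhs x) _ _ (fun z j => dpsi j z)).
Qed.

Let t k : R := 2^-1 ^+ k.
Let t0 k : 0 < t k. Proof. by apply: exprn_gt0; lra. Qed.
(** The transition of [zeta k] is the strip -2 t <= psi <= -t inside the domain, and the gradient of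
    [zeta k] is -D k times that of [psi]. *)
Let arg k x : R := - (t k)^-1 * psi x + -1.
Let zeta k x : R := step (arg k x).
Let D k x : R := dstep (arg k x) * (t k)^-1.

Let carg k : continuous (arg k).
Proof. exact: (contD (contM (@contC _ _ (- (t k)^-1)) cpsi) (@contC _ _ (-1))). Qed.

Let czeta k : continuous (zeta k).
Proof. exact: (cont_comp (@cont_step R) (carg k)). Qed.

Let cD k : continuous (D k).
Proof. exact: (contM (cont_comp (@cont_dstep R) (carg k)) (@contC _ _ (t k)^-1)). Qed.

Let D0 k x : 0 <= D k x.
Proof. by apply: mulr_ge0; [exact: dstep_ge0|rewrite invr_ge0 ltW]. Qed.

Let dzeta k i x : is_derive x (e_ i) (zeta k) (- (D k x * psi1 i x)).
Proof.
apply: (drv_eq (drv_comp (is_derive_step (arg k x)) (drvD (drvZ (- (t k)^-1) (dpsi i x)) (drvC (-1) x (e_ i))))).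
by rewrite addr0 /D mulNr mulrN mulrA.
Qed.

Let argE k x : arg k x = - (psi x / t k) - 1.
Proof. by rewrite /arg mulNr mulrC. Qed.

Let zeta1 k x : psi x <= - (2 * t k) -> zeta k x = 1.
Proof.
move=> px; apply: step1; rewrite argE lerBrDr -mulNr ler_pdivlMr//.
by move: px; rewrite mulrDl !mul1r; lra.
Qed.

Let zeta0 k x : - t k < psi x -> zeta k x = 0.
Proof.
move=> px; apply: step0; rewrite argE subr_le0 -mulNr ler_pdivrMr//.
by move: px; rewrite mul1r; lra.
Qed.

Let Dstrip k x : D k x != 0 -> - (2 * t k) <= psi x <= - t k.
Proof.
move=> Dn; apply/andP; split; rewrite leNgt; apply/negP => px; move/eqP: Dn; apply.
  rewrite /D dstep0 ?mul0r//; right; rewrite argE ltrBrDr -mulNr ltr_pdivlMr//.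
  by move: px; rewrite mulrDl !mul1r; lra.
rewrite /D dstep0 ?mul0r//; left; rewrite argE subr_lt0 -mulNr ltr_pdivrMr//.
by move: px; rewrite mul1r; lra.
Qed.

Let zeta_norm k x : `|zeta k x| <= 1.
Proof. by rewrite ger0_norm; [exact: step_le1|exact: step_ge0]. Qed.

Let t_small (d : R) : 0 < d -> exists k0, forall k, (k0 <= k)%N -> t k <= d.
Proof. exact: half_to0. Qed.

Set Implicit Arguments.

Lemma cutoff_graph_cvg (g : V -> R) : mu.-integrable [set: L] (EFin \o g) ->
  (forall x, g x != 0 -> psi x < 0) ->
  (fun k => \int[mu]_x (g x * zeta k x)) @ \oo --> \int[mu]_x g x.
Proof.
move=> ig g0.
have mg : measurable_fun [set: L] (g : L -> R).
  by apply/measurable_EFinP; exact: measurable_int ig.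
apply: (@Rintegral_dominated_cvg R n (fun k x => g x * zeta k x) g (fun x => `|g x|)).
- by move=> k; apply: (measurable_funM mg); exact: continuous_measurableN.
- exact: mg.
- apply: aeW => x; case: (eqVneq (g x) 0) => [->|gx].
    by apply: cvg_near_cst; apply: nearW => k; rewrite mul0r.
  have px : 0 < - psi x / 2 by have := g0 x gx; lra.
  have [k0 hk] := t_small _ px.
  apply: cvg_near_cst; near=> k; rewrite zeta1 ?mulr1//.
  have kk : (k0 <= k)%N by near: k; exists k0.
  by have := hk k kk; lra.
- exact: (integrable_norm ig).
- by move=> k x; apply: le_norm_mul1.
Unshelve. all: by end_near. Qed.

(** The derivative of [psi] along [i0] is the constant [s] of modulus 1, so [D k] is up to sign the
    derivative along [i0] of a function with values in [0, 1]. A cut-off equal to 1 on [K] receives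
    that derivative, and [C] is the integral of its absolute value. *)
Lemma cutoff_graph_mass K : compact K -> exists2 C : R, 0 <= C & forall k (g : V -> R) (d : R),
  measurable_fun [set: L] (g : L -> R) -> 0 <= d ->
  (forall x, `|g x| <= d) -> (forall x, ~ K x -> g x = 0) ->
  `|\int[mu]_x (g x * D k x)| <= d * C.
Proof.
move=> /compact_boundedN[M0' KM0]; pose M := `|M0'| + 1.
have KM x : K x -> `|x| <= M by move=> /KM0 h1; have := ler_norm M0'; rewrite /M; lra.
have M1 : 1 <= M by rewrite /M lerDr.
pose a := n.+1%:R * M ^+ 2 : R; pose b := a + 1; pose N := b + 1.
have ab : a < b by rewrite /b ltrDl.
have a0 : 0 <= a by apply: mulr_ge0 => //; apply: exprn_ge0; lra.
have [cc cc1 _ [dcc _] _] := cutoff_C2 (n := n) a b.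
have coff x : N < `|x| -> cutoff a b x = 0.
  move=> Nx; apply: cutoff_eq0 => //.
  have [i xi] : exists i, N < `|x ord0 i|.
    apply: contrapT => /forallNP h1; move: Nx; rewrite ltNge => /negP; apply.
    apply/normV_leP; first by rewrite /N /b; lra.
    by move=> i; rewrite leNgt; apply/negP; exact: h1.
  rewrite /sq (bigD1 i)//=; apply: (@le_trans _ _ (x ord0 i ^+ 2)); last first.
    by rewrite lerDl; apply: sumr_ge0 => j _; exact: sqr_ge0.
  rewrite -real_normK ?num_real// expr2.
  move: xi a0; rewrite /N /b; move: `|x ord0 i| => r; move: (a) => a' ra a0'; nra.
have con x : K x -> cutoff a b x = 1.
  move=> Kx; apply: cutoff_eq1 => //; rewrite /sq /a.
  apply: (@le_trans _ _ (\sum_(i < n.+1) M ^+ 2)).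
    apply: ler_sum => i _; have := le_trans (normV_coord x i) (KM x Kx).
    move: (x ord0 i) => r; rewrite ler_norml => /andP[r1 r2].
    rewrite -subr_ge0 (_ : _ - _ = (M - r) * (M - - r)); last by ring.
    by apply: mulr_ge0; [rewrite subr_ge0|rewrite subr_ge0 lerNl].
  by rewrite sumr_const card_ord -[leLHS]mulr_natl.
have c1off i x : N < `|x| -> cutoff1 a b i x = 0.
  move=> /near_lt_norm Nx; apply: is_derive_near0 (dcc i x).
  by apply: filterS Nx => y; exact: coff.
pose C := \int[mu]_x `|cutoff1 a b i0 x|.
have C0 : 0 <= C by apply: Rintegral_ge0.
have icc (p q : V -> R) : continuous p -> continuous q -> (forall x, N < `|x| -> q x = 0) ->
    mu.-integrable [set: L] (EFin \o (fun x => p x * q x)).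
  move=> cp cq q0; apply: (integrable_Cc (M := N)); first exact: contM.
  by move=> x /q0 ->; rewrite mulr0.
have ic1 : mu.-integrable [set: L] (EFin \o (fun x => `|cutoff1 a b i0 x|)).
  by apply: integrable_norm; apply: (integrable_Cc (cc1 i0) (M := N)); exact: c1off.
exists C => // k g d mg d0 gd g0.
have iD : mu.-integrable [set: L] (EFin \o (fun x => D k x * cutoff a b x)).
  exact: icc (cD k) cc coff.
have mass : \int[mu]_x (D k x * cutoff a b x) <= C.
  have := @integral_partial0 R n (fun x => zeta k x * cutoff a b x)
    (fun x => - (D k x * psi1 i0 x) * cutoff a b x + zeta k x * cutoff1 a b i0 x) i0 N
    (contM (czeta k) cc) (contD (contM (contN (contM (cD k) (cpsi1 i0))) cc) (contM (czeta k) (cc1 i0)))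
    (fun x => drvM (dzeta k i0 x) (dcc i0 x)) (fun x Nx => etrans (congr1 _ (coff x Nx)) (mulr0 _)).
  rewrite RintegralD//; last 2 first.
  - exact: (icc _ _ (contN (contM (cD k) (cpsi1 i0))) cc coff).
  - exact: (icc _ _ (czeta k) (cc1 i0) (c1off i0)).
  have -> : \int[mu]_x (- (D k x * psi1 i0 x) * cutoff a b x) = - s * \int[mu]_x (D k x * cutoff a b x).
    have <- : \int[mu]_x (- s * (D k x * cutoff a b x)) = - s * \int[mu]_x (D k x * cutoff a b x).
      by apply: RintegralZl.
    congr (Rintegral _ _ _); apply/funext => x; rewrite psi_axis.
    by move: (D k x) (cutoff a b x) => p q; ring.
  move=> e.
  have h1 : `|\int[mu]_x (zeta k x * cutoff1 a b i0 x)| <= C.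
    apply: (le_trans (le_normr_Rintegral _ _)) => //.
      exact: (icc _ _ (czeta k) (cc1 i0) (c1off i0)).
    apply: le_Rintegral => //.
    - by apply: integrable_norm; exact: (icc _ _ (czeta k) (cc1 i0) (c1off i0)).
    - by move=> x _; rewrite mulrC; apply: le_norm_mul1.
  apply: (le_trans _ h1); move: e.
  move: (\int[mu]_x (D k x * _)) (\int[mu]_x (zeta k x * _)) => p q /eqP.
  rewrite mulNr addrC subr_eq0 => /eqP ->; rewrite normrM s1 mul1r; exact: ler_norm.
have igD : mu.-integrable [set: L] (EFin \o (fun x => g x * D k x)).
  rewrite (_ : (fun x => g x * D k x) = fun x => (D k x * cutoff a b x) * g x).
    exact: (integrable_mulb (@measurableT _ L) iD mg gd).
  apply/funext => x; case: (pselect (K x)) => Kx; last by rewrite (g0 x Kx) mul0r mulr0.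
  by rewrite (con x Kx) mulr1 mulrC.
apply: (le_trans (le_normr_Rintegral _ _)) => //.
apply: (@le_trans _ _ (\int[mu]_x (d * (D k x * cutoff a b x)))).
  apply: le_Rintegral => //.
  - exact: integrable_norm.
  - exact: integrable_scale.
  - move=> x _; rewrite normrM (ger0_norm (D0 k x)).
    case: (pselect (K x)) => Kx.
      by rewrite (con x Kx) mulr1; apply: ler_wpM2r.
    rewrite (g0 x Kx) normr0 mul0r; apply: mulr_ge0 => //; apply: mulr_ge0 => //; exact: cutoff_ge0.
have -> : \int[mu]_x (d * (D k x * cutoff a b x)) = d * \int[mu]_x (D k x * cutoff a b x) by exact: RintegralZl.
exact: ler_wpM2l.
Qed.

(** Compactness, with three kinds of points: where psi < 0 the strip eventually moves away, where
    psi = 0 the field is small nearby, and near a point with psi > 0 the strip does not come. *)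
Lemma strip_small K (e : R) : compact K -> K `<=` B -> 0 < e ->
  exists k0, forall k x i, (k0 <= k)%N -> K x -> D k x != 0 -> `|h i x| <= e.
Proof.
move=> /compact_near_coveringP cK KB e0.
pose P k x := - (2 * t k) <= psi x -> psi x < 0 -> forall i, `|h i x| <= e.
suff hP : forall x, K x -> \forall y \near x & k \near \oo, P k y.
  have [k0 _ hk] := cK nat \oo P _ hP.
  exists k0 => k x i kk Kx /Dstrip/andP[d1 d2]; apply: (hk k kk x Kx) => //.
  by apply: le_lt_trans d2 _; rewrite oppr_lt0.
move=> x Kx; have [px|px|px] := ltgtP (psi x) 0.
- have p2 : psi x < psi x / 2 by lra.
  have p4 : 0 < - psi x / 4 by lra.
  have [k0 hk] := t_small _ p4.
  exists ([set y | psi y < psi x / 2], [set k | (k0 <= k)%N]).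
    by split; [exact: near_cont_lt p2|exists k0].
  by move=> [y k] /= [py kk]; rewrite /P => h1 h2; have := hk k kk; lra.
- exists ([set y | 0 < psi y], setT); first by split; [exact: near_cont_gt px|exact: filterT].
  by move=> [y k] /= [py _]; rewrite /P => _; rewrite ltNge (ltW py).
- exists ([set y | forall i, `|h i y| <= e], setT); last by move=> [y k] /= [hy _] _ _; exact: hy.
  split; last exact: filterT.
  apply: (@filter_forall _ _ (fun i y => `|h i y| <= e) (nbhs x) _) => i.
  exact: h_bd (KB _ Kx) px e e0.
Qed.

Lemma wdiv_extend : wdiv B h f.
Proof.
move=> E c K cE cK KB K0.
set phi := prodf E c; pose phi1 i := prodf E (cS c i).
have cphi : continuous phi by exact: cont_prodf.
have cphi1 i : continuous (phi1 i) by exact: cont_prodf.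
have dphi i x : is_derive x (e_ i) phi (phi1 i x) by exact: drv_prodf.
have phi1K i x : ~ K x -> phi1 i x = 0 by move=> nK; exact: (prodf_cS_off i cE cK K0 nK).
have [M KM] := compact_boundedN cK.
have phiM x : M < `|x| -> phi x = 0.
  by move=> Mx; apply: K0 => /KM; rewrite leNgt Mx.
have phi1M i x : M < `|x| -> phi1 i x = 0.
  by move=> Mx; apply: phi1K => /KM; rewrite leNgt Mx.
have [Cp Cp0 phiC] := bounded_bsupp cphi phiM.
rewrite -/phi -[LHS]/(\sum_i \int[mu]_x (h i x * phi1 i x)).
have {}K0 x : ~ K x -> phi x = 0 by exact: K0.
clearbody phi phi1.
have ihb i (g : V -> R) : continuous g -> (forall x, M < `|x| -> g x = 0) ->
    mu.-integrable [set: L] (EFin \o (fun x => h i x * g x)).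
  move=> cg gM; have [C _ gC] := bounded_bsupp cg gM.
  by apply: (integrable_mulb (@measurableT _ L) (ih i) _ gC); exact: continuous_measurableN.
have ifb (g : V -> R) : continuous g -> (forall x, M < `|x| -> g x = 0) ->
    mu.-integrable [set: L] (EFin \o (fun x => f x * g x)).
  move=> cg gM; have [C _ gC] := bounded_bsupp cg gM.
  by apply: (integrable_mulb (@measurableT _ L) i_f _ gC); exact: continuous_measurableN.
have neg x : K x -> Om x -> psi x < 0 by move=> /KB /BO[+ _].
have id k : \sum_i (\int[mu]_x (h i x * phi1 i x * zeta k x) - \int[mu]_x (h i x * phi x * psi1 i x * D k x)) =
    - \int[mu]_x (f x * phi x * zeta k x).
  (* The product of the test function and the cut-off is supported at depth at least t, in a compact
     subset of [Om], so the equation in [Om] applies to it. *)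
  pose Kk := K `&` [set x | psi x <= - t k].
  have cKk : compact Kk.
    apply: compact_closedI => //.
    by have /continuous_closedP/(_ _ (@closed_le R (- t k))) := cpsi.
  have KkO : Kk `<=` Om.
    move=> x [Kx /= px]; apply/(BO x (KB _ Kx)); apply: (le_lt_trans px).
    by rewrite oppr_lt0.
  have off x : ~ Kk x -> phi x * zeta k x = 0.
    move=> nK; case: (pselect (K x)) => Kx; last by rewrite (K0 x Kx) mul0r.
    rewrite zeta0 ?mulr0// ltNge; apply/negP => px; exact: nK.
  have := wdiv_C1 oO wd ih i_f (contM cphi (czeta k))
    (fun i => contD (contM (cphi1 i) (czeta k)) (contM cphi (contN (contM (cD k) (cpsi1 i)))))
    (fun i x => drvM (dphi i x) (dzeta k i x)) cKk KkO off.
  have -> : (fun x => f x * (phi x * zeta k x)) = fun x => f x * phi x * zeta k x.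
    by apply/funext => x; rewrite mulrA.
  move=> <-; apply: eq_bigr => i _.
  have i1 : mu.-integrable [set: L] (EFin \o (fun x => h i x * phi1 i x * zeta k x)).
    rewrite (_ : (fun x => _) = fun x => h i x * (phi1 i x * zeta k x)).
      apply: ihb; first exact: contM.
      by move=> x /phi1M ->; rewrite mul0r.
    by apply/funext => x; rewrite mulrA.
  have i2 : mu.-integrable [set: L] (EFin \o (fun x => h i x * phi x * psi1 i x * D k x)).
    rewrite (_ : (fun x => _) = fun x => h i x * (phi x * (psi1 i x * D k x))).
      apply: ihb; first by apply: contM => //; exact: contM.
      by move=> x /phiM ->; rewrite mul0r.
    by apply/funext => x; rewrite !mulrA.
  rewrite -RintegralB//; congr (Rintegral _ _ _); apply/funext => x.
  by move: (h i x) (phi1 i x) (zeta k x) (phi x) (D k x) (psi1 i x) => a b c' d e' f'; ring.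
have A1 i : (fun k => \int[mu]_x (h i x * phi1 i x * zeta k x)) @ \oo --> \int[mu]_x (h i x * phi1 i x).
  apply: (@cutoff_graph_cvg (fun x => h i x * phi1 i x) (ihb i (phi1 i) (cphi1 i) (phi1M i))).
  move=> x; case: (pselect (Om x)) => Ox; last by rewrite h0// mul0r eqxx.
  case: (pselect (K x)) => Kx; last by rewrite phi1K// mulr0 eqxx.
  by move=> _; exact: neg.
have A2 : (fun k => \int[mu]_x (f x * phi x * zeta k x)) @ \oo --> \int[mu]_x (f x * phi x).
  apply: (@cutoff_graph_cvg (fun x => f x * phi x) (ifb phi cphi phiM)).
  move=> x; case: (pselect (Om x)) => Ox; last by rewrite f0// mul0r eqxx.
  case: (pselect (K x)) => Kx; last by rewrite K0// mulr0 eqxx.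
  by move=> _; exact: neg.
have [Cm Cm0 mass] := cutoff_graph_mass cK.
have A3 i : (fun k => \int[mu]_x (h i x * phi x * psi1 i x * D k x)) @ \oo --> (0 : R).
  have [Q Q0 pQ] : exists2 Q, 0 < Q & forall x, `|phi x * psi1 i x| <= Q.
    by apply: (bounded_bsupp (M := M)); [exact: contM|move=> x /phiM ->; rewrite mul0r].
  apply/(@cvgrPdist_le R R^o) => e e0.
  pose d := e / (Q * (Cm + 1)).
  have QC : 0 < Q * (Cm + 1) by apply: mulr_gt0 => //; lra.
  have d0 : 0 < d by rewrite divr_gt0.
  have [k0 hk] := strip_small cK KB d0.
  near=> k; have kk : (k0 <= k)%N by near: k; exists k0.
  rewrite sub0r normrN.
  (* [h i] is known to be small only on the strip; replacing the factor by 0 where [D k] vanishes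
     leaves the product unchanged and makes the bound global. *)
  pose g x := if D k x == 0 then 0 else h i x * phi x * psi1 i x.
  have -> : (fun x => h i x * phi x * psi1 i x * D k x) = fun x => g x * D k x.
    by apply/funext => x; rewrite /g; case: eqP => [->|//]; rewrite !mulr0.
  have mh : measurable_fun [set: L] (h i : L -> R).
    by apply/measurable_EFinP; exact: measurable_int (ih i).
  apply: (le_trans (mass k g (d * Q) _ _ _ _)).
  - apply: measurable_fun_ifT; last 2 first.
    + exact: measurable_cst.
    + apply: measurable_funM; last exact: continuous_measurableN.
      by apply: measurable_funM => //; exact: continuous_measurableN.
    + apply: measurable_fun_eqr; [exact: continuous_measurableN|exact: measurable_cst].
  - by apply: mulr_ge0; exact: ltW.
  - move=> x; rewrite /g; case: eqP => [_|/eqP Dx].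
      by rewrite normr0; apply: mulr_ge0; exact: ltW.
    case: (pselect (K x)) => Kx; last first.
      by rewrite (K0 x Kx) mulr0 mul0r normr0; apply: mulr_ge0; exact: ltW.
    by rewrite -mulrA normrM; apply: ler_pM => //; exact: hk kk Kx Dx.
  - move=> x nK; rewrite /g; case: eqP => // _.
    by rewrite (K0 x nK) mulr0 mul0r.
  - rewrite -mulrA; apply: (@le_trans _ _ (d * (Q * (Cm + 1)))).
      by apply: ler_wpM2l; [exact: ltW|apply: ler_wpM2l; [exact: ltW|lra]].
    by rewrite /d divfK// gt_eqF.
have l1 : (fun k => \sum_i (\int[mu]_x (h i x * phi1 i x * zeta k x) - \int[mu]_x (h i x * phi x * psi1 i x * D k x)))
   @ \oo --> \sum_i (\int[mu]_x (h i x * phi1 i x) - 0).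
  by apply: (@cvg_sumr _ (fun i k => \int[mu]_x (h i x * phi1 i x * zeta k x) - \int[mu]_x (h i x * phi x * psi1 i x * D k x))) => i; apply: cvgB; [exact: A1|exact: A3].
have l2 : (fun k => - \int[mu]_x (f x * phi x * zeta k x)) @ \oo --> - \int[mu]_x (f x * phi x).
  exact: cvgN.
have l3 : (fun k => \sum_i (\int[mu]_x (h i x * phi1 i x * zeta k x) - \int[mu]_x (h i x * phi x * psi1 i x * D k x)))
   @ \oo --> - \int[mu]_x (f x * phi x).
  have E1 : (fun k => \sum_i (\int[mu]_x (h i x * phi1 i x * zeta k x) - \int[mu]_x (h i x * phi x * psi1 i x * D k x)))
    = (fun k => - \int[mu]_x (f x * phi x * zeta k x)) by apply/funext => k; exact: id.
  by rewrite E1; exact: l2.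
have e := @cvg_unique _ (@norm_hausdorff _ R^o) _ _ _ _ l1 l3.
transitivity (\sum_i (\int[mu]_x (h i x * phi1 i x) - 0)); last exact: e.
by apply: eq_bigr => i _; rewrite subr0.
Unshelve. all: by end_near. Qed.

End extension.

End divergence_identity.

(** * Vanishing of the gradient on the boundary *)

Section boundary_gradient.
Context {R : realType} {n : nat}.
Local Notation V := ('rV[R]_n.+1).
Local Notation e_ i := (delta_mx ord0 i : V).
Implicit Types (x y z v : V) (Om : set V) (w : V -> R) (G : V -> V).

Lemma lformBl (A A' v : V) : lform A v - lform A' v = lform (A - A') v.
Proof. by rewrite /lform -sumrB; apply: eq_bigr => i _; rewrite !mxE mulrBr. Qed.

Lemma lformZ (A v : V) (c : R) : lform A (c *: v) = c * lform A v.
Proof. by rewrite linearZ. Qed.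

Lemma lformD (A v v' : V) : lform A (v + v') = lform A v + lform A v'.
Proof. by rewrite linearD. Qed.

(** Only the open segment has to lie in [Om]: [w] is continuous up to the end points, so the mean
    value theorem needs derivatives at interior points alone. *)
Lemma segment_increment Om w G x0 y z (e : R) : C1_closure Om w G ->
  closure Om y -> closure Om z ->
  (forall t : R, 0 < t < 1 -> Om (y + t *: (z - y)) /\ `|G (y + t *: (z - y)) - G x0| <= e) ->
  `|w z - w y - lform (G x0) (z - y)| <= n.+1%:R * e * `|z - y|.
Proof.
move=> [cw _ dw] cy cz seg; set v := z - y.
pose F (t : R) := w (y + t *: v).
have F0 : F 0 = w y by rewrite /F scale0r addr0.
have F1 : F 1 = w z by rewrite /F scale1r /v addrCA subrr addr0.
have clF (t : R) : t \in `[0, 1] -> closure Om (y + t *: v).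
  rewrite in_itv/= => /andP[t0 t1].
  have [->|tn0] := eqVneq t 0; first by rewrite scale0r addr0.
  have [->|tn1] := eqVneq t 1; first by rewrite scale1r /v addrCA subrr addr0.
  apply: subset_closure; apply: (seg t _).1.
  by rewrite !lt_def tn0 t0 eq_sym tn1 t1.
have cF : {within `[0, 1], continuous F}.
  apply/subspace_continuousP => t /= t01.
  apply/(@cvgrPdist_lt R R^o) => eps eps0.
  have /subspace_continuousP/(_ _ (clF t t01)) := cw.
  move=> /(@cvgrPdist_lt R R^o V (within (closure Om) (nbhs (y + t *: v))) _ w (w (y + t *: v)))/(_ _ eps0).
  move=> /nbhs_ballP[r /= r0 hr].
  have v1 : 0 < `|v| + 1 by have := normr_ge0 v; lra.
  have d0 : 0 < r / (`|v| + 1) by rewrite divr_gt0.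
  exists (r / (`|v| + 1)) => //= t' tt' t'01.
  apply: (hr (y + t' *: v)); last exact: clF.
  rewrite -ball_normE /= opprD addrACA subrr add0r -scalerBl normrZ.
  apply: (@le_lt_trans _ _ (r / (`|v| + 1) * `|v|)); first by apply: ler_wpM2r => //; exact: ltW.
  by rewrite mulrAC ltr_pdivrMr// (ltr_pM2l r0); lra.
have dF (t : R) : t \in `]0, 1[ -> is_derive t 1 F (lform (G (y + t *: v)) v).
  rewrite in_itv/= => t01; have [Ot _] := seg t t01.
  have [d1 d2] := dw _ Ot.
  apply: is_derive_line; rewrite d2; apply: is_derive_diff => //.
  exact: diff_grad.
have [t] := MVT (@ltr01 R) dF cF.
rewrite in_itv/= => t01; rewrite F0 F1 subr0 mulr1 => ->.
rewrite lformBl; apply: (le_trans (lform_le _ _)).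
apply: ler_wpM2r => //; apply: ler_wpM2l => //.
exact: (seg t t01).2.
Qed.

Lemma graph_fun_axis i s (gam : 'rV[R]_n -> R) y (a : R) :
  graph_fun i s gam (y + a *: ((-1) ^+ s *: e_ i)) = graph_fun i s gam y - a.
Proof.
rewrite /graph_fun; have -> : col' i (y + a *: ((-1) ^+ s *: e_ i)) = col' i y.
  by apply/rowP => l; rewrite !mxE eqxx/= eq_sym (negbTE (neq_lift _ _)) !mulr0 addr0.
rewrite !mxE !eqxx/= mulr1 mulrDr (mulrC a) mulrA -expr2 sqrr_sign mul1r.
by rewrite opprD addrA.
Qed.

Lemma graph_zero_closure Om x i s gam (r : R) :
  (forall y, `|y - x| < r -> Om y <-> graph_fun i s gam y < 0) ->
  forall y, `|y - x| < r -> graph_fun i s gam y = 0 -> closure Om y.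
Proof.
move=> rO y yx py B /nbhs_ballP[d /= d0 dB].
set nu := (-1) ^+ s *: e_ i.
have nu1 : `|nu| = 1 by rewrite normrZ norm_delta mulr1 normrX normrN1 expr1n.
pose a := Num.min (d / 2) ((r - `|y - x|) / 2).
have rx : 0 < r - `|y - x| by rewrite subr_gt0.
have a0 : 0 < a by rewrite lt_min !divr_gt0.
have [a1 a2] : a <= d / 2 /\ a <= (r - `|y - x|) / 2 by rewrite /a !ge_min !lexx orbT.
have na : `|a *: nu| = a by rewrite normrZ nu1 mulr1 gtr0_norm.
exists (y + a *: nu); split; last first.
  by apply: dB; rewrite -ball_normE /= opprD addNKr normrN na; lra.
apply/rO.
  rewrite addrAC; apply: (le_lt_trans (ler_normD _ _)); rewrite na.
  by move: a2 rx; move: `|y - x| => b; lra.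
by rewrite graph_fun_axis py sub0r oppr_lt0.
Qed.

Lemma chart_closure0 Om x i s gam : boundary_chart Om x i s gam ->
  \forall y \near x, graph_fun i s gam y = 0 -> closure Om y.
Proof.
move=> ch; have [r r0 [rO _]] := chart_closure ch.
by apply: filterS (near_dist x r0) => y yx; exact: (graph_zero_closure rO).
Qed.

Lemma le_eps_eq0 (a C : R) : 0 <= C -> (forall e, 0 < e -> e <= 1 -> `|a| <= e * C) -> a = 0.
Proof.
move=> C0 h; apply: contrapT => /eqP a0.
have na : 0 < `|a| by rewrite normr_gt0.
pose e := Num.min 1 (`|a| / (2 * (C + 1))).
have C1 : 0 < 2 * (C + 1) by lra.
have e0 : 0 < e by rewrite lt_min ltr01 divr_gt0.
have e1 : e <= 1 by rewrite /e ge_min lexx.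
have e2 : e <= `|a| / (2 * (C + 1)) by rewrite /e ge_min lexx orbT.
have := h e e0 e1; rewrite leNgt => /negP; apply.
apply: (@le_lt_trans _ _ (`|a| / (2 * (C + 1)) * C)); first exact: ler_wpM2r.
rewrite mulrAC ltr_pdivrMr// (ltr_pM2l na); lra.
Qed.

(** The arithmetic of [tangential_gradient]: two expressions for w P, obtained from two zeros of
    [w], are subtracted and divided by [th], and what is left of the tangential derivative is of
    order [e]. *)
Lemma tangent_arith (N T e th gt gd gv gy nv de wP : R) : 0 < th -> 0 < e -> e <= 1 -> 0 <= N -> 0 <= T ->
  gv = th * (gt + e * gd) -> gy = de * gd -> nv <= th * (T + 1) -> 0 <= de -> de <= 2 * (th * e) ->
  `|wP - gv| <= N * e * nv -> `|wP - gy| <= N * e * de ->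
  `|gt| <= e * (N * (T + 3) + 3 * `|gd|).
Proof.
move=> th0 e0 e1 N0 T0 -> -> nvb de0 deb h1 h2.
have Ne : 0 <= N * e by apply: mulr_ge0 => //; exact: ltW.
rewrite -(ler_pM2l th0) -[X in X * `|gt|](gtr0_norm th0) -normrM.
have -> : th * gt = (wP - de * gd) - (wP - th * (gt + e * gd)) + (de * gd - th * e * gd) by ring.
apply: (le_trans (ler_normD _ _)).
have h3 : `|(wP - de * gd) - (wP - th * (gt + e * gd))| <= N * e * de + N * e * nv.
  by apply: (le_trans (ler_normB _ _)); exact: lerD h2 h1.
have h4 : N * e * de + N * e * nv <= N * e * (th * (T + 3)).
  rewrite -mulrDr; apply: ler_wpM2l => //.
  apply: (le_trans (lerD deb nvb)).
  have : th * e <= th * 1 by apply: ler_wpM2l => //; exact: ltW.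
  lra.
have h5 : `|de * gd - th * e * gd| <= 3 * (th * e) * `|gd|.
  rewrite -mulrBl normrM; apply: ler_wpM2r => //.
  have te : 0 < th * e by apply: mulr_gt0.
  by rewrite ler_norml; apply/andP; split; lra.
apply: (le_trans (lerD (le_trans h3 h4) h5)).
by rewrite le_eqVlt; apply/orP; left; apply/eqP; ring.
Qed.

(** A tangent vector need not lead into [Om], so it is tilted by e nu, where nu is the inward axis:
    P = x + th (tau + e nu) is inside, at depth [de] of order th e. Going back from P along the axis
    reaches a point y of the graph. As w x = w y = 0, the increments of [w] from x to P and from y
    to P agree, and e tends to 0. *)
Lemma tangential_gradient Om w G x i s gam (tau : V) : boundary_chart Om x i s gam ->
  C1_closure Om w G -> closure Om x -> graph_fun i s gam x = 0 ->
  (\forall y \near x, graph_fun i s gam y = 0 -> w y = 0) ->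
  lform (\row_j graph_partial i s gam j x) tau = 0 -> lform (G x) tau = 0.
Proof.
move=> ch wG clx px w0 At.
have gC1 := ch.1; have [cw cG dw] := wG.
set psi := graph_fun i s gam in px w0 *; set A := \row_j _ in At.
set nu := (-1) ^+ s *: e_ i.
have nu1 : `|nu| = 1 by rewrite normrZ norm_delta mulr1 normrX normrN1 expr1n.
have Anu : lform A nu = -1.
  rewrite lformZ lform_delta mxE graph_partial_axis mulrN -expr2.
  by rewrite sqrr_sign.
have [r1 r10 [rO _]] := chart_closure ch.
have N0 : 0 <= n.+1%:R :> R by [].
have T0 := normr_ge0 tau; set T := `|tau| in T0.
apply: (@le_eps_eq0 _ (n.+1%:R * (T + 3) + 3 * `|lform (G x) nu|)).
  apply: addr_ge0; first by apply: mulr_ge0 => //; lra.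
  by apply: mulr_ge0.
move=> e e0 e1.
have e20 : 0 < e / (2 * (T + 1)) by rewrite divr_gt0//; lra.
have [r2 r20 inc] := graph_increment i s gC1 x e20.
have [r3 r30 Gr] : exists2 r3, 0 < r3 & forall y, closure Om y -> `|y - x| < r3 -> `|G y - G x| <= e.
  have /subspace_continuousP/(_ _ clx) := cG.
  move=> /(@cvgrPdist_le R V V (within (closure Om) (nbhs x)) _ G (G x))/(_ _ e0)/nbhs_ballP[r3 /= r30 hr].
  exists r3 => // y cy yx; rewrite distrC; apply: (hr y) => //.
  by rewrite -ball_normE /= distrC.
have /nbhs_ballP[r4 /= r40 hr4] := w0.
have /nbhs_ballP[r5 /= r50 hr5] := chart_closure0 ch.
pose r := Num.min (Num.min (Num.min r1 r2) (Num.min r3 r4)) r5.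
have r0 : 0 < r by rewrite !lt_min r10 r20 r30 r40 r50.
have hr y : `|y - x| < r -> [/\ `|y - x| < r1, `|y - x| < r2 & `|y - x| < r3] /\
    (ball x r4 y /\ ball x r5 y).
  rewrite !lt_min => /andP[/andP[/andP[-> ->] /andP[-> h4]] h5]; split => //.
  by rewrite -!ball_normE /= distrC.
have {inc} inc v : `|v| < r -> `|psi (x + v) - lform A v| <= e / (2 * (T + 1)) * `|v|.
  rewrite !lt_min => /andP[/andP[/andP[_ v2] _] _].
  by have := inc x v; rewrite subrr normr0 -/psi px subr0; apply.
have {}rO y : `|y - x| < r -> psi y < 0 -> Om y by move=> /hr[[h1 _ _] _] py; apply/(rO y h1).
have {}Gr y : closure Om y -> `|y - x| < r -> `|G y - G x| <= e by move=> cy /hr[[_ _ h3] _]; exact: Gr.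
have {hr4}w0' y : `|y - x| < r -> psi y = 0 -> w y = 0 by move=> /hr[_ [h4 _]]; exact: hr4.
have {hr5}cl0 y : `|y - x| < r -> psi y = 0 -> closure Om y by move=> /hr[_ [_ h5]]; exact: hr5.
clear w0.
move: r r0 {hr} inc rO Gr w0' cl0 => r r0 inc rO Gr w0' cl0.
clear r1 r10 r2 r20 r3 r30 r4 r40 r5 r50.
(* Small enough for the segments from x to P and from P to y to stay in the ball of radius [r]; the
   summand 4 leaves room for the depth of P. *)
pose th := r / (2 * (T + 4)).
have T4 : 0 < 2 * (T + 4) by lra.
have th0 : 0 < th by rewrite divr_gt0.
have thr : th * (T + 4) < r by rewrite /th invfM mulrA -(mulrA _ (T + 4)^-1) mulVf ?mulr1; [lra|lra].
clearbody th.
pose v := th *: (tau + e *: nu).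
have nv : `|v| <= th * (T + 1).
  rewrite normrZ (gtr0_norm th0); apply: ler_wpM2l; first exact: ltW.
  apply: (le_trans (ler_normD _ _)); rewrite normrZ nu1 mulr1 (gtr0_norm e0).
  exact: lerD.
have Av : lform A v = - (th * e) by rewrite lformZ lformD lformZ At Anu add0r mulrN1 mulrN.
have the : 0 < th * e by rewrite mulr_gt0.
have thT : 0 <= th * T by apply: mulr_ge0 => //; exact: ltW.
have the1 : th * e <= th by rewrite -[leRHS]mulr1; apply: ler_wpM2l => //; exact: ltW.
have psiv (t : R) : 0 <= t -> t <= 1 -> `|psi (x + t *: v) + t * (th * e)| <= t * (th * e) / 2 /\ `|t *: v| <= t * (th * (T + 1)).
  move=> t0 t1; have ntv : `|t *: v| <= t * (th * (T + 1)).
    by rewrite normrZ ger0_norm//; apply: ler_wpM2l.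
  split => //.
  have tv : `|t *: v| < r.
    apply: (le_lt_trans ntv); apply: (@le_lt_trans _ _ (1 * (th * (T + 1)))).
      by apply: ler_wpM2r => //; apply: mulr_ge0; [exact: ltW|lra].
    by rewrite mul1r; move: thr; lra.
  have := inc _ tv; rewrite lformZ Av mulrN opprK => h; apply: (le_trans h).
  apply: (@le_trans _ _ (e / (2 * (T + 1)) * (t * (th * (T + 1))))).
    by apply: ler_wpM2l => //; exact: ltW.
  have T1 : T + 1 != 0 by rewrite gt_eqF//; lra.
  rewrite le_eqVlt; apply/orP; left; apply/eqP; field.
  by rewrite T1.
pose P := x + v.
have [psiP nvr] := psiv 1 ler01 (lexx 1).
rewrite !scale1r !mul1r -/P in psiP nvr.
pose de := - psi P.
have [de1 de2] : th * e / 2 <= de /\ de <= 3 / 2 * (th * e).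
  by move: psiP; rewrite ler_norml /de => /andP[d1 d2]; clear - d1 d2 the; split; lra.
have de0 : 0 < de by apply: lt_le_trans de1; rewrite divr_gt0.
pose y := P + (- de) *: nu.
have py : psi y = 0 by rewrite /psi graph_fun_axis -/psi opprK /de subrr.
have near_y (t : R) : 0 <= t -> t <= 1 -> `|P + (- (t * de)) *: nu - x| < r.
  move=> t0 t1.
  rewrite /P addrAC [x + v]addrC addrK; apply: (le_lt_trans (ler_normD _ _)).
  rewrite [`|(- (t * de)) *: nu|]normrZ nu1 mulr1 normrN (ger0_norm (x := t * de)); last by apply: mulr_ge0 => //; exact: ltW.
  have h1 : t * de <= 1 * de by apply: ler_wpM2r => //; exact: ltW.
  by move: thr nv; move: (T) the1 de2 h1 => T' h2 h3 h4 h5 h6; clear - h2 h3 h4 h5 h6 the thT; lra.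
have yx : `|y - x| < r by have := near_y 1 ler01 (lexx 1); rewrite mul1r.
have Px : `|P - x| < r by have := near_y 0 (lexx 0) ler01; rewrite mul0r oppr0 scale0r addr0.
have OP : Om P by apply: rO => //; rewrite -oppr_gt0.
have wx : w x = 0 by apply: w0' => //; rewrite subrr normr0.
have wy : w y = 0 by exact: w0'.
have s1 : `|w P - w x - lform (G x) (P - x)| <= n.+1%:R * e * `|P - x|.
  apply: segment_increment wG clx _ _; first exact: subset_closure.
  move=> t /andP[t0 t1]; have -> : P - x = v by rewrite /P addrAC subrr add0r.
  have [h1 h2] := psiv t (ltW t0) (ltW t1).
  have tr : `|x + t *: v - x| < r.
    rewrite addrAC subrr add0r; apply: (le_lt_trans h2).
    have thT1 : 0 <= th * (T + 1) by rewrite mulrDr mulr1; exact: addr_ge0 thT (ltW th0).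
    apply: (@le_lt_trans _ _ (1 * (th * (T + 1)))).
      by apply: ler_wpM2r => //; exact: ltW.
    by clear - thr th0 thT; rewrite mul1r; move: thr; lra.
  have Ot : Om (x + t *: v).
    apply: rO => //; move: h1; rewrite ler_norml => /andP[_ h1].
    have h3 : 0 < t * (th * e) by rewrite mulr_gt0.
    by clear - h1 h3; lra.
  by split => //; apply: Gr => //; exact: subset_closure.
have Py : P - y = de *: nu by rewrite /y opprD addrA subrr add0r scaleNr opprK.
have s2 : `|w P - w y - lform (G x) (P - y)| <= n.+1%:R * e * `|P - y|.
  apply: segment_increment wG (cl0 _ yx py) _ _; first exact: subset_closure.
  move=> t /andP[t0 t1]; rewrite Py.
  have E : y + t *: (de *: nu) = P + (- ((1 - t) * de)) *: nu.
    rewrite /y -addrA (scalerA t de nu) -(scalerDl nu); congr (_ + _ *: _).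
    by move: (de) => d; ring.
  have yr : `|y + t *: (de *: nu) - x| < r.
    by rewrite E; apply: near_y; clear - t0 t1; lra.
  have Oy : Om (y + t *: (de *: nu)).
    apply: rO => //; rewrite scalerA /psi graph_fun_axis -/psi py sub0r oppr_lt0.
    exact: mulr_gt0.
  by split => //; apply: Gr => //; exact: subset_closure.
rewrite wx subr0 in s1; rewrite wy subr0 in s2.
have Pxv : P - x = v by rewrite /P addrAC subrr add0r.
rewrite Pxv in s1; rewrite Py in s2.
apply: (@tangent_arith n.+1%:R T e th (lform (G x) tau) (lform (G x) nu) _ _ _ de (w P)
  th0 e0 e1 N0 T0 _ _ nv (ltW de0) _ s1).
- by rewrite lformZ lformD lformZ.
- exact: lformZ.
- by clear - de2 the; lra.
- by move: s2; rewrite [`|de *: nu|]normrZ nu1 mulr1 (gtr0_norm de0).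
Qed.

(** The vanishing normal derivative says that G x is itself tangential; with tau = G x,
    [tangential_gradient] yields that the Euclidean square of G x is 0. *)
Lemma gradient_boundary0 Om Gam w G : C1_domain Om ->
  (exists2 U : set V, open U & Gam = U `&` boundary Om) -> C1_closure Om w G ->
  (forall x, Gam x -> w x = 0) ->
  (forall x, Gam x -> \sum_i G x ord0 i * outer_normal Om x ord0 i = 0) ->
  forall x, Gam x -> G x = 0.
Proof.
move=> [oO cO bO] [U oU ->] wG w0 n0 x [Ux bx].
have clx : closure Om x by exact: bx.1.
have nOx : ~ Om x.
  by move=> Ox; apply: bx.2; exact: open_nbhs_nbhs.
(* [outer_normal] is a choice among the normals given by charts; the proof continues in the chart
   belonging to the chosen one. *)
have [i [s [gam [ch nuE]]]] : is_outer_normal Om x (outer_normal Om x).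
  apply: (@getPex _ [set nu | is_outer_normal Om x nu]).
  have [i [s [gam ch]]] := bO x bx.
  by exists ((euclidean_norm (grad (graph_fun i s gam) x))^-1 *: grad (graph_fun i s gam) x);
    exists i, s, gam.
have [r r0 [rO rc]] := chart_closure ch.
have gC1 := ch.1.
have px : graph_fun i s gam x = 0.
  apply/eqP; rewrite eq_le rc ?subrr ?normr0//= leNgt; apply/negP => h.
  by apply: nOx; apply/(rO x); rewrite ?subrr ?normr0.
pose A : V := \row_j graph_partial i s gam j x.
have gA : grad (graph_fun i s gam) x = A.
  by have [d1 d2] := diff_graph i s gC1 x; exact: grad_lform d1 d2.
have A0 : 0 < euclidean_norm A.
  rewrite sqrtr_gt0 (bigD1 i)//= ltr_wpDr//.
    by apply: sumr_ge0 => j _; exact: sqr_ge0.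
  by rewrite mxE graph_partial_axis sqrrN sqrr_sign ltr01.
have GA : lform A (G x) = 0.
  have := n0 x (conj Ux bx); rewrite nuE gA.
  have -> : \sum_j G x ord0 j * ((euclidean_norm A)^-1 *: A) ord0 j = (euclidean_norm A)^-1 * lform A (G x).
    by rewrite /lform mulr_sumr; apply: eq_bigr => j _; rewrite mxE mulrCA.
  by move/eqP; rewrite mulf_eq0 invr_eq0 gt_eqF//= => /eqP.
have GG : lform (G x) (G x) = 0.
  apply: (tangential_gradient ch wG clx px _ GA).
  have c1 := chart_closure0 ch.
  have c2 : \forall y \near x, U y by exact: open_nbhs_nbhs.
  have c3 := near_dist x r0.
  apply: filterS3 c1 c2 c3 => y cy Uy yr py.
  apply: w0; split => //; split; first exact: cy.
  by move=> /interior_subset /(rO y yr).1; rewrite py ltxx.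
apply: sq_eq0; rewrite le_eqVlt; apply/orP; left; apply/eqP.
rewrite -GG; apply: eq_bigr => j _; exact: expr2.
Qed.

End boundary_gradient.

(** * Weak equations for functions extended by zero *)

Section zero_extension.
Context {R : realType} {n : nat}.
Local Notation V := ('rV[R]_n.+1).
Local Notation L := (lebesgue_space R n).
Local Notation mu := (lebesgueN R n).
Local Notation e_ i := (delta_mx ord0 i : V).
Implicit Types (x y z : V) (w f : V -> R) (K W Om : set V).

Lemma measurable_cont_open Om w : open Om -> (forall x, Om x -> {for x, continuous w}) ->
  measurable_fun (Om : set L) (w : L -> R).
Proof.
move=> oO cw; apply: (measurability _ (RGenOpens.measurableE R)).
move=> _ [_ [a [b ->]] <-]; apply: open_measurableN.
rewrite openE => x [Ox wx].
have h1 : \forall y \near x, Om y by exact: open_nbhs_nbhs.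
have h2 : \forall y \near x, `]a, b[%classic (w y).
  by apply: (cw x Ox); apply: open_nbhs_nbhs; split => //; exact: interval_open.
exact: filterI h1 h2.
Qed.

Lemma weak_eq_wdiv W w (G : 'I_n.+1 -> V -> R) f : (forall i, wderiv W i w (G i)) ->
  wdiv W G f -> weak_eq W w f.
Proof.
move=> wd dv x e e0 xW.
have sA := stepfuns_aff x e0 (@stepfuns_bumpf R n).
set K := [set y | ~ outbox (fun j => x ord0 j + e * -1) (fun j => x ord0 j + e * 1) y].
have cK : compact K by exact: compact_box.
have KW : K `<=` W.
  move=> y /= /(contra_not (outbox_aff _ _ _ _ e0).2) /nout1 h.
  by have := xW _ h; rewrite scalerA mulfV ?gt_eqF// scale1r addrCA subrr addr0.
have K0 c : (forall j, (0 < c j)%N) -> forall y, ~ K y -> prodf (aff e x bumpf) c y = 0.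
  by move=> c0 y /contrapT; exact: (prodf_step0 sA).
rewrite /mo; transitivity (- \sum_i \int[mu]_y (G i y * prodf (aff e x bumpf) (cS c1 i) y)).
  rewrite -sumrN; apply: eq_bigr => i _.
  by apply: (wd i _ _ K) => //; [exact: sA.1|apply: K0 => j; rewrite /cS /c1].
rewrite (dv _ _ K) ?opprK//; [exact: sA.1|exact: K0].
Qed.

(** The derivative of [w] along i is the divergence of this field, which makes [wderiv] a case of
    [wdiv]. *)
Definition axis_field (i : 'I_n.+1) w : 'I_n.+1 -> V -> R := fun j => if j == i then w else (fun=> 0).

Lemma sum_axis_field i w (g : 'I_n.+1 -> V -> R) :
  \sum_j \int[mu]_x (axis_field i w j x * g j x) = \int[mu]_x (w x * g i x).
Proof.
rewrite (bigD1 i)//= /axis_field eqxx big1 ?addr0// => j /negbTE ->.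
rewrite (_ : (fun x => _) = fun=> 0); first by rewrite /Rintegral integral0.
by apply/funext => x; rewrite mul0r.
Qed.

Lemma wderiv_wdiv W i w (g : V -> R) : wderiv W i w g <-> wdiv W (axis_field i w) g.
Proof.
by split => h E c K cE cK KW K0; have := h E c K cE cK KW K0; rewrite sum_axis_field.
Qed.

Section classical.
Variables (Om : set V) (w : V -> R) (G : V -> V).
Hypothesis oO : open Om.
Hypothesis Ob : bounded_set Om.
Hypothesis wG : C1_closure Om w G.
Local Notation wt := (w \_ Om).
Local Notation Gt i := ((fun x => G x ord0 i) \_ Om).

Lemma near_patch (f : V -> R) x : Om x -> \forall y \near x, f y = (f \_ Om) y.
Proof.
move=> Ox; have : \forall y \near x, Om y by exact: open_nbhs_nbhs.
by apply: filterS => y Oy; rewrite patchE mem_set.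
Qed.

Lemma cont_patch (f : V -> R) x : Om x -> {within closure Om, continuous f} ->
  {for x, continuous (f \_ Om)}.
Proof.
move=> Ox /subspace_continuousP/(_ x (subset_closure Ox)) cf.
apply/(@cvgrPdist_lt R R^o V (nbhs (x : V)) _ (f \_ Om) ((f \_ Om) x)) => e e0.
move: cf => /(@cvgrPdist_lt R R^o V (within (closure Om) (nbhs x)) _ f (f x))/(_ _ e0) cf.
have h : \forall y \near x, Om y by exact: open_nbhs_nbhs.
apply: filterS2 h cf => y Oy hy.
by rewrite !patchE !mem_set//; apply: hy; exact: subset_closure.
Qed.

Lemma within_coord i : {within closure Om, continuous (fun x => G x ord0 i)}.
Proof.
have [_ cG _] := wG.
apply/subspace_continuousP => x cx.
apply/(@cvgrPdist_lt R R^o) => e e0.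
have /subspace_continuousP/(_ _ cx) := cG.
move=> /(@cvgrPdist_lt R V V (within (closure Om) (nbhs x)) _ G (G x))/(_ _ e0).
apply: filterS => y hy; apply: le_lt_trans hy.
have -> : G x ord0 i - G y ord0 i = (G x - G y) ord0 i by rewrite !mxE.
exact: normV_coord.
Qed.

Lemma bounded_patch (f : V -> R) : {within closure Om, continuous f} ->
  exists2 C, 0 < C & forall x, `|(f \_ Om) x| <= C.
Proof.
move=> cf.
have cK : compact (closure Om).
  apply: bounded_closed_compact; last exact: closed_closure.
  have [M OM] := bounded_sub_cube Ob.
  have cM : closed (cubeN M : set V).
    by apply: (compact_closed (@norm_hausdorff _ _)); exact: compact_normV_le.
  exists M; split; first exact: num_real.
  move=> r Mr x /= cx; apply: ltW; apply: le_lt_trans Mr.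
  by have := closure_subset OM cx; rewrite -(closure_id _).1.
have := continuous_compact cf cK => /compact_bounded[C [_ hC]].
have C1 : C < `|C| + 1 by have := ler_norm C; lra.
exists (`|C| + 1); first by have := normr_ge0 C; lra.
move=> x; rewrite patchE; case: ifPn => [|_]; last by rewrite normr0; have := normr_ge0 C; lra.
rewrite inE => Ox; apply: (hC _ C1) => /=; exists x => //; exact: subset_closure.
Qed.

Lemma measurable_patch (f : V -> R) : {within closure Om, continuous f} ->
  measurable_fun [set: L] (f \_ Om : L -> R).
Proof.
move=> cf; apply/(measurable_restrictT _ (open_measurableN oO)).
apply: measurable_cont_open => // x Ox.
have := cont_patch Ox cf.
move=> /(@cvgrPdist_lt R R^o V (nbhs (x : V)) _ (f \_ Om) ((f \_ Om) x)) h.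
apply/(@cvgrPdist_lt R R^o V (nbhs (x : V)) _ f (f x)) => e e0.
apply: filterS2 (near_patch f Ox) (h e e0) => y E; rewrite -E.
by rewrite patchE mem_set.
Qed.

Lemma integrable_patch (f : V -> R) : {within closure Om, continuous f} ->
  mu.-integrable [set: L] (EFin \o (f \_ Om)).
Proof.
move=> cf; have [C C0 fC] := bounded_patch cf; have [M OM] := bounded_sub_cube Ob.
apply: (integrable_bsupp (M := M) (measurable_patch cf) fC) => x Mx.
by rewrite patchE memNset// => /OM; rewrite /cubeN/= leNgt Mx.
Qed.

(** The test function has compact support in [Om], so its product with the extension of [w] is C^1
    on the whole space, and the integral of its derivative vanishes. *)
Lemma classical_wderiv i : wderiv Om i wt (Gt i).
Proof.
move=> E c K cE cK KO K0; have [cw cG dw] := wG.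
set phi := prodf E c; set phi1 := prodf E (cS c i).
have cphi : continuous phi by exact: cont_prodf.
have cphi1 : continuous phi1 by exact: cont_prodf.
have dphi x : is_derive x (e_ i) phi (phi1 x) by exact: drv_prodf.
have phi1K x : ~ K x -> phi1 x = 0 by move=> nK; exact: (prodf_cS_off i cE cK K0 nK).
have {}K0 x : ~ K x -> phi x = 0 by exact: K0.
clearbody phi phi1.
have [M KM] := compact_boundedN cK.
have wK x : K x -> {for x, continuous wt} by move=> /KO Ox; exact: cont_patch.
have GK x : K x -> {for x, continuous (Gt i)} by move=> /KO Ox; exact: (cont_patch Ox (@within_coord i)).
have c1 := cont_mul_supp wK cphi cK K0.
have c2 := cont_mul_supp wK cphi1 cK phi1K.
have c3 := cont_mul_supp GK cphi cK K0.
have out x : M < `|x| -> ~ K x by move=> Mx /KM; rewrite leNgt Mx.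
have i2 : mu.-integrable [set: L] (EFin \o (fun x => wt x * phi1 x)).
  by apply: (integrable_Cc c2 (M := M)) => x /out nK; rewrite phi1K ?mulr0.
have i3 : mu.-integrable [set: L] (EFin \o (fun x => Gt i x * phi x)).
  by apply: (integrable_Cc c3 (M := M)) => x /out nK; rewrite K0 ?mulr0.
have dp x : is_derive x (e_ i) (fun x => wt x * phi x) (Gt i x * phi x + wt x * phi1 x).
  case: (pselect (K x)) => Kx.
    have Ox := KO _ Kx; apply: drvM => //.
    apply: (near_is_derive (f := w)); [exact: delta_neq0|exact: near_patch|].
    have [d1 d2] := dw x Ox.
    have := is_derive_diff (e_ i) d1 (diff_grad d1); rewrite lform_delta -d2.
    by rewrite patchE mem_set.
  rewrite (K0 x Kx) (phi1K x Kx) !mulr0 addr0.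
  have nK : \forall y \near x, ~ K y.
    apply: open_nbhs_nbhs; split => //; apply: closed_openC.
    exact: (compact_closed (@norm_hausdorff _ _) cK).
  have h : \forall y \near x, 0 = wt y * phi y.
    by apply: filterS nK => y nKy; rewrite (K0 y nKy) mulr0.
  exact: (near_is_derive (@delta_neq0 R n i) h (drvC 0 x (e_ i))).
have := integral_partial0 c1 (contD c3 c2) dp (fun x Mx => etrans (congr1 _ (K0 x (out x Mx))) (mulr0 _)).
rewrite RintegralD// => /eqP; rewrite addrC addr_eq0 => /eqP; exact.
Qed.

End classical.

Lemma Rintegral_ae (f g : V -> R) : measurable_fun [set: L] (f : L -> R) ->
  measurable_fun [set: L] (g : L -> R) -> {ae mu, forall x, f x = g x} ->
  \int[mu]_x f x = \int[mu]_x g x.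
Proof.
move=> mf mg fg; rewrite /Rintegral; congr fine; apply: (@ae_eq_integral _ L R mu setT (EFin \o g) (EFin \o f)).
- exact: measurableT.
- exact/measurable_EFinP.
- exact/measurable_EFinP.
- by apply: (@filterS _ _ (ae_filter_ringOfSetsType mu) _ _ _ fg) => x /= ->.
Qed.

Lemma integrable_loc (f phi : V -> R) K (C : R) : compact K -> mu.-integrable (K : set L) (EFin \o f) ->
  continuous phi -> (forall x, ~ K x -> phi x = 0) -> (forall x, `|phi x| <= C) ->
  mu.-integrable [set: L] (EFin \o (fun x => f x * phi x)).
Proof.
move=> cK i_f cphi K0 phiC.
have mK : measurable (K : set L).
  rewrite -[K]setCK; apply: measurableC; apply: open_measurableN; apply: closed_openC.
  exact: (compact_closed (@norm_hausdorff _ _) cK).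
have h : mu.-integrable (K : set L) (EFin \o (fun x => f x * phi x)).
  apply: (integrable_mulb mK i_f _ phiC).
  by apply: (measurable_funS (@measurableT _ L)) => //; exact: continuous_measurableN.
have := (integrable_mkcond _ mK).1 h.
rewrite (_ : patch _ _ _ = EFin \o (fun x => f x * phi x))//.
apply/funext => x; rewrite patchE; case: ifPn => // nK.
rewrite /= K0 ?mulr0// => Kx; move/negP: nK; apply; exact: mem_set.
Qed.

(** Both [G] against first derivatives of the test function and the weak second derivatives against
    the test function itself reduce to [w], equal to [u] almost everywhere, against second
    derivatives. *)
Lemma laplacian_wdiv Om (m : R) u w (G : V -> V) (F : V -> R) : n.+1%:R < m -> bounded_set Om ->
  open Om -> sobolev Om 2 m u -> C1_closure Om w G -> {ae mu, forall x, Om x -> w x = u x} ->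
  measurable_fun [set: L] (F : L -> R) ->
  {ae mu, forall x, F x = (laplacian Om u \_ Om) x} ->
  wdiv Om (fun i => (fun x => G x ord0 i) \_ Om) F.
Proof.
move=> mn Ob oO Wu wG wu mF FE E c K cE cK KO K0.
pose g i := weak_deriv Om [:: i; i] u.
have gP i : is_weak_deriv Om [:: i; i] u (g i).
  have [h [_ hP]] := Wu.2 [:: i; i] isT.
  by apply: (@getPex _ [set g | is_weak_deriv Om [:: i; i] u g]); exists h.
have [iu _] := Lp_integrable mn Ob oO Wu.1.
have mu_ : measurable_fun [set: L] (u \_ Om : L -> R).
  by apply/measurable_EFinP; exact: measurable_int iu.
have cw : {within closure Om, continuous w} by case: wG.
have mw := measurable_patch oO cw.
have K1 i := @prodf_cS_off R n E c i K cE cK K0.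
have [M KM] := compact_boundedN cK.
have cphi := @cont_prodf R n E c cE.
have [C C0 phiC] := bounded_bsupp (M := M) cphi (fun x Mx => K0 x (fun Kx => ltac:(by have := KM x Kx; rewrite leNgt Mx))).
have mphi : measurable_fun [set: L] (prodf E c : L -> R) by exact: continuous_measurableN.
have E1 i : \int[mu]_x (((fun x => G x ord0 i) \_ Om) x * prodf E (cS c i) x) =
    - \int[mu]_x ((g i \_ Om) x * prodf E c x).
  have h1 := @classical_wderiv Om w G oO wG i E (cS c i) K cE cK KO (K1 i).
  apply: (oppr_inj); rewrite opprK -h1.
  have h2 := weak_deriv_prodf (gP i) cE cK KO K0.
  rewrite expr2 mulrNN mulr1 mul1r in h2; rewrite -h2.
  have -> : cS (cS c i) i = fun k => (c k + count_mem k [:: i; i])%N.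
    by apply/funext => k; rewrite /cS /= addn0 addnA (eq_sym i).
  have mp : measurable_fun [set: L] (prodf E (fun k => (c k + count_mem k [:: i; i])%N) : L -> R).
    by apply: continuous_measurableN; exact: cont_prodf.
  apply: Rintegral_ae; [exact: measurable_funM|exact: measurable_funM|].
  apply: (@filterS _ _ (ae_filter_ringOfSetsType mu) _ _ _ wu) => x hx.
  by rewrite !patchE; case: ifPn => //; rewrite inE => /hx ->.
rewrite (eq_bigr _ (fun i _ => E1 i)) sumrN; congr (- _).
have ig i : mu.-integrable [set: L] (EFin \o (fun x => (g i \_ Om) x * prodf E c x)).
  rewrite (_ : (fun x => (g i \_ Om) x * _) = fun x => g i x * prodf E c x).
    apply: (integrable_loc cK _ cphi K0 phiC).
    by have [_ [_ h] _] := gP i; exact: h.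
  apply/funext => x; rewrite patchE; case: ifPn => // nO.
  rewrite K0 ?mulr0// => /KO Ox; move/negP: nO; apply; exact: mem_set.
have <- : \int[mu]_x (\sum_i ((g i \_ Om) x * prodf E c x)) = \sum_i \int[mu]_x ((g i \_ Om) x * prodf E c x).
  by apply: Rintegral_sumN.
have iS := integrable_sumN (@measurableT _ L) ig.
apply: Rintegral_ae; last first.
- apply: (@filterS _ _ (ae_filter_ringOfSetsType mu) _ _ _ FE) => x ->.
  rewrite -mulr_suml; congr (_ * _); rewrite patchE; case: ifPn => [xO|xO].
    by apply: eq_bigr => i _; rewrite patchE xO.
  by rewrite big1// => i _; rewrite patchE (negbTE xO).
- exact: measurable_funM.
- by apply/measurable_EFinP; exact: measurable_int iS.
Qed.

End zero_extension.

(** * Continuation across the boundary *)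

Section boundary_continuation.
Context {R : realType} {n : nat}.
Local Notation V := ('rV[R]_n.+1).
Local Notation L := (lebesgue_space R n).
Local Notation mu := (lebesgueN R n).
Local Notation e_ i := (delta_mx ord0 i : V).
Implicit Types (x y z : V) (w F : V -> R) (G : V -> V) (Om : set V).

Definition dist_ball x0 (r : R) : set V := [set y | `|y - x0| < r].

Lemma open_dist_ball x0 (r : R) : open (dist_ball x0 r).
Proof.
rewrite openE => y yr; have d0 : 0 < r - `|y - x0| by rewrite subr_gt0.
apply: filterS (near_dist y d0) => z zy; rewrite /dist_ball/=.
rewrite (_ : z - x0 = (z - y) + (y - x0)); last by rewrite addrA subrK.
by apply: (le_lt_trans (ler_normD _ _)); rewrite -ltrBrDr.
Qed.

Lemma connected_dist_ball x0 (r : R) : 0 < r -> connected (dist_ball x0 r).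
Proof.
move=> r0.
rewrite (_ : dist_ball x0 r = \bigcup_(y in dist_ball x0 r) [set x0 + t *: (y - x0) | t in `[0 : R, 1]]).
  apply: bigcup_connected.
    by exists x0 => y _; exists 0; rewrite ?scale0r ?addr0//= in_itv/= lexx ler01.
  move=> y _; apply: connected_continuous_connected; first exact: segment_connected.
  apply: continuous_subspaceT => t.
  apply: (@continuousD _ _ _ (fun=> x0) (fun t : R => t *: (y - x0))); first exact: cst_continuous.
  exact: scalel_continuous.
apply/seteqP; split => [y yr|y [z zr [t /= t01 <-]]].
  by exists y => //; exists 1; rewrite ?scale1r ?[x0 + _]addrC ?subrK//= in_itv/= lexx ler01.
move: t01; rewrite in_itv/= => /andP[t0 t1].
rewrite /dist_ball/= addrAC subrr add0r normrZ ger0_norm//.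
apply: le_lt_trans zr; rewrite -[leRHS]mul1r; exact: ler_wpM2r.
Qed.

Lemma patch_small Om (f : V -> R) x : {within closure Om, continuous f} -> closure Om x -> f x = 0 ->
  forall e : R, 0 < e -> \forall y \near x, `|(f \_ Om) y| <= e.
Proof.
move=> /subspace_continuousP cf cx fx e e0; have := cf x cx.
move=> /(@cvgrPdist_lt R R^o V (within (closure Om) (nbhs x)) _ f (f x))/(_ _ e0).
move=> hh; apply: (@filterS _ (nbhs x) _ (fun y => closure Om y -> `|f x - f y| < e) _ _ hh) => y hy.
rewrite patchE; case: ifPn => [|_]; last by rewrite normr0 ltW.
rewrite inE => Oy; apply: ltW.
by have := hy (subset_closure Oy); rewrite fx sub0r normrN.
Qed.

Section chart.
Variables (Om Gam U : set V) (x0 : V) (i : 'I_n.+1) (s : bool) (gam : 'rV[R]_n -> R) (r : R).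
Hypothesis oO : open Om.
Hypothesis Ob : bounded_set Om.
Hypothesis gC1 : C1 gam.
Hypothesis rO : forall y, `|y - x0| < r -> Om y <-> graph_fun i s gam y < 0.
Hypothesis rU : forall y, `|y - x0| < r -> U y.
Hypothesis GamE : Gam = U `&` boundary Om.

Lemma chart_boundary y : `|y - x0| < r -> graph_fun i s gam y = 0 -> closure Om y /\ Gam y.
Proof.
move=> yr py; have cy := graph_zero_closure rO yr py.
split => //; rewrite GamE; split; first exact: rU.
by split => // /interior_subset /(rO yr).1; rewrite py ltxx.
Qed.

Lemma near_outside y : `|y - x0| < r -> 0 < graph_fun i s gam y -> \forall z \near y, ~ Om z.
Proof.
move=> yr py.
have h1 : \forall z \near y, 0 < graph_fun i s gam z by apply: near_cont_gt py; exact: cont_graph.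
have h2 : \forall z \near y, dist_ball x0 r z.
  by apply: open_nbhs_nbhs; split => //; exact: open_dist_ball.
by apply: filterS2 h1 h2 => z z1 z2 /(rO z2).1; rewrite ltNge (ltW z1).
Qed.

Lemma cont_zero_extension w : {within closure Om, continuous w} ->
  (forall x, Gam x -> w x = 0) -> forall y, `|y - x0| < r -> {for y, continuous (w \_ Om)}.
Proof.
move=> cw w0 y yr; have [py|py|py] := ltgtP (graph_fun i s gam y) 0.
- by apply: cont_patch => //; apply/(rO yr).
- apply/(@cvgrPdist_le R R^o V (nbhs (y : V)) _ (w \_ Om) ((w \_ Om) y)) => e e0.
  have nO := near_outside yr py.
  apply: filterS nO => z nz; rewrite !patchE !memNset// ?subrr ?normr0 ?ltW//.
  by move=> /(rO yr).1; rewrite ltNge (ltW py).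
- have [cy gy] := chart_boundary yr py.
  apply/(@cvgrPdist_le R R^o V (nbhs (y : V)) _ (w \_ Om) ((w \_ Om) y)) => e e0.
  apply: filterS (patch_small cw cy (w0 y gy) e0) => z hz.
  rewrite [X in `|X - _|]patchE memNset ?sub0r ?normrN//.
  by move=> /(rO yr).1; rewrite py ltxx.
Qed.

Hypothesis mu_pos : forall A : set V, open A -> A !=set0 -> (0 < mu A)%E.

(** [w] and [G] both vanish on [Gam], so the extension result applies twice: to the axis fields of
    [w], which identifies the weak gradient across the boundary, and to the gradient field, which
    gives the equation. *)
Lemma weak_eq_zero_extension w G F : C1_closure Om w G ->
  (forall x, Gam x -> w x = 0) -> (forall x, Gam x -> G x = 0) ->
  wdiv Om (fun j => (fun x => G x ord0 j) \_ Om) F ->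
  mu.-integrable [set: L] (EFin \o F) -> (forall x, ~ Om x -> F x = 0) ->
  weak_eq (dist_ball x0 r) (w \_ Om) F.
Proof.
move=> wG w0 G0 dv iF F0.
have cw : {within closure Om, continuous w} by case: wG.
have cG j := within_coord wG (i := j).
have iw := integrable_patch oO Ob cw.
have iG j := integrable_patch oO Ob (cG j).
have axis x : graph_partial i s gam i x = - (-1) ^+ s by exact: graph_partial_axis.
have s1 : `|- (-1) ^+ s : R| = 1 by rewrite normrN normrX normrN1 expr1n.
have off (f : V -> R) x : ~ Om x -> (f \_ Om) x = 0 by move=> nO; rewrite patchE memNset.
have ext (h : 'I_n.+1 -> V -> R) f : wdiv Om h f -> (forall j, mu.-integrable [set: L] (EFin \o h j)) ->
    mu.-integrable [set: L] (EFin \o f) -> (forall j x, ~ Om x -> h j x = 0) ->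
    (forall x, ~ Om x -> f x = 0) -> (forall j x, dist_ball x0 r x -> graph_fun i s gam x = 0 ->
      forall e : R, 0 < e -> \forall y \near x, `|h j y| <= e) -> wdiv (dist_ball x0 r) h f.
  move=> wd ih i_f h0 f0 hs.
  exact: (@wdiv_extend R n mu_pos Om (dist_ball x0 r) (graph_fun i s gam) (graph_partial i s gam) i
    (- (-1) ^+ s) h f oO (@cont_graph_partial R n i s gam gC1)
    (@drv_graph R n i s gam gC1) axis s1 rO wd ih i_f h0 f0 hs).
apply: (@weak_eq_wdiv R n (dist_ball x0 r) (w \_ Om) (fun j => (fun x => G x ord0 j) \_ Om) F).
  move=> j; apply/wderiv_wdiv; apply: ext.
  - by apply/wderiv_wdiv; exact: classical_wderiv.
  - move=> l; rewrite /axis_field; case: eqP => _ //.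
    rewrite (_ : EFin \o _ = cst 0%E)//; exact: integrable0.
  - exact: iG.
  - by move=> l x nO; rewrite /axis_field; case: eqP => _ //; exact: off.
  - by move=> x nO; exact: off.
  - move=> l x xr px e e0; have [cx gx] := chart_boundary xr px.
    rewrite /axis_field; case: eqP => _; first exact: patch_small cw cx (w0 x gx) e e0.
    by apply: (@filterE _ (nbhs x)) => y; rewrite normr0 ltW.
apply: ext => //.
- by move=> j x nO; exact: off.
- move=> j x xr px e e0; have [cx gx] := chart_boundary xr px.
  by apply: (patch_small (cG j) cx _ e0); rewrite (G0 x gx) mxE.
Qed.

End chart.

Lemma measurable_laplacian Om (m : R) u : open Om -> sobolev Om 2 m u ->
  measurable_fun [set: L] (laplacian Om u \_ Om : L -> R).
Proof.
move=> oO Wu; apply/(measurable_restrictT _ (open_measurableN oO)).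
rewrite /laplacian; apply: (@measurable_sum _ L R Om _ _ (fun i => weak_deriv Om [:: i; i] u)) => i.
have [g [_ gP]] := Wu.2 [:: i; i] isT.
by have [_ [+ _] _] := @getPex _ [set g | is_weak_deriv Om [:: i; i] u g] (ex_intro _ g gP).
Qed.

(** The growth bound fails at most on a null set, and there [F] is set to 0. The bound then holds at
    every point, as the unique continuation argument requires, and the weak equation is
    unaffected. *)
Lemma equation_data Om (m q C B : R) u w G (v : V -> R) : n.+1%:R < m -> bounded_set Om ->
  open Om -> sobolev Om 2 m u -> C1_closure Om w G -> {ae mu, forall x, Om x -> w x = u x} ->
  0 < q -> 0 <= C -> measurable_fun [set: L] (v : L -> R) -> (forall x, `|v x| <= B) ->
  {ae mu, forall x, Om x -> `|laplacian Om u x| <= C * `|v x| `^ q} ->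
  exists F, [/\ mu.-integrable [set: L] (EFin \o F), forall x, ~ Om x -> F x = 0,
    forall x, `|F x| <= C * `|v x| `^ q &
    wdiv Om (fun j => (fun x => G x ord0 j) \_ Om) F].
Proof.
move=> mn Ob oO Wu wG wu q0 C0 mv vB lb.
set l := laplacian Om u \_ Om.
have ml : measurable_fun [set: L] (l : L -> R) by exact: measurable_laplacian Wu.
have l0 x : ~ Om x -> l x = 0 by move=> nO; rewrite /l patchE memNset.
pose F x := if `|l x| <= C * `|v x| `^ q then l x else 0.
have Fb x : `|F x| <= C * `|v x| `^ q.
  by rewrite /F; case: ifPn => // _; rewrite normr0; apply: mulr_ge0 => //; exact: powR_ge0.
have F0 x : ~ Om x -> F x = 0 by move=> /l0 lx; rewrite /F lx; case: ifP.
have B0 : 0 <= B := le_trans (normr_ge0 (v 0)) (vB 0).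
have mF : measurable_fun [set: L] (F : L -> R).
  apply: measurable_fun_ifT; [|exact: ml|exact: measurable_cst].
  apply: measurable_fun_ler; first exact: measurableT_comp.
  apply: measurable_funM; first exact: measurable_cst.
  by apply: (measurableT_comp (measurable_powR q)); exact: measurableT_comp.
have [M OM] := bounded_sub_cube Ob.
have FB x : `|F x| <= C * B `^ q.
  apply: (le_trans (Fb x)); apply: ler_wpM2l => //.
  by apply: ge0_ler_powR; rewrite ?nnegrE// ltW.
exists F; split => //.
  apply: (integrable_bsupp (M := M) mF FB) => x Mx; apply: F0 => /OM.
  by rewrite /cubeN/= leNgt Mx.
apply: (laplacian_wdiv mn Ob oO Wu wG wu mF).
apply: (@filterS _ _ (ae_filter_ringOfSetsType mu) _ _ _ lb) => x hx.
rewrite -/l /F; case: ifPn => //; case: (pselect (Om x)) => Ox; last by rewrite l0.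
by rewrite /l patchE mem_set// hx.
Qed.

(** Every ball around the origin can be shrunk affinely into the null open set, hence is null, and
    countably many of them cover the space. *)
Lemma null_open_negligible : (exists A : set V, [/\ open A, A !=set0 & mu A = 0%E]) ->
  mu.-negligible [set: L].
Proof.
move=> [A [oA [c Ac] A0]].
have /nbhs_ballP[r /= r0 rA] : nbhs c A by exact: open_nbhs_nbhs.
have -> : [set: L] = \bigcup_k (ball (0 : V) k.+1%:R : set L).
  apply/seteqP; split => // x _; exists (Num.bound `|x : V|) => //.
  rewrite -ball_normE /= sub0r normrN.
  apply: (lt_trans (archi_boundP (normr_ge0 (x : V)))).
  by rewrite ltr_nat.
apply: (@negligible_bigcup _ L R mu (fun k => ball (0 : V) k.+1%:R)) => k.
exists (affineN c (r / k.+1%:R) @^-1` A); split.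
- have l0 : 0 < r / k.+1%:R by rewrite divr_gt0.
  rewrite -[X in measurable X]setTI.
  by apply: (measurable_affineN c l0) => //; exact: open_measurableN.
- by rewrite lebesgueN_affine ?divr_gt0// A0 mule0.
- move=> x; rewrite -ball_normE /= sub0r normrN => xk.
  apply: rA; rewrite -ball_normE /= /affineN opprD addNKr normrN normrZ gtr0_norm ?divr_gt0//.
  by rewrite mulrAC -[ltRHS]mulr1 -[X in X < _]mulrA (ltr_pM2l r0) ltr_pdivrMr// mul1r.
Qed.

End boundary_continuation.

Section unique_continuation_boundary.
Context {R : realType} {n : nat}.
Local Notation V := ('rV[R]_n.+1).
Local Notation L := (lebesgue_space R n).
Local Notation mu := (lebesgueN R n).
Local Notation e_ i := (delta_mx ord0 i : V).

Lemma zero_from_boundary (Om Gam : set V) (p q C : R) (u v : V -> R) (Gu Gv : V -> V) (Fu Fv : V -> R) :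
  (forall A : set V, open A -> A !=set0 -> (0 < mu A)%E) ->
  bounded_set Om -> C1_domain Om -> Gam !=set0 ->
  (exists2 U : set V, open U & Gam = U `&` boundary Om) ->
  0 < p -> 0 < q -> 1 < p * q -> 0 <= C ->
  C1_closure Om u Gu -> C1_closure Om v Gv ->
  (forall x, Gam x -> [/\ u x = 0, v x = 0, Gu x = 0 & Gv x = 0]) ->
  mu.-integrable [set: L] (EFin \o Fu) -> mu.-integrable [set: L] (EFin \o Fv) ->
  (forall x, ~ Om x -> Fu x = 0) -> (forall x, ~ Om x -> Fv x = 0) ->
  wdiv Om (fun j => (fun x => Gu x ord0 j) \_ Om) Fu ->
  wdiv Om (fun j => (fun x => Gv x ord0 j) \_ Om) Fv ->
  (forall x, `|Fu x| <= C * `|(v \_ Om) x| `^ q) ->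
  (forall x, `|Fv x| <= C * `|(u \_ Om) x| `^ p) ->
  forall x, Om x -> u x = 0 /\ v x = 0.
Proof.
move=> mu_pos Ob OC [x0 Gx0] [U oU GamE] p0 q0 pq C0 uG vG zG iFu iFv Fu0 Fv0 dFu dFv bFu bFv.
have [oO coO bO] := OC.
have [Ux0 bx0] : U x0 /\ boundary Om x0 by move: Gx0; rewrite GamE.
have [i [s [gam ch]]] := bO x0 bx0.
have [r1 r10 [rO1 rc1]] := chart_closure ch.
have [r2 /= r20 rU2] : exists2 r2, 0 < r2 & forall y, `|y - x0| < r2 -> U y.
  have /nbhs_ballP[r2 /= r20 h] : nbhs x0 U by exact: open_nbhs_nbhs.
  by exists r2 => // y yx; apply: h; rewrite -ball_normE /= distrC.
pose r := Num.min r1 r2.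
have r0 : 0 < r by rewrite lt_min r10.
have rO y : `|y - x0| < r -> Om y <-> graph_fun i s gam y < 0.
  by rewrite lt_min => /andP[h _]; exact: rO1.
have rU y : `|y - x0| < r -> U y by rewrite lt_min => /andP[_ h]; exact: rU2.
clearbody r.
have gC1 := ch.1.
have cu : {within closure Om, continuous u} by case: uG.
have cv : {within closure Om, continuous v} by case: vG.
have iu := integrable_patch oO Ob cu; have iv := integrable_patch oO Ob cv.
have u0 x : Gam x -> u x = 0 by case/zG.
have v0 x : Gam x -> v x = 0 by case/zG.
have Gu0 x : Gam x -> Gu x = 0 by case/zG.
have Gv0 x : Gam x -> Gv x = 0 by case/zG.
have weu := weak_eq_zero_extension oO Ob gC1 rO rU GamE mu_pos uG u0 Gu0 dFu iFu Fu0.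
have wev := weak_eq_zero_extension oO Ob gC1 rO rU GamE mu_pos vG v0 Gv0 dFv iFv Fv0.
have cBu := cont_zero_extension oO gC1 rO rU GamE cu u0.
have cBv := cont_zero_extension oO gC1 rO rU GamE cv v0.
have px0 : graph_fun i s gam x0 = 0.
  have x0r : `|x0 - x0| < r1 by rewrite subrr normr0.
  apply/eqP; rewrite eq_le (rc1 x0 x0r bx0.1)/= leNgt; apply/negP => h.
  by apply: bx0.2; apply: open_nbhs_nbhs; split => //; apply/(rO1 x0 x0r).
set nu := (-1) ^+ s *: e_ i.
have nu1 : `|nu| = 1 by rewrite normrZ norm_delta mulr1 normrX normrN1 expr1n.
have sh (a : R) : `|a| < r -> `|x0 + a *: nu - x0| < r /\ graph_fun i s gam (x0 + a *: nu) = - a.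
  move=> ar; rewrite addrAC subrr add0r normrZ nu1 mulr1; split => //.
  by rewrite graph_fun_axis px0 sub0r.
(* At distance r/2 outside [Om] along the axis both extensions vanish identically near the point,
   which starts the continuation in the cube. *)
have ZB : [set x | dist_ball x0 r x /\ \forall y \near x, (u \_ Om) y = 0 /\ (v \_ Om) y = 0] !=set0.
  have ar : `|- (r / 2)| < r by rewrite normrN gtr0_norm ?divr_gt0//; lra.
  have [h1 h2] := sh _ ar.
  exists (x0 + (- (r / 2)) *: nu); split => //.
  have hp : 0 < graph_fun i s gam (x0 + (- (r / 2)) *: nu) by rewrite h2 opprK divr_gt0.
  apply: filterS (near_outside gC1 rO h1 hp) => y nO.
  by rewrite !patchE !memNset.
have zB := unique_continuation mu_pos p0 q0 pq C0 iu iv iFu iFv weu wev cBu cBv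
  (fun x _ => bFu x) (fun x _ => bFv x) (@open_dist_ball R n x0 r) (@connected_dist_ball R n x0 r r0) ZB.
(* The point at depth r/2 lies in the cube as well as in [Om], and the zeros just found in the cube
   start the continuation in [Om]. *)
have ZO : [set x | Om x /\ \forall y \near x, (u \_ Om) y = 0 /\ (v \_ Om) y = 0] !=set0.
  have ar : `|r / 2| < r by rewrite gtr0_norm ?divr_gt0//; lra.
  have [h1 h2] := sh _ ar.
  exists (x0 + (r / 2) *: nu); split.
    by apply/(rO _ h1); rewrite h2 oppr_lt0 divr_gt0.
  have : \forall y \near (x0 + (r / 2) *: nu), dist_ball x0 r y.
    by apply: open_nbhs_nbhs; split => //; exact: open_dist_ball.
  by apply: filterS => y; exact: zB.
have wOu := weak_eq_wdiv (fun j => @classical_wderiv R n Om u Gu oO uG j) dFu.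
have wOv := weak_eq_wdiv (fun j => @classical_wderiv R n Om v Gv oO vG j) dFv.
have zO := unique_continuation mu_pos p0 q0 pq C0 iu iv iFu iFv wOu wOv
  (fun x Ox => cont_patch oO Ox cu) (fun x Ox => cont_patch oO Ox cv)
  (fun x _ => bFu x) (fun x _ => bFv x) oO coO ZO.
by move=> x Ox; have := zO x Ox; rewrite !patchE !mem_set.
Qed.

End unique_continuation_boundary.

Theorem corollary1p5 (R : realType) (n : nat) (Om Gam : set 'rV[R]_n.+1)
    (m p q : R) (f g : 'rV[R]_n.+1 -> R * R -> R) (u v : 'rV[R]_n.+1 -> R)
    (Om_bounded : bounded_set Om) (Om_C1 : C1_domain Om)
    (m_gtN : n.+1%:R < m)
    (Gam_neq0 : Gam !=set0)
    (Gam_open : exists2 U : set 'rV[R]_n.+1, open U & Gam = U `&` boundary Om)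
    (p_gt0 : 0 < p) (q_gt0 : 0 < q) (pq_gt1 : 1 < p * q)
    (f_car : caratheodory_fun Om f) (g_car : caratheodory_fun Om g)
    (fg_growth : forall K : set (R * R), compact K -> exists2 C : R, 0 < C &
      {ae lebesgueN R n, forall x, Om x -> forall s, K s ->
         `|f x s| <= C * `|s.2| `^ q /\ `|g x s| <= C * `|s.1| `^ p})
    (u_W2m : sobolev Om 2 m u) (v_W2m : sobolev Om 2 m v)
    (eq_u : {ae lebesgueN R n, forall x, Om x ->
       laplacian Om u x + f x (u x, v x) = 0})
    (eq_v : {ae lebesgueN R n, forall x, Om x ->
       laplacian Om v x + g x (u x, v x) = 0})
    (uv_Gam : forall x, Gam x ->
       boundary_value Om u x = 0 /\ boundary_value Om v x = 0)
    (dnu_uv_Gam : forall x, Gam x ->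
       normal_derivative Om u x = 0 /\ normal_derivative Om v x = 0) :
  {ae lebesgueN R n, forall x, Om x -> u x = 0 /\ v x = 0}.
Proof.
(* If a nonempty open set were null, so would be the whole space: the strict
   positivity of mu on open sets need not be proved. *)
have [mu_pos|/existsNP[A /not_implyP[oA /not_implyP[A0 nA]]]] :=
    pselect (forall A : set 'rV[R]_n.+1, open A -> A !=set0 -> (0 < lebesgueN R n A)%E); last first.
  apply: (@negligibleS _ _ _ (lebesgueN R n) setT); first exact: subsetT.
  apply: null_open_negligible; exists A; split => //.
  apply/eqP; rewrite eq_le measure_ge0 andbT leNgt; exact/negP.
have [oO _ _] := Om_C1.
have cone x := @cone_domain R n Om x Om_C1.
have [uC uae] := C1_reprP m_gtN Om_bounded oO mu_pos cone u_W2m.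
have [vC vae] := C1_reprP m_gtN Om_bounded oO mu_pos cone v_W2m.
have u0 x : Gam x -> (C1_repr Om u).1 x = 0 by move=> /uv_Gam[].
have v0 x : Gam x -> (C1_repr Om v).1 x = 0 by move=> /uv_Gam[].
have Gu0 := gradient_boundary0 Om_C1 Gam_open uC u0 (fun x Gx => (dnu_uv_Gam x Gx).1).
have Gv0 := gradient_boundary0 Om_C1 Gam_open vC v0 (fun x Gx => (dnu_uv_Gam x Gx).2).
move: (C1_repr Om u) (C1_repr Om v) uC uae vC vae u0 v0 Gu0 Gv0 => [wu Gu] [wv Gv] /= uC uae vC vae u0 v0 Gu0 Gv0.
have cu : {within closure Om, continuous wu} by case: uC.
have cv : {within closure Om, continuous wv} by case: vC.
have [Bu Bu0 uB] := bounded_patch Om_bounded cu.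
have [Bv Bv0 vB] := bounded_patch Om_bounded cv.
(* A compact rectangle containing all values of the representatives, so that a single growth
   constant applies almost everywhere in [Om]. *)
have cK : compact (`[- Bu, Bu]%classic `*` `[- Bv, Bv]%classic : set (R * R)).
  by apply: compact_setX; exact: segment_compact.
have [C C0 grow] := fg_growth _ cK.
have sol : {ae lebesgueN R n, forall x, Om x ->
    `|laplacian Om u x| <= C * `|(wv \_ Om) x| `^ q /\
    `|laplacian Om v x| <= C * `|(wu \_ Om) x| `^ p}.
  have h1 := @filterI _ _ (ae_filter_ringOfSetsType (lebesgueN R n)) _ _ uae vae.
  have h2 := @filterI _ _ (ae_filter_ringOfSetsType (lebesgueN R n)) _ _ eq_u eq_v.
  apply: (@filterS3 _ _ (ae_filter_ringOfSetsType (lebesgueN R n)) _ _ _ _ _ h1 h2 grow).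
  move=> x [ux vx] [eu ev] gr Ox.
  have Eu : (wu \_ Om) x = u x by rewrite patchE mem_set// ux.
  have Ev : (wv \_ Om) x = v x by rewrite patchE mem_set// vx.
  have vb := vB x; have ub := uB x; rewrite Ev in vb; rewrite Eu in ub.
  have [|g1 g2] := gr Ox (u x, v x).
    by split; rewrite /= in_itv/= -ler_norml.
  rewrite Eu Ev.
  have := eu Ox; have := ev Ox => /eqP; rewrite addr_eq0 => /eqP -> /eqP.
  by rewrite addr_eq0 => /eqP ->; rewrite !normrN.
have sol1 : {ae lebesgueN R n, forall x, Om x -> `|laplacian Om u x| <= C * `|(wv \_ Om) x| `^ q}.
  by apply: (@filterS _ _ (ae_filter_ringOfSetsType (lebesgueN R n)) _ _ _ sol) => x h /h[].
have sol2 : {ae lebesgueN R n, forall x, Om x -> `|laplacian Om v x| <= C * `|(wu \_ Om) x| `^ p}.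
  by apply: (@filterS _ _ (ae_filter_ringOfSetsType (lebesgueN R n)) _ _ _ sol) => x h /h[].
have [Fu [iFu Fu0 bFu dFu]] := equation_data m_gtN Om_bounded oO u_W2m uC uae q_gt0 (ltW C0)
  (measurable_patch oO cv) vB sol1.
have [Fv [iFv Fv0 bFv dFv]] := equation_data m_gtN Om_bounded oO v_W2m vC vae p_gt0 (ltW C0)
  (measurable_patch oO cu) uB sol2.
have zero := @zero_from_boundary R n Om Gam p q C wu wv Gu Gv Fu Fv mu_pos Om_bounded Om_C1 Gam_neq0 Gam_open
  p_gt0 q_gt0 pq_gt1 (ltW C0) uC vC
  (fun x Gx => And4 (u0 x Gx) (v0 x Gx) (Gu0 x Gx) (Gv0 x Gx)) iFu iFv Fu0 Fv0 dFu dFv bFu bFv.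
apply: (@filterS2 _ _ (ae_filter_ringOfSetsType (lebesgueN R n)) _ _ _ _ uae vae) => x ux vx Ox.
by have := zero x Ox; rewrite ux// vx.
Qed.
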